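(* Let $d\ge2$, $r\in\mathbb N$, $0\le\theta<d$, $\sigma\ge1$, $1\le p\le q\le\infty$, let $\Omega\in\mathcal G_{\theta,\sigma}$, and suppose that $r+(\sigma(d-1)+1)(1/q-1/p)>0$. Set $$\kappa=\frac{r+(1/q-1/p)(\sigma(d-1)+1)}{\sigma\theta}$$ (with $\kappa=+\infty$ if $\theta=0$), and $$\alpha_1=\frac rd,\qquad \alpha_2=\kappa+\frac1p-\frac1q .$$ (a) If $\alpha_1\ne\alpha_2$, then there is $C=C(p,q,r,d,\Omega)>0$ such that for all sufficiently large $n$ $$e_n\bigl(\mathrm{Id}:\tilde{\mathcal W}^r_p(\Omega)\to L_q(\Omega)\bigr)\le C\,n^{-\min\{\alpha_1,\alpha_2\}},$$ where $\mathrm{Id}$ is the embedding operator. (b) Let in addition $1<p\le q<\infty$; let $\vartheta_n$ denote the Kolmogorov, the linear, or the Gelfand $n$-width, and correspondingly let $\hat q=q$, $\hat q=\min\{q,p'\}$, or $\hat q=p'$, where $1/p+1/p'=1$. 1. If $\hat q\le2$ or $p=q$, and $\alpha_1\ne\alpha_2$, then there is $C=C(p,q,r,d,\Omega)>0$ such that for all sufficiently large $n$ $$\vartheta_n(W^r_p(\Omega),L_q(\Omega))\le C\,n^{-\min\{\alpha_1,\alpha_2\}+1/p-1/q}.$$ 2. Let $p<q$, $\hat q>2$, and set $$\theta_1=\frac rd+\frac1q-\frac1p+\min\Bigl\{\frac1p-\frac1q,\frac12-\frac1{\hat q}\Bigr\},\quad \theta_2=\frac{\hat q}2\Bigl(\frac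 rd+\frac1q-\frac1p\Bigr),$$ $$\theta_3=\kappa+\min\Bigl\{\frac1p-\frac1q,\frac12-\frac1{\hat q}\Bigr\},\quad \theta_4=\frac{\hat q}2\,\kappa .$$ If there is $j_*\in\{1,2,3,4\}$ such that $\theta_{j_*}<\min_{j\ne j_*}\theta_j$, then there is $C=C(p,q,r,d,\Omega)>0$ such that for all sufficiently large $n$ $$\vartheta_n(W^r_p(\Omega),L_q(\Omega))\le C\,n^{-\theta_{j_*}}.$$
   Context: **$h$-sets.** $B_t(x)$ is the ball of radius $t$ centred at $x$ in $(\mathbb R^k,\|\cdot\|_{l_\infty^k})$, $\|x\|_{l_\infty^k}=\max_i|x_i|$. Let $h:(0,1]\to(0,\infty)$ be non-decreasing. A nonempty compact $\Gamma\subset\mathbb R^k$ is an $h$-set if there are $c_*\ge1$ and a finite $\sigma$-additive Borel measure $\mu$ on $\mathbb R^k$ with $\operatorname{supp}\mu=\Gamma$ and $c_*^{-1}h(t)\le\mu(B_t(x))\le c_*h(t)$ for all $x\in\Gamma$, $t\in(0,1]$. **Class $\mathcal G_{\theta,\sigma}$.** For $0\le\theta<d$, $\sigma\ge1$, $\Omega\in\mathcal G_{\theta,\sigma}$ means $\Omega=\{(x',x_d):x'\in(0,1)^{d-1},\ 0<x_d<\psi(x')\}$ with $\psi(x')=2-(\operatorname{dist}(x',\Gamma))^{1/\sigma}$, where $\Gamma\subset[0,1]^{d-1}$ is an $h$-set with $h(t)=t^\theta$ and $\operatorname{dist}(x',\Gamma)=\inf_{y\in\Gamma}\|x'-y\|_{l_\infty^{d-1}}$.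 **Sobolev spaces and classes.** $\|\nabla^rf\|_{L_p(\Omega)}=\max_{|\alpha|=r}\|\partial_\alpha f\|_{L_p(\Omega)}$ (distributional derivatives, $\alpha\in\mathbb Z_+^d$). $\tilde{\mathcal W}^r_p(\Omega)=\{f\in L_1^{\rm loc}(\Omega):\|\nabla^rf\|_{L_p(\Omega)}+\|f\|_{L_p(\Omega)}<\infty\}$, normed by this sum. $W^r_p(\Omega)=\{f\in L_1^{\rm loc}(\Omega):\|\nabla^rf\|_{L_p(\Omega)}\le1\}$. **Entropy numbers.** For normed spaces $X,Y$ with unit balls $B_X,B_Y$ and bounded linear $T:X\to Y$, $e_n(T)=\inf\{\varepsilon>0:\exists y_1,\dots,y_{2^{n-1}}\in Y,\ T(B_X)\subset\bigcup_{i=1}^{2^{n-1}}(y_i+\varepsilon B_Y)\}$, $n\in\mathbb N$. **Widths.** For a normed space $X$, nonempty $M\subset X$, $n\in\mathbb Z_+$: Kolmogorov width $d_n(M,X)=\inf_{L}\sup_{x\in M}\inf_{y\in L}\|x-y\|$ over linear subspaces $L\subset X$ of dimension at most $n$; linear width $\lambda_n(M,X)=\inf_A\sup_{x\in M}\|x-Ax\|$ over continuous linear $A:X\to X$ of rank at most $n$; Gelfand width $d^n(M,X)=\inf_{x_1^*,\dots,x_n^*\in X^*}\sup\{\|x\|:x\in M\cap\bigcap_{j=1}^n\ker x_j^*\}$ ($\sup\varnothing=0$). *)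

(* Defs.v *)
From HB Require Import structures.
From mathcomp Require Import all_boot all_order all_algebra.
From mathcomp Require Import generic_quotient ring_quotient.
From mathcomp Require Import all_classical all_reals all_analysis.
From mathcomp Require Import measurable_realfun.

Set Implicit Arguments.
Unset Strict Implicit.
Unset Printing Implicit Defensive.

Import Order.TTheory GRing.Theory Num.Theory.
Import numFieldNormedType.Exports.

Local Open Scope classical_set_scope.
Local Open Scope ring_scope.

(* R^n is ['rV[R]_n]: its library norm is the max-norm, and it carries the Borel
   sigma-algebra. *)
HB.instance Definition _ (R : realType) (n : nat) :=
  Measurable.copy 'rV[R]_n (g_sigma_algebraType (@open 'rV[R]_n)).

Section Borel.
Variable R : realType.

Lemma open_measurable_rV n (U : set 'rV[R]_n) : open U -> measurable U.
Proof. by move=> oU; apply: sub_sigma_algebra. Qed.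

Lemma closed_measurable_rV n (U : set 'rV[R]_n) : closed U -> measurable U.
Proof.
move=> cU; rewrite -[U]setCK; apply: measurableC; apply: open_measurable_rV.
exact: closed_openC.
Qed.

Lemma continuous_measurable_rV n (f : 'rV[R]_n -> R) :
  continuous f -> measurable_fun setT f.
Proof.
move=> cf; apply: (measurability _ (RGenOpens.measurableE R)).
move=> _ [_ [a [b ->] <-]]; rewrite setTI; apply: open_measurable_rV.
by move/continuousP : cf; apply; exact: interval_open.
Qed.

Lemma measurable_coord n (i : 'I_n) :
  measurable_fun setT (fun x : 'rV[R]_n => x ord0 i).
Proof. by apply: continuous_measurable_rV => x; exact: coord_continuous. Qed.

Lemma measurable_fun_rV d (T : measurableType d) n (f : T -> 'rV[R]_n) :
  (forall i, measurable_fun setT (fun t => f t ord0 i)) ->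
  measurable_fun setT f.
Proof.
move=> mf; apply: (measurability (@open 'rV[R]_n)) => // _ [U oU <-].
pose box (qk : 'rV[rat]_n * nat) : set 'rV[R]_n :=
  [set v | forall i, `|v ord0 i - ratr (qk.1 ord0 i)| < qk.2.+1%:R^-1].
have -> : U = \bigcup_qk (if `[< box qk `<=` U >] then box qk else set0).
  apply/seteqP; split=> [v Uv|v [qk _]]; last first.
    by case: ifPn => // /asboolP; apply.
  have /nbhs_ballP[e /= e0 eU] : nbhs v U by exact: open_nbhs_nbhs.
  have [k ke] : exists k, 0 + k.+1%:R^-1 < e / 2 by apply/ltr_add_invr/divr_gt0.
  rewrite add0r in ke.
  have /choice[q qP] : forall i, exists q : rat,
      `|v ord0 i - ratr q| < k.+1%:R^-1.
    move=> i; have [|q] := @rat_in_itvoo R (v ord0 i - k.+1%:R^-1)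
      (v ord0 i + k.+1%:R^-1).
      by rewrite ltrD2l gtrN// invr_gt0.
    by rewrite in_itv/= => /andP[q1 q2]; exists q; rewrite ltr_distlC q1.
  exists (\row_i q i, k) => //.
  case: ifPn => [_ /= i|/asboolPn[]]; first by rewrite mxE.
  move=> w wb; apply: eU; split => // i j; rewrite ord1.
  have := wb j; rewrite /= mxE => wj.
  rewrite /ball /= -(subrK (ratr (q j)) (v ord0 j)) -addrA.
  rewrite (le_lt_trans (ler_normD _ _))//.
  by rewrite (splitr e) ltrD// ?(lt_trans (qP j))// distrC (lt_trans wj).
rewrite setTI preimage_bigcup; apply: countable_bigcupT_measurable => // qk.
case: ifPn => _; last by rewrite preimage_set0.
have -> : f @^-1` box qk =
   \bigcap_i ((fun t => f t ord0 i) @^-1`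
     (ball (ratr (qk.1 ord0 i) : R) qk.2.+1%:R^-1)).
  apply/seteqP; split=> [t h i _|t h i].
    by rewrite /ball /= distrC; exact: h.
  by rewrite distrC; exact: h.
apply: fin_bigcap_measurable => // i _; rewrite -[X in measurable X]setTI.
by apply: mf => //; exact: measurable_ball.
Qed.

Local Open Scope ereal_scope.

Definition rV_cons n (z : R * 'rV[R]_n) : 'rV[R]_n.+1 :=
  \row_i oapp (z.2 ord0) z.1 (unlift ord0 i).

Lemma measurable_rV_cons n : measurable_fun setT (@rV_cons n).
Proof.
apply: measurable_fun_rV => i; rewrite /rV_cons.
case: (unliftP ord0 i) => [j ->|->].
  rewrite (_ : (fun _ => _) = (fun v : 'rV[R]_n => v ord0 j) \o snd).
    by apply: measurableT_comp => //; exact: measurable_coord.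
  by apply/funext => z /=; rewrite mxE liftK.
rewrite (_ : (fun _ => _) = fst)//.
by apply/funext => z; rewrite mxE unlift_none.
Qed.

Definition rV_uncons n (v : 'rV[R]_n.+1) : R * 'rV[R]_n :=
  (v ord0 ord0, \row_i v ord0 (lift ord0 i)).

Lemma rV_consK n : cancel (@rV_cons n) (@rV_uncons n).
Proof.
case=> x v; rewrite /rV_uncons /rV_cons mxE unlift_none/=; congr pair.
by apply/rowP => i; rewrite !mxE liftK.
Qed.

Lemma measurable_rV_uncons n : measurable_fun setT (@rV_uncons n).
Proof.
apply/measurable_fun_pairP; split; first exact: measurable_coord.
apply: measurable_fun_rV => i.
rewrite (_ : (fun _ => _) = (fun v : 'rV[R]_n.+1 => v ord0 (lift ord0 i))).
  exact: measurable_coord.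
by apply/funext => v; rewrite /= mxE.
Qed.

Section LebesgueStep.
Variables (n : nat) (m : {sigma_finite_measure set 'rV[R]_n -> \bar R}).

Definition leb_step : set 'rV[R]_n.+1 -> \bar R :=
  pushforward (@lebesgue_measure R \x m) (@rV_cons n).

Let leb_step0 : leb_step set0 = 0.
Proof. by rewrite /leb_step /pushforward preimage_set0 measure0. Qed.

Let leb_step_ge0 A : 0 <= leb_step A.
Proof. by rewrite /leb_step /pushforward measure_ge0. Qed.

Let leb_step_sigma : semi_sigma_additive leb_step.
Proof.
pose mu : {measure set _ -> \bar R} :=
  measure_function_pushforward__canonical__measure_function_Measure
    (@lebesgue_measure R \x m) (@measurable_rV_cons n).
exact: (@measure_semi_sigma_additive _ _ _ mu).
Qed.

HB.instance Definition _ := isMeasure.Build _ _ _ leb_step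
  leb_step0 leb_step_ge0 leb_step_sigma.

Let leb_step_sf : sigma_finite setT leb_step.
Proof.
have /sigma_finiteP[F [TF ndF Foo]] := sigma_finiteT (@lebesgue_measure R).
have /sigma_finiteP[G [TG ndG Goo]] := sigma_finiteT m.
exists (fun k => @rV_uncons n @^-1` (F k `*` G k)).
  rewrite -preimage_bigcup; apply/seteqP; split=> // v _.
  have : (setT : set (measurableTypeR R)) (rV_uncons v).1 by [].
  have : (setT : set 'rV[R]_n) (rV_uncons v).2 by [].
  rewrite TF TG => -[i _ Gi] [j _ Fj]; exists (maxn i j) => //; split.
    by move: Fj; apply/subsetPset/ndF/leq_maxr.
  by move: Gi; apply/subsetPset/ndG/leq_maxl.
move=> k; have [mF Fk] := Foo k; have [mG Gk] := Goo k; split.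
  rewrite -[X in measurable X]setTI.
  by apply: measurable_rV_uncons => //; exact: measurableX.
rewrite /leb_step /pushforward -comp_preimage.
rewrite (_ : _ \o _ = id); last by apply/funext => z /=; rewrite rV_consK.
by rewrite preimage_id product_measure1E// lte_mul_pinfty// ge0_fin_numE.
Qed.

HB.instance Definition _ :=
  Measure_isSigmaFinite.Build _ _ _ leb_step leb_step_sf.

End LebesgueStep.

(* n-dimensional Lebesgue measure, as an iterated product of the one-dimensional
   one; [lebesgue_rV_box] below gives its value on boxes. *)
Fixpoint lebesgue_rV n : {sigma_finite_measure set 'rV[R]_n -> \bar R} :=
  if n is n'.+1 then leb_step (lebesgue_rV n') else \d_(0%R : 'rV[R]_0).

Arguments lebesgue_rV : clear implicits.

Lemma lebesgue_rV_box n (a b : 'rV[R]_n) :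
  (forall i, a ord0 i <= b ord0 i)%R ->
  lebesgue_rV n [set v : 'rV[R]_n |
    forall i, (a ord0 i <= v ord0 i <= b ord0 i)%R] =
  (\prod_i (b ord0 i - a ord0 i))%:E.
Proof.
elim: n a b => [|n IH] a b ab.
  rewrite big_ord0 /= diracE mem_set//=; by case.
rewrite big_ord_recl EFinM.
pose a' : 'rV[R]_n := \row_i a ord0 (lift ord0 i).
pose b' : 'rV[R]_n := \row_i b ord0 (lift ord0 i).
have -> : (\prod_i (b ord0 (lift ord0 i) - a ord0 (lift ord0 i)))%:E =
    lebesgue_rV n [set v : 'rV[R]_n |
      forall i, (a' ord0 i <= v ord0 i <= b' ord0 i)%R].
  rewrite IH => [|i]; last by rewrite !mxE.
  by congr EFin; apply: eq_bigr => i _; rewrite !mxE.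
rewrite /= /leb_step /pushforward.
rewrite (_ : _ @^-1` _ = `[a ord0 ord0, b ord0 ord0]%classic `*`
    [set v : 'rV[R]_n | forall i, (a' ord0 i <= v ord0 i <= b' ord0 i)%R]).
  rewrite product_measure1E//=; last first.
    rewrite [X in measurable X](_ : _ = \bigcap_i
        ((fun v : 'rV[R]_n => v ord0 i) @^-1` `[a' ord0 i, b' ord0 i])).
      apply: fin_bigcap_measurable => // i _; rewrite -[X in measurable X]setTI.
      by apply: measurable_coord.
    apply/seteqP; split => v /= h i; first by move=> _; exact: h.
    exact: h i I.
  rewrite lebesgue_measure_itv/= lte_fin.
  have [//||->] := ltgtP (a ord0 ord0); last by rewrite subrr.
  by rewrite ltNge ab.
apply/seteqP; split => [[x v]/= h|[x v]/= [h1 h2] i].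
  split; first by have := h ord0; rewrite mxE unlift_none in_itv.
  by move=> i; have := h (lift ord0 i); rewrite !mxE liftK.
rewrite mxE; case: (unliftP ord0 i) => [j ->|->].
  by have := h2 j; rewrite !mxE.
by move: h1; rewrite in_itv.
Qed.

End Borel.

(* Seminorms with values in [0, +oo]. *)
Record eseminorm (R : realType) (V : lmodType R) := ESeminorm {
  esn :> V -> \bar R;
  esn_ge0 : forall x, (0 <= esn x)%E;
  esnD : forall x y, (esn (x + y) <= esn x + esn y)%E;
  esnZ : forall (a : R) x, (esn (a *: x) = `|a|%:E * esn x)%E }.

Lemma scale_le_homog (R : realType) (V : lmodType R) (N : V -> \bar R) :
  (forall x, (0 <= N x)%E) -> N 0 = 0%E ->
  (forall (a : R) x, a != 0 -> (N (a *: x) <= `|a|%:E * N x)%E) ->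
  forall (a : R) x, (N (a *: x) = `|a|%:E * N x)%E.
Proof.
move=> N0 N00 NZ a x; have [->|a0] := eqVneq a 0.
  by rewrite scale0r N00 normr0 mul0e.
apply/eqP; rewrite eq_le NZ//=.
have := NZ a^-1 (a *: x); rewrite invr_eq0 => /(_ a0).
rewrite scalerA mulVf// scale1r normfV => h.
by rewrite -lee_pdivlMl ?normr_gt0.
Qed.

(* The normed space of the vectors of finite seminorm, modulo those of
   seminorm 0. *)
Section NormedQuotient.
Variables (R : realType) (V : lmodType R) (N : eseminorm V).

Definition esn_fin : {pred V} := fun x => (N x < +oo)%E.

Lemma esn_fin_submod : submod_closed esn_fin.
Proof.
split=> [|a x y]; rewrite !unfold_in.
  by rewrite -(scale0r 0) esnZ normr0 mul0e ltry.
move=> xf yf; apply: (le_lt_trans (esnD _ _ _)).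
by rewrite lte_add_pinfty// esnZ lte_mul_pinfty// lee_fin.
Qed.

HB.instance Definition _ :=
  GRing.isSubmodClosed.Build R V esn_fin esn_fin_submod.

Record esn_dom := EsnDom { esn_val :> V; esn_valP : esn_val \in esn_fin }.
HB.instance Definition _ := [isSub for esn_val].
HB.instance Definition _ := [Choice of esn_dom by <:].
HB.instance Definition _ := [SubChoice_isSubLmodule of esn_dom by <:].

Definition esn_null : {pred esn_dom} := fun x => N (esn_val x) == 0%E.

Lemma esn_null_zmod : zmod_closed esn_null.
Proof.
split=> [|x y]; rewrite !unfold_in /=.
  by rewrite -(scale0r 0) esnZ normr0 mul0e.
move=> /eqP x0 /eqP y0; rewrite eq_le esn_ge0 andbT.
rewrite (le_trans (esnD _ _ _))// -scaleN1r esnZ x0 y0 mule0 adde0//.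
Qed.

HB.instance Definition _ :=
  GRing.isZmodClosed.Build esn_dom esn_null esn_null_zmod.

Definition normed_quot : Type := {ideal_quot esn_null}.
HB.instance Definition _ := GRing.Zmodule.on normed_quot.
HB.instance Definition _ := EqQuotient.on normed_quot.
Definition class_of (x : esn_dom) : normed_quot := (\pi_normed_quot x)%qT.
(* A representative of the class [u]. *)
Definition rep (u : normed_quot) : V := esn_val (repr u).
Definition nq_scale (a : R) (u : normed_quot) : normed_quot :=
  class_of (a *: (repr u : esn_dom)).

Lemma class_ofP x y :
  (class_of x = class_of y) <-> N (esn_val x - esn_val y) = 0%E.
Proof.
split=> [/eqP|h]; last apply/eqP.
  by rewrite -Quotient.idealrBE unfold_in => /eqP.
by rewrite -Quotient.idealrBE unfold_in h.
Qed.

Lemma class_of_repr u : class_of (repr u) = u.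
Proof. exact: reprK. Qed.

Lemma class_ofD x y : class_of (x + y) = class_of x + class_of y.
Proof. by rewrite /class_of; exact: Quotient.pi_add. Qed.

Lemma rep_class x : N (rep (class_of x) - esn_val x) = 0%E.
Proof. by apply/class_ofP; rewrite class_of_repr. Qed.

Lemma class_ofZ a x : class_of (a *: x) = nq_scale a (class_of x).
Proof.
apply/esym/class_ofP => /=; rewrite -scalerBr esnZ.
by rewrite -/(rep (class_of x)) rep_class mule0.
Qed.

Lemma nq_scaleA a b u : nq_scale a (nq_scale b u) = nq_scale (a * b) u.
Proof. by rewrite -[u]class_of_repr -!class_ofZ scalerA. Qed.

Lemma nq_scale1 : left_id 1 nq_scale.
Proof. by move=> u; rewrite -[u]class_of_repr -!class_ofZ scale1r. Qed.

Lemma nq_scaleDr : right_distributive nq_scale +%R.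
Proof.
move=> a u v; rewrite -[u]class_of_repr -[v]class_of_repr.
by rewrite -!class_ofZ -!class_ofD -!class_ofZ scalerDr class_ofD.
Qed.

Lemma nq_scaleDl u : {morph nq_scale^~ u : a b / a + b}.
Proof.
by move=> a b; rewrite -[u]class_of_repr -!class_ofZ scalerDl class_ofD.
Qed.

HB.instance Definition _ := GRing.Zmodule_isLmodule.Build R normed_quot
  nq_scaleA nq_scale1 nq_scaleDr nq_scaleDl.

Definition nq_norm (u : normed_quot) : R := fine (N (rep u)).

Lemma esn_finE (x : esn_dom) : (fine (N (esn_val x)))%:E = N (esn_val x).
Proof. by rewrite fineK// ge0_fin_numE ?esn_ge0//; exact: esn_valP. Qed.

Lemma esn_eq x y : N (x - y) = 0%E -> N x = N y.
Proof.
move=> h; apply/eqP; rewrite eq_le; apply/andP; split.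
  by rewrite -[x](subrK y) (le_trans (esnD _ _ _))// h add0e.
rewrite -[y](subKr x) (le_trans (esnD _ _ _))// -scaleN1r esnZ h mule0 adde0//.
Qed.

Lemma nq_norm_class x : (nq_norm (class_of x))%:E = N (esn_val x).
Proof. by rewrite /nq_norm /rep esn_finE; apply/esn_eq/rep_class. Qed.

Lemma nq_normD u v : nq_norm (u + v) <= nq_norm u + nq_norm v.
Proof.
rewrite -[u]class_of_repr -[v]class_of_repr -class_ofD -lee_fin EFinD.
by rewrite !nq_norm_class esnD.
Qed.

Lemma nq_normZ a u : nq_norm (a *: u) = `|a| * nq_norm u.
Proof.
rewrite -[u]class_of_repr -[a *: _]class_ofZ; apply/EFin_inj.
by rewrite EFinM !nq_norm_class esnZ.
Qed.

Lemma nq_norm_eq0 u : nq_norm u = 0 -> u = 0.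
Proof.
rewrite -[u]class_of_repr => u0.
have h : N (esn_val (repr u)) = 0%E by rewrite -nq_norm_class u0.
have -> : 0 = class_of 0.
  by rewrite -(subrr (class_of 0)) -{1}[0]addr0 class_ofD addrK.
by apply/class_ofP; rewrite subr0.
Qed.

HB.instance Definition _ := Lmodule_isNormed.Build R normed_quot
  nq_normD nq_normZ nq_norm_eq0.

Lemma normed_quot_normE (u : normed_quot) : (`|u|)%:E = N (rep u).
Proof. by rewrite -[u in LHS]class_of_repr [LHS]nq_norm_class. Qed.

Lemma normed_quot_eqP (u v : normed_quot) :
  u = v <-> N (rep u - rep v) = 0%E.
Proof. by rewrite -class_ofP !class_of_repr. Qed.

End NormedQuotient.

Section Sobolev.
Context {R : realType} {n : nat}.
Variable Omega : set 'rV[R]_n.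
Local Notation leb := (lebesgue_rV R n).
Implicit Types f g phi : 'rV[R]_n -> R.

(* For measurable Omega, this is [measurable_fun Omega f]. *)
Definition measurable_on f := measurable_fun [set: 'rV[R]_n] (f \_ Omega).

Definition Lp_norm (p : \bar R) f : \bar R :=
  if `[< measurable_on f >] then 'N[leb]_p[EFin \o (f \_ Omega)]%E else +oo%E.

Definition L1loc f := measurable_on f /\
  forall K, compact K -> K `<=` Omega ->
    (\int[leb]_(x in K) `|f x|%:E < +oo)%E.

Definition iter_partial (s : seq 'I_n) phi : 'rV[R]_n -> R :=
  foldr (fun i (psi : 'rV[R]_n -> R) x => 'D_(delta_mx ord0 i) psi x) phi s.

Definition multi_partial (a : 'I_n -> nat) phi :=
  iter_partial (flatten [seq nseq (a i) i | i <- enum 'I_n]) phi.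

Definition smooth phi := forall s x, differentiable (iter_partial s phi) x.

Definition fun_support phi := closure [set x | phi x != 0].

Definition test_function phi :=
  [/\ smooth phi, compact (fun_support phi) & fun_support phi `<=` Omega].

Definition weak_partial (a : 'I_n -> nat) f g :=
  [/\ L1loc f, L1loc g &
    forall phi, test_function phi ->
      (\int[leb]_(x in Omega) (f x * multi_partial a phi x)%:E =
       ((-1) ^+ (\sum_i a i)%N)%:E *
         \int[leb]_(x in Omega) (g x * phi x)%:E)%E].

(* The norm of the weak derivative of order [a], which is unique up to equality
   almost everywhere on Omega; it is +oo if there is no such function. *)
Definition weak_norm (p : \bar R) (a : 'I_n -> nat) f : \bar R :=
  ereal_inf [set Lp_norm p g | g in weak_partial a f].

Definition grad_norm (r : nat) (p : \bar R) f : \bar R :=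
  \big[maxe/0%E]_(a : {ffun 'I_n -> 'I_r.+1} | (\sum_i a i == r)%N)
    weak_norm p (fun i => a i) f.

Definition sobolev_norm (r : nat) (p : \bar R) f : \bar R :=
  if `[< L1loc f >] then (grad_norm r p f + Lp_norm p f)%E else +oo%E.

Lemma restrictRD f g : (f + g) \_ Omega = f \_ Omega \+ g \_ Omega.
Proof.
by apply/funext => x /=; rewrite !patchE; case: ifPn => //; rewrite addr0.
Qed.

Lemma restrictRZ (a : R) f : (a *: f) \_ Omega = a \*o (f \_ Omega).
Proof.
by apply/funext => x /=; rewrite !patchE; case: ifPn => //; rewrite mulr0.
Qed.

Lemma measurable_onD f g : measurable_on f -> measurable_on g ->
  measurable_on (f + g).
Proof. by rewrite /measurable_on restrictRD; exact: measurable_funD. Qed.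

Lemma measurable_onZ (a : R) f : measurable_on f -> measurable_on (a *: f).
Proof.
by move=> mf; rewrite /measurable_on restrictRZ; exact: measurable_funM.
Qed.

Lemma Lp_norm_ge0 p f : (0 <= Lp_norm p f)%E.
Proof. by rewrite /Lp_norm; case: ifPn => // _; exact: Lnorm_ge0. Qed.

Lemma Lp_norm0 p : (1 <= p)%E -> Lp_norm p 0 = 0%E.
Proof.
move=> p1; have h : (0 : 'rV[R]_n -> R) \_ Omega = cst 0.
  by apply/funext => x; rewrite patchE; case: ifPn.
rewrite /Lp_norm asboolT; last by rewrite /measurable_on h.
by rewrite h Lnorm0// gt_eqF// (lt_le_trans _ p1).
Qed.

Lemma Lp_normD p f g : (1 <= p)%E ->
  (Lp_norm p (f + g)%R <= Lp_norm p f + Lp_norm p g)%E.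
Proof.
move=> p1; have gN := Lp_norm_ge0 p g; have fN := Lp_norm_ge0 p f.
rewrite {2}/Lp_norm; case: asboolP => [mf|_]; last first.
  by rewrite addye ?leey// -ltNye (lt_le_trans _ gN).
rewrite {2}/Lp_norm; case: asboolP => [mg|_]; last first.
  by rewrite addey ?leey// -ltNye (lt_le_trans _ (Lnorm_ge0 _ _ _)).
rewrite /Lp_norm asboolT; last exact: measurable_onD.
by rewrite restrictRD; exact: eminkowski.
Qed.

Lemma Lp_normZ p (a : R) f : (1 <= p)%E ->
  Lp_norm p (a *: f) = (`|a|%:E * Lp_norm p f)%E.
Proof.
move=> p1; apply: (scale_le_homog (Lp_norm_ge0 p) (Lp_norm0 p1)) => {}a {}f a0.
rewrite {2}/Lp_norm; case: asboolP => [mf|_]; last first.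
  by rewrite gt0_muley ?leey// lte_fin normr_gt0.
rewrite /Lp_norm asboolT; last exact: measurable_onZ.
have [->|Noo] := eqVneq ('N[leb]_p[EFin \o (f \_ Omega)])%E +oo%E.
  by rewrite gt0_muley ?leey// lte_fin normr_gt0.
have fL : f \_ Omega \in Lfun leb p.
  by rewrite inE; apply/andP; split; rewrite inE//= /finite_norm ltey.
by rewrite restrictRZ -[f \_ Omega](Lfun_valP p1 fL) -LnormZ.
Qed.

Lemma compact_measurable_rV (K : set 'rV[R]_n) : compact K -> measurable K.
Proof.
move=> cK; apply: closed_measurable_rV; apply: compact_closed => //.
Qed.

Lemma measurable_onS f K : measurable_on f -> measurable K -> K `<=` Omega ->
  measurable_fun K f.
Proof.
move=> mf mK KO; apply: (eq_measurable_fun (f \_ Omega)); last first.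
  exact: measurable_funTS.
by move=> x /set_mem/KO xO; rewrite patchE mem_set.
Qed.

Lemma L1locD f g : L1loc f -> L1loc g -> L1loc (f + g).
Proof.
move=> [mf fK] [mg gK]; split=> [|K cK KO]; first exact: measurable_onD.
have mK := compact_measurable_rV cK.
have mfK := measurable_onS mf mK KO; have mgK := measurable_onS mg mK KO.
have mafK : measurable_fun K (fun x => `|f x|%:E).
  exact/measurable_EFinP/measurableT_comp.
have magK : measurable_fun K (fun x => `|g x|%:E).
  exact/measurable_EFinP/measurableT_comp.
apply: (@le_lt_trans _ _ (\int[leb]_(x in K) (`|f x|%:E + `|g x|%:E))%E).
  apply: ge0_le_integral => //.
  - apply/measurable_EFinP/measurableT_comp => //; exact: measurable_funD.
  - exact: emeasurable_funD.
  - by move=> x _; rewrite -EFinD lee_fin ler_normD.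
by rewrite ge0_integralD// lte_add_pinfty ?fK ?gK.
Qed.

Lemma L1locZ (a : R) f : L1loc f -> L1loc (a *: f).
Proof.
move=> [mf fK]; split=> [|K cK KO]; first exact: measurable_onZ.
have mK := compact_measurable_rV cK.
have mfK := measurable_onS mf mK KO.
under eq_integral do rewrite normrM EFinM.
rewrite ge0_integralZl//; last exact/measurable_EFinP/measurableT_comp.
by rewrite lte_mul_pinfty// fK.
Qed.

Lemma L1loc0 : L1loc 0.
Proof.
split; last by move=> K _ _; rewrite integral0_eq// => x _; rewrite normr0.
rewrite /measurable_on (_ : _ \_ _ = cst 0)//.
by apply/funext => x; rewrite patchE; case: ifPn.
Qed.

Lemma iter_partial_out s phi x : ~ fun_support phi x ->
  iter_partial s phi x = 0.
Proof.
elim: s x => [|i s IH] x xs /=.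
  by apply: contrapT => /eqP px; apply: xs; exact: subset_closure.
rewrite (@near_eq_derive _ _ _ _ (cst 0)) ?derive_cst//.
have oS : open (~` fun_support phi).
  by apply: closed_openC; exact: closed_closure.
by apply: filterS (open_nbhs_nbhs (conj oS xs)) => y; exact: IH.
Qed.

Lemma L1loc_integrable f s phi : L1loc f -> test_function phi ->
  leb.-integrable [set: _]
    ((fun x => (f x * iter_partial s phi x)%:E) \_ Omega).
Proof.
move=> [mf fK] [sphi cK KO]; set K := fun_support phi in cK KO *.
have mK : measurable K := compact_measurable_rV cK.
have cpsi : continuous (iter_partial s phi).
  by move=> x; apply: differentiable_continuous.
set psi := iter_partial s phi.
have psi0 x : ~ K x -> psi x = 0 by exact: iter_partial_out.
pose h x := (f \_ Omega) x * psi x.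
have -> : (fun x => (f x * psi x)%:E) \_ Omega = EFin \o h.
  by apply/funext => x /=; rewrite /h !patchE; case: ifPn; rewrite ?mul0r.
have mh : measurable_fun setT h.
  by apply: measurable_funM => //; exact: continuous_measurable_rV.
apply/integrableP; split; first exact/measurable_EFinP.
have [M [Mreal MP]] : bounded_set (psi @` K).
  apply/compact_bounded/continuous_compact => //.
  exact: continuous_subspaceT.
pose M' := Num.max 0 (M + 1).
have psiM x : `|psi x| <= M'.
  have [Kx|Kx] := pselect (K x); last by rewrite psi0// normr0 le_max lexx.
  by rewrite (MP M') ?lt_max ?ltrDl ?ltr01 ?orbT//; exists x.
have M'0 : 0 <= M' by rewrite le_max lexx.
have mfK := measurable_onS mf mK KO.
have mafK : measurable_fun K (fun x => `|f x|%:E).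
  exact/measurable_EFinP/measurableT_comp.
rewrite (_ : (fun x => _) = (fun x => `|h x|%:E) \_ K); last first.
  apply/funext => x; rewrite patchE; case: ifPn => //= /negP xK.
  by rewrite /h psi0 ?mulr0 ?normr0// => Kx; apply: xK; exact: mem_set.
rewrite -integral_mkcond.
apply: (@le_lt_trans _ _ (\int[leb]_(x in K) (M'%:E * `|f x|%:E))%E).
  apply: ge0_le_integral => //.
  - exact/measurable_EFinP/measurableT_comp/measurable_funTS.
  - by apply: measurable_funeM.
  - move=> x /KO xO; rewrite -EFinM lee_fin /h patchE mem_set// normrM mulrC.
    by rewrite ler_wpM2r.
by rewrite ge0_integralZl// lte_mul_pinfty// fK.
Qed.

Lemma weak_partialD a f1 f2 g1 g2 : weak_partial a f1 g1 ->
  weak_partial a f2 g2 -> weak_partial a (f1 + f2) (g1 + g2).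
Proof.
move=> [lf1 lg1 h1] [lf2 lg2 h2]; split; [exact: L1locD|exact: L1locD|].
have key u v s phi : L1loc u -> L1loc v -> test_function phi ->
  (\int[leb]_(x in Omega) ((u + v) x * iter_partial s phi x)%:E =
   \int[leb]_(x in Omega) (u x * iter_partial s phi x)%:E +
   \int[leb]_(x in Omega) (v x * iter_partial s phi x)%:E)%E.
  move=> lu lv tphi; rewrite !(integral_mkcond Omega) -integralD//; last 2 first.
  - exact: L1loc_integrable.
  - exact: L1loc_integrable.
  apply: eq_integral => x _; rewrite !patchE; case: ifPn => _.
    by rewrite -EFinD -mulrDl.
  by rewrite adde0.
have fin u s phi : L1loc u -> test_function phi ->
  (\int[leb]_(x in Omega) (u x * iter_partial s phi x)%:E)%E \is a fin_num.
  move=> lu tphi; rewrite (integral_mkcond Omega).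
  by apply: integrable_fin_num => //; exact: L1loc_integrable.
move=> phi tphi; rewrite key// -!/(multi_partial a phi) h1// h2//.
rewrite (key g1 g2 [::])// [RHS]muleDr//.
by apply: fin_num_adde_defr; exact: (fin g1 [::]).
Qed.

Lemma weak_partialZ a (c : R) f g : weak_partial a f g ->
  weak_partial a (c *: f) (c *: g).
Proof.
move=> [lf lg h]; split; [exact: L1locZ|exact: L1locZ|].
have key u s phi : L1loc u -> test_function phi ->
  (\int[leb]_(x in Omega) ((c *: u) x * iter_partial s phi x)%:E =
   c%:E * \int[leb]_(x in Omega) (u x * iter_partial s phi x)%:E)%E.
  move=> lu tphi; rewrite !(integral_mkcond Omega) -integralZl//; last first.
    exact: L1loc_integrable.
  apply: eq_integral => x _; rewrite !patchE; case: ifPn => _.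
    by rewrite -EFinM mulrA.
  by rewrite mule0.
move=> phi tphi; rewrite key// -/(multi_partial a phi) h//.
by rewrite (key g [::])// muleCA.
Qed.

Lemma weak_partial0 a : weak_partial a 0 0.
Proof.
split; [exact: L1loc0|exact: L1loc0|move=> phi _].
by rewrite !integral0_eq ?mule0// => x _; rewrite mul0r.
Qed.

Lemma weak_norm_ge0 p a f : (0 <= weak_norm p a f)%E.
Proof. by apply: le_ereal_inf_tmp => _ [g _ <-]; exact: Lp_norm_ge0. Qed.

Lemma weak_norm0 p a : (1 <= p)%E -> weak_norm p a 0 = 0%E.
Proof.
move=> p1; apply/eqP; rewrite eq_le weak_norm_ge0 andbT.
apply: ereal_inf_lbound; exists 0; first exact: weak_partial0.
exact: Lp_norm0.
Qed.

Lemma weak_normD p a f g : (1 <= p)%E ->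
  (weak_norm p a (f + g)%R <= weak_norm p a f + weak_norm p a g)%E.
Proof.
move=> p1; have fN := weak_norm_ge0 p a f; have gN := weak_norm_ge0 p a g.
have [->|foo] := eqVneq (weak_norm p a f) +oo%E.
  by rewrite addye ?leey// -ltNye (lt_le_trans _ gN).
have [->|goo] := eqVneq (weak_norm p a g) +oo%E.
  by rewrite addey ?leey// -ltNye (lt_le_trans _ fN).
have ffin : weak_norm p a f \is a fin_num by rewrite ge0_fin_numE ?ltey.
have gfin : weak_norm p a g \is a fin_num by rewrite ge0_fin_numE ?ltey.
apply/lee_addgt0Pr => e e0.
have e20 : 0 < e / 2 by rewrite divr_gt0.
have [_ [u fu <-] ue] := lb_ereal_inf_adherent e20 ffin.
have [_ [v gv <-] ve] := lb_ereal_inf_adherent e20 gfin.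
apply: (@le_trans _ _ (Lp_norm p (u + v)%R)).
  by apply: ereal_inf_lbound; exists (u + v) => //; exact: weak_partialD.
rewrite (le_trans (Lp_normD _ _ p1))//.
rewrite (splitr e) EFinD addeACA.
by apply: leeD; exact: ltW.
Qed.

Lemma weak_normZ p a (c : R) f : (1 <= p)%E ->
  weak_norm p a (c *: f) = (`|c|%:E * weak_norm p a f)%E.
Proof.
move=> p1; apply: (scale_le_homog (weak_norm_ge0 p a) (weak_norm0 a p1)).
move=> {}c {}f c0; have c00 : 0 < `|c| by rewrite normr_gt0.
rewrite -lee_pdivrMl//; apply: le_ereal_inf_tmp => _ [g fg <-].
rewrite lee_pdivrMl// -Lp_normZ//; apply: ereal_inf_lbound.
by exists (c *: g) => //; exact: weak_partialZ.
Qed.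

Lemma grad_norm_ge0 r p f : (0 <= grad_norm r p f)%E.
Proof.
rewrite /grad_norm; elim/big_ind : _ => // [x y x0 y0|a _].
  by rewrite le_max x0.
exact: weak_norm_ge0.
Qed.

Lemma grad_normD r p f g : (1 <= p)%E ->
  (grad_norm r p (f + g)%R <= grad_norm r p f + grad_norm r p g)%E.
Proof.
move=> p1; apply/bigmax_leP; split.
  by apply: adde_ge0; exact: grad_norm_ge0.
move=> a ar; rewrite (le_trans (weak_normD _ _ _ p1))//.
by apply: leeD; exact: le_bigmax_cond.
Qed.

Lemma grad_norm0 r p : (1 <= p)%E -> grad_norm r p 0 = 0%E.
Proof.
move=> p1; apply/eqP; rewrite eq_le grad_norm_ge0 andbT.
by apply/bigmax_leP; split => // a _; rewrite weak_norm0.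
Qed.

Lemma grad_normZ r p (c : R) f : (1 <= p)%E ->
  grad_norm r p (c *: f) = (`|c|%:E * grad_norm r p f)%E.
Proof.
move=> p1; apply: (scale_le_homog (grad_norm_ge0 r p) (grad_norm0 r p1)).
move=> {}c {}f c0; apply/bigmax_leP; split.
  by rewrite mule_ge0 ?grad_norm_ge0.
move=> a ar; rewrite weak_normZ// lee_pmul2l ?lte_fin ?normr_gt0//.
exact: le_bigmax_cond.
Qed.

Lemma sobolev_norm_ge0 r p f : (0 <= sobolev_norm r p f)%E.
Proof.
rewrite /sobolev_norm; case: ifPn => // _.
by rewrite adde_ge0 ?grad_norm_ge0 ?Lp_norm_ge0.
Qed.

Lemma sobolev_normD r p f g : (1 <= p)%E ->
  (sobolev_norm r p (f + g)%R <= sobolev_norm r p f + sobolev_norm r p g)%E.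
Proof.
move=> p1; have fN := sobolev_norm_ge0 r p f; have gN := sobolev_norm_ge0 r p g.
rewrite {2}/sobolev_norm; case: asboolP => [lf|_]; last first.
  by rewrite addye ?leey// -ltNye (lt_le_trans _ gN).
rewrite {2}/sobolev_norm; case: asboolP => [lg|_]; last first.
  by rewrite addey ?leey// -ltNye (lt_le_trans _ (adde_ge0 (grad_norm_ge0 _ _ _)
    (Lp_norm_ge0 _ _))).
rewrite /sobolev_norm asboolT; last exact: L1locD.
by rewrite addeACA leeD// ?grad_normD ?Lp_normD.
Qed.

Lemma sobolev_normZ r p (c : R) f : (1 <= p)%E ->
  sobolev_norm r p (c *: f) = (`|c|%:E * sobolev_norm r p f)%E.
Proof.
move=> p1; apply: (scale_le_homog (sobolev_norm_ge0 r p)).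
  by rewrite /sobolev_norm asboolT ?grad_norm0 ?Lp_norm0 ?adde0//; exact: L1loc0.
move=> {}c {}f c0; rewrite {2}/sobolev_norm; case: asboolP => [lf|_]; last first.
  by rewrite gt0_muley ?leey// lte_fin normr_gt0.
rewrite /sobolev_norm asboolT; last exact: L1locZ.
by rewrite grad_normZ// Lp_normZ// ge0_muleDr ?grad_norm_ge0 ?Lp_norm_ge0.
Qed.

End Sobolev.

Section FunctionSpaces.
Context {R : realType} {n : nat}.
Variable Omega : set 'rV[R]_n.

Definition Lp_eseminorm (p : \bar R) (p1 : (1 <= p)%E) :
    eseminorm ('rV[R]_n -> R) :=
  ESeminorm (Lp_norm_ge0 Omega p) (fun f g => Lp_normD Omega f g p1)
    (fun a f => Lp_normZ Omega a f p1).

Definition Lp_space (p : \bar R) (p1 : (1 <= p)%E) : normedModType R :=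
  normed_quot (Lp_eseminorm p1).

Definition sobolev_eseminorm (r : nat) (p : \bar R) (p1 : (1 <= p)%E) :
    eseminorm ('rV[R]_n -> R) :=
  ESeminorm (sobolev_norm_ge0 Omega r p)
    (fun f g => sobolev_normD Omega r f g p1)
    (fun a f => sobolev_normZ Omega r a f p1).

Definition sobolev_space (r : nat) (p : \bar R) (p1 : (1 <= p)%E) :
    normedModType R :=
  normed_quot (sobolev_eseminorm r p1).

Definition sobolev_class (r : nat) (p : \bar R) : set ('rV[R]_n -> R) :=
  [set f | L1loc Omega f /\ (grad_norm Omega r p f <= 1)%E].

Definition sobolev_class_in (r : nat) (p q : \bar R) (q1 : (1 <= q)%E) :
    set (Lp_space q1) :=
  [set u | sobolev_class r p (rep u)].

Definition is_embedding (r : nat) (p q : \bar R) (p1 : (1 <= p)%E)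
    (q1 : (1 <= q)%E) (T : sobolev_space r p1 -> Lp_space q1) :=
  forall u, ae_eq (lebesgue_rV R n) Omega (rep (T u)) (rep u).

End FunctionSpaces.
Arguments sobolev_class_in {R n} Omega r p {q} q1.

Section Widths.
Context {R : realType}.

Definition entropy_number (X Y : normedModType R) (T : X -> Y) (n : nat) :
    \bar R :=
  ereal_inf [set e%:E | e in [set e : R | 0 < e /\
    exists y : 'I_(2 ^ n.-1) -> Y,
      T @` [set x | `|x| <= 1] `<=` \bigcup_i [set z | `|z - y i| <= e]]].

Variable X : normedModType R.
Implicit Types (n : nat) (M : set X).

Definition span_of n (v : 'I_n -> X) : set X :=
  [set \sum_i a i *: v i | a in [set: 'I_n -> R]].

Definition kolmogorov_width n M : \bar R :=
  ereal_inf [set ereal_sup [set ereal_inf [set `|x - y|%:E | y in L] | x in M]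
    | L in range (@span_of n)].

Definition linear_width n M : \bar R :=
  ereal_inf [set ereal_sup [set `|x - A x|%:E | x in M]
    | A in [set A : {linear X -> X} | continuous A /\
        exists v : 'I_n -> X, range A `<=` span_of v]].

(* The value 0 is added so that the inner supremum is 0 on the empty set. *)
Definition gelfand_width n M : \bar R :=
  ereal_inf [set ereal_sup (0%E |`
      [set `|x|%:E | x in M `&` [set x | forall j, l j x = 0]])
    | l in [set l : 'I_n -> {linear X -> R^o} | forall j, continuous (l j)]].

Inductive width_kind := WKolmogorov | WLinear | WGelfand.

Definition width (k : width_kind) n M : \bar R :=
  match k with
  | WKolmogorov => kolmogorov_width n M
  | WLinear => linear_width n M
  | WGelfand => gelfand_width n M
  end.

Definition qhat (k : width_kind) (p q : \bar R) : R :=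
  match k with
  | WKolmogorov => fine q
  | WLinear => Num.min (fine q) (fine (hoelder_conjugate p))
  | WGelfand => fine (hoelder_conjugate p)
  end.

Definition eventually_bounded (w : nat -> \bar R) (s : R) :=
  exists2 C : R, 0 < C &
    exists n0 : nat, forall n, (n0 <= n)%N ->
      (w n <= (C * n%:R `^ (- s))%:E)%E.

End Widths.

Section Domains.
Context {R : realType}.

Definition measure_support n (mu : set 'rV[R]_n -> \bar R) : set 'rV[R]_n :=
  [set x | forall U, open U -> U x -> (0 < mu U)%E].

Definition h_set n (h : R -> R) (Gamma : set 'rV[R]_n) :=
  [/\ forall t, 0 < t <= 1 -> 0 < h t,
      forall s t, 0 < s -> s <= t -> t <= 1 -> h s <= h t,
      Gamma !=set0, compact Gamma &
      exists (c : R) (mu : {finite_measure set 'rV[R]_n -> \bar R}),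
        [/\ 1 <= c, measure_support mu = Gamma &
          forall x t, Gamma x -> 0 < t <= 1 ->
            ((c^-1 * h t)%:E <= mu (ball x t) <= (c * h t)%:E)%E]].

Definition dist_to n (x : 'rV[R]_n) (Gamma : set 'rV[R]_n) : R :=
  inf [set `|x - y| | y in Gamma].

Definition first_coords m (x : 'rV[R]_m.+1) : 'rV[R]_m :=
  \row_i x ord0 (widen_ord (leqnSn m) i).

(* Subsets of R^d with d = m.+1; points are (x', x_d) with x' in R^m. *)
Definition class_G m (theta sigma : R) (Omega : set 'rV[R]_m.+1) :=
  exists Gamma : set 'rV[R]_m,
    [/\ Gamma `<=` [set y : 'rV[R]_m | forall i, 0 <= y ord0 i <= 1],
        h_set (fun t => t `^ theta) Gamma &
        Omega = [set x | (forall i, 0 < first_coords x ord0 i < 1) /\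
          0 < x ord0 ord_max <
            2 - dist_to (first_coords x) Gamma `^ sigma^-1]].

End Domains.

Section Exponents.
Context {R : realType}.
Variables (d r : nat) (theta sigma : R) (p q : \bar R).

(* 1/p as a real number, with 1/oo = 0 *)
Definition recip (p : \bar R) : R := fine p^-1%E.

Definition kappa : \bar R :=
  if theta == 0 then +oo%E
  else ((r%:R + (recip q - recip p) * (sigma * (d%:R - 1) + 1))
        / (sigma * theta))%:E.

Definition alpha1 : \bar R := (r%:R / d%:R)%:E.

Definition alpha2 : \bar R := (kappa + (recip p - recip q)%:E)%E.

(* Values of [fine] below are meaningful: the minimum is at most alpha1. *)
Definition alpha_min : R := fine (mine alpha1 alpha2).

Definition theta_exps (qh : R) : 4.-tuple (\bar R) :=
  let delta := Num.min (recip p - recip q) (2^-1 - qh^-1) in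
  let s := r%:R / d%:R + recip q - recip p in
  [tuple (s + delta)%:E; (qh / 2 * s)%:E;
         (kappa + delta%:E)%E; ((qh / 2)%:E * kappa)%E].

End Exponents.

(* Main.v *)
Require Import Defs.
From HB Require Import structures.
From mathcomp Require Import all_boot all_order all_algebra.
From mathcomp Require Import all_classical all_reals all_analysis.
From mathcomp Require Import measurable_realfun ring lra zify.

(** The graph domain is cut into cells indexed by (k, t): k measures the distance
2^-k to the top level x_d = 2, t is a further refinement, a cell has vertical
size ~ 2^-(k+t) and horizontal size ~ 2^-(sigma k + t), and the h-set condition
leaves O(2^(sigma theta k + d t)) of them.  Averaged Taylor polynomials on the
cells, telescoped in the level i = k + t, split the embedding into blocks
l_p^N -> l_q^N with N = O(2^(sigma theta k + d t)), of weight
2^-(rho k + tau t), rho = r - (sigma (d-1) + 1) delta, tau = r - d delta,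
delta = 1/p - 1/q.  A block is treated by rounding to a lattice (entropy), or by
random sign matrices (Gelfand and linear widths; Kolmogorov widths follow by
duality).  The budgets of the blocks are chosen so that both they and the errors
decay geometrically away from a critical line in the (k, t) quadrant. *)

Set Implicit Arguments.
Unset Strict Implicit.
Unset Printing Implicit Defensive.

Import Order.TTheory GRing.Theory Num.Theory.
Import numFieldNormedType.Exports.
Local Open Scope classical_set_scope.
Local Open Scope ring_scope.

(** * Entropy of embeddings between finite-dimensional sequence spaces *)

Section Lattice.
Variable R : realType.

(** What makes the cells work under a merely Holder continuous graph is that the box carrying the
    averaging kernel need not contain its cell: outside the strip k = 0 it is lowered by three
    vertical sides. By (s + v)^sigma >= s^sigma + v s^(sigma - 1) the height gained leaves enough
    horizontal room for the box, its parent and the hull of both; this explains the horizontal side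
    2^-(sigma k + t). A difference of two kernels is a sum of unmixed derivatives of order r of test
    functions, so only weak derivatives on the hull enter, and no Poincare inequality on Omega is
    used. Probability is replaced by counting over all sign matrices, with a union bound in which k
    ln(N/k) is majorized by k^(1 - eta) N^eta; this power of N is the one present in the width
    bounds anyway. The class in part (b) bounds only derivatives of order r, so the finitely many
    coefficients of level 0 are reproduced exactly instead of being approximated. A strictly
    smallest exponent is what leaves positive rates of decay along the critical line and on both
    sides of it. *)

Lemma powR_le1 (x a : R) : 0 <= x <= 1 -> 0 <= a -> x `^ a <= 1.
Proof.
move=> /andP[x0 x1] a0; rewrite (le_trans (ge0_ler_powR a0 _ _ x1)) ?nnegrE//.
by rewrite powR1.
Qed.

Lemma powR_ge1 (x a : R) : 1 <= x -> 0 <= a -> 1 <= x `^ a.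
Proof. by move=> x1 a0; rewrite -(powRr0 x) ler_powR. Qed.

Lemma powRN_ge1 (x a : R) : 0 < x <= 1 -> 0 <= a -> 1 <= x `^ (- a).
Proof.
move=> /andP[x0 x1] a0; rewrite powRN invf_ge1 ?powR_gt0// powR_le1//.
by rewrite (ltW x0).
Qed.

Lemma recip_fin (t : R) : t != 0 -> recip t%:E = t^-1.
Proof. by move=> t0; rewrite /recip/= inver (negbTE t0). Qed.

Lemma recipy : recip +oo%E = 0 :> R.
Proof. by rewrite /recip invey. Qed.

Lemma recip_ge0 (p : \bar R) : (1 <= p)%E -> 0 <= recip p <= 1.
Proof.
case: p => [t||]//; last by rewrite recipy lexx ler01.
rewrite lee_fin => t1; have t0 : 0 < t by rewrite (lt_le_trans _ t1).
by rewrite recip_fin ?gt_eqF// invr_ge0 ltW//= invf_le1.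
Qed.

Lemma recip_le (p q : \bar R) : (1 <= p)%E -> (p <= q)%E -> recip q <= recip p.
Proof.
case: p => [t||]//; case: q => [u||]//.
- rewrite !lee_fin => t1 tu; have t0 : 0 < t by rewrite (lt_le_trans _ t1).
 have u0 : 0 < u by rewrite (lt_le_trans _ tu).
 by rewrite !recip_fin ?gt_eqF// lef_pV2.
- by move=> t1 _; rewrite recipy; have /andP[] := recip_ge0 t1.
Qed.

(** The second branch is meant for [+oo]; [-oo] falls into it too but is excluded wherever [1 <= p]
    is assumed. *)
Definition lpn (p : \bar R) (I : finType) (v : I -> R) : R :=
 if p is r%:E then (\sum_i `|v i| `^ r) `^ r^-1 else \big[Num.max/0]_i `|v i|.

Lemma lpn_ge0 p (I : finType) (v : I -> R) : 0 <= lpn p v.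
Proof.
case: p => [r||] /=; first exact: powR_ge0.
 by elim/big_ind : _ => // x y x0 y0; rewrite le_max x0.
by elim/big_ind : _ => // x y x0 y0; rewrite le_max x0.
Qed.

Lemma lpn_le1P (r : R) (I : finType) (v : I -> R) : 0 < r ->
 (lpn r%:E v <= 1) = (\sum_i `|v i| `^ r <= 1).
Proof.
move=> r0 /=; set S := \sum_i _.
have S0 : 0 <= S by apply: sumr_ge0 => i _; exact: powR_ge0.
apply/idP/idP => h; last first.
 by rewrite (le_trans (ge0_ler_powR _ _ _ h)) ?nnegrE ?invr_ge0 ?powR1// ltW.
have := ge0_ler_powR (ltW r0) _ _ h; rewrite !nnegrE powR_ge0 => /(_ isT ler01).
by rewrite -powRrM mulVf ?gt_eqF// powRr1// powR1.
Qed.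

Lemma lpn_coord p (I : finType) (v : I -> R) i : (1 <= p)%E -> `|v i| <= lpn p v.
Proof.
case: p => [r||]//=; rewrite ?lee_fin => r1; last by apply: (le_bigmax_cond _ (fun i => `|v i|)).
have r0 : 0 < r by rewrite (lt_le_trans _ r1).
rewrite -[leLHS](powRr1 (normr_ge0 _)) -(divff (lt0r_neq0 r0)) powRrM.
rewrite ge0_ler_powR ?invr_ge0 ?(ltW r0) ?nnegrE ?powR_ge0//.
 by apply: sumr_ge0 => j _; exact: powR_ge0.
by rewrite (bigD1 i)//= lerDl; apply: sumr_ge0 => j _; exact: powR_ge0.
Qed.

Lemma lpnZ p (I : finType) (v : I -> R) c : (1 <= p)%E ->
 lpn p (fun i => c * v i) = `|c| * lpn p v.
Proof.
case: p => [r||]//=; rewrite ?lee_fin => r1.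
 have r0 : 0 < r by rewrite (lt_le_trans _ r1).
 under eq_bigr do rewrite normrM powRM//.
 rewrite -mulr_sumr powRM ?powR_ge0//; last by apply: sumr_ge0 => j _; exact: powR_ge0.
 by rewrite -powRrM divff ?gt_eqF// powRr1.
elim/big_rec2 : _ => [|i x y _ ->]; first by rewrite mulr0.
by rewrite normrM maxr_pMr.
Qed.

(* [w] stands for [v] cut off at height k^(-1/p). *)
Lemma lpn_cut (p q : \bar R) (I : finType) (v w : I -> R) (k : R) :
 (1 <= p)%E -> (p <= q)%E -> 0 < k -> lpn p v <= 1 ->
 (forall i, `|w i| <= `|v i|) -> (forall i, `|w i| <= k `^ (- recip p)) ->
 lpn q w <= k `^ (- (recip p - recip q)).
Proof.
case: p => [r||]//.
- rewrite lee_fin => r1; have r0 : 0 < r by rewrite (lt_le_trans _ r1).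
 case: q => [s||]//; rewrite ?lee_fin => rs k0 hv wv wk.
  have s0 : 0 < s by rewrite (lt_le_trans r0).
  have -> : recip r%:E = r^-1 by rewrite /recip/= inver gt_eqF.
  rewrite /recip/= inver gt_eqF//=.
  have hr : recip r%:E = r^-1 by rewrite /recip/= inver gt_eqF.
  rewrite hr in wk.
  apply: (@le_trans _ _ ((k `^ (- r^-1 * (s - r))) `^ s^-1)); last first.
   rewrite -powRrM le_eqVlt; apply/orP; left; apply/eqP; congr (_ `^ _).
   by field; rewrite !gt_eqF.
  rewrite ge0_ler_powR ?invr_ge0 ?(ltW s0) ?nnegrE ?powR_ge0//.
   by apply: sumr_ge0 => j _; exact: powR_ge0.
  rewrite (@le_trans _ _ (\sum_i `|v i| `^ r * k `^ (- r^-1 * (s - r))))//.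
   apply: ler_sum => i _; have [->|w0] := eqVneq (w i) 0.
    by rewrite normr0 powR0 ?gt_eqF// mulr_ge0 ?powR_ge0.
   rewrite -[s in leLHS](subrK r) addrC powRD; last by rewrite normr_eq0 w0 implybT.
   apply: ler_pM; rewrite ?powR_ge0//.
    by rewrite ge0_ler_powR ?nnegrE ?(ltW r0).
   by rewrite powRrM ge0_ler_powR ?nnegrE ?powR_ge0 ?subr_ge0.
  rewrite -mulr_suml ler_piMl ?powR_ge0//.
  by move: hv; rewrite lpn_le1P.
 have -> : recip +oo%E = 0 :> R by rewrite /recip invey.
 rewrite subr0; apply/bigmax_leP; split; first exact: powR_ge0.
 by move=> i _; exact: wk.
- move=> _; case: q => [s||]// _ k0 hv wv wk.
 rewrite subrr oppr0 powRr0; apply/bigmax_leP; split => // i _.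
 by rewrite (le_trans (wv i))// (le_trans _ hv)// (@lpn_coord +oo%E)// leey.
Qed.

Lemma lpn_le_lpn (p q : \bar R) (I : finType) (v : I -> R) :
 (1 <= p)%E -> (p <= q)%E -> lpn p v <= 1 -> lpn q v <= 1.
Proof.
move=> p1 pq hv; have := @lpn_cut p q I v v 1 p1 pq ltr01 hv (fun=> lexx _).
rewrite !powR1; apply=> i; exact: (le_trans (lpn_coord _ _ p1)).
Qed.

Lemma sum_geom (q : R) n : 0 <= q < 1 -> \sum_(i < n) q ^+ i <= (1 - q)^-1.
Proof.
move=> /andP[q0 q1]; rewrite -[leRHS]mul1r ler_pdivlMr ?subr_gt0// mulrC.
by rewrite -opprB mulNr -subrX1 opprB gerBl exprn_ge0.
Qed.

(** Shifted codes turn the integers of [-K, K] into a finite type, so that lattice vectors can be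
    counted as finite functions. *)
Definition int_of_code (K : nat) (u : 'I_(K.*2.+1)) : int := (u : nat)%:Z - K%:Z.

(** Chernoff's counting argument: each vector counted contributes at least q^K to the N-th power of
    the sum of q^|u| over one coordinate. The two-sided series equals (1 + q)/(1 - q), which for q =
    K/(K + N) is 1 + 2K/N, while 1/q = 1 + N/K. *)
Lemma lattice_count (I : finType) (K : nat) : (0 < K)%N -> (0 < #|I|)%N ->
 #|[pred u : {ffun I -> 'I_(K.*2.+1)} | (\sum_i `|int_of_code (u i)| <= K)%N]|%:R <=
 (1 + #|I|%:R / K%:R) ^+ K * (1 + 2 * K%:R / #|I|%:R) ^+ #|I| :> R.
Proof.
set N := #|I| => K0 N0.
have K0R : 0 < K%:R :> R by rewrite ltr0n.
have N0R : 0 < N%:R :> R by rewrite ltr0n.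
pose q : R := K%:R / (K%:R + N%:R).
have KN : 0 < K%:R + N%:R :> R by rewrite addr_gt0.
have q0 : 0 < q by rewrite divr_gt0.
have q1 : q < 1 by rewrite ltr_pdivrMr// mul1r ltrDl.
have qh : 0 <= q < 1 by rewrite (ltW q0) q1.
have qK : (1 + N%:R / K%:R) ^+ K * q ^+ K = 1.
 by rewrite -exprMn (_ : _ * _ = 1) ?expr1n// /q; field; rewrite !gt_eqF.
have one : \sum_(u < K.*2.+1) q ^+ `|int_of_code u|%N <= 1 + 2 * K%:R / N%:R.
 have -> : 1 + 2 * K%:R / N%:R = q * (1 - q)^-1 + (1 - q)^-1.
  have -> : 1 - q = N%:R / (K%:R + N%:R) by rewrite /q; field; rewrite gt_eqF.
  by rewrite /q invf_div; field; rewrite !gt_eqF.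
 pose F (u : nat) : R := q ^+ `|u%:Z - K%:Z|%N.
 rewrite (_ : \sum_(u < _) _ = \sum_(u < K.*2.+1) F u)//.
 rewrite -(big_mkord xpredT F) (@big_cat_nat _ _ _ K)//=; last first.
  by rewrite -addnn -addSn leq_addl.
 apply: lerD.
  rewrite big_nat_rev/= add0n big_mkord.
  apply: (@le_trans _ _ (q * \sum_(i < K) q ^+ i)).
   rewrite mulr_sumr ler_sum// => i _; rewrite -exprS /F.
   rewrite (_ : `|_ - _|%N = i.+1)//; have := ltn_ord i; lia.
  by rewrite ler_wpM2l ?sum_geom// ltW.
 rewrite -{1}[K]add0n big_addn big_mkord.
 apply: le_trans (sum_geom (K.*2.+1 - K) qh).
 apply: ler_sum => i _; rewrite /F (_ : `|_ - _|%N = i)//; lia.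
set S := [pred u | _].
have -> : #|S|%:R = (1 + N%:R / K%:R) ^+ K * (q ^+ K * #|S|%:R) by rewrite mulrA qK mul1r.
apply: ler_wpM2l.
 by rewrite exprn_ge0 ?addr_ge0 ?divr_ge0.
rewrite mulrC.
apply: (@le_trans _ _ (\prod_(i : I) \sum_(u < K.*2.+1) q ^+ `|int_of_code u|%N)); last first.
 rewrite prodr_const ler_pXn2r ?nnegrE ?addr_ge0 ?divr_ge0 ?mulr_ge0//.
 by apply: sumr_ge0 => u _; rewrite exprn_ge0// ltW.
rewrite bigA_distr_bigA/=.
rewrite -sum1_card natr_sum mulr_suml big_mkcond/=.
apply: ler_sum => u _; rewrite -expr_sum.
case: ifPn => [|_]; last by rewrite exprn_ge0// ltW.
by rewrite inE => h; rewrite mul1r ler_wiXn2l ?(ltW q0) ?(ltW q1).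
Qed.

(** Coordinates are rounded towards zero, not to the nearest multiple of h. The error is then
    bounded by |v_i| as well as by h, that is, it is a cut-off of v as in [lpn_cut], and the integer
    code has l_1 norm at most K. *)
Lemma quantize (I : finType) (h : R) (K : nat) : 0 < h -> (0 < K)%N -> (0 < #|I|)%N ->
 exists s : seq {ffun I -> R},
  (size s)%:R <= (1 + #|I|%:R / K%:R) ^+ K * (1 + 2 * K%:R / #|I|%:R) ^+ #|I| :> R /\
  forall v : I -> R, (\sum_i Num.truncn (`|v i| / h) <= K)%N ->
   exists2 c, c \in s & forall i, `|v i - c i| <= `|v i| /\ `|v i - c i| <= h.
Proof.
move=> h0 K0 N0.
pose S := [pred u : {ffun I -> 'I_(K.*2.+1)} | (\sum_i `|int_of_code (u i)| <= K)%N].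
pose dec (u : {ffun I -> 'I_(K.*2.+1)}) : {ffun I -> R} :=
 [ffun i => h * (int_of_code (u i))%:~R].
exists [seq dec u | u <- enum S]; split.
 by rewrite size_map -cardE; exact: lattice_count.
move=> v vK; pose t i := Num.truncn (`|v i| / h).
have tK i : (t i <= K)%N by apply: leq_trans vK; rewrite (bigD1 i)//= leq_addr.
pose u : {ffun I -> 'I_(K.*2.+1)} :=
 [ffun i => inord (if 0 <= v i then (K + t i)%N else (K - t i)%N)].
have ui i : int_of_code (u i) = if 0 <= v i then (t i)%:Z else - (t i)%:Z.
 rewrite /int_of_code ffunE inordK; last by have := tK i; case: ifP => _; lia.
 by have := tK i; case: ifP => _; lia.
have uS : u \in S.
 rewrite inE; apply: leq_trans vK; apply: leq_sum => i _; rewrite ui.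
 by case: ifP => _; rewrite ?abszN.
exists (dec u); first by apply/mapP; exists u => //; rewrite mem_enum.
move=> i; rewrite ffunE ui.
have /truncn_itv /andP[t1 t2] : 0 <= `|v i| / h by rewrite divr_ge0// ltW.
rewrite ler_pdivlMr// in t1; rewrite ltr_pdivrMr// in t2.
rewrite -natr1 mulrDl mul1r in t2.
have th0 : 0 <= (t i)%:R * h by rewrite mulr_ge0// ltW.
rewrite -/(t i) in t1 t2; move: t1 t2 th0; rewrite (mulrC _ h).
have eT : h * ((t i)%:Z)%:~R = h * (t i)%:R by [].
case: ifPn => vi; rewrite ?mulrNz ?mulrN ?eT; set T := h * _ => t1 t2 th0.
 rewrite (ger0_norm vi) in t1 t2 *.
 by rewrite ger0_norm ?subr_ge0//; split; lra.
rewrite -ltNge in vi; rewrite (ltr0_norm vi) in t1 t2 *.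
by rewrite ler0_norm; [split|]; lra.
Qed.

Lemma ln_le_powR (y b : R) : 0 < b -> 0 < y -> ln y <= b^-1 * y `^ b.
Proof.
move=> b0 y0; rewrite ler_pdivlMl// -ln_powR -{1}[y `^ b](subrKC 1).
have h := powR_gt0 b y0.
by rewrite (le_trans (le_ln1Dx _))// ?ltrBrDl ?subrr// lerBlDr lerDl.
Qed.

(** Converts exponential bounds on the number of codes into powers of two, the unit in which entropy
    numbers count. *)
Lemma expR_le_pow2 (c : R) : exists A : nat, forall n : nat,
 expR (c * n%:R) <= (2 ^ (A * n))%:R.
Proof.
have l2 : 0 < ln (2 : R) by rewrite ln_gt0// ltr1n.
exists (Num.truncn (`|c| / ln 2)).+1 => n.
have e2 : expR (ln 2) = 2 :> R by rewrite lnK// posrE.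
set A := (Num.truncn _).+1.
have -> : (2 ^ (A * n))%:R = expR (ln 2 * (A * n)%:R) :> R by rewrite expRM_natr e2 natrX.
rewrite ler_expR natrM mulrA; apply: ler_wpM2r => //.
rewrite mulrC -ler_pdivrMr// (le_trans _ (ltW (truncnS_gt (`|c| / ln 2))))//.
by apply: ler_wpM2r; [rewrite invr_ge0 ltW|exact: ler_norm].
Qed.

(** The case n <= N. With K about k = n (n/N)^eta and step K^(-1/p), the codes have l_1 norm at most
    K and the error is a vector cut off at height K^(-1/p). The factor (N/n)^eta, with eta as small
    as desired, stands in for a logarithm. *)
Lemma entropy_lp_small (p q : \bar R) (eta : R) : (1 <= p)%E -> (p <= q)%E -> 0 < eta ->
 exists (A : nat) (C : R), forall (I : finType) (n : nat), (0 < n)%N -> (n <= #|I|)%N ->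
 exists s : seq {ffun I -> R}, (size s <= 2 ^ (A * n))%N /\
  forall v : I -> R, lpn p v <= 1 -> exists2 c, c \in s &
   lpn q (fun i => v i - c i) <=
    C * n%:R `^ (- (recip p - recip q)) * (#|I|%:R / n%:R) `^ eta.
Proof.
move=> p1 pq eta0; pose tau := recip p - recip q.
have tau01 : 0 <= tau <= 1.
 have /andP[a0 a1] := recip_ge0 p1.
 have /andP[b0 b1] := recip_ge0 (le_trans p1 pq).
 by have := recip_le p1 pq; rewrite /tau => ?; apply/andP; split; lra.
have /andP[tau0 tau1] := tau01.
(* This exponent solves eta (1 - beta) = beta, so that k (N/k)^beta is exactly n. *)
pose beta := eta / (1 + eta).
have e1 : 0 < 1 + eta by rewrite addr_gt0.
have beta0 : 0 < beta by rewrite divr_gt0.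
have [A hA] := expR_le_pow2 (2 / beta + 2).
exists A, 2 => I n n0; set N := #|I| => nN.
have n0R : 0 < n%:R :> R by rewrite ltr0n.
have N0 : (0 < N)%N := leq_trans n0 nN.
have N0R : 0 < N%:R :> R by rewrite ltr0n.
have nNR : n%:R <= N%:R :> R by rewrite ler_nat.
pose x : R := N%:R / n%:R.
have x1 : 1 <= x by rewrite ler_pdivlMr ?mul1r.
have x0 : 0 < x by rewrite (lt_le_trans _ x1).
pose k : R := n%:R * x `^ (- eta).
have k0 : 0 < k by rewrite mulr_gt0// powR_gt0.
have kn : k <= n%:R.
 by rewrite ler_piMr// -(powRr0 x) ler_powR// oppr_le0 ltW.
have kt : k `^ (- tau) <= n%:R `^ (- tau) * x `^ eta.
 rewrite powRM ?powR_ge0// ler_wpM2l ?powR_ge0// -powRrM mulrNN ler_powR//.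
 by rewrite ler_piMr// ltW.
(* For k < 1 the claimed error is at least 1, and the zero vector is a sufficient code. *)
have [k1|k1] := ltP k 1.
 exists [:: [ffun=> 0]]; split; first by rewrite expn_gt0.
 move=> v hv; exists [ffun=> 0]; first by rewrite inE.
 under eq_fun do rewrite ffunE subr0.
 rewrite (le_trans (lpn_le_lpn p1 pq hv))// -mulrA (@le_trans _ _ (2 * k `^ (- tau)))//; last first.
  by rewrite ler_wpM2l.
 have : 1 <= k `^ (- tau).
  by rewrite powRN_ge1// k0 ltW.
 lra.
case: p p1 pq @tau tau01 tau0 tau1 kt => [t||]//; last first.
 move=> p1 pq tau tau01 tau0 tau1 kt.
 exists [:: [ffun=> 0]]; split; first by rewrite expn_gt0.
 move=> v hv; exists [ffun=> 0]; first by rewrite inE.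
 under eq_fun do rewrite ffunE subr0.
 rewrite (le_trans (lpn_le_lpn p1 pq hv))//.
 have qE : q = +oo%E by apply/eqP; rewrite eq_le leey.
 rewrite qE subrr oppr0 powRr0 mulr1.
 have : 1 <= x `^ eta by rewrite -(powRr0 x) ler_powR// ltW.
 rewrite -/x; lra.
rewrite lee_fin => t1 pq tau tau01 tau0 tau1 kt.
have t0 : 0 < t by rewrite (lt_le_trans _ t1).
pose K := Num.truncn k.
have K0 : (0 < K)%N by rewrite truncn_gt0.
have K0R : 0 < K%:R :> R by rewrite ltr0n.
have /truncn_itv/andP[Kk kK] : 0 <= k by exact: ltW.
have K1 : 1 <= K%:R :> R by rewrite ler1n.
rewrite -/K -natr1 in Kk kK.
pose h := K%:R `^ (- t^-1).
have h0 : 0 < h by rewrite powR_gt0.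
have [s [ss hs]] := quantize h0 K0 N0.
exists s; split.
 rewrite -(ler_nat R) (le_trans _ (hA n))// (le_trans ss)//.
 rewrite [(_ + 2) * _]mulrDl expRD; apply: ler_pM; rewrite ?exprn_ge0 ?addr_ge0 ?divr_ge0 ?mulr_ge0//.
  have y0 : 0 < 1 + N%:R / K%:R :> R by rewrite addr_gt0// divr_gt0.
  rewrite -ler_ln ?posrE ?exprn_gt0 ?expR_gt0// lnXn// expRK.
  rewrite -[ln _ *+ K]mulr_natl.
  rewrite (le_trans (ler_wpM2l (ltW K0R) (ln_le_powR beta0 y0)))//.
  rewrite mulrCA -mulrA [leRHS]mulrCA ler_wpM2l ?invr_ge0 ?(ltW beta0)//.
  have beta1 : beta <= 1 by rewrite /beta ler_pdivrMr// mul1r lerDr.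
  have y2 : 1 + N%:R / K%:R <= 2 * (N%:R / K%:R) :> R.
   have : 1 <= N%:R / K%:R :> R.
    by rewrite ler_pdivlMr// mul1r (le_trans Kk)// (le_trans kn).
   by clear; lra.
  rewrite (@le_trans _ _ (K%:R * (2 * (N%:R / K%:R)) `^ beta))//.
   rewrite ler_wpM2l ?(ltW K0R)// ge0_ler_powR ?nnegrE ?(ltW beta0) ?(ltW y0)//.
  have NK0 : 0 <= N%:R / K%:R :> R by rewrite divr_ge0.
  rewrite powRM// powRM ?invr_ge0// mulrCA.
  rewrite (@le_trans _ _ (2 * (K%:R * (N%:R `^ beta * K%:R^-1 `^ beta))))//.
   rewrite ler_wpM2r ?mulr_ge0 ?powR_ge0//.
   by rewrite ler1_powR// ler1n.
  rewrite ler_wpM2l//.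
  have -> : K%:R * (N%:R `^ beta * K%:R^-1 `^ beta) = N%:R `^ beta * K%:R `^ (1 - beta) :> R.
   rewrite mulrCA; congr (_ * _).
   rewrite powRD ?(gt_eqF K0R) ?implybT// powRr1 ?(ltW K0R)//; congr (_ * _).
   by rewrite -(powR_inv1 (ltW K0R)) -powRrM mulN1r.
  rewrite (@le_trans _ _ (N%:R `^ beta * k `^ (1 - beta)))//.
   by rewrite ler_wpM2l ?powR_ge0// ge0_ler_powR ?nnegrE ?subr_ge0 ?(ltW k0).
  rewrite /k powRM ?powR_ge0// -powRrM.
  have -> : - eta * (1 - beta) = - beta by rewrite /beta; field; rewrite gt_eqF.
  have -> : N%:R = n%:R * x :> R by rewrite /x mulrCA divff ?mulr1// gt_eqF.
  rewrite powRM ?(ltW x0)// mulrACA -powRD ?(gt_eqF n0R) ?implybT//.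
  rewrite -powRD ?(gt_eqF x0) ?implybT// subrKC subrr powRr0 powRr1 ?mulr1//.
 have y0 : 0 <= 2 * K%:R / N%:R :> R by rewrite divr_ge0.
 rewrite (@le_trans _ _ (expR (2 * K%:R / N%:R) ^+ N))//.
  by rewrite lerXn2r ?nnegrE ?addr_ge0 ?expR_ge0// expR_ge1Dx.
 rewrite -expRM_natl ler_expR mulrCA divff ?gt_eqF// mulr1 ler_wpM2l//.
 exact: le_trans kn.
move=> v hv; have [|c cs hc] := hs v.
 rewrite -(ler_nat R) natr_sum.
 move: hv; rewrite lpn_le1P// => hv.
 (* An integer part is 0, or else its argument is at least 1 and hence dominated by its power of
    exponent t >= 1. *)
 rewrite (@le_trans _ _ (\sum_i (`|v i| / h) `^ t))//.
  apply: ler_sum => i _.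
  have vh : 0 <= `|v i| / h by rewrite divr_ge0// ltW.
  have /andP[T1 T2] := truncn_itv vh.
  have [->|T0] := posnP (Num.truncn (`|v i| / h)); first exact: powR_ge0.
  rewrite (le_trans T1)// -[leLHS](powRr1 vh) ler_powR//.
  by rewrite -truncn_gt0.
 have hK : h^-1 `^ t = K%:R.
  by rewrite /h powRN invrK -powRrM mulVf ?gt_eqF// powRr1 ?(ltW K0R).
 under eq_bigr do rewrite powRM ?invr_ge0 ?(ltW h0)// hK.
 by rewrite -mulr_suml ler_piMl.
exists c => //.
have rt : recip t%:E = t^-1 by rewrite /recip/= inver gt_eqF.
have := @lpn_cut t%:E q I v (fun i => v i - c i) K%:R t1 pq K0R hv.
move=> /(_ (fun i => (hc i).1)); rewrite rt => /(_ (fun i => (hc i).2)) H.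
rewrite (le_trans H)// -rt -/tau -mulrA -/x.
rewrite (@le_trans _ _ (2 * k `^ (- tau)))//; last by rewrite ler_wpM2l.
rewrite !powRN ler_pdivlMr ?powR_gt0// mulrC ler_pdivrMr ?powR_gt0//.
rewrite (@le_trans _ _ ((2 * K%:R) `^ tau))//.
 have k2 : k <= 2 * K%:R by move: kK K1; clear; lra.
 by apply: (ge0_ler_powR tau0) k2; rewrite nnegrE; [exact: ltW|rewrite mulr_ge0].
rewrite powRM// ler_wpM2r ?powR_ge0// -[leRHS](powRr1 (ler0n _ 2)).
by rewrite ler_powR// ler1n.
Qed.

(** Holder's inequality up to the factor 2, from y <= 1 + y^r applied to y = N^(1/r) |v_i|. *)
Lemma lpn_sum_le (p : \bar R) (I : finType) (v : I -> R) : (1 <= p)%E ->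
 (0 < #|I|)%N -> lpn p v <= 1 -> \sum_i `|v i| <= 2 * #|I|%:R `^ (1 - recip p).
Proof.
set N := #|I| => p1 N0; have N0R : 0 < N%:R :> R by rewrite ltr0n.
case: p p1 => [r||]//; last first.
 move=> _ hv; have -> : recip +oo%E = 0 :> R by rewrite /recip invey.
 rewrite subr0 powRr1// (@le_trans _ _ (\sum_(i : I) 1))//.
  by apply: ler_sum => i _; rewrite (le_trans _ hv)// (@lpn_coord +oo%E)// leey.
 by rewrite sumr_const -/N -[1 *+ N]/(N%:R) ler_peMl// ler1n.
rewrite lee_fin => r1; have r0 : 0 < r by rewrite (lt_le_trans _ r1).
rewrite lpn_le1P// => hv.
have -> : recip r%:E = r^-1 by rewrite /recip/= inver gt_eqF.
rewrite powRD ?(gt_eqF N0R) ?implybT// powRr1// powRN.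
have Nr : 0 < N%:R `^ r^-1 :> R by rewrite powR_gt0.
rewrite mulrA ler_pdivlMr// mulr_suml.
apply: (@le_trans _ _ (\sum_(i : I) (1 + N%:R * `|v i| `^ r))).
 apply: ler_sum => i _.
 have -> : N%:R * `|v i| `^ r = (`|v i| * N%:R `^ r^-1) `^ r.
  by rewrite powRM ?(ltW Nr)// -powRrM mulVf ?gt_eqF// powRr1// mulrC.
 set y := _ * _; have y0 : 0 <= y by rewrite mulr_ge0// ltW.
 have [y1|y1] := leP y 1; first by rewrite (le_trans y1)// lerDl powR_ge0.
 rewrite (@le_trans _ _ (y `^ r))// ?lerDr// -[leLHS](powRr1 y0).
 by rewrite ler_powR// ltW.
have e1 : \sum_(i : I) (1 : R) = N%:R by rewrite sumr_const.
rewrite big_split/= e1 -mulr_sumr.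
have : N%:R * \sum_i `|v i| `^ r <= N%:R by rewrite ler_piMr.
lra.
Qed.

(** The case N <= n. Rounding every coordinate with one step h gives an l_q error of at most N^(1/q)
    h, and the logarithm of the number of codes is of order N (1 + ln(n/N)), hence of order n at
    most. The power k of N/n is arbitrary and replaces an exponential gain. *)
Lemma entropy_lp_large (p q : \bar R) (k : R) : (1 <= p)%E -> (p <= q)%E -> 0 <= k ->
 exists A : nat, forall (I : finType) (n : nat), (0 < #|I|)%N -> (#|I| <= n)%N ->
 exists s : seq {ffun I -> R}, (size s <= 2 ^ (A * n))%N /\
  forall v : I -> R, lpn p v <= 1 -> exists2 c, c \in s &
   lpn q (fun i => v i - c i) <=
    n%:R `^ (- (recip p - recip q)) * (#|I|%:R / n%:R) `^ k.
Proof.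
move=> p1 pq k0; pose tau := recip p - recip q.
have /andP[a0 a1] := recip_ge0 p1.
have /andP[b0 b1] := recip_ge0 (le_trans p1 pq).
have tau0 : 0 <= tau by have := recip_le p1 pq; rewrite /tau; lra.
have tau1 : tau <= 1 by rewrite /tau; lra.
have [A hA] := expR_le_pow2 (1 + (5 + (k + 1))).
exists A => I n; set N := #|I| => N0 Nn.
have n0 : (0 < n)%N := leq_trans N0 Nn.
have n0R : 0 < n%:R :> R by rewrite ltr0n.
have N0R : 0 < N%:R :> R by rewrite ltr0n.
have nNR : N%:R <= n%:R :> R by rewrite ler_nat.
pose x : R := n%:R / N%:R.
have x1 : 1 <= x by rewrite ler_pdivlMr ?mul1r.
have x0 : 0 < x by rewrite (lt_le_trans _ x1).
have k10 : 0 <= k + 1 by rewrite addr_ge0.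
(* Of the exponent k + 1, one power of N/n is spent on replacing N^(-tau) by n^(-tau), where tau <=
   1. *)
pose h := N%:R `^ (- recip p) * x `^ (- (k + 1)).
have h0 : 0 < h by rewrite mulr_gt0 ?powR_gt0.
(* This is 2 N^(1 - 1/p)/h, the bound of [lpn_sum_le] for the l_1 norm of v in units of h. *)
pose kk : R := 2 * N%:R * x `^ (k + 1).
have kk1 : 1 <= kk.
 have := powR_ge1 x1 k10; have : 1 <= N%:R :> R by rewrite ler1n.
 by rewrite /kk; nra.
pose K := Num.truncn kk.
have K0 : (0 < K)%N by rewrite truncn_gt0.
have K0R : 0 < K%:R :> R by rewrite ltr0n.
have /truncn_itv/andP[Kk kK] : 0 <= kk by exact: le_trans kk1.
rewrite -/K in Kk kK.
have [s [ss hs]] := quantize h0 K0 N0.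
exists s; split.
 rewrite -(ler_nat R) (le_trans _ (hA n))// (le_trans ss)//.
 rewrite [(1 + (5 + _)) * _]mulrDl mul1r expRD; apply: ler_pM; rewrite ?exprn_ge0 ?addr_ge0 ?divr_ge0 ?mulr_ge0//.
  rewrite (@le_trans _ _ (expR (N%:R / K%:R) ^+ K))//.
   by rewrite lerXn2r ?nnegrE ?addr_ge0 ?divr_ge0 ?expR_ge0// expR_ge1Dx.
  by rewrite -expRM_natl ler_expR mulrCA divff ?gt_eqF// mulr1.
 have y0 : 0 < 1 + 2 * K%:R / N%:R :> R by rewrite addr_gt0// divr_gt0// mulr_gt0.
 rewrite -ler_ln ?posrE ?exprn_gt0 ?expR_gt0// lnXn// expRK.
 rewrite -[ln _ *+ _]mulr_natl.
 have y5 : 1 + 2 * K%:R / N%:R <= 5 * x `^ (k + 1).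
  have h2 : 2 * K%:R / N%:R <= 4 * x `^ (k + 1).
   rewrite ler_pdivrMr// (_ : 4 * _ * _ = 2 * kk) ?ler_wpM2l//.
   by rewrite /kk; ring.
  have := lerD (powR_ge1 x1 k10) h2.
  by rewrite (_ : _ + 4 * _ = 5 * x `^ (k + 1))//; ring.
 have xk0 : 0 < x `^ (k + 1) by rewrite powR_gt0.
 have lnx : ln x <= x.
  rewrite -{1}(subrKC 1 x) (le_trans (le_ln1Dx _))//.
   by rewrite ltrBrDl subrr.
  by rewrite lerBlDr lerDl.
 have ln5 : ln 5 <= 5 :> R.
  rewrite -{1}(subrKC 1 5) (le_trans (le_ln1Dx _))//.
   by rewrite ltrBrDl subrr.
  by rewrite lerBlDr lerDl.
 have lny : ln (1 + 2 * K%:R / N%:R) <= (5 + (k + 1)) * x.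
  rewrite (le_trans (_ : _ <= ln (5 * x `^ (k + 1))))//.
   by rewrite ler_ln ?posrE ?mulr_gt0.
  rewrite lnM ?posrE// ln_powR.
  rewrite [leRHS]mulrDl; apply: lerD; last exact: ler_wpM2l.
  by rewrite (le_trans ln5)// ler_peMr.
 rewrite (le_trans (ler_wpM2l (ltW N0R) lny))//.
 by rewrite /x mulrCA [N%:R * _]mulrCA divff ?gt_eqF// mulr1.
move=> v hv; have [|c cs hc] := hs v.
 rewrite -(ltnS _ K) -(ltr_nat R) (le_lt_trans _ kK)// natr_sum.
 apply: (@le_trans _ _ (\sum_i `|v i| / h)).
  apply: ler_sum => i _.
  by have /truncn_itv/andP[] : 0 <= `|v i| / h by rewrite divr_ge0// ltW.
 rewrite -mulr_suml ler_pdivrMr// (le_trans (lpn_sum_le p1 N0 hv))// -/N /kk /h.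
 rewrite -!mulrA ler_wpM2l// mulrCA [X in _ <= _ * X]mulrA.
 rewrite [N%:R `^ (1 - _)]powRD ?(gt_eqF N0R) ?implybT// powRr1 ?(ltW N0R)//.
 rewrite [leRHS](_ : _ = N%:R * N%:R `^ (- recip p) * (x `^ (k + 1) * x `^ (- (k + 1)))); last by ring.
 by rewrite -powRD ?(gt_eqF x0) ?implybT// subrr powRr0 mulr1.
exists c => //.
have wN : lpn q (fun i => v i - c i) <= N%:R `^ (recip q) * h.
 case: q pq {tau tau0 tau1 b0 b1} => [u||]; last first.
 - by rewrite leeNy_eq => /eqP pE; rewrite pE in p1.
 - rewrite recipy powRr0 mul1r => _; apply/bigmax_leP; split; first exact: ltW.
  by move=> i _; have [] := hc i.
 -
  case: p p1 {a0 a1 hv} h h0 hs hc => [t||]//; rewrite ?lee_fin => t1 h h0 hs hc tu.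
  have u0 : 0 < u by rewrite (lt_le_trans _ tu)// (lt_le_trans _ t1).
  rewrite /= recip_fin ?gt_eqF//.
  rewrite (_ : N%:R `^ u^-1 * h = (N%:R * h `^ u) `^ u^-1).
   apply: ge0_ler_powR; rewrite ?nnegrE ?mulr_ge0 ?powR_ge0 ?invr_ge0 ?(ltW u0)//.
    by apply: sumr_ge0 => i _; exact: powR_ge0.
   rewrite mulr_natl -sumr_const; apply: ler_sum => i _.
   by apply: ge0_ler_powR; rewrite ?nnegrE ?(ltW u0) ?(ltW h0)//; have [] := hc i.
  by rewrite powRM ?powR_ge0// -powRrM divff ?gt_eqF// powRr1// ltW.
rewrite (le_trans wN)// /h mulrA -powRD ?(gt_eqF N0R) ?implybT//.
have -> : recip q - recip p = - tau by rewrite opprB.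
have -> : N%:R = n%:R * x^-1 by rewrite /x invf_div mulrCA divff ?mulr1// gt_eqF.
rewrite [_ * _ / n%:R]mulrAC divff ?gt_eqF// mul1r.
rewrite powRM ?invr_ge0 ?(ltW x0)// -mulrA ler_wpM2l ?powR_ge0//.
rewrite -(powR_inv1 (ltW x0)) -!powRrM -powRD ?(gt_eqF x0) ?implybT//.
rewrite ler_powR// !mulN1r opprK.
by move: tau0 tau1 k0; clear; lra.
Qed.

End Lattice.

(** * One-dimensional kernels of averaged Taylor polynomials *)

Section SmoothOneDim.
Variable R : realType.
Implicit Types f g : R -> R.

Fixpoint times_derivable (k : nat) f : Prop :=
 if k is k'.+1 then (forall x, derivable f x 1) /\ times_derivable k' (derive1 f)
 else True.

Definition smooth1 f := forall k, times_derivable k f.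

Lemma times_derivableW k f : times_derivable k.+1 f -> times_derivable k f.
Proof.
elim: k f => [//|k IH] f [df h]; split=> //; exact: IH.
Qed.

Lemma smooth1_derivable f x : smooth1 f -> derivable f x 1.
Proof. by move=> /(_ 1%N)[]. Qed.

Lemma smooth1_derive f : smooth1 f -> smooth1 (derive1 f).
Proof. by move=> h k; have [] := h k.+1. Qed.

Lemma smooth1_deriven n f : smooth1 f -> smooth1 (derive1n n f).
Proof. by move=> h; elim: n => // n; rewrite derive1nS => /smooth1_derive. Qed.

Lemma smooth1_continuous f : smooth1 f -> continuous f.
Proof.
by move=> h x; apply/differentiable_continuous/derivable1_diffP/smooth1_derivable.
Qed.

Lemma derive1_cst (c : R) : derive1 (cst c) = cst 0.
Proof. by apply/funext => x; rewrite derive1E derive_cst. Qed.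

Lemma derive1_add f g : (forall x, derivable f x 1) ->
 (forall x, derivable g x 1) -> derive1 (f \+ g) = (derive1 f) \+ (derive1 g).
Proof. by move=> df dg; apply/funext => x; rewrite /= !derive1E deriveD. Qed.

Lemma derive1_mul f g : (forall x, derivable f x 1) ->
 (forall x, derivable g x 1) -> derive1 (f \* g) = ((derive1 f) \* g) \+ (f \* (derive1 g)).
Proof.
move=> df dg; apply/funext => x; rewrite /= !derive1E deriveM// /GRing.scale/=; ring.
Qed.

Lemma times_derivable_cst k (c : R) : times_derivable k (cst c).
Proof.
elim: k c => // k IH c; split; first by move=> x; exact: derivable_cst.
by rewrite derive1_cst; exact: IH.
Qed.

Lemma times_derivableD k f g : times_derivable k f -> times_derivable k g ->
 times_derivable k (f \+ g).
Proof.
elim: k f g => // k IH f g [df hf] [dg hg]; split.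
 by move=> x; exact: derivableD.
by rewrite derive1_add//; exact: IH.
Qed.

Lemma times_derivableM k f g : times_derivable k f -> times_derivable k g ->
 times_derivable k (f \* g).
Proof.
elim: k f g => // k IH f g hf hg; have [df kf] := hf; have [dg kg] := hg; split.
 by move=> x; exact: derivableM.
rewrite derive1_mul//; apply: times_derivableD; apply: IH => //;
 exact: times_derivableW.
Qed.

Lemma smooth1_cst c : smooth1 (cst c).
Proof. by move=> k; exact: times_derivable_cst. Qed.

Lemma smooth1D f g : smooth1 f -> smooth1 g -> smooth1 (f \+ g).
Proof. by move=> hf hg k; exact: times_derivableD. Qed.

Lemma smooth1M f g : smooth1 f -> smooth1 g -> smooth1 (f \* g).
Proof. by move=> hf hg k; exact: times_derivableM. Qed.

Lemma derive1_affine f (a b : R) : (forall x, derivable f x 1) ->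
 (forall x, derivable (fun y => f (a * y + b)) x 1) /\
 derive1 (fun y => f (a * y + b)) = cst a \* (fun y => (derive1 f) (a * y + b)).
Proof.
move=> df.
have h x : is_derive x (1 : R) (fun y => a * y + b) a.
 apply: is_derive_eq; rewrite /GRing.scale/=; ring.
have hf x : is_derive x (1 : R) (fun y => f (a * y + b)) (a * (derive1 f) (a * x + b)).
 have e : is_derive (a * x + b) (1:R) f ((derive1 f) (a * x + b)).
  by rewrite derive1E; exact: derivableP.
 by have := @is_derive1_comp _ f (fun y => a * y + b) x _ _ e (h x); rewrite mulrC.
split=> [x|]; first by have [] := hf x.
by apply/funext => x; rewrite derive1E; apply: (@derive_val _ _ _ _ _ _ _ (hf x)).
Qed.

Lemma smooth1_affine f (a b : R) : smooth1 f -> smooth1 (fun y => f (a * y + b)).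
Proof.
move=> hf k; elim: k f hf => // k IH f hf.
have [h1 h2] := derive1_affine a b (fun x => @smooth1_derivable f x hf).
split=> //; rewrite h2; apply: times_derivableM.
 exact: times_derivable_cst.
exact/IH/smooth1_derive.
Qed.

Lemma smooth1_id : smooth1 id.
Proof.
case=> // k; split; first by move=> x; exact: derivable_id.
rewrite (_ : derive1 (id : R -> R) = cst (1 : R)); first exact: times_derivable_cst.
by apply/funext => x; rewrite derive1E derive_id.
Qed.

Lemma smooth1X f n : smooth1 f -> smooth1 (fun x => f x ^+ n).
Proof.
move=> hf; elim: n => [|n IH].
 by under eq_fun do rewrite expr0; exact: smooth1_cst.
by under eq_fun do rewrite exprS; exact: smooth1M.
Qed.

Lemma smooth1_inv f : (forall x, f x != 0) -> smooth1 f ->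
 smooth1 (fun x => (f x)^-1).
Proof.
move=> f0 hf k; elim: k => // k IH; split.
 by move=> x; apply: derivableV => //; exact: smooth1_derivable.
rewrite (_ : derive1 _ = (cst (-1) \* (derive1 f)) \*
  ((fun x => (f x)^-1) \* (fun x => (f x)^-1))); last first.
 apply/funext => x; rewrite derive1E deriveV//; last exact: smooth1_derivable.
 by rewrite /GRing.scale/= derive1E -exprVn expr2; ring.
apply: times_derivableM; last exact: times_derivableM.
apply: times_derivableM; first exact: times_derivable_cst.
exact: smooth1_derive.
Qed.

(** With y = 1/x this is the flatness of exp(-1/x) at 0. A power y^n is compared with e^y through
    y/n <= 1 + y/n <= e^(y/n). *)
Lemma poly_expR_bound (P : {poly R}) n :
 exists2 C : R, 0 <= C & forall y, 1 <= y -> `|P.[y]| * y ^+ n * expR (- y) <= C.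
Proof.
elim/poly_ind: P n => [|P c IH] n.
 by exists 0 => // y _; rewrite horner0 normr0 !mul0r.
have [C C0 hC] := IH n.+1.
exists (C + `|c| * n%:R ^+ n) => [|y y1].
 by rewrite addr_ge0// mulr_ge0// exprn_ge0.
have y0 : 0 < y by rewrite (lt_le_trans _ y1).
rewrite hornerMXaddC.
have e0 := expR_gt0 (- y).
apply: (@le_trans _ _ ((`|P.[y]| * y + `|c|) * y ^+ n * expR (- y))).
 apply: ler_wpM2r; first exact: ltW.
 apply: ler_wpM2r; first by rewrite exprn_ge0// ltW.
 by rewrite (le_trans (ler_normD _ _))// normrM (gtr0_norm y0).
rewrite -mulrA mulrDl lerD//.
 by rewrite mulrA -[`|_| * y * _]mulrA -exprS hC.
rewrite ler_wpM2l// expRN ler_pdivrMr ?expR_gt0//.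
case: n {IH hC} => [|n]; first by rewrite !expr0 mul1r -expR0 ler_expR ltW.
rewrite (_ : y = (y / n.+1%:R) *+ n.+1); last by rewrite -mulr_natr divfK.
rewrite -mulr_natl expRM_natl -exprMn.
rewrite lerXn2r ?nnegrE ?mulr_ge0 ?mulrn_wge0 ?divr_ge0 ?expR_ge0 ?ltW//.
rewrite ltr_pM2l ?ltr0n//.
by rewrite (lt_le_trans _ (expR_ge1Dx _))// ltrDr.
Qed.

(** A class stable under differentiation: the derivative replaces P by X^2 (P - P'). It contains the
    standard flat function, for P = 1, which is therefore smooth. *)
Definition flat_poly (P : {poly R}) (x : R) : R :=
 if 0 < x then P.[x^-1] * expR (- x^-1) else 0.

Lemma flat_cvg P C : 0 <= C ->
 (forall y, 1 <= y -> `|P.[y]| * y ^+ 2 * expR (- y) <= C) ->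
 h^-1 *: ((flat_poly P \o shift 0) (h *: (1 : R)) - flat_poly P 0) @[h --> 0^'] --> (0 : R).
Proof.
move=> C0 hC; apply/cvgrPdist_le => e e0.
have C1 : 0 < C + 1 by rewrite ltr_wpDl.
near=> h.
have h0 : h != 0 by near: h; exact: nbhs_dnbhs_neq.
rewrite sub0r normrN /= {2}/flat_poly ltxx subr0 /GRing.scale/= mulr1 addr0.
rewrite /flat_poly; case: ifPn => [hp|_]; last by rewrite mulr0 normr0 ltW.
have h1 : h <= 1.
 apply: le_trans (ler_norm _) _; near: h; apply: dnbhs0_le; exact: ltr01.
have h2 : h <= e / (C + 1).
 apply: le_trans (ler_norm _) _; near: h; apply: dnbhs0_le; exact: divr_gt0.
have := hC h^-1; rewrite invf_ge1// => /(_ h1) hh.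
rewrite !normrM (gtr0_norm (expR_gt0 _)) gtr0_norm ?invr_gt0//.
have {hh} : h^-1 * (`|P.[h^-1]| * expR (- h^-1)) <= C * h.
 rewrite -ler_pdivrMr// (le_trans _ hh)// expr2 le_eqVlt; apply/orP; left.
 by apply/eqP; ring.
move/le_trans; apply.
rewrite ler_pdivlMr// in h2.
by rewrite (le_trans _ h2)// mulrC ler_wpM2l ?lerDl// ltW.
Unshelve. all: by end_near. Qed.

Lemma flat_poly_derive P x :
 is_derive x (1 : R) (flat_poly P) (flat_poly ('X^2 * (P - P^`())) x).
Proof.
have [x0|x0|->] := ltgtP x 0.
- rewrite {2}/flat_poly ltNge (ltW x0)/=.
 apply: (@near_eq_is_derive _ _ _ (cst (0 : R))).
 near=> y; rewrite /flat_poly ifF//; apply/negbTE; rewrite -leNgt ltW//.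
 by near: y; exact: lt_nbhsl.
- rewrite {2}/flat_poly x0.

 have x0' : x != 0 by rewrite gt_eqF.
 have hV : is_derive x (1:R) (fun y : R => y^-1) (- x ^- 2).
  have := @is_deriveV _ id x 1 1 x0' (is_derive_id _ _).
  by rewrite /GRing.scale/= mulr1.
 have hP : is_derive x (1:R) (fun y => P.[y^-1]) (- x ^- 2 * P^`().[x^-1]).
  by have := is_derive1_comp (is_derive_poly P _) hV; rewrite mulrC.
 have hE : is_derive x (1:R) (fun y => expR (- y^-1)) (x ^- 2 * expR (- x^-1)).
  have hN : is_derive x (1:R) (fun y : R => - y^-1) (x ^- 2).
   by apply: is_derive_eq (is_deriveN hV) _; rewrite opprK.
  by have := is_derive1_comp (is_derive_expR _) hN; rewrite mulrC.
 have hd : is_derive x (1:R) (fun y => P.[y^-1] * expR (- y^-1))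
   (('X^2 * (P - P^`())).[x^-1] * expR (- x^-1)).
  apply: is_derive_eq (is_deriveM hP hE) _.
  rewrite /GRing.scale/= hornerM hornerXn hornerD hornerN exprVn.
  by set u := x ^- 2; set e := expR _; ring.
 apply: (near_eq_is_derive _ hd).
 near=> y; rewrite /flat_poly ifT//.
 by near: y; exact: lt_nbhsr.
- have [C C0 hC] := poly_expR_bound P 2.
 have h0 : flat_poly P 0 = 0 by rewrite /flat_poly ltxx.
 have h0' : flat_poly ('X^2 * (P - P^`())) 0 = 0 by rewrite /flat_poly ltxx.
 rewrite h0'; apply: DeriveDef; last first.
  apply: cvg_lim => //; exact: (flat_cvg C0 hC).
 by apply/cvg_ex; exists 0; exact: (flat_cvg C0 hC).
Unshelve. all: by end_near. Qed.

Lemma flat_poly_times P k : times_derivable k (flat_poly P).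
Proof.
elim: k P => // k IH P; split; first by move=> x; have [] := flat_poly_derive P x.
rewrite (_ : derive1 _ = flat_poly ('X^2 * (P - P^`()))); first exact: IH.
apply/funext => x; rewrite derive1E.
by apply: (@derive_val _ _ _ _ _ _ _ (flat_poly_derive P x)).
Qed.

(** The transition from 0 to 1 takes place inside [1/4, 3/4]; the margins keep the supports of the
    kernels away from the faces of their boxes. *)
Definition smooth_step (x : R) : R :=
 let F := flat_poly 1 in F (x - 4^-1) / (F (x - 4^-1) + F (3 / 4 - x)).

Lemma flat1_ge0 x : 0 <= flat_poly 1 x.
Proof. by rewrite /flat_poly; case: ifP => // _; rewrite hornerC mul1r expR_ge0. Qed.

Lemma flat1_gt0 x : 0 < x -> 0 < flat_poly 1 x.
Proof. by move=> x0; rewrite /flat_poly x0 hornerC mul1r expR_gt0. Qed.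

Lemma flat1_eq0 x : x <= 0 -> flat_poly 1 x = 0.
Proof. by move=> x0; rewrite /flat_poly ltNge x0. Qed.

Lemma smooth_step_den_gt0 x : 0 < flat_poly 1 (x - 4^-1) + flat_poly 1 (3 / 4 - x).
Proof.
have [h|h] := ltP (4^-1) x.
 by rewrite ltr_wpDr ?flat1_ge0// flat1_gt0// subr_gt0.
by rewrite ltr_wpDl ?flat1_ge0// flat1_gt0//; lra.
Qed.

Lemma smooth_step_le1 x : 0 <= smooth_step x <= 1.
Proof.
rewrite /smooth_step; apply/andP; split.
 by rewrite divr_ge0 ?flat1_ge0// ltW// smooth_step_den_gt0.
by rewrite ler_pdivrMr ?smooth_step_den_gt0// mul1r lerDl flat1_ge0.
Qed.

Lemma smooth_step0 x : x <= 4^-1 -> smooth_step x = 0.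
Proof. by move=> h; rewrite /smooth_step flat1_eq0 ?mul0r//; lra. Qed.

Lemma smooth_step1 x : 3 / 4 <= x -> smooth_step x = 1.
Proof.
move=> h; rewrite /smooth_step [flat_poly 1 (3 / 4 - x)]flat1_eq0; last by lra.
by rewrite addr0 divff// gt_eqF// flat1_gt0//; lra.
Qed.

Lemma smooth_step_smooth : smooth1 smooth_step.
Proof.
have s1 : smooth1 (flat_poly 1) by move=> k; exact: flat_poly_times.
have sl : smooth1 (fun x => flat_poly 1 (x - 4^-1)).
 have := smooth1_affine 1 (- 4^-1) s1.
 by under eq_fun do rewrite mul1r.
have sr : smooth1 (fun x => flat_poly 1 (3 / 4 - x)).
 have := smooth1_affine (-1) (3 / 4) s1.
 by under eq_fun do rewrite mulN1r addrC.
apply: (smooth1M sl); apply: smooth1_inv; last exact: smooth1D.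
by move=> x; rewrite gt_eqF// smooth_step_den_gt0.
Qed.

Lemma derive1n_near n f g (U : set R) : open U -> (forall x, U x -> f x = g x) ->
 forall x, U x -> derive1n n f x = derive1n n g x.
Proof.
move=> oU; elim: n f g => [//|n IH] f g fg x Ux.
rewrite !derive1Sn; apply: IH => // y Uy; rewrite !derive1E.
apply: near_eq_derive.
by apply: filterS (open_nbhs_nbhs (conj oU Uy)) => z; exact: fg.
Qed.

Lemma derive1n_horner n (P : {poly R}) : derive1n n (horner P) = horner P^`(n).
Proof.
elim: n P => [//|n IH] P.
rewrite derive1Sn (_ : derive1 _ = horner P^`()) ?IH ?derivSn//.
apply/funext => x; rewrite derive1E.
by apply: (@derive_val _ _ _ _ _ _ _ (is_derive_poly P x)).
Qed.

Lemma derive1nD n f g : smooth1 f -> smooth1 g ->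
 derive1n n (f \+ g) = derive1n n f \+ derive1n n g.
Proof.
elim: n f g => [//|n IH] f g sf sg; rewrite !derive1Sn derive1_add; last 2 first.
- by move=> x; exact: smooth1_derivable.
- by move=> x; exact: smooth1_derivable.
by rewrite IH//; exact: smooth1_derive.
Qed.

Lemma derive1nZ n (c : R) f : smooth1 f ->
 derive1n n (fun x => c * f x) = (fun x => c * derive1n n f x).
Proof.
elim: n f => [//|n IH] f sf; rewrite !derive1Sn -IH; last exact: smooth1_derive.
congr derive1n; apply/funext => x; rewrite !derive1E.
have -> : (fun x => c * f x) = c *: f by [].
by rewrite deriveZ//; exact: smooth1_derivable.
Qed.

Lemma smooth1_sum (I : Type) (t : seq I) (F : I -> R -> R) :
 (forall i, smooth1 (F i)) -> smooth1 (\sum_(i <- t) F i).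
Proof.
move=> sF; elim: t => [|i t IH]; first by rewrite big_nil; exact: smooth1_cst.
by rewrite big_cons; exact: smooth1D.
Qed.

Lemma derive1n_sum (I : Type) (t : seq I) n (F : I -> R -> R) x :
 (forall i, smooth1 (F i)) ->
 derive1n n (\sum_(i <- t) F i) x = \sum_(i <- t) derive1n n (F i) x.
Proof.
move=> sF; elim: t => [|i t IH]; last first.
 rewrite !big_cons -IH.
 by rewrite (derive1nD n (sF i) (smooth1_sum t sF)).
rewrite !big_nil (_ : 0 = horner (0 : {poly R})) ?derive1n_horner ?linear0 ?horner0//.
by apply/funext => z; rewrite horner0.
Qed.

Lemma derive1n_affine n f (a b : R) : smooth1 f ->
 derive1n n (fun y => f (a * y + b)) = (fun y => a ^+ n * derive1n n f (a * y + b)).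
Proof.
elim: n f => [|n IH] f sf; first by apply/funext => y; rewrite expr0 mul1r.
rewrite !derive1Sn (derive1_affine _ _ (fun x => @smooth1_derivable f x sf)).2.
rewrite (derive1nZ _ _ (smooth1_affine _ _ (smooth1_derive sf))) IH.
 by apply/funext => y; rewrite mulrA -exprS.
exact: smooth1_derive.
Qed.

(* The kernel of Sobolev's averaged Taylor polynomial of degree at most [s] on
  the interval [a, a + h]: it is the derivative of order [s + 1] of [taylor_prim],
  so that the difference of two such kernels is the derivative of order [s + 1]
  of a function with compact support. *)
Definition taylor_prim (s : nat) (a h x y : R) : R :=
 (-1) ^+ s / s`!%:R * (smooth_step (h^-1 * y + - (h^-1 * a)) * (x - y) ^+ s).

Definition taylor_ker (s : nat) (a h x : R) : R -> R :=
 derive1n s.+1 (taylor_prim s a h x).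

Lemma taylor_prim_smooth s a h x : smooth1 (taylor_prim s a h x).
Proof.
apply: (smooth1M (smooth1_cst _)); apply: smooth1M.
 exact: (smooth1_affine h^-1 (- (h^-1 * a)) smooth_step_smooth).
apply: smooth1X; have := smooth1_affine (-1) x smooth1_id.
by under eq_fun do rewrite mulN1r addrC.
Qed.

Lemma taylor_ker_smooth s a h x : smooth1 (taylor_ker s a h x).
Proof. exact/smooth1_deriven/taylor_prim_smooth. Qed.

Lemma taylor_ker_scale s a h x y : 0 < h ->
 taylor_ker s a h x y = h^-1 * taylor_ker s 0 1 ((x - a) / h) ((y - a) / h).
Proof.
move=> h0; rewrite /taylor_ker.
have hh : h != 0 by rewrite gt_eqF.
have -> : taylor_prim s a h x = (fun y => h ^+ s *
  taylor_prim s 0 1 ((x - a) / h) (h^-1 * y + - (h^-1 * a))).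
 apply/funext => z; rewrite /taylor_prim invr1 mul1r mulr0 subr0.
 rewrite (_ : (x - z) ^+ s = h ^+ s *
  ((x - a) / h - (h^-1 * z - h^-1 * a)) ^+ s); first by rewrite !mulrA; ring.
 by rewrite -exprMn; congr (_ ^+ _); field.
rewrite derive1nZ; last first.
 exact: (smooth1_affine h^-1 (- (h^-1 * a)) (taylor_prim_smooth _ _ _ _)).
rewrite derive1n_affine; last exact: taylor_prim_smooth.
rewrite mulrA exprSr mulrA -exprMn divff// expr1n mul1r.
by rewrite (_ : (y - a) / h = h^-1 * y - h^-1 * a)// mulrBl ![_ / h]mulrC.
Qed.

Lemma taylor_prim_lt s a h x y : 0 < h -> y <= a + h / 4 ->
 taylor_prim s a h x y = 0.
Proof.
move=> h0 ya; rewrite /taylor_prim smooth_step0 ?mul0r ?mulr0//.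
by rewrite -mulrBr mulrC ler_pdivrMr//; lra.
Qed.

Lemma taylor_prim_gt s a h x y : 0 < h -> a + 3 * h / 4 <= y ->
 taylor_prim s a h x y = (-1) ^+ s / s`!%:R * (x - y) ^+ s.
Proof.
move=> h0 ya; rewrite /taylor_prim smooth_step1 ?mul1r//.
rewrite (_ : _ - _ = (y - a) / h); last by rewrite mulrBl ![_ / h]mulrC.
by rewrite ler_pdivlMr//; lra.
Qed.

(** To the left of the transition the primitive vanishes; to the right it is a polynomial in y of
    degree s, annihilated by s + 1 derivatives. *)
Lemma taylor_ker_eq0 s a h x y : 0 < h ->
 (y < a + h / 4) || (a + 3 * h / 4 < y) -> taylor_ker s a h x y = 0.
Proof.
move=> h0 /orP[hy|hy]; rewrite /taylor_ker.
 rewrite (@derive1n_near _ _ (cst 0) [set z | z < a + h / 4])//.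
 - by rewrite (_ : cst 0 = horner (0 : {poly R})) ?derive1n_horner ?linear0 ?horner0//;
   apply/funext => z; rewrite horner0.
 - by move=> z /= /ltW zl; exact: taylor_prim_lt.
pose P : {poly R} := ((-1) ^+ s / s`!%:R) *: (x%:P - 'X) ^+ s.
rewrite (@derive1n_near _ _ (horner P) [set z | a + 3 * h / 4 < z])//.
- rewrite derive1n_horner derivn_poly0 ?horner0//.
 rewrite (leq_trans (size_scale_leq _ _))// (leq_trans (size_poly_exp_leq _ _))//.
 by rewrite -opprB size_polyN size_XsubC mul1n.
- move=> z /= /ltW zl; rewrite taylor_prim_gt//.
 by rewrite /P !hornerE.
Qed.

Lemma taylor_ker_diff s a1 h1 a2 h2 x y :
 taylor_ker s a1 h1 x y - taylor_ker s a2 h2 x y =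
 derive1n s.+1 (fun z => taylor_prim s a1 h1 x z - taylor_prim s a2 h2 x z) y.
Proof.
have sN : smooth1 (fun z => -1 * taylor_prim s a2 h2 x z).
 exact: (smooth1M (smooth1_cst (-1)) (taylor_prim_smooth _ _ _ _)).
have -> : (fun z => taylor_prim s a1 h1 x z - taylor_prim s a2 h2 x z) =
 taylor_prim s a1 h1 x \+ (fun z => -1 * taylor_prim s a2 h2 x z).
 by apply/funext => z; rewrite /= mulN1r.
rewrite derive1nD//; last exact: taylor_prim_smooth.
have := congr1 (fun g => g y) (derive1nZ s.+1 (-1) (taylor_prim_smooth s a2 h2 x)).
by rewrite mulN1r => e; rewrite -e.
Qed.

Lemma taylor_prim_diff_supp s a1 h1 a2 h2 x y lo hi : 0 < h1 -> 0 < h2 ->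
 lo <= a1 + h1 / 4 -> lo <= a2 + h2 / 4 ->
 a1 + 3 * h1 / 4 <= hi -> a2 + 3 * h2 / 4 <= hi ->
 (y < lo) || (hi < y) ->
 taylor_prim s a1 h1 x y - taylor_prim s a2 h2 x y = 0.
Proof.
move=> h10 h20 l1 l2 r1 r2 /orP[hy|hy].
 by rewrite !taylor_prim_lt ?subrr// ltW// (lt_le_trans hy).
by rewrite !taylor_prim_gt ?subrr// ltW// (le_lt_trans _ hy).
Qed.

Lemma taylor_prim_diff_le s a1 h1 a2 h2 x y :
 `|taylor_prim s a1 h1 x y - taylor_prim s a2 h2 x y| <= `|x - y| ^+ s.
Proof.
rewrite /taylor_prim -mulrBr -mulrBl !normrM normfV !normrX normrN1 expr1n div1r.
rewrite mulrA ler_piMl ?exprn_ge0//.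
have f1 : `|s`!%:R : R|^-1 <= 1.
 by rewrite normr_nat invf_le1 ?ler1n ?ltr0n ?fact_gt0.
have := smooth_step_le1 (h1^-1 * y - h1^-1 * a1).
have := smooth_step_le1 (h2^-1 * y - h2^-1 * a2).
set u := smooth_step _; set v := smooth_step _ => /andP[u0 u1] /andP[v0 v1].
rewrite -[leRHS]mulr1; apply: ler_pM => //.
by rewrite ler_norml; apply/andP; split; lra.
Qed.

Definition lagrange_nat n (i : 'I_n) : {poly R} :=
 (\prod_(j < n | j != i) (i%:R - j%:R))^-1 *: \prod_(j < n | j != i) ('X - j%:R%:P).

Lemma lagrange_natE n (P : {poly R}) : (size P <= n)%N ->
 P = \sum_(i < n) P.[i%:R] *: lagrange_nat i.
Proof.
move=> sP; apply/eqP; rewrite -subr_eq0; apply/eqP.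
pose rs := [seq ((i : 'I_n) : nat)%:R : R | i <- enum 'I_n].
have sL (i : 'I_n) : (size (lagrange_nat i) <= n)%N.
 rewrite (leq_trans (size_scale_leq _ _))// -big_filter size_prod_XsubC.
 rewrite -sum1_size big_filter sum1dep_card cardsE cardC1 card_ord.
 by case: n i {sP rs} => [[]//|].
apply: (@roots_geq_poly_eq0 _ _ rs).
- apply/allP => _ /mapP[k _ ->]; rewrite rootE !hornerE horner_sum (bigD1 k)//=.
 rewrite hornerZ /lagrange_nat hornerZ horner_prod.
 under [X in _^-1 * X]eq_bigr do rewrite hornerXsubC.
 rewrite mulVf ?mulr1; last first.
  by apply/prodf_neq0 => j jk; rewrite subr_eq0 eqr_nat eq_sym.
 rewrite big1 ?addr0 ?subrr// => i ik.
 have ki : k != i by rewrite eq_sym.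
 rewrite hornerZ [X in _ * X]hornerZ horner_prod.
 by rewrite [\prod_(_ < n | _) _.[_]](bigD1 k ki)/= hornerXsubC subrr mul0r !mulr0.
- rewrite map_inj_uniq ?enum_uniq// => i j /eqP.
 by rewrite eqr_nat => /eqP/val_inj.
- rewrite size_map size_enum_ord (leq_trans (size_polyD _ _))// geq_max sP size_polyN.
 by apply: (leq_trans (size_sum _ _ _)); apply/bigmax_leqP => i _;
  exact: (leq_trans (size_scale_leq _ _)).
Qed.

(** In x the kernel is a polynomial of degree at most s, hence determined by its values at the s + 1
    nodes b + l i. This reduces an averaged Taylor polynomial to finitely many coefficients. *)
Lemma taylor_ker_lagrange s a h b l x y : 0 < l ->
 taylor_ker s a h x y =
 \sum_(i < s.+1) taylor_ker s a h (b + l * i%:R) y * (lagrange_nat i).[(x - b) / l].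
Proof.
move=> l0; have hh : l != 0 by rewrite gt_eqF.
rewrite /taylor_ker.
have -> : taylor_prim s a h x = \sum_(i < s.+1)
  (fun y => (lagrange_nat i).[(x - b) / l] * taylor_prim s a h (b + l * i%:R) y).
 apply/funext => z; rewrite fct_sumE /taylor_prim.
 under eq_bigr do rewrite mulrCA; rewrite -mulr_sumr; congr (_ * _).
 under eq_bigr do rewrite mulrCA; rewrite -mulr_sumr; congr (_ * _).
 pose P : {poly R} := ((b - z)%:P + l *: 'X) ^+ s.
 have sP : (size P <= s.+1)%N.
  rewrite (leq_trans (size_poly_exp_leq _ _))// ltnS -[X in (_ <= X)%N]mul1n.
  rewrite leq_mul2r; apply/orP; right.
  have sq : (size (((b - z)%:P + l *: 'X)%R : {poly R}) <= 2)%N.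
   rewrite (leq_trans (size_polyD _ _))// geq_max size_polyC.
   rewrite (leq_trans (size_scale_leq _ _)) ?size_polyX ?andbT//.
   by case: (_ == _).
  by move: sq; case: (size _) => // -[].
 have PE u : P.[u] = (b - z + l * u) ^+ s by rewrite /P !hornerE.
 have := lagrange_natE sP => /(congr1 (fun p => p.[(x - b) / l])).
 have e : b - z + l * ((x - b) / l) = x - z by field.
 rewrite PE e => ->; rewrite horner_sum; apply: eq_bigr => i _.
 by rewrite hornerZ PE mulrC; congr (_ * _ ^+ s); ring.
rewrite derive1n_sum; last first.
 by move=> i; exact: (smooth1M (smooth1_cst _) (taylor_prim_smooth _ _ _ _)).
by apply: eq_bigr => i _; rewrite (derive1nZ _ _ (taylor_prim_smooth _ _ _ _)) mulrC.
Qed.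

Lemma derivn_subX_exp (x : R) s :
 ((x%:P - 'X) ^+ s : {poly R})^`(s) = ((-1) ^+ s * s`!%:R)%:P.
Proof.
elim: s => [|s IH]; first by rewrite expr0 fact0 mulr1.
rewrite derivSn deriv_exp derivB derivC derivX sub0r /= derivnMn mulN1r derivnN IH.
by rewrite -polyCN -polyCMn; congr polyC; rewrite factS natrM exprS; ring.
Qed.

Lemma continuous_bounded_itv (f : R -> R) (K : R) : continuous f ->
 exists2 M, 0 <= M & forall x, `|x| <= K -> `|f x| <= M.
Proof.
move=> cf.
have [M [Mreal MP]] : bounded_set (f @` `[- K, K]).
 apply/compact_bounded/continuous_compact; first exact: continuous_subspaceT.
 exact: segment_compact.
exists (`|M| + 1) => [|x xK]; first by rewrite addr_ge0.
apply: MP; first by rewrite (le_lt_trans (ler_norm _))// ltrDl.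
by exists x => //=; rewrite in_itv/= -ler_norml.
Qed.

(** Scaling reduces to the kernel of [0, 1]. Lagrange interpolation then separates x from y, leaving
    s + 1 compactly supported functions of y and polynomials of x on [-K, K]. *)
Lemma taylor_ker_bound s (K : R) : exists2 C, 0 <= C &
 forall a h x y, 0 < h -> `|x - a| <= K * h -> `|taylor_ker s a h x y| <= C / h.
Proof.
have /choice[B hB] : forall i : 'I_s.+1, exists M : R, 0 <= M /\
  forall y, `|taylor_ker s 0 1 i%:R y| <= M.
 move=> i; have [M M0 hM] := continuous_bounded_itv 1
  (smooth1_continuous (taylor_ker_smooth s 0 1 i%:R)).
 exists M; split=> // y; have [|y1] := leP `|y| 1; first exact: hM.
 rewrite taylor_ker_eq0 ?normr0//.
 by move: y1; rewrite ltr_normr => /orP[] h; apply/orP; [right|left]; lra.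
have /choice[D hD] : forall i : 'I_s.+1, exists M : R, 0 <= M /\
  forall x, `|x| <= K -> `|(lagrange_nat i).[x]| <= M.
 move=> i; have [M M0 hM] := continuous_bounded_itv K
  (@continuous_horner _ (lagrange_nat i)).
 by exists M.
exists (\sum_i B i * D i).
 by apply: sumr_ge0 => i _; rewrite mulr_ge0//; [have [] := hB i|have [] := hD i].
move=> a h x y h0 xa; have hi : 0 < h^-1 by rewrite invr_gt0.
rewrite taylor_ker_scale// normrM (gtr0_norm hi) mulrC.
apply: ler_wpM2r; first by rewrite invr_ge0 ltW.
rewrite (taylor_ker_lagrange _ _ _ 0 _ _ ltr01) (le_trans (ler_norm_sum _ _ _))//.
apply: ler_sum => i _; rewrite normrM; apply: ler_pM => //.
 by rewrite add0r mul1r; have [_] := hB i; apply.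
have [_] := hD i; apply; rewrite subr0 divr1 normrM normfV (gtr0_norm h0).
by rewrite ler_pdivrMr.
Qed.

(** The kernel is the derivative of a function that rises from 0 to the s-th derivative of (-1)^s (x
    - y)^s / s!, which is 1. Hence constants are reproduced. *)
Lemma taylor_ker_integral s a h x : 0 < h ->
 (\int[lebesgue_measure]_y (taylor_ker s a h x y)%:E = 1)%E.
Proof.
move=> h0; have ah : a < a + h by rewrite ltrDl.
have -> : (\int[lebesgue_measure]_y (taylor_ker s a h x y)%:E =
 \int[lebesgue_measure]_(y in `[a, (a + h)%R]) (taylor_ker s a h x y)%:E)%E.
 rewrite [RHS]integral_mkcond; apply: eq_integral => y _; rewrite patchE.
 case: ifPn => // /negP; rewrite inE/= in_itv/= => /negP; rewrite negb_and -!ltNge => hy.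
 rewrite taylor_ker_eq0//; case/orP: hy => hy; apply/orP; [left|right]; lra.
pose G := derive1n s (taylor_prim s a h x).
have sG : smooth1 G by exact/smooth1_deriven/taylor_prim_smooth.
have cG := smooth1_continuous sG.
rewrite (@continuous_FTC2 _ _ G)//.
- have -> : G a = 0.
  rewrite /G (@derive1n_near _ _ (horner 0) [set z | z < a + h / 4])//.
  + by rewrite derive1n_horner linear0 horner0.
  + by move=> z /= zl; rewrite taylor_prim_lt ?horner0// ltW.
  + by rewrite /= ltrDl divr_gt0.
 have -> : G (a + h) = 1; last by rewrite sube0.
 rewrite /G (@derive1n_near _ _
  (horner (((-1) ^+ s / s`!%:R) *: (x%:P - 'X) ^+ s)) [set z | a + 3 * h / 4 < z])//.
 + rewrite derive1n_horner derivnZ derivn_subX_exp hornerZ hornerC.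
  rewrite mulrCA mulrA mulrA -exprD addnn -mul2n exprM sqrrN expr1n expr1n mul1r.
  by rewrite mulVf// pnatr_eq0 -lt0n fact_gt0.
 + by move=> z /= zl; rewrite taylor_prim_gt ?ltW// !hornerE.
 + by rewrite /=; lra.
- by apply: continuous_subspaceT => y; exact/smooth1_continuous/taylor_ker_smooth.
- split; first by move=> y _; exact: smooth1_derivable.
  by apply: cvg_at_right_filter; exact: cG.
 by apply: cvg_at_left_filter; exact: cG.
Qed.

End SmoothOneDim.

(** * Tensor products as test functions *)

Section Tensor.
Variables (R : realType) (n : nat).
Implicit Types (F G : 'I_n -> R -> R) (x : 'rV[R]_n).

Definition tensor F x : R := \prod_i F i (x ord0 i).

Definition upd F (j : 'I_n) (g : R -> R) : 'I_n -> R -> R :=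
 fun i => if i == j then g else F i.

Lemma smooth1_upd F j g : (forall i, smooth1 (F i)) -> smooth1 g ->
 forall i, smooth1 (upd F j g i).
Proof. by move=> sF sg i; rewrite /upd; case: ifP. Qed.

Lemma tensor_upd F j g x :
 tensor (upd F j g) x = g (x ord0 j) * \prod_(i | i != j) F i (x ord0 i).
Proof.
rewrite /tensor (bigD1 j)//= /upd eqxx; congr (_ * _).
by apply: eq_bigr => i /negbTE ->.
Qed.

Lemma tensor_differentiable F x : (forall i, smooth1 (F i)) ->
 differentiable (tensor F) x.
Proof.
move=> sF.
have -> : tensor F = \prod_i (fun x => F i (x ord0 i)).
 by apply/funext => y; rewrite /tensor fct_prodE.
elim/big_ind : _ => [|f g|i _].
- exact: (@differentiable_cst _ _ _ (1 : R)).
- exact: differentiableM.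
apply: (@differentiable_comp _ _ _ _ (fun y : 'rV[R]_n => y ord0 i) (F i)).
 exact: differentiable_coord.
by apply/derivable1_diffP; exact: smooth1_derivable.
Qed.

Lemma tensor_partial F (j : 'I_n) : (forall i, smooth1 (F i)) ->
 (fun x => 'D_(delta_mx ord0 j) (tensor F) x) = tensor (upd F j (derive1 (F j))).
Proof.
move=> sF; apply/funext => x; rewrite tensor_upd derive1E.
set c := \prod_(i | _) _.
have -> : 'D_(delta_mx ord0 j) (tensor F) x = 'D_1 (fun t => c * F j t) (x ord0 j).
 have tE (y : 'rV[R]_n) : (forall i, i != j -> y ord0 i = x ord0 i) ->
   tensor F y = c * F j (y ord0 j).
  move=> yx; rewrite /tensor (bigD1 j)//= mulrC; congr (_ * _).
  by apply: eq_bigr => i ij; rewrite yx.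
 have E : (fun h : R => h^-1 *: ((tensor F \o shift x) (h *: delta_mx ord0 j) - tensor F x)) =
   (fun h : R => h^-1 *: (((fun t => c * F j t) \o shift (x ord0 j)) (h *: (1 : R)) -
    c * F j (x ord0 j))).
  apply/funext => h /=; rewrite !tE//; first by rewrite !mxE !eqxx.
  by move=> i ij; rewrite !mxE eqxx (negbTE ij) mulr0 add0r.
 by rewrite /derive E.
rewrite (_ : (fun t => _) = c *: F j)//.
rewrite deriveZ; last exact: smooth1_derivable.
exact: mulrC.
Qed.

Lemma tensor_iter_partial F (t : seq 'I_n) : (forall i, smooth1 (F i)) ->
 exists2 G, (forall i, smooth1 (G i)) & iter_partial t (tensor F) = tensor G.
Proof.
move=> sF; elim: t => [|j t [G sG IH]]; first by exists F.
exists (upd G j (derive1 (G j))); first by apply: smooth1_upd => //; exact: smooth1_derive.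
have -> : iter_partial (j :: t) (tensor F) =
 (fun x => 'D_(delta_mx ord0 j) (iter_partial t (tensor F)) x) by [].
by rewrite IH; exact: tensor_partial.
Qed.

Lemma tensor_smooth F : (forall i, smooth1 (F i)) -> smooth (tensor F).
Proof.
move=> sF t x; have [G sG ->] := tensor_iter_partial t sF.
exact: tensor_differentiable.
Qed.

Lemma iter_partial_nseq F j k : (forall i, smooth1 (F i)) ->
 iter_partial (nseq k j) (tensor F) = tensor (upd F j (derive1n k (F j))).
Proof.
move=> sF; elim: k => [|k IH]/=.
 by congr tensor; apply/funext => i; rewrite /upd; case: eqP => [->|].
have sk : smooth1 (derive1n k (F j)) by exact: smooth1_deriven.
rewrite IH; etransitivity; first exact: (tensor_partial j (smooth1_upd j sF sk)).
congr tensor; apply/funext => i; rewrite /upd; case: eqP => // _.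
by rewrite eqxx.
Qed.

(** The multi-index of an unmixed derivative; the remainder formula for averaged Taylor polynomials
    involves no other. *)
Definition pure_index (k : nat) (j i : 'I_n) : nat := if i == j then k else 0%N.

Lemma multi_partial_pure F j k : (forall i, smooth1 (F i)) ->
 multi_partial (pure_index k j) (tensor F) = tensor (upd F j (derive1n k (F j))).
Proof.
move=> sF; rewrite -iter_partial_nseq//; congr iter_partial.
have : uniq (enum 'I_n) by exact: enum_uniq.
have : j \in enum 'I_n by rewrite mem_enum.
have h0 (s : seq 'I_n) : j \notin s ->
  flatten [seq nseq (pure_index k j i) i | i <- s] = [::].
 elim: s => //= i s IH; rewrite in_cons negb_or => /andP[ji /IH ->].
 by rewrite /pure_index eq_sym (negbTE ji).
elim: (enum _) => //= i s IH; rewrite in_cons => /orP[/eqP <-|js] /andP[iS us].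
 by rewrite h0// cats0 /pure_index eqxx.
rewrite IH// /pure_index; case: eqP => // ij; by rewrite ij js in iS.
Qed.

Lemma sum_pure_index k j : (\sum_i pure_index k j i = k)%N.
Proof.
rewrite (bigD1 j)//= /pure_index eqxx big1 ?addn0// => i /negbTE ->; by [].
Qed.

Definition cbox (lo hi : 'I_n -> R) : set 'rV[R]_n :=
 [set x | forall i, lo i <= x ord0 i <= hi i].

Lemma cbox_compact lo hi : compact (cbox lo hi).
Proof.
suff -> : cbox lo hi = [set v : 'rV[R]_n | forall i, `[lo i, hi i]%classic (v ord0 i)].
 exact: (@rV_compact _ n (fun i => `[lo i, hi i]%classic) (fun i => @segment_compact _ _ _)).
by apply/seteqP; split => x h i; have := h i; rewrite /= in_itv.
Qed.

Lemma cbox_closed lo hi : closed (cbox lo hi).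
Proof. by apply: compact_closed => //; exact: cbox_compact. Qed.

Lemma cbox_measurable lo hi : measurable (cbox lo hi).
Proof. by apply: closed_measurable_rV; exact: cbox_closed. Qed.

Lemma tensor_support F lo hi :
 (forall i y, ~~ (lo i <= y <= hi i) -> F i y = 0) ->
 fun_support (tensor F) `<=` cbox lo hi.
Proof.
move=> F0; rewrite /fun_support [X in _ `<=` X](closure_id _).1; last exact: cbox_closed.
apply: closureS => x /= /eqP tx i; apply/negP => /negP /F0 h; apply: tx.
by rewrite /tensor (bigD1 i)//= h mul0r.
Qed.

Lemma tensor_test (Omega : set 'rV[R]_n) F lo hi : (forall i, smooth1 (F i)) ->
 (forall i y, ~~ (lo i <= y <= hi i) -> F i y = 0) -> cbox lo hi `<=` Omega ->
 test_function Omega (tensor F).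
Proof.
move=> sF F0 EO; have sE := tensor_support F0; split; first exact: tensor_smooth.
 apply: subclosed_compact (@cbox_compact lo hi) sE.
 exact: closed_closure.
exact: subset_trans EO.
Qed.

End Tensor.

(** Factors are exchanged one at a time. For kernels, the summand with the difference in place j is
    an unmixed derivative in direction j. *)
Lemma prodB_telescope (K : comRingType) n (a b : 'I_n -> K) :
 \prod_i a i - \prod_i b i = \sum_(j < n) \prod_(i < n)
  (if (i < j)%N then a i else if i == j then a i - b i else b i).
Proof.
elim: n a b => [|n IH] a b; first by rewrite !big_ord0 subrr.
rewrite [\prod_i a i]big_ord_recl [\prod_i b i]big_ord_recl [RHS]big_ord_recl.
set A := \prod_(i < n) a _; set B := \prod_(i < n) b _.
have -> : \sum_(i < n) \prod_(i0 < n.+1)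
  (if (i0 < lift ord0 i)%N then a i0 else
  if i0 == lift ord0 i then a i0 - b i0 else b i0) = a ord0 * (A - B).
 rewrite IH mulr_sumr; apply: eq_bigr => j _.
 rewrite big_ord_recl; congr (_ * _); exact: eq_bigr.
rewrite big_ord_recl /= -/B; ring.
Qed.

(** * Differences of averaged Taylor polynomials *)

Section TaylorDiff.
Variables (R : realType) (n : nat).
Local Notation leb := (lebesgue_rV R n).
Implicit Types (f g phi : 'rV[R]_n -> R) (Omega E : set 'rV[R]_n).

Lemma L1loc_test_integrable Omega f phi : measurable Omega -> L1loc Omega f ->
 test_function Omega phi ->
 leb.-integrable Omega (EFin \o (fun x => f x * phi x)).
Proof.
move=> mO lf tphi; apply/integrable_mkcond => //.
exact: (L1loc_integrable [::] lf tphi).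
Qed.

Lemma weak_partial_Rint Omega (a : 'I_n -> nat) f g phi : weak_partial Omega a f g ->
 test_function Omega phi ->
 \int[leb]_(x in Omega) (f x * multi_partial a phi x) =
 (-1) ^+ (\sum_i a i)%N * \int[leb]_(x in Omega) (g x * phi x).
Proof.
move=> [lf lg h] tphi; rewrite /Rintegral h// fineM//.
rewrite (integral_mkcond Omega).
by apply: integrable_fin_num => //; exact: (L1loc_integrable [::] lg tphi).
Qed.

Lemma L1loc_integrable_compact Omega g E : L1loc Omega g -> compact E -> E `<=` Omega ->
 leb.-integrable E (EFin \o g).
Proof.
move=> [mg gK] cE EO; have mE := compact_measurable_rV cE.
apply/integrableP; split; last exact: gK.
by apply/measurable_EFinP; exact: measurable_onS EO.
Qed.

Lemma Rint_mul_le Omega g phi E (B : R) : measurable Omega -> L1loc Omega g ->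
 compact E -> E `<=` Omega -> 0 <= B ->
 leb.-integrable Omega (EFin \o (fun x => g x * phi x)) ->
 (forall x, E x -> `|phi x| <= B) -> (forall x, ~ E x -> phi x = 0) ->
 `|\int[leb]_(x in Omega) (g x * phi x)| <= B * \int[leb]_(x in E) `|g x|.
Proof.
move=> mO lg cE EO B0 ig phiB phi0; have mE := compact_measurable_rV cE.
have iE := L1loc_integrable_compact lg cE EO.
rewrite (le_trans (le_normr_Rintegral _ _))//.
have -> : \int[leb]_(x in Omega) `|g x * phi x| = \int[leb]_(x in E) `|g x * phi x|.
 rewrite [LHS]Rintegral_mkcond [RHS]Rintegral_mkcond; congr Rintegral.
 apply/funext => x; rewrite !patchE; case: ifPn => xO; case: ifPn => // xE.
  by rewrite phi0 ?mulr0 ?normr0// => /mem_set; apply/negP.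
 by exfalso; move/negP: xO; apply; apply/mem_set/EO/set_mem.
rewrite -RintegralZl//; last exact: integrable_norm.
apply: le_Rintegral => //.
- by apply: integrable_norm => //; exact: integrableS ig.
- exact: (integrableZl mE B (integrable_norm iE)).
- by move=> x Ex; rewrite normrM mulrC ler_wpM2r// phiB.
Qed.

Lemma Rintegral_sum d (T : measurableType d) (mu : {measure set T -> \bar R})
  (D : set T) (I : Type) (t : seq I) (F : I -> T -> R) : measurable D ->
 (forall i, mu.-integrable D (EFin \o F i)) ->
 \int[mu]_(x in D) (\sum_(i <- t) F i x) = \sum_(i <- t) \int[mu]_(x in D) F i x.
Proof.
move=> mD iF; elim: t => [|i t IH].
 rewrite big_nil; under eq_Rintegral do rewrite big_nil.
 by rewrite Rintegral_cst// mul0r.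
rewrite big_cons -IH -RintegralD//.
 by apply: eq_Rintegral => x _; rewrite big_cons.
rewrite (_ : EFin \o _ = (fun x => \sum_(i <- t) (EFin \o F i) x)%E).
 exact: integrable_sum.
by apply/funext => x /=; rewrite sumEFin.
Qed.

Definition taylor_tensor (s : nat) (a h x : 'I_n -> R) : 'rV[R]_n -> R :=
 tensor (fun i => taylor_ker s (a i) (h i) (x i)).

(** The value at x of the averaged Taylor polynomial, written as an integral of f against a test
    function: no derivative of f is involved. *)
Definition taylor Omega (s : nat) (f : 'rV[R]_n -> R) (a h x : 'I_n -> R) : R :=
 \int[leb]_(y in Omega) (f y * taylor_tensor s a h x y).

Lemma taylor_tensor_test Omega s a h x : (forall i, 0 < h i) ->
 cbox (fun i => a i + h i / 4) (fun i => a i + 3 * h i / 4) `<=` Omega ->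
 test_function Omega (taylor_tensor s a h x).
Proof.
move=> h0; apply: tensor_test; first by move=> i; exact: taylor_ker_smooth.
by move=> i y; rewrite negb_and -!ltNge => hy; rewrite taylor_ker_eq0.
Qed.

(** Telescoping leaves in coordinate j the derivative of order s + 1 of a difference of primitives,
    which is supported in [lo, hi]. The definition of the weak derivative moves these s + 1
    derivatives to f, and what remains is an integral over the common hull against a kernel bounded
    factor by factor. *)
Lemma taylor_diff s (K : R) : 0 <= K -> exists2 C, 0 <= C &
 forall Omega f (g : 'I_n -> 'rV[R]_n -> R) a1 h1 a2 h2 eta lo hi x,
 measurable Omega -> (forall j, weak_partial Omega (pure_index s.+1 j) f (g j)) ->
 (forall i, [/\ 0 < h1 i, 0 < h2 i, 0 < eta i, eta i <= K * h1 i & eta i <= K * h2 i]) ->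
 (forall i, `|x i - a1 i| <= K * h1 i /\ `|x i - a2 i| <= K * h2 i) ->
 (forall i, [/\ lo i <= a1 i + h1 i / 4, lo i <= a2 i + h2 i / 4,
   a1 i + 3 * h1 i / 4 <= hi i & a2 i + 3 * h2 i / 4 <= hi i]) ->
 (forall i, `|x i - lo i| <= K * eta i /\ `|x i - hi i| <= K * eta i) ->
 cbox lo hi `<=` Omega ->
 `|taylor Omega s f a1 h1 x - taylor Omega s f a2 h2 x| <=
  C * (\prod_i eta i)^-1 * \sum_j eta j ^+ s.+1 * \int[leb]_(y in cbox lo hi) `|g j y|.
Proof.
move=> K0; have [C0 C00 hC0] := taylor_ker_bound s K.
(* One constant for every factor: a kernel is at most C0/h <= C0 K/eta, and the difference of
   primitives is at most (K eta)^s, which is K^s eta^(s+1)/eta. *)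
pose C1 := Num.max 1 (Num.max (C0 * K) (K ^+ s)).
have C1_1 : 1 <= C1 by rewrite le_max lexx.
have C1_0 : 0 <= C1 by rewrite (le_trans _ C1_1).
have C1_a : C0 * K <= C1 by rewrite !le_max lexx orbT.
have C1_b : K ^+ s <= C1 by rewrite !le_max lexx !orbT.
exists (C1 ^+ n); first by rewrite exprn_ge0.
move=> Omega f g a1 h1 a2 h2 eta lo hi x mO wf hpos hx hlo hxl EO.
have cE := @cbox_compact R n lo hi.
pose Z (j : 'I_n) : 'I_n -> R -> R := fun i =>
 if (i < j)%N then taylor_ker s (a1 i) (h1 i) (x i) else
 if i == j then (fun y => taylor_prim s (a1 i) (h1 i) (x i) y -
  taylor_prim s (a2 i) (h2 i) (x i) y) else taylor_ker s (a2 i) (h2 i) (x i).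
have sZ j i : smooth1 (Z j i).
 rewrite /Z; case: ifP => _; first exact: taylor_ker_smooth.
 case: ifP => _; last exact: taylor_ker_smooth.
 have := smooth1D (taylor_prim_smooth s (a1 i) (h1 i) (x i))
  (smooth1M (smooth1_cst (-1)) (taylor_prim_smooth s (a2 i) (h2 i) (x i))).
 by rewrite (_ : _ \+ _ = (fun y => taylor_prim s (a1 i) (h1 i) (x i) y -
  taylor_prim s (a2 i) (h2 i) (x i) y))//; apply/funext => y /=; rewrite mulN1r.
have Z0 j i y : ~~ (lo i <= y <= hi i) -> Z j i y = 0.
 have [h10 h20 _ _ _] := hpos i; have [l1 l2 r1 r2] := hlo i.
 rewrite negb_and -!ltNge /Z => hy; case: ifP => _.
  rewrite taylor_ker_eq0//; case/orP: hy => hy; apply/orP; [left|right].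
   exact: lt_le_trans l1.
  exact: le_lt_trans hy.
 case: ifP => _; first exact: taylor_prim_diff_supp hy.
 rewrite taylor_ker_eq0//; case/orP: hy => hy; apply/orP; [left|right].
  exact: lt_le_trans l2.
 exact: le_lt_trans hy.
have tZ j : test_function Omega (tensor (Z j)) by exact: tensor_test (Z0 j) EO.
have ZB j y : cbox lo hi y ->
  `|tensor (Z j) y| <= C1 ^+ n * (\prod_i eta i)^-1 * eta j ^+ s.+1.
 move=> Ey; have e0 i : 0 < eta i by have [] := hpos i.
 have -> : C1 ^+ n * (\prod_i eta i)^-1 * eta j ^+ s.+1 =
  \prod_i (C1 * ((eta i)^-1 * (if i == j then eta j ^+ s.+1 else 1))).
  rewrite !big_split/= prodr_const card_ord -mulrA prodfV; congr (_ * (_ * _)).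
  by rewrite -big_mkcond/= big_pred1_eq.
 rewrite /tensor normr_prod; apply: ler_prod => i _; rewrite normr_ge0/=.
 have [h10 h20 ei k1 k2] := hpos i; have [x1 x2] := hx i.
 have ker_le a h : 0 < h -> eta i <= K * h -> `|x i - a| <= K * h ->
   `|taylor_ker s a h (x i) (y ord0 i)| <= C1 * ((eta i)^-1 * 1).
  move=> h0 kh xa; rewrite (le_trans (hC0 _ _ _ _ h0 xa))// mulr1.
  rewrite ler_pdivrMr// mulrAC ler_pdivlMr// (le_trans (ler_wpM2l C00 kh))// mulrA.
  by rewrite ler_wpM2r// ltW.
 rewrite /Z; case: ifP => [ij|_].
  by rewrite (_ : (i == j) = false) ?ker_le//; apply/negP => /eqP ij'; rewrite ij' ltnn in ij.
 case: eqP => [ij|_]; last exact: ker_le.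
 rewrite -ij exprS mulKf ?gt_eqF// (le_trans (taylor_prim_diff_le _ _ _ _ _ _ _))//.
 have xy : `|x i - y ord0 i| <= K * eta i.
  have [xl xh] := hxl i; have /andP[yl yh] := Ey i.
  move: xl xh; rewrite !ler_norml => /andP[xl1 xl2] /andP[xh1 xh2].
  by apply/andP; split; lra.
 rewrite (le_trans (lerXn2r s _ _ xy)) ?nnegrE ?mulr_ge0// ?(ltW ei)//.
 by rewrite exprMn ler_wpM2r// exprn_ge0// ltW.
have t1 : test_function Omega (taylor_tensor s a1 h1 x).
 apply: taylor_tensor_test => [i|]; first by have [] := hpos i.
 apply: subset_trans EO => y hy i; have /andP[y1 y2] := hy i.
 by have [l1 l2 r1 r2] := hlo i; apply/andP; split; lra.
have t2 : test_function Omega (taylor_tensor s a2 h2 x).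
 apply: taylor_tensor_test => [i|]; first by have [] := hpos i.
 apply: subset_trans EO => y hy i; have /andP[y1 y2] := hy i.
 by have [l1 l2 r1 r2] := hlo i; apply/andP; split; lra.
(* In dimension 0 both kernels coincide; otherwise any coordinate supplies the local integrability
   of f. *)
have [j0|n0] := pselect (exists j : 'I_n, True); last first.
 rewrite /taylor (_ : taylor_tensor s a1 h1 x = taylor_tensor s a2 h2 x).
  rewrite subrr normr0 mulr_ge0 ?mulr_ge0 ?exprn_ge0 ?invr_ge0//.
   by apply: prodr_ge0 => i _; have [_ _ /ltW] := hpos i.
  by apply: sumr_ge0 => i _; case: n0; exists i.
 by apply/funext => y; apply: eq_bigr => i _; case: n0; exists i.
have lf : L1loc Omega f by have [j _] := j0; have [] := wf j.
have dE : taylor Omega s f a1 h1 x - taylor Omega s f a2 h2 x =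
  \sum_j \int[leb]_(y in Omega) (f y * multi_partial (pure_index s.+1 j) (tensor (Z j)) y).
 have iZ j : leb.-integrable Omega (EFin \o
   (fun y => f y * multi_partial (pure_index s.+1 j) (tensor (Z j)) y)).
  apply/integrable_mkcond => //; exact: (L1loc_integrable _ lf (tZ j)).
 rewrite /taylor -RintegralB//; try exact: L1loc_test_integrable.
 rewrite -Rintegral_sum//; apply: eq_Rintegral => y _.
 rewrite -mulrBr -mulr_sumr; congr (_ * _).
 rewrite /taylor_tensor /tensor prodB_telescope; apply: eq_bigr => j _.
 rewrite multi_partial_pure//; apply: eq_bigr => i _; rewrite /upd /Z.
 case: ltnP => [ij|ji]; first by rewrite (_ : (i == j) = false)//; apply/negP => /eqP ij'; rewrite ij' ltnn in ij.
 by case: eqP => // ->; rewrite ltnn eqxx taylor_ker_diff.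
rewrite dE (le_trans (ler_norm_sum _ _ _))// mulr_sumr; apply: ler_sum => j _.
rewrite (weak_partial_Rint (wf j) (tZ j)) normrM normrX normrN1 expr1n mul1r mulrA.
have [_ lg _] := wf j.
apply: Rint_mul_le => //.
- rewrite !mulr_ge0 ?exprn_ge0 ?invr_ge0//; last by have [_ _ /ltW] := hpos j.
 by apply: prodr_ge0 => i _; have [_ _ /ltW] := hpos i.
- exact: L1loc_test_integrable.
- by move=> y Ey; exact: ZB.
- move=> y nEy; have [i hi'] : exists i, ~~ (lo i <= y ord0 i <= hi i).
  by apply/not_existsP => h; apply: nEy => i; apply/negPn/negP => /h.
 by rewrite /tensor (bigD1 i)//= Z0// mul0r.
Qed.

End TaylorDiff.

(** * Concentration for random sign matrices *)

Section SignMatrix.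
Variable R : realType.

(** For small arguments e^w <= 1/(1 - w) suffices. Doubling does the rest: with E = exp(2 z^2),
    e^(2z) + e^(-2z) = (e^z + e^-z)^2 - 2 <= 4 E^2 - 2 <= 2 E^4. The constant 2 in the exponent, in
    place of the optimal 1/2, keeps this elementary. *)
Lemma cosh_le (y : R) : expR y + expR (- y) <= 2 * expR (2 * y ^+ 2).
Proof.
have small (z : R) : `|z| <= 2^-1 -> expR z + expR (- z) <= 2 * expR (2 * z ^+ 2).
 move=> zh; have z2 : z ^+ 2 <= 4^-1.
  rewrite -real_normK ?num_real// (le_trans (lerXn2r 2 _ _ zh)) ?nnegrE//.
  by rewrite exprVn -natrX.
 have /andP[z1 z3] : - 2^-1 <= z <= 2^-1 by rewrite -ler_norml.
 have e1 (w : R) : w < 1 -> expR w <= (1 - w)^-1.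
  move=> w1; rewrite -[w in leLHS]opprK expRN lef_pV2 ?posrE ?expR_gt0 ?subr_gt0//.
  exact: expR_ge1Dx.
 have h1 := e1 z ltac:(lra); have h2 := e1 (- z) ltac:(lra); rewrite opprK in h2.
 have h3 := expR_ge1Dx (2 * z ^+ 2).
 have p1 : 0 < 1 - z by lra.
 have p2 : 0 < 1 + z by lra.
 have -> : 2 * expR (2 * z ^+ 2) = expR (2 * z ^+ 2) * (1 - z ^+ 2) * ((1 - z)^-1 + (1 + z)^-1).
  by field; rewrite !gt_eqF.
 rewrite (le_trans (lerD h1 h2))// ler_peMl ?addr_ge0 ?invr_ge0 ?(ltW p1) ?(ltW p2)//.
 have := sqr_ge0 z; move: z2 h3; set u := z ^+ 2; clear; set E := expR _; nra.
have dbl (z : R) : expR z + expR (- z) <= 2 * expR (2 * z ^+ 2) ->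
  expR (2 * z) + expR (- (2 * z)) <= 2 * expR (2 * (2 * z) ^+ 2).
 move=> h; set E := expR (2 * z ^+ 2) in h *.
 have -> : expR (2 * (2 * z) ^+ 2) = E ^+ 4.
  by rewrite /E -expRM_natl; congr expR; ring.
 rewrite -mulrN !expRM_natl.
 have ez : expR z * expR (- z) = 1 by rewrite -expRD subrr expR0.
 have h0 : 0 <= expR z + expR (- z) by rewrite addr_ge0 ?expR_ge0.
 have h2 : (expR z + expR (- z)) ^+ 2 <= (2 * E) ^+ 2.
  by rewrite lerXn2r ?nnegrE// mulr_ge0// expR_ge0.
 have -> : expR z ^+ 2 + expR (- z) ^+ 2 = (expR z + expR (- z)) ^+ 2 - 2 * (expR z * expR (- z)).
  by ring.
 rewrite ez mulr1 lerBlDr (le_trans h2)// -subr_ge0.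
 clearbody E; have -> : 2 * E ^+ 4 + 2 - (2 * E) ^+ 2 = 2 * (E ^+ 2 - 1) ^+ 2 by ring.
 by rewrite mulr_ge0// sqr_ge0.
have all m (z : R) : `|z| <= 2 ^+ m / 2 -> expR z + expR (- z) <= 2 * expR (2 * z ^+ 2).
 elim: m z => [|m IH] z zm; first by apply: small; rewrite expr0 div1r in zm.
 rewrite -(@divfK _ 2 _ z)// mulrC; apply/dbl/IH.
 have : `|z| <= 2 ^+ m by move: zm; rewrite exprS mulrAC divff// mul1r.
 by rewrite normrM normfV [`|2|]ger0_norm// => /ler_wpM2r; apply.
apply: (all (Num.truncn (2 * `|y|)).+1); rewrite ler_pdivlMr// mulrC.
rewrite (le_trans (ltW (truncnS_gt _)))// -natrX ler_nat.
by rewrite ltnW// ltn_expl.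
Qed.

Definition sgn (b : bool) : R := if b then 1 else -1.

Section Rows.
Variable I : finType.
Implicit Types (x : I -> R) (e : {ffun I -> bool}).

Definition sq_norm x : R := \sum_i x i ^+ 2.
Definition rdot e x : R := \sum_i sgn (e i) * x i.

Lemma sq_norm_ge0 x : 0 <= sq_norm x.
Proof. by apply: sumr_ge0 => i _; exact: sqr_ge0. Qed.

Let M := #|{ffun I -> bool}|%:R : R.

Lemma card_signs : M = 2 ^+ #|I|.
Proof. by rewrite /M card_ffun card_bool natrX. Qed.

(** Sums over all sign vectors play the role of expectations, and independence of the signs is the
    distributivity of products over sums. *)
Lemma sum_exp_rdot x (t : R) :
 \sum_e expR (t * rdot e x) <= M * expR (2 * t ^+ 2 * sq_norm x).
Proof.
have -> : \sum_e expR (t * rdot e x) =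
  \prod_(i : I) \sum_(b : bool) expR (t * (sgn b * x i)).
 rewrite bigA_distr_bigA/=; apply: eq_bigr => e _.
 by rewrite -expR_sum mulr_sumr.
have -> : M * expR (2 * t ^+ 2 * sq_norm x) =
  \prod_(i : I) (2 * expR (2 * (t * x i) ^+ 2)).
 rewrite big_split/= prodr_const -card_signs -expR_sum; congr (_ * expR _).
 by rewrite mulr_sumr; apply: eq_bigr => i _; ring.
apply: ler_prod => i _; rewrite big_bool /sgn/= !mul1r mulN1r mulrN.
by rewrite addr_ge0 ?expR_ge0//=; exact: cosh_le.
Qed.

Lemma sum_rdot_sq x : \sum_e rdot e x ^+ 2 = M * sq_norm x.
Proof.
have E i j : \sum_(e : {ffun I -> bool}) sgn (e i) * sgn (e j) = if i == j then M else 0.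
 case: eqP => [->|/eqP ij].
  rewrite (eq_bigr (fun=> 1)) ?sumr_const// => e _.
  by rewrite /sgn; case: (e j); rewrite ?mulrNN mulr1.
 pose F k b := if (k == i) || (k == j) then sgn b else 1.
 transitivity (\sum_(e : {ffun I -> bool}) \prod_k F k (e k)).
  apply: eq_bigr => e _; rewrite (bigD1 i)//= (bigD1 j)/= 1?eq_sym//.
  rewrite /F !eqxx orbT/= big1 ?mulr1// => k /andP[/negbTE -> /negbTE ->]//.
 rewrite -bigA_distr_bigA (bigD1 i)//= big_bool /F eqxx/= /sgn subrr mul0r//.
transitivity (\sum_(e : {ffun I -> bool}) \sum_i \sum_j (x i * x j) * (sgn (e i) * sgn (e j))).
 apply: eq_bigr => e _; rewrite expr2 mulr_suml; apply: eq_bigr => i _.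
 by rewrite mulr_sumr; apply: eq_bigr => j _; ring.
rewrite exchange_big/= mulr_sumr; apply: eq_bigr => i _.
rewrite exchange_big/= (bigD1 i)//= -mulr_sumr E eqxx mulrC expr2.
by rewrite big1 ?addr0// => j ji; rewrite -mulr_sumr E eq_sym (negbTE ji) mulr0.
Qed.

End Rows.

(** A discrete Gaussian mixture: exp(z^2/32) is dominated by a sum over j of exponentials linear in
    z, of which the term j = floor |z| alone is large enough. After averaging with the sub-Gaussian
    bound the term j decays like exp(-j/32). *)
Lemma sum_exp_sq : exists2 C : R, 0 < C & forall (I : finType) (x : I -> R),
 sq_norm x <= 1 ->
 \sum_(e : {ffun I -> bool}) expR (rdot e x ^+ 2 / 32) <= C * #|{ffun I -> bool}|%:R.
Proof.
exists (2 * expR (32^-1) * 33); first by rewrite !mulr_gt0// expR_gt0.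
move=> I x x1.
have [J hJ] : exists J : nat, forall e : {ffun I -> bool}, `|rdot e x| < J.+1%:R.
 exists (\sum_(e : {ffun I -> bool}) Num.truncn `|rdot e x|)%N => e.
 rewrite (lt_le_trans (truncnS_gt _))// ler_nat ltnS (bigD1 e)//= leq_addr//.
pose c (j : nat) : R := 2 * expR (j.+1%:R ^+ 2 / 32 - j%:R ^+ 2 / 4).
pose cosh2 (j : nat) (z : R) : R := expR (j%:R / 4 * z) + expR (- (j%:R / 4) * z).
have c0 j : 0 <= c j by rewrite mulr_ge0// expR_ge0.
have mix (e : {ffun I -> bool}) : expR (rdot e x ^+ 2 / 32) <=
  \sum_(j < J.+1) c j * (cosh2 j (rdot e x) / 2).
 set z := rdot e x.
 have zJ : (Num.truncn `|z| < J.+1)%N.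
  by have := hJ e; rewrite -/z -truncn_lt_nat.
 rewrite (bigD1 (Ordinal zJ))//= ler_wpDr//.
  by apply: sumr_ge0 => j _; rewrite mulr_ge0// divr_ge0// addr_ge0// expR_ge0.
 set j := Num.truncn _.
 have /andP[j1 j2] := truncn_itv (normr_ge0 z); rewrite -/j in j1 j2.
 have half (a b : R) : 2 * a * (b / 2) = a * b by field.
 rewrite /c /cosh2 half.
 rewrite (@le_trans _ _ (expR (j.+1%:R ^+ 2 / 32 - j%:R ^+ 2 / 4) * expR (j%:R / 4 * `|z|)))//.
  rewrite -expRD ler_expR.
  have h1 : z ^+ 2 <= j.+1%:R ^+ 2.
   by rewrite -real_normK ?num_real// lerXn2r ?nnegrE// ltW.
  have h2 : j%:R ^+ 2 <= j%:R * `|z| by rewrite expr2 ler_wpM2l.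
  move: h1 h2; set A := z ^+ 2; set B := _ ^+ 2; set D := _ ^+ 2; set E := _ * _.
  rewrite (_ : j%:R / 4 * `|z| = E / 4); last by rewrite /E; ring.
  by clear; lra.
 rewrite ler_wpM2l ?expR_ge0//.
 have [z0|z0] := leP 0 z; first by rewrite ger0_norm// lerDl expR_ge0.
 rewrite ltr0_norm//.
 by rewrite mulrN -mulNr lerDr expR_ge0.
apply: (@le_trans _ _ (\sum_e \sum_(j < J.+1) c j * (cosh2 j (rdot e x) / 2))).
 by apply: ler_sum => e _; exact: mix.
rewrite exchange_big/=.
pose q : R := expR (- 32^-1).
have q1 : 0 <= q < 1 by rewrite expR_ge0/= expR_lt1 oppr_lt0 invr_gt0.
apply: (@le_trans _ _ (\sum_(j < J.+1) (2 * expR 32^-1 * q ^+ j) * #|{ffun I -> bool}|%:R)).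
 apply: ler_sum => j _; rewrite -mulr_sumr.
 have : \sum_e cosh2 j (rdot e x) / 2 <=
   #|{ffun I -> bool}|%:R * expR (2 * (j%:R / 4) ^+ 2).
  rewrite -mulr_suml ler_pdivrMr// big_split/=.
  have mono (t : R) : \sum_e expR (t * rdot e x) <= #|{ffun I -> bool}|%:R * expR (2 * t ^+ 2).
   rewrite (le_trans (sum_exp_rdot _ _))// ler_wpM2l// ler_expR.
   by rewrite ler_piMr// mulr_ge0// sqr_ge0.
  have h1 := mono (j%:R / 4); have h2 := mono (- (j%:R / 4)).
  rewrite sqrrN in h2; rewrite (le_trans (lerD h1 h2))//.
  by rewrite -mulrDr -mulrA ler_wpM2l// mulr_natr mulr2n.
 move=> /(ler_wpM2l (c0 j))/le_trans; apply.
 rewrite mulrCA mulrC; apply: ler_wpM2r => //.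
 rewrite /c /q -mulrA -mulrA ler_wpM2l// -expRM_natl -!expRD ler_expR.
 have jj : (j%:R : R) <= j%:R ^+ 2.
  by rewrite -natrX ler_nat; case: (nat_of_ord j) => // k; rewrite leq_pmulr.
 rewrite -natr1; move: jj; set t := j%:R; clear.
 rewrite (_ : (t + 1) ^+ 2 = t ^+ 2 + 2 * t + 1); last by ring.
 rewrite (_ : (t / 4) ^+ 2 = t ^+ 2 / 16); last by field.
 by set s := t ^+ 2; lra.
rewrite -mulr_suml; apply: ler_wpM2r => //.
rewrite -mulr_sumr; apply: ler_wpM2l; first by rewrite mulr_ge0// expR_ge0.
rewrite (le_trans (sum_geom _ q1))//.
have q2 : q <= 32 / 33.
 rewrite /q expRN -[32 / 33]invf_div lef_pV2 ?posrE ?expR_gt0 ?divr_gt0//.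
 by rewrite (le_trans _ (expR_ge1Dx _))//; lra.
rewrite invf_ple ?posrE ?subr_gt0//; last by case/andP: q1.
by move: q2; clear; lra.
Qed.

Lemma expR_le_quad (y : R) : expR y <= 1 + y + y ^+ 2 * expR `|y|.
Proof.
have h (z : R) : expR z - 1 <= z * expR z.
 have := expR_ge1Dx (- z); rewrite expRN -(ler_pM2r (expR_gt0 z)).
 rewrite mulVf ?gt_eqF ?expR_gt0// mulrDl mul1r mulNr; lra.
have : y * (expR y - 1) <= y ^+ 2 * expR `|y|.
 have [y0|/ltW y0] := leP 0 y; [rewrite ger0_norm//|rewrite ler0_norm//].
  by rewrite expr2 -mulrA ler_wpM2l.
 have -> : y * (expR y - 1) = - y * (1 - expR y) by ring.
 rewrite -sqrrN expr2 -mulrA; apply: ler_wpM2l; first by rewrite oppr_ge0.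
 have h1 := expR_ge1Dx y; have := expR_ge1Dx (- y).
 nra.
have := h y; lra.
Qed.

(** The squared form has mean exactly 1, so the linear term of the exponential averages to 0, and
    [sum_exp_sq] controls the quadratic one. The bound 1/64 on l leaves room for u^2 <= 128^2
    exp(u/64), where u = z^2 + 1. *)
Lemma sum_exp_bernstein : exists2 c : R, 0 < c & forall (I : finType) (x : I -> R) (l : R),
 sq_norm x = 1 -> `|l| <= 64^-1 ->
 \sum_(e : {ffun I -> bool}) expR (l * (rdot e x ^+ 2 - 1)) <=
  #|{ffun I -> bool}|%:R * expR (c * l ^+ 2).
Proof.
have [C C0 hC] := sum_exp_sq.
exists (128 ^+ 2 * expR 32^-1 * C); first by rewrite !mulr_gt0// expR_gt0.
move=> I x l x1 l1; set c := _ * C.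
have pt (z : R) : expR (l * (z ^+ 2 - 1)) <=
  1 + l * (z ^+ 2 - 1) + l ^+ 2 * (128 ^+ 2 * expR 32^-1) * expR (z ^+ 2 / 32).
 rewrite (le_trans (expR_le_quad _))// lerD2l exprMn -[leLHS]mulrA -[leRHS]mulrA.
 apply: ler_wpM2l; first exact: sqr_ge0.
 rewrite -[leRHS]mulrA.
 set u := z ^+ 2 + 1.
 have u0 : 0 <= u by rewrite addr_ge0 ?sqr_ge0.
 have zu : `|z ^+ 2 - 1| <= u.
  by rewrite /u ler_norml; have := sqr_ge0 z; clear; lra.
 rewrite (@le_trans _ _ (u ^+ 2 * expR (u / 64)))//.
  apply: ler_pM; rewrite ?sqr_ge0 ?expR_ge0//.
   by rewrite -real_normK ?num_real// lerXn2r ?nnegrE.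
  rewrite ler_expR normrM [leRHS]mulrC; exact: ler_pM.
 have -> : expR 32^-1 * expR (z ^+ 2 / 32) = expR (u / 128) ^+ 2 * expR (u / 64).
  by rewrite -expRM_natl -!expRD; congr expR; rewrite /u; field.
 rewrite mulrA -exprMn; apply: ler_wpM2r; first exact: expR_ge0.
 rewrite lerXn2r ?nnegrE ?mulr_ge0 ?expR_ge0//.
 rewrite mulrC -ler_pdivrMr//.
 by rewrite (le_trans _ (expR_ge1Dx _))// lerDr.
rewrite (le_trans (ler_sum _ (fun e _ => pt (rdot e x))))//.
rewrite !big_split/= -!mulr_sumr sumrB/= sum_rdot_sq x1 mulr1 sumr_const.
rewrite subrr mulr0 addr0.
rewrite (@le_trans _ _ (#|{ffun I -> bool}|%:R * (1 + c * l ^+ 2)))//; last first.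
 by rewrite ler_wpM2l// expR_ge1Dx.
rewrite mulrDr mulr1 lerD2l.
have K0 : 0 <= l ^+ 2 * (128 ^+ 2 * expR 32^-1).
 by apply: mulr_ge0; [exact: sqr_ge0|rewrite mulr_ge0 ?expR_ge0// exprn_ge0].
have x1' : sq_norm x <= 1 by rewrite x1.
rewrite (le_trans (ler_wpM2l K0 (hC I x x1')))//.
by rewrite /c le_eqVlt; apply/orP; left; apply/eqP; ring.
Qed.

Section Matrix.
Variables (I : finType) (n : nat).
Implicit Types (x : I -> R) (w : {ffun 'I_n -> {ffun I -> bool}}).

Definition qform w x : R := \sum_k rdot (w k) x ^+ 2.

(** Chernoff's bound for both tails at once; the rows are independent, so the exponential moment is
    an n-th power. *)
Lemma qform_tail (c : R) x (l s : R) :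
 (forall l : R, `|l| <= 64^-1 -> \sum_(e : {ffun I -> bool}) expR (l * (rdot e x ^+ 2 - 1)) <=
  #|{ffun I -> bool}|%:R * expR (c * l ^+ 2)) ->
 0 <= l <= 64^-1 ->
 #|[pred w : {ffun 'I_n -> {ffun I -> bool}} | s <= `|qform w x - n%:R| ]|%:R <=
 2 * expR (c * l ^+ 2 * n%:R - l * s) * #|{ffun 'I_n -> {ffun I -> bool}}|%:R.
Proof.
move=> hc /andP[l0 l1].
set M := #|{ffun I -> bool}|.
have mgf (t : R) : `|t| <= 64^-1 -> \sum_w expR (t * (qform w x - n%:R)) <=
  expR (c * t ^+ 2 * n%:R) * #|{ffun 'I_n -> {ffun I -> bool}}|%:R.
 move=> t1; have -> : \sum_w expR (t * (qform w x - n%:R)) =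
   \prod_(k < n) \sum_e expR (t * (rdot e x ^+ 2 - 1)).
  rewrite bigA_distr_bigA/=; apply: eq_bigr => w _.
  rewrite -expR_sum; congr expR; rewrite -mulr_sumr sumrB sumr_const card_ord.
  by [].
 have -> : expR (c * t ^+ 2 * n%:R) * #|{ffun 'I_n -> {ffun I -> bool}}|%:R =
   \prod_(k < n) (M%:R * expR (c * t ^+ 2)).
  by rewrite prodr_const card_ord exprMn -expRM_natr card_ffun card_ord natrX mulrC.
 apply: ler_prod => k _; rewrite hc// andbT.
 by apply: sumr_ge0 => e _; exact: expR_ge0.
rewrite -sum1_card natr_sum big_mkcond/=.
apply: (@le_trans _ _ (\sum_w (expR (l * (qform w x - n%:R)) * expR (- (l * s)) +
  expR (- l * (qform w x - n%:R)) * expR (- (l * s))))).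
 apply: ler_sum => w _; case: ifPn; last by rewrite addr_ge0// mulr_ge0// expR_ge0.
 rewrite inE -!expRD => h.
 have e1 (y : R) : 0 <= y -> 1 <= expR y by move=> y0; rewrite -expR0 ler_expR.
 have [y0|y0] := leP 0 (qform w x - n%:R);
   [rewrite ger0_norm// in h|rewrite ltr0_norm// in h].
  rewrite ler_wpDr ?expR_ge0// e1//.
  by rewrite subr_ge0 ler_wpM2l.
 by rewrite ler_wpDl ?expR_ge0// e1// mulNr -mulrN subr_ge0 ler_wpM2l.
rewrite big_split/= -!mulr_suml -mulrDl expRD [2 * (_ * _)]mulrA.
rewrite [leRHS]mulrAC; apply: ler_wpM2r; first exact: expR_ge0.
have dbl (a : R) : 2 * a = a + a by ring.
rewrite -[leRHS]mulrA dbl; apply: lerD; first by apply: mgf; rewrite ger0_norm.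
by rewrite -(sqrrN l); apply: mgf; rewrite normrN ger0_norm.
Qed.

Lemma qformZ w (c : R) x : qform w (fun i => c * x i) = c ^+ 2 * qform w x.
Proof.
rewrite /qform mulr_sumr; apply: eq_bigr => k _; rewrite -exprMn /rdot mulr_sumr.
by congr (_ ^+ 2); apply: eq_bigr => i _; ring.
Qed.

End Matrix.

Lemma sq_normZ (I : finType) (c : R) (x : I -> R) :
 sq_norm (fun i => c * x i) = c ^+ 2 * sq_norm x.
Proof. by rewrite /sq_norm mulr_sumr; apply: eq_bigr => i _; rewrite exprMn. Qed.

(** Up to a factor depending on eta, a majorant of k (1 + ln(N/k)), the logarithm of the number of
    integer vectors of l_1 norm of order k. *)
Definition sparse_exp (eta : R) (N k : nat) : R := k%:R `^ (1 - eta) * N%:R `^ eta.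

Lemma sparse_exp_ge (eta : R) (N k : nat) : 0 < eta < 1 -> (0 < k <= N)%N ->
 k%:R <= sparse_exp eta N k.
Proof.
move=> /andP[e0 e1] /andP[k0 kN]; have k0R : 0 < k%:R :> R by rewrite ltr0n.
apply: (@le_trans _ _ (k%:R `^ (1 - eta) * k%:R `^ eta)).
 by rewrite -powRD ?(gt_eqF k0R) ?implybT// subrK powRr1// ltW.
rewrite ler_wpM2l ?powR_ge0//.
by apply: (ge0_ler_powR (ltW e0)); rewrite ?nnegrE// ler_nat.
Qed.

Lemma lattice_count_sparse (eta : R) : 0 < eta < 1 -> exists2 A : R, 0 < A &
 forall N k, (0 < k <= N)%N ->
 (1 + N%:R / (16 * k)%:R) ^+ (16 * k) * (1 + 2 * (16 * k)%:R / N%:R) ^+ N <=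
 expR (A * sparse_exp eta N k).
Proof.
move=> /andP[e0 e1]; exists (32 / eta + 32); first by rewrite addr_gt0// divr_gt0.
move=> N k /andP[k0 kN]; have k0R : 0 < k%:R :> R by rewrite ltr0n.
have N0R : 0 < N%:R :> R by rewrite ltr0n (leq_trans k0).
have kNR : k%:R <= N%:R :> R by rewrite ler_nat.
have gk : k%:R <= sparse_exp eta N k by apply: sparse_exp_ge; rewrite ?e0 ?k0.
set g := sparse_exp _ _ _ in gk *.
have K0R : 0 < (16 * k)%:R :> R by rewrite ltr0n muln_gt0.
rewrite [(_ + 32) * _]mulrDl expRD; apply: ler_pM; rewrite ?exprn_ge0 ?addr_ge0 ?divr_ge0 ?mulr_ge0//.
 have y0 : 0 < 1 + N%:R / (16 * k)%:R :> R by rewrite addr_gt0// divr_gt0.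
 rewrite -ler_ln ?posrE ?exprn_gt0 ?expR_gt0// lnXn// expRK.
 rewrite -[ln _ *+ _]mulr_natl.
 rewrite (le_trans (ler_wpM2l (ltW K0R) (ln_le_powR e0 y0)))//.
 have y2 : 1 + N%:R / (16 * k)%:R <= 2 * (N%:R / k%:R) :> R.
  have h1 : 1 <= N%:R / k%:R :> R by rewrite ler_pdivlMr// mul1r.
  have h2 : N%:R / (16 * k)%:R <= N%:R / k%:R :> R.
   by rewrite ler_wpM2l// lef_pV2 ?posrE// ler_nat leq_pmull.
  by move: h1 h2; clear; lra.
 have NK0 : 0 <= N%:R / k%:R :> R by rewrite divr_ge0.
 have y3 : (1 + N%:R / (16 * k)%:R) `^ eta <= 2 * (N%:R / k%:R) `^ eta.
  rewrite (@le_trans _ _ ((2 * (N%:R / k%:R)) `^ eta))//.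
   by apply: (ge0_ler_powR (ltW e0)); rewrite ?nnegrE ?(ltW y0)// mulr_ge0.
  by rewrite powRM// ler_wpM2r ?powR_ge0// ler1_powR ?ler1n// ltW.
 rewrite (@le_trans _ _ ((16 * k)%:R * (eta^-1 * (2 * (N%:R / k%:R) `^ eta))))//.
  by rewrite ler_wpM2l// ler_wpM2l// invr_ge0 ltW.
 rewrite /g /sparse_exp powRM// ?invr_ge0//.
 have -> : k%:R `^ (1 - eta) = k%:R * k%:R^-1 `^ eta :> R.
  rewrite powRD ?(gt_eqF k0R) ?implybT// powRr1// ?(ltW k0R)//; congr (_ * _).
  by rewrite -(powR_inv1 (ltW k0R)) -powRrM mulN1r.
 rewrite natrM le_eqVlt; apply/orP; left; apply/eqP; ring.
rewrite (@le_trans _ _ (expR (2 * (16 * k)%:R / N%:R) ^+ N))//.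
 by rewrite lerXn2r ?nnegrE ?addr_ge0 ?expR_ge0 ?divr_ge0 ?mulr_ge0// expR_ge1Dx.
rewrite -expRM_natl ler_expR mulrCA divff ?gt_eqF// mulr1 natrM mulrA.
by rewrite (_ : 2 * 16 = 32)// ?ler_wpM2l//; ring.
Qed.

(** A union bound over all k and all integer vectors of l_1 norm at most 16 k. With g the value of
    [sparse_exp], one vector fails with frequency at most 2 exp(-(A + 2) g) and there are at most
    exp(A g) of them; since g >= k, what remains is at most 2 * 4^-k, and these sum to less than
    1. *)
Lemma good_signs (eta : R) : 0 < eta < 1 -> exists2 D : R, 0 < D &
 forall (I : finType) (n : nat), (0 < #|I|)%N -> (0 < n)%N ->
 exists w : {ffun 'I_n -> {ffun I -> bool}}, forall (k : nat) (z : I -> int),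
  (0 < k <= #|I|)%N -> (\sum_i `|z i| <= 16 * k)%N ->
  let g := sparse_exp eta #|I| k in let x := fun i => (z i)%:~R : R in
  `|qform w x - n%:R * sq_norm x| <= D * (Num.sqrt (n%:R * g) + g) * sq_norm x.
Proof.
move=> eta01; have [c c0 hc] := sum_exp_bernstein.
have [A A0 hA] := lattice_count_sparse eta01.
(* The factor 64 undoes the restriction on l; c pays for the quadratic term of the exponent, A for
   the number of vectors and 2 for the sum over k. *)
pose D := 64 * (c + (A + 2)).
have D0 : 0 < D by rewrite mulr_gt0// !addr_gt0.
exists D => // I n N0 n0; set N := #|I|.
have n0R : 0 < n%:R :> R by rewrite ltr0n.
pose Tot := #|{ffun 'I_n -> {ffun I -> bool}}|%:R : R.
have Tot0 : 0 < Tot by rewrite ltr0n; apply/card_gt0P; exists [ffun=> [ffun=> true]].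
pose vec K (u : {ffun I -> 'I_(K.*2.+1)}) : I -> R := fun i => (int_of_code (u i))%:~R.
pose thr (k : nat) : R := D * (Num.sqrt (n%:R * sparse_exp eta N k) + sparse_exp eta N k).
pose bad (k : nat) (u : {ffun I -> 'I_((16 * k).*2.+1)})
  (w : {ffun 'I_n -> {ffun I -> bool}}) : bool :=
 thr k * sq_norm (vec _ u) < `|qform w (vec _ u) - n%:R * sq_norm (vec _ u)|.
have badle (k : nat) u : (0 < k <= N)%N -> #|[pred w | bad k u w]|%:R <=
  2 * expR (- (A + 2) * sparse_exp eta N k) * Tot.
 move=> kN; set g := sparse_exp _ _ _.
 have g0 : 0 < g.
  apply: lt_le_trans (sparse_exp_ge eta01 kN); rewrite ltr0n; by case/andP: kN.
 have [x0|x0] := eqVneq (sq_norm (vec _ u)) 0.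
  rewrite eq_card0 ?mulr_ge0 ?expR_ge0 ?ltW// => w; rewrite !inE /bad x0 !mulr0 subr0.
  apply/negbTE; rewrite -leNgt normr_le0 /qform big1// => j _.
  have v0 i : vec _ u i = 0.
   have /psumr_eq0P := x0 => /(_ (fun i _ => sqr_ge0 _))/(_ i isT)/eqP.
   by rewrite sqrf_eq0 => /eqP.
  by rewrite /rdot big1 ?expr0n// => i _; rewrite v0 mulr0.
 have x00 : 0 < sq_norm (vec _ u) by rewrite lt_def x0 sq_norm_ge0.
 set a := (Num.sqrt (sq_norm (vec _ u)))^-1.
 have a2 : a ^+ 2 * sq_norm (vec _ u) = 1.
  by rewrite exprVn sqr_sqrtr ?ltW// mulVf.
 pose y i := a * vec _ u i.
 have y1 : sq_norm y = 1 by rewrite sq_normZ.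
 pose rg := Num.sqrt g; pose rn := Num.sqrt (n%:R : R).
 have rg0 : 0 < rg by rewrite sqrtr_gt0.
 have rn0 : 0 < rn by rewrite sqrtr_gt0.
 have rg2 : rg ^+ 2 = g by rewrite sqr_sqrtr// ltW.
 have rn2 : rn ^+ 2 = n%:R by rewrite sqr_sqrtr.
 (* With this l the gain l * thr k is D g/64 while l^2 n <= g, so gain and quadratic term are both
    of the order of g. *)
 pose l := rg / (rn + rg) / 64.
 have rs0 : 0 < rn + rg by rewrite addr_gt0.
 have l01 : 0 <= l <= 64^-1.
  rewrite /l divr_ge0 ?divr_ge0 ?(ltW rg0) ?(ltW rs0)//=.
  by rewrite ler_piMl// ler_pdivrMr// mul1r lerDr ltW.
 have := @qform_tail I n c y l (thr k) (fun l hl => hc I y l y1 hl) l01.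
 move=> H; apply: le_trans (le_trans H _).
  rewrite ler_nat; apply: subset_leq_card; apply/fintype.subsetP => w; rewrite !inE /bad => h.
  have -> : qform w y - n%:R = a ^+ 2 * (qform w (vec _ u) - n%:R * sq_norm (vec _ u)).
   by rewrite /y qformZ mulrBr mulrCA a2 mulr1.
  have e : thr k = a ^+ 2 * (thr k * sq_norm (vec _ u)) by rewrite mulrCA a2 mulr1.
  rewrite normrM [`|a ^+ 2|]ger0_norm ?sqr_ge0// [leLHS]e.
  by apply: ler_wpM2l; [exact: sqr_ge0|exact: ltW].
 apply: ler_wpM2r; first exact: ltW.
 rewrite ler_wpM2l// ler_expR.
 have -> : l * thr k = D / 64 * g.
  rewrite /l /thr -/g sqrtrM// -/rg -/rn -rg2; field; by rewrite gt_eqF.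
 have : c * l ^+ 2 * n%:R <= c * g.
  rewrite -mulrA ler_wpM2l ?(ltW c0)// -rn2 -exprMn -rg2 lerXn2r ?nnegrE ?(ltW rg0)//.
   by rewrite mulr_ge0 ?(ltW rn0)//; case/andP: l01.
  rewrite /l mulrAC ler_pdivrMr// mulrAC ler_pdivrMr// -mulrA ler_wpM2l ?(ltW rg0)//.
  by move: rn0 rg0; clear; nra.
 rewrite /D [64 * _]mulrC mulfK//.
 by clear; lra.
apply: contrapT => /forallNP nogood.
have ex_bad (w : {ffun 'I_n -> {ffun I -> bool}}) : exists k : 'I_N, exists u : {ffun I -> 'I_((16 * k.+1).*2.+1)}, [&& (\sum_i `|int_of_code (u i)| <= 16 * k.+1)%N & bad k.+1 u w].
 have /existsNP[k /existsNP[z]] := nogood w.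
 case/not_implyP => /andP[k0 kN] /not_implyP[zk].
 move/negP; rewrite -ltNge => hb.
 case: k k0 kN zk hb => // k _ kN zk hb.
 have zi i : (`|z i| <= 16 * k.+1)%N by apply: leq_trans zk; rewrite (bigD1 i)//= leq_addr.
 exists (Ordinal kN), [ffun i => inord (absz (z i + Posz (16 * k.+1)))].
 have e i : int_of_code ([ffun i => inord (absz (z i + Posz (16 * k.+1)))] i :
   'I_((16 * k.+1).*2.+1)) = z i.
  by rewrite /int_of_code ffunE inordK; have := zi i; lia.
 apply/andP; split; first by under eq_bigr do rewrite e.
 rewrite /bad /vec; have -> : (fun i => (int_of_code ([ffun i => inord (absz (z i + Posz (16 * k.+1)))] i :
   'I_((16 * k.+1).*2.+1)))%:~R) = (fun i => (z i)%:~R) :> (I -> R).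
  by apply/funext => i; rewrite e.
 exact: hb.
have le1 : Tot <= \sum_(k < N) \sum_(u : {ffun I -> 'I_((16 * k.+1).*2.+1)} | (\sum_i `|int_of_code (u i)| <= 16 * k.+1)%N)
  #|[pred w : {ffun 'I_n -> {ffun I -> bool}} | bad k.+1 u w]|%:R.
 have -> : Tot = \sum_(w : {ffun 'I_n -> {ffun I -> bool}}) 1 by rewrite sumr_const.
 rewrite (@le_trans _ _ (\sum_(w : {ffun 'I_n -> {ffun I -> bool}}) \sum_(k < N)
   \sum_(u : {ffun I -> 'I_((16 * k.+1).*2.+1)} | (\sum_i `|int_of_code (u i)| <= 16 * k.+1)%N) (bad k.+1 u w)%:R))//.
  apply: ler_sum => w _; have [k [u /andP[uk hb]]] := ex_bad w.
  rewrite (bigD1 k)//= (bigD1 u)//= hb -addrA lerDl addr_ge0//.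
   by apply: sumr_ge0 => *; exact: ler0n.
  by apply: sumr_ge0 => *; apply: sumr_ge0 => *; exact: ler0n.
 rewrite exchange_big/=; apply: ler_sum => k _.
 rewrite exchange_big/=; apply: ler_sum => u _.
 rewrite -sum1_card natr_sum [leRHS]big_mkcond/=; apply: ler_sum => w _.
 by rewrite inE; case: (bad _ _ _).
have le2 : \sum_(k < N) \sum_(u : {ffun I -> 'I_((16 * k.+1).*2.+1)} | (\sum_i `|int_of_code (u i)| <= 16 * k.+1)%N)
  #|[pred w : {ffun 'I_n -> {ffun I -> bool}} | bad k.+1 u w]|%:R <= \sum_(k < N) 2 * (4^-1) ^+ k.+1 * Tot.
 apply: ler_sum => k _.
 have kN : (0 < k.+1 <= N)%N by rewrite /= ltn_ord.
 rewrite (le_trans (ler_sum _ (fun u _ => badle _ u kN)))//.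
 rewrite sumr_const -[_ *+ _]mulr_natl mulrA; apply: ler_wpM2r; first exact: ltW.
 have := @lattice_count R I (16 * k.+1) _ N0; rewrite muln_gt0 => /(_ isT) h.
 rewrite mulrCA ler_wpM2l//.
 rewrite (@le_trans _ _ (expR (A * sparse_exp eta N k.+1) * expR (- (A + 2) * sparse_exp eta N k.+1)))//.
  apply: ler_wpM2r; first exact: expR_ge0.
  by rewrite (le_trans h)// hA.
 rewrite -expRD -mulrDl opprD addrA subrr sub0r.
 rewrite (@le_trans _ _ (expR (- 2 * k.+1%:R)))//.
  by rewrite ler_expR !mulNr lerN2 ler_wpM2l// sparse_exp_ge.
 rewrite expRM_natr lerXn2r ?nnegrE ?expR_ge0// expRN lef_pV2 ?posrE ?expR_gt0//.
 rewrite -[X in expR X]mulr1 expRM_natl.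
 have e1 : 2 <= expR 1 :> R by rewrite (le_trans _ (expR_ge1Dx _)).
 by rewrite (le_trans _ (lerXn2r 2 _ _ e1)) ?nnegrE ?expR_ge0// -natrX.
have := le_trans le1 le2; rewrite -mulr_suml -mulr_sumr.
rewrite ler_pMl//; apply/negP; rewrite -ltNge.
have -> : \sum_(k < N) (4^-1 : R) ^+ k.+1 = 4^-1 * \sum_(k < N) 4^-1 ^+ k.
 by rewrite mulr_sumr; apply: eq_bigr => k _; rewrite exprS.
have h4 : 0 <= (4^-1 : R) < 1 by apply/andP; split; lra.
have := sum_geom N h4; set S := \sum_(k < N) _; move: S; clear => S.
rewrite (_ : 1 - 4^-1 = 3 / 4 :> R); last by field.
rewrite invf_div; lra.
Qed.

End SignMatrix.

(** * From integer vectors to sparse vectors and to l_a balls *)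

Section SparseForms.
Variable R : realType.

Section Forms.
Variables (I : finType) (n : nat) (w : {ffun 'I_n -> {ffun I -> bool}}).
Implicit Types x y : I -> R.

Definition defect x : R := qform w x - n%:R * sq_norm x.
Definition dot x y : R := \sum_i x i * y i.
Definition bform x y : R := \sum_k rdot (w k) x * rdot (w k) y.

Lemma defectZ c x : defect (fun i => c * x i) = c ^+ 2 * defect x.
Proof. by rewrite /defect qformZ sq_normZ; ring. Qed.

Lemma rdotD e (c d : R) x y : rdot e (fun i => c * x i + d * y i) = c * rdot e x + d * rdot e y.
Proof.
rewrite /rdot !mulr_sumr -big_split/=; apply: eq_bigr => i _; ring.
Qed.

(** Replacing x, y by t x, y/t does not change the bilinear form; the free t serves to balance
    vectors of different norms. *)
Lemma defect_polar x y (t : R) : t != 0 ->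
 defect (fun i => t * x i + t^-1 * y i) - defect (fun i => t * x i + (- t^-1) * y i) =
 4 * (bform x y - n%:R * dot x y).
Proof.
move=> t0; rewrite /defect /qform /sq_norm /bform /dot.
have -> : forall a b c d : R, a - n%:R * b - (c - n%:R * d) = (a - c) - n%:R * (b - d).
 by move=> *; ring.
rewrite -!sumrB [RHS]mulrBr [4 * (n%:R * _)]mulrCA; congr (_ - _ * _); rewrite mulr_sumr.
 by apply: eq_bigr => k _; rewrite !rdotD; field.
by apply: eq_bigr => i _; field.
Qed.

Lemma sq_normD x y (c d : R) :
 sq_norm (fun i => c * x i + d * y i) + sq_norm (fun i => c * x i + (- d) * y i) =
 2 * (c ^+ 2 * sq_norm x + d ^+ 2 * sq_norm y).
Proof.
rewrite /sq_norm -big_split/= !mulr_sumr -big_split/= mulr_sumr.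
by apply: eq_bigr => i _; ring.
Qed.

Definition supp_in (S : {set I}) x := forall i, i \notin S -> x i = 0.

Lemma supp_inD S (c d : R) x y : supp_in S x -> supp_in S y ->
 supp_in S (fun i => c * x i + d * y i).
Proof. by move=> xS yS i iS; rewrite xS// yS// !mulr0 addr0. Qed.

(** Crude, but it makes the supremum in [sparse_defect] finite and the defect of a zero vector
    vanish. *)
Lemma defect_bound x : `|defect x| <= (n%:R * #|I|%:R + n%:R) * sq_norm x.
Proof.
rewrite (le_trans (ler_normB _ _))// mulrDl; apply: lerD; last first.
 by rewrite ger0_norm// mulr_ge0// sq_norm_ge0.
rewrite ger0_norm; last by apply: sumr_ge0 => k _; exact: sqr_ge0.
rewrite (@le_trans _ _ (\sum_(k < n) #|I|%:R * sq_norm x))//; last first.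
 by rewrite sumr_const card_ord -[_ *+ _]mulr_natl mulrA.
apply: ler_sum => k _; set e := w k.
have : 0 <= \sum_i \sum_j (sgn R (e i) * x i - sgn R (e j) * x j) ^+ 2.
 by apply: sumr_ge0 => i _; apply: sumr_ge0 => j _; exact: sqr_ge0.
have -> : \sum_i \sum_j (sgn R (e i) * x i - sgn R (e j) * x j) ^+ 2 =
  2 * (#|I|%:R * sq_norm x - rdot e x ^+ 2).
 transitivity (\sum_i \sum_j (x i ^+ 2 + x j ^+ 2 - 2 * ((sgn R (e i) * x i) * (sgn R (e j) * x j)))).
  apply: eq_bigr => i _; apply: eq_bigr => j _.
  have s2 b : sgn R b ^+ 2 = 1 by rewrite /sgn; case: b; rewrite ?sqrrN expr1n.
  by rewrite sqrrB !exprMn !s2 !mul1r; ring.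
 have cst (c : R) : \sum_(i : I) c = #|I|%:R * c by rewrite sumr_const mulr_natl.
 under eq_bigr do rewrite sumrB big_split/= cst -mulr_sumr -mulr_sumr.
 rewrite sumrB big_split/= -!mulr_sumr -mulr_suml cst -/(sq_norm x) -/(rdot e x).
 move: (#|I|%:R : R) (sq_norm x) (rdot e x) => a b c; clear; ring.
by rewrite pmulr_rge0// subr_ge0.
Qed.

End Forms.

(** A net argument that improves itself. Let b be the supremum of the defect over k-sparse vectors
    of norm at most 1. Rounding x towards zero yields a multiple y of an integer vector, and the
    difference of the defects of x and y is the polar form of x - y and x + y, whose squared norms
    are at most 1/16 and 4. Hence b <= s + 51/100 b. *)
Lemma sparse_defect (I : finType) n (w : {ffun 'I_n -> {ffun I -> bool}}) (k : nat) (s : R) :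
 (0 < k)%N -> 0 <= s ->
 (forall z : I -> int, (\sum_i `|z i| <= 16 * k)%N ->
  `|defect w (fun i => (z i)%:~R)| <= s * sq_norm (fun i => (z i)%:~R : R)) ->
 forall (S : {set I}) x, (#|S| <= k)%N -> supp_in S x -> `|defect w x| <= 3 * s * sq_norm x.
Proof.
move=> k0 s0 hz.
have k0R : 0 < k%:R :> R by rewrite ltr0n.
pose A : set R := [set `|defect w x| | x in
 [set x : I -> R | sq_norm x <= 1 /\ exists S : {set I}, (#|S| <= k)%N /\ supp_in S x]].
have supA : has_sup A.
 split; first by exists `|defect w (fun=> 0)|, (fun=> 0) => //; split;
  [rewrite /sq_norm big1// => i _; rewrite expr0n|exists finset.set0; rewrite cards0; split].
 exists (n%:R * #|I|%:R + n%:R) => _ [x [x1 _] <-].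
 by rewrite (le_trans (defect_bound w x))// ler_piMr// addr_ge0// mulr_ge0.
set b := sup A.
have hb (S : {set I}) x : (#|S| <= k)%N -> supp_in S x -> `|defect w x| <= b * sq_norm x.
 move=> Sk xS; have [x0|x0] := eqVneq (sq_norm x) 0.
  by rewrite x0 mulr0; have := defect_bound w x; rewrite x0 mulr0.
 have x00 : 0 < sq_norm x by rewrite lt_def x0 sq_norm_ge0.
 set a := (Num.sqrt (sq_norm x))^-1.
 have a2 : a ^+ 2 = (sq_norm x)^-1 by rewrite exprVn sqr_sqrtr ?ltW.
 have : A `|defect w (fun i => a * x i)|.
  exists (fun i => a * x i) => //; split; first by rewrite sq_normZ a2 mulVf.
  by exists S; split => // i iS; rewrite xS// mulr0.
 move=> /(ub_le_sup supA.2); rewrite -/b defectZ a2 normrM ger0_norm; last first.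
  by rewrite invr_ge0 ltW.
 by rewrite mulrC ler_pdivrMr.
have b0 : 0 <= b.
 case: supA => -[y Ay] hubA.
 apply: le_trans (ub_le_sup hubA Ay).
 by case: Ay => x _ <-.
have bs : b <= s + 51 / 100 * b.
 apply: ge_sup; first by case: supA.
 move=> _ [x [x1 [S [Sk xS]]] <-].
 pose rk := Num.sqrt (k%:R : R).
 have rk0 : 0 < rk by rewrite sqrtr_gt0.
 have rk2 : rk ^+ 2 = k%:R by rewrite sqr_sqrtr// ltW.
 (* With this step the rounded vector is h times an integer vector of l_1 norm at most 1/h^2 = 16 k,
    the range covered by the hypothesis. *)
 pose h : R := (4 * rk)^-1.
 have h0 : 0 < h by rewrite invr_gt0 mulr_gt0.
 have h2 : 16 * k%:R * h ^+ 2 = 1.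
  by rewrite /h exprVn exprMn rk2 -natrX mulfV// mulf_neq0// gt_eqF.
 pose z i : int := if 0 <= x i then Posz (Num.truncn (`|x i| / h))
  else - Posz (Num.truncn (`|x i| / h)).
 have za i : `|z i|%N = Num.truncn (`|x i| / h).
  by rewrite /z; case: ifP => _; rewrite ?abszN.
 pose y i : R := h * (z i)%:~R.
 have yx i : `|x i - y i| <= h /\ `|y i| <= `|x i|.
  have := truncn_itv (divr_ge0 (normr_ge0 (x i)) (ltW h0)).
  move=> /andP[]; rewrite ler_pdivlMr// ltr_pdivrMr// -natr1 => t1 t2.
  rewrite /y /z; move: t1 t2; set t := Num.truncn _.
  have t0 : 0 <= t%:R * h by rewrite mulr_ge0// ltW.
  have [x0|x0] := leP 0 (x i).
   rewrite (ger0_norm x0) -pmulrn [h * _]mulrC (ger0_norm t0) => t1 t2; split => //.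
   by rewrite ger0_norm ?subr_ge0//; move: t2; clear; lra.
  rewrite (ltr0_norm x0) mulrNz -pmulrn mulrN normrN [h * _]mulrC (ger0_norm t0) => t1 t2; split => //.
  by rewrite ler0_norm; move: t1 t2 h0; clear; lra.
 have yS : supp_in S y.
  move=> i iS; apply/eqP; rewrite -normr_le0.
  by have [_ ] := yx i; rewrite xS// normr0.
 have zk : (\sum_i `|z i| <= 16 * k)%N.
  rewrite -(ler_nat R) natr_sum.
  rewrite (@le_trans _ _ (\sum_i x i ^+ 2 / h ^+ 2))//; last first.
   rewrite -mulr_suml ler_pdivrMr ?exprn_gt0// natrM h2//.
  apply: ler_sum => i _; rewrite za.
  rewrite (@le_trans _ _ ((Num.truncn (`|x i| / h))%:R ^+ 2))//.
   by rewrite -natrX ler_nat; case: (Num.truncn _) => // m; rewrite leq_pmulr.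
  rewrite -expr_div_n -[leRHS]real_normK ?num_real// lerXn2r ?nnegrE//.
  rewrite normrM normfV [`|h|]gtr0_norm//.
  by case/andP: (truncn_itv (divr_ge0 (normr_ge0 (x i)) (ltW h0))).
 have dy : `|defect w y| <= s.
  rewrite /y defectZ normrM ger0_norm ?sqr_ge0//.
  rewrite (le_trans (ler_wpM2l (sqr_ge0 _) (hz z zk)))//.
  rewrite mulrCA -sq_normZ -/y ler_piMr// (le_trans _ x1)//.
  apply: ler_sum => i _; rewrite -[leLHS]real_normK ?num_real// -[leRHS]real_normK ?num_real//.
  by rewrite lerXn2r ?nnegrE//; case: (yx i).
 pose e i := 1 * x i + (-1) * y i; pose f i := 1 * x i + 1 * y i.
 have eS : supp_in S e by exact: supp_inD.
 have fS : supp_in S f by exact: supp_inD.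
 have e1 : sq_norm e <= 16^-1.
  rewrite (@le_trans _ _ (\sum_(i in S) h ^+ 2))//.
   rewrite /sq_norm (bigID (fun i => i \in S))/= [X in _ + X]big1 ?addr0; last first.
    by move=> i iS; rewrite eS// expr0n.
   apply: ler_sum => i _; rewrite -[leLHS]real_normK ?num_real// lerXn2r ?nnegrE ?(ltW h0)//.
   by rewrite /e mul1r mulN1r; case: (yx i).
  rewrite sumr_const -[_ *+ _]mulr_natl.
  have : #|S|%:R <= k%:R :> R by rewrite ler_nat.
  move: h2 (sqr_ge0 h); set u := h ^+ 2; move: k0R; clear; set K := k%:R; set c := #|S|%:R.
  move=> K0 h2 u0 cK; have : c * u <= K * u by rewrite ler_wpM2r.
  by lra.
 have f1 : sq_norm f <= 4.
  rewrite (@le_trans _ _ (\sum_i 4 * x i ^+ 2))//; last by rewrite -mulr_sumr ler_piMr.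
  apply: ler_sum => i _; rewrite (_ : 4 * x i ^+ 2 = (2 * `|x i|) ^+ 2); last first.
   by rewrite exprMn real_normK ?num_real// -natrX.
  rewrite -[leLHS]real_normK ?num_real// lerXn2r ?nnegrE ?mulr_ge0//.
  rewrite /f !mul1r (le_trans (ler_normD _ _))//; case: (yx i) => _; clear; lra.
 (* The value 3 is close to the square root of 8, which balances 1/16 against 4; it gives the factor
    (9/16 + 4/9)/2 < 51/100. *)
 have t0 : 3 != 0 :> R by [].
 have ide : 4 * (bform w e f - n%:R * dot e f) = 4 * (defect w x - defect w y).
  rewrite /defect /qform /sq_norm /bform /dot.
  have -> : forall a b c d : R, a - n%:R * b - (c - n%:R * d) = (a - c) - n%:R * (b - d).
   by move=> *; ring.
  rewrite -!sumrB; congr (_ * (_ - _ * _)).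
   by apply: eq_bigr => j _; rewrite /e /f !rdotD; ring.
  by apply: eq_bigr => i _; rewrite /e /f; ring.
 have := defect_polar w e f t0; rewrite ide.
 set u := fun i => 3 * e i + 3^-1 * f i; set v := fun i => 3 * e i + - 3^-1 * f i => pol.
 have hu := hb S u Sk (supp_inD _ _ eS fS); have hv := hb S v Sk (supp_inD _ _ eS fS).
 have uv := sq_normD e f 3 3^-1; rewrite -/u -/v in uv.
 have key : b * (sq_norm u + sq_norm v) <= b * (2 * (9 / 16 + 4 / 9)).
  apply: ler_wpM2l => //; rewrite uv; move: e1 f1; clear.
  rewrite exprVn -!natrX; set E := sq_norm e; set F := sq_norm f; move=> e1 f1.
  by rewrite /= ; lra.
 move: hu hv dy key pol b0.
 rewrite !ler_norml mulrDr; set Du := defect w u; set Dv := defect w v.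
 set Dx := defect w x; set Dy := defect w y.
 set U := b * sq_norm u; set V := b * sq_norm v.
 move: Du Dv Dx Dy U V; clear => Du Dv Dx Dy U V.
 by move=> /andP[u1 u2] /andP[v1 v2] /andP[y1 y2] key pol b0; apply/andP; split; lra.
move=> S x Sk xS; apply: le_trans (hb S x Sk xS) _.
apply: ler_wpM2r; first exact: sq_norm_ge0.
by move: bs s0; clear; lra.
Qed.

Definition l2 (K : finType) (x : K -> R) : R := Num.sqrt (sq_norm x).

Lemma l2_ge0 (K : finType) (x : K -> R) : 0 <= l2 x.
Proof. exact: sqrtr_ge0. Qed.

Lemma l2_sq (K : finType) (x : K -> R) : l2 x ^+ 2 = sq_norm x.
Proof. by rewrite sqr_sqrtr// sq_norm_ge0. Qed.

Lemma l2_le (K : finType) (x : K -> R) (b : R) : 0 <= b -> sq_norm x <= b ^+ 2 -> l2 x <= b.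
Proof. by move=> b0 h; rewrite -(ger0_norm b0) -sqrtr_sqr ler_wsqrtr. Qed.

Lemma dot_le (K : finType) (x y : K -> R) : `|dot x y| <= l2 x * l2 y.
Proof.
have [x0|x0] := eqVneq (sq_norm x) 0.
 have v0 i : x i = 0.
  have /psumr_eq0P := x0 => /(_ (fun i _ => sqr_ge0 _))/(_ i isT)/eqP.
  by rewrite sqrf_eq0 => /eqP.
 rewrite /dot big1 ?normr0 ?mulr_ge0 ?l2_ge0// => i _; by rewrite v0 mul0r.
have x00 : 0 < sq_norm x by rewrite lt_def x0 sq_norm_ge0.
rewrite -(ger0_norm (mulr_ge0 (l2_ge0 x) (l2_ge0 y))) -!sqrtr_sqr ler_wsqrtr//.
rewrite exprMn !l2_sq.
have : 0 <= \sum_i (sq_norm x * y i - dot x y * x i) ^+ 2.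
 by apply: sumr_ge0 => i _; exact: sqr_ge0.
have -> : \sum_i (sq_norm x * y i - dot x y * x i) ^+ 2 =
  sq_norm x * (sq_norm x * sq_norm y - dot x y ^+ 2).
 set X := sq_norm x; set B := dot x y.
 transitivity (\sum_i (X ^+ 2 * y i ^+ 2 - 2 * X * B * (x i * y i) + B ^+ 2 * x i ^+ 2)).
  by apply: eq_bigr => i _; ring.
 rewrite big_split/= sumrB -!mulr_sumr -/(sq_norm x) -/(sq_norm y) -/(dot x y) -/X -/B.
 by move: (sq_norm y) X B; clear => Y X B; ring.
by rewrite pmulr_rge0// subr_ge0.
Qed.

Lemma l2D (K : finType) (x y : K -> R) : l2 (fun i => x i + y i) <= l2 x + l2 y.
Proof.
apply: l2_le; first by rewrite addr_ge0 ?l2_ge0.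
have -> : sq_norm (fun i => x i + y i) = sq_norm x + sq_norm y + 2 * dot x y.
 rewrite /sq_norm /dot mulr_sumr -!big_split/=; apply: eq_bigr => i _; ring.
rewrite -!l2_sq; have := dot_le x y; rewrite ler_norml => /andP[_].
by move: (dot x y) (l2 x) (l2 y); clear => *; lra.
Qed.

Lemma l2_sum (K : finType) (J : Type) (s : seq J) (P : pred J) (x : J -> K -> R) :
 l2 (fun i => \sum_(j <- s | P j) x j i) <= \sum_(j <- s | P j) l2 (x j).
Proof.
elim: s => [|j s IH].
 rewrite big_nil; have -> : (fun i : K => \sum_(j <- [::] | P j) x j i) = fun=> 0.
  by apply/funext => i; rewrite big_nil.
 by apply: l2_le => //; rewrite /sq_norm big1 ?expr0n// => i _; rewrite expr0n.
rewrite big_cons; case: ifP => Pj; last first.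
 by under [X in l2 X]eq_fun do rewrite big_cons Pj.
under [X in l2 X]eq_fun do rewrite big_cons Pj.
by apply: le_trans (l2D _ _) _; rewrite lerD2l.
Qed.

Lemma level_ex (y : R) J : y <= 1 ->
 exists l, [/\ (l <= J)%N, y <= 2^-1 ^+ l & (l < J)%N -> 2^-1 ^+ l.+1 < y].
Proof.
move=> y1; elim: J => [|J [l [lJ yl yl2]]]; first by exists 0%N; rewrite expr0.
have [E|E] := eqVneq l J; last first.
 have lJ' : (l < J)%N by rewrite ltn_neqAle E.
 exists l; split => //; [exact: leqW|by move=> _; exact: yl2].
have [h|h] := leP y (2^-1 ^+ J.+1).
 by exists J.+1; rewrite ltnn.
by exists l; split => //; [exact: leqW|rewrite E].
Qed.

(** Dyadic level sets of u_i = |x_i|^a with 1/a = 1 - eta. On level j, u_i is at most 2^-j and,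
    unless j = J, exceeds 2^-(j+1); so the levels up to j contain at most 2^(j+1) indices. The l_2
    bound is x_i^2 = u_i^(1 - 2 eta) u_i. *)
Lemma level_blocks (eta : R) (I : finType) (x : I -> R) (J : nat) : 0 < eta < 2^-1 ->
 (#|I| <= 2 ^ J)%N -> \sum_i `|x i| `^ (1 - eta)^-1 <= 1 ->
 exists (xs : nat -> I -> R) (S : nat -> {set I}),
 [/\ forall i, x i = \sum_(j < J.+1) xs j i,
   forall j, supp_in (S j) (xs j),
   forall j, (j <= J)%N -> (#|S j| <= 2 ^ j.+1)%N,
   forall i j, (i <= j)%N -> S i \subset S j &
   forall j, l2 (xs j) <= (2 `^ (eta - 2^-1)) ^+ j].
Proof.
move=> /andP[e0 e1] NJ x1.
have a0 : 0 < 1 - eta by move: e1; clear; lra.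
pose u i := `|x i| `^ (1 - eta)^-1.
have u0 i : 0 <= u i by exact: powR_ge0.
have u1 i : u i <= 1.
 by apply: le_trans x1; rewrite (bigD1 i)//= lerDl; apply: sumr_ge0 => j _; exact: powR_ge0.
have /choice[lev hlev] := fun i => @level_ex (u i) J (u1 i).
exists (fun j i => if lev i == j then x i else 0), (fun j => finset.finset (fun i => (lev i <= j)%N)).
split.
- move=> i; have lJ : (lev i < J.+1)%N by have [] := hlev i.
 rewrite (bigD1 (Ordinal lJ))//= eqxx big1 ?addr0// => j jl.
 case: eqP => // E; move: jl; rewrite -val_eqE/= E eqxx//.
- move=> j i; rewrite inE -ltnNge => h; rewrite gtn_eqF//.
- move=> j jJ; have [->|jJ'] := eqVneq j J.
  rewrite (leq_trans (max_card _))// (leq_trans NJ)// leq_exp2l//.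
 have {jJ'}jJ : (j < J)%N by rewrite ltn_neqAle jJ'.
 have P0 : 0 < (2 ^ j.+1)%:R :> R by rewrite ltr0n expn_gt0.
 rewrite -(ler_nat R) -sum1_card natr_sum.
 rewrite (@le_trans _ _ (\sum_i (2 ^ j.+1)%:R * u i))//; last first.
  by rewrite -mulr_sumr ler_piMr// ltW.
 rewrite big_mkcond/=; apply: ler_sum => i _; rewrite inE; case: ifPn => [lij|_]; last first.
  by rewrite mulr_ge0// ltW.
 have [_ _ h] := hlev i; have /ltW {}h := h (leq_ltn_trans lij jJ).
 rewrite -ler_pdivrMl// mulr1 (le_trans _ h)// natrX -exprVn.
 by apply: ler_wiXn2l => //; rewrite ?invr_ge0// invf_le1// ler1n.
- by move=> i j ij; apply/fintype.subsetP => k; rewrite !inE => /leq_trans; apply.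
move=> j; apply: l2_le; first by rewrite exprn_ge0// powR_ge0.
pose b : R := 2^-1 ^+ j.
have b0 : 0 <= b by rewrite exprn_ge0// invr_ge0.
have -> : ((2 `^ (eta - 2^-1)) ^+ j) ^+ 2 = b `^ (1 - 2 * eta).
 have -> : b = 2 `^ (- j%:R) by rewrite powRN powR_mulrn// -exprVn.
 rewrite -powRrM -exprM -powR_mulrn ?powR_ge0// -powRrM natrM.
 by congr (_ `^ _); field.
have c0 : 0 <= 1 - 2 * eta by move: e1; clear; lra.
rewrite (@le_trans _ _ (\sum_i b `^ (1 - 2 * eta) * u i))//; last first.
 by rewrite -mulr_sumr ler_piMr// powR_ge0.
apply: ler_sum => i _; case: eqP => [lij|_]; last first.
 by rewrite expr0n/= mulr_ge0// powR_ge0.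
have [_ + _] := hlev i; rewrite lij -/b => ub.
have -> : x i ^+ 2 = u i `^ (1 - 2 * eta) * u i.
 rewrite -real_normK ?num_real// -powR_mulrn// /u -powRrM.
 have ne : (1 - eta)^-1 != 0 by rewrite invr_eq0 gt_eqF.
 have [->|x0] := eqVneq `|x i| 0; first by rewrite [X in _ * X]powR0// mulr0 powR0// pnatr_eq0.
 rewrite -powRD ?x0 ?implybT//; congr (_ `^ _); field.
 by rewrite gt_eqF.
apply: ler_wpM2r => //.
by apply: (ge0_ler_powR c0); rewrite ?nnegrE.
Qed.

Lemma sum_powers (b : R) (m : nat) : 1 < b -> \sum_(j < m) b ^+ j <= (b - 1)^-1 * b ^+ m.
Proof.
move=> b1; rewrite ler_pdivlMl ?subr_gt0// -subrX1.
by rewrite lerBlDr lerDl.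
Qed.

Lemma pow2_gt1 (c : R) : 0 < c -> 1 < 2 `^ c.
Proof.
move=> c0; rewrite -[ltLHS](powRr0 2) -!/(powR _ _) /powR pnatr_eq0/= ltr_expR mul0r.
by rewrite mulr_gt0// ln_gt0// ltr1n.
Qed.

(** The summands are bounded by a geometric progression of ratio 2^(eta/2), so the last one
    dominates; as 2^J is at most 2N, it is of the order n^(-1/2) N^eta. *)
Lemma level_sum (eta : R) : 0 < eta < 2^-1 -> exists2 C : R, 0 < C &
 forall (N n J : nat), (0 < N)%N -> (0 < n)%N -> (2 ^ J <= N.*2)%N ->
 \sum_(j < J.+1) (2 `^ (eta - 2^-1)) ^+ j *
   Num.sqrt (sparse_exp eta N (minn N (2 ^ j.+2)) / n%:R) <=
 C * (n%:R `^ (- 2^-1) * N%:R `^ eta).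
Proof.
move=> /andP[e0 e1].
pose chi : R := 2 `^ (eta / 2).
have chi1 : 1 < chi.
 by apply: pow2_gt1; rewrite divr_gt0.
exists (2 * ((chi - 1)^-1 * chi * 2)).
 by rewrite !mulr_gt0// ?invr_gt0 ?subr_gt0// (lt_trans _ chi1).
move=> N n J N0 n0 JN.
have N0R : 0 < N%:R :> R by rewrite ltr0n.
have n0R : 0 < n%:R :> R by rewrite ltr0n.
have n00 := ltW n0R; have N00 := ltW N0R.
have e00 : 0 <= 1 - eta by move: e1; clear; lra.
pose e' : R := N%:R `^ (eta / 2) * n%:R `^ (- 2^-1).
have e'0 : 0 <= e' by rewrite mulr_ge0 ?powR_ge0.
rewrite (@le_trans _ _ (\sum_(j < J.+1) 2 * e' * chi ^+ j))//.
 apply: ler_sum => j _.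
 have step : Num.sqrt (sparse_exp eta N (minn N (2 ^ j.+2)) / n%:R) <=
   2 `^ ((1 - eta) / 2) ^+ j.+2 * e'.
  rewrite -(ger0_norm (mulr_ge0 (exprn_ge0 _ (powR_ge0 _ _)) e'0)) -sqrtr_sqr ler_wsqrtr//.
  rewrite exprMn -exprM mulnC exprM -[_ ^+ 2]powR_mulrn ?powR_ge0// -powRrM divfK//.
  have -> : e' ^+ 2 = N%:R `^ eta / n%:R.
   rewrite /e' exprMn -!powR_mulrn ?powR_ge0// -!powRrM divfK// mulNr mulVf//.
   by rewrite powR_inv1.
  rewrite mulrA ler_pM2r ?invr_gt0// /sparse_exp.
  apply: ler_wpM2r; first exact: powR_ge0.
  rewrite -powR_mulrn ?powR_ge0// -powRrM mulrC powRrM powR_mulrn//.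
  apply: (ge0_ler_powR e00); rewrite ?nnegrE ?exprn_ge0//.
  by rewrite -natrX ler_nat geq_minr.
 have r0 : 0 <= (2 `^ (eta - 2^-1) : R) ^+ j by rewrite exprn_ge0// powR_ge0.
 rewrite (le_trans (ler_wpM2l r0 step))// mulrA [leRHS]mulrAC.
 apply: ler_wpM2r => //.
 have -> : (2 `^ (eta - 2^-1)) ^+ j * (2 `^ ((1 - eta) / 2)) ^+ j.+2 =
   chi ^+ j * (2 `^ ((1 - eta) / 2) : R) ^+ 2.
  rewrite -(addn2 j) exprD mulrA -exprMn -powRD ?pnatr_eq0 ?implybT//.
  by congr ((_ `^ _) ^+ _ * _); field.
 rewrite mulrC; apply: ler_wpM2r; first by rewrite exprn_ge0// powR_ge0.
 rewrite -powR_mulrn ?powR_ge0// -powRrM divfK//.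
 by rewrite (le_trans (ler_powR _ (_ : _ <= 1))) ?ler1n// ?powRr1// gerBl ltW.
rewrite -mulr_sumr.
have e20 : 0 <= 2 * e' by rewrite mulr_ge0.
rewrite (le_trans (ler_wpM2l e20 (sum_powers _ chi1)))//.
have cJ : chi ^+ J <= 2 * N%:R `^ (eta / 2).
 have -> : chi ^+ J = (2 ^+ J) `^ (eta / 2).
  by rewrite /chi -!powR_mulrn ?powR_ge0// -!powRrM mulrC.
 have e02 : 0 <= eta / 2 by rewrite divr_ge0// ltW.
 rewrite (@le_trans _ _ ((2 * N%:R) `^ (eta / 2)))//.
  apply: (ge0_ler_powR e02); rewrite ?nnegrE ?exprn_ge0 ?mulr_ge0//.
  by rewrite -natrX -natrM ler_nat mul2n.
 rewrite powRM//; apply: ler_wpM2r; first exact: powR_ge0.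
 by rewrite (le_trans (ler_powR _ (_ : _ <= 1))) ?ler1n// ?powRr1//; move: e1; clear; lra.
rewrite exprSr [_ * (chi ^+ J * chi)]mulrC.
have chi0 : 0 <= chi by exact: powR_ge0.
have P0 : 0 <= 2 * e' * (chi * (chi - 1)^-1).
 by rewrite mulr_ge0// mulr_ge0// invr_ge0 subr_ge0 ltW.
have -> : 2 * e' * (chi ^+ J * chi / (chi - 1)) = 2 * e' * (chi / (chi - 1)) * chi ^+ J.
 by rewrite [chi ^+ J * _]mulrC -!mulrA [(chi - 1)^-1 * _]mulrC.
rewrite (le_trans (ler_wpM2l P0 cJ))//.
have -> : N%:R `^ eta = N%:R `^ (eta / 2) * N%:R `^ (eta / 2).
 by rewrite -powRD ?(gt_eqF N0R) ?implybT//; congr (_ `^ _); field.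
rewrite /e' le_eqVlt; apply/orP; left; apply/eqP.
by move: (_ `^ (eta / 2)) (_ `^ (- 2^-1)) ((chi - 1)^-1) => u v z; ring.
Qed.

(** On level j the form is n times the Euclidean one up to a relative error of order s_j + s_j^2.
    For a vector annihilated by the rows, the levels with s_j <= c0 make up a head on which the form
    is coercive, and the tail is small in l_2 because the sum of rho^j s_j is. The bilinear bound is
    a double sum over pairs of levels. *)
Lemma sign_forms (eta : R) : 0 < eta < 2^-1 -> exists2 C : R, 0 < C &
 forall (I : finType) (n : nat), (0 < #|I|)%N -> (0 < n)%N ->
 exists w : {ffun 'I_n -> {ffun I -> bool}},
  let e := n%:R `^ (- 2^-1) * #|I|%:R `^ eta in
  (forall x, \sum_i `|x i| `^ (1 - eta)^-1 <= 1 -> (forall k, rdot (w k) x = 0) ->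
    sq_norm x <= C * e ^+ 2) /\
  (forall x y, \sum_i `|x i| `^ (1 - eta)^-1 <= 1 -> \sum_i `|y i| `^ (1 - eta)^-1 <= 1 ->
    `|dot x y - n%:R^-1 * bform w x y| <= C * (e + e ^+ 2)).
Proof.
move=> eta01; have [C1 C10 hC1] := level_sum eta01.
case/andP: (eta01) => e0 e1.
have eta1 : 0 < eta < 1 by rewrite e0/=; move: e1; clear; lra.
have [D D0 hD] := good_signs eta1.
pose E := 3 * D; have E0 : 0 < E by rewrite mulr_gt0.
pose rho : R := 2 `^ (eta - 2^-1).
have rho0 : 0 <= rho by exact: powR_ge0.
have rho1 : 0 <= rho < 1.
 rewrite rho0/= /rho -opprB powRN invf_lt1 ?powR_gt0//.
 by apply: pow2_gt1; rewrite subr_gt0.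
(* Small enough for the relative defect E (s + s^2) to stay below 1/2 whenever s <= c0. *)
pose c0 : R := (4 * (E + 1))^-1.
have c00 : 0 < c0 by rewrite invr_gt0 mulr_gt0// addr_gt0.
have cE : E * (c0 + c0 ^+ 2) <= 2^-1.
 have h : c0 * (E + 1) = 4^-1 by rewrite /c0; field; rewrite gt_eqF// addr_gt0.
 have c4 : c0 <= 4^-1.
  by rewrite -h ler_pMr// lerDr ltW.
 have : E * c0 <= 4^-1 by rewrite -h mulrC ler_pM2l// lerDl.
 rewrite mulrDr expr2 mulrA; set u := E * c0 => u1.
 have : u * c0 <= 4^-1 * c0 by rewrite ler_pM2r.
 by move: u1 c4; clear; lra.
pose K1 := (1 + E) * (c0^-1 + 1).
pose C2 := 3 * (1 + E) ^+ 2.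
pose C := 2 * (2 * (K1 * C1) ^+ 2 + (C1 / c0) ^+ 2) + C2 * (2 * ((1 - rho)^-1 * C1) + C1 ^+ 2).
have K10 : 0 < K1 by rewrite mulr_gt0// addr_gt0// invr_gt0.
have C20 : 0 < C2 by rewrite mulr_gt0// exprn_gt0// addr_gt0.
have ri : 0 < (1 - rho)^-1 by rewrite invr_gt0 subr_gt0; case/andP: rho1.
have Ca : 0 < 2 * (2 * (K1 * C1) ^+ 2 + (C1 / c0) ^+ 2).
 have c1 : 0 < C1 / c0 by rewrite divr_gt0.
 have c2 : 0 < K1 * C1 by rewrite mulr_gt0.
 by apply: mulr_gt0 => //; apply: addr_gt0; [apply: mulr_gt0|]; rewrite ?exprn_gt0.
have Cb : 0 < C2 * (2 * ((1 - rho)^-1 * C1) + C1 ^+ 2).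
 by apply: mulr_gt0 => //; apply: addr_gt0; rewrite ?exprn_gt0// !mulr_gt0.
exists C; first by rewrite addr_gt0.
move=> I n N0 n0; set N := #|I|.
have n0R : 0 < n%:R :> R by rewrite ltr0n.
have [w hw] := hD I n N0 n0; exists w => e.
pose J := up_log 2 N.
have NJ : (N <= 2 ^ J)%N by exact: up_logP.
have JN : (2 ^ J <= N.*2)%N.
 have [N1|N1] := leqP N 1.
  have -> : J = 0%N by apply/eqP; rewrite /J up_log_eq0.
  by rewrite expn0 double_gt0.
 have /andP[+ _] := up_log_bounds (ltnSn 1) N1; rewrite -/J.
 case: J NJ => [|j] NJ /=; first by rewrite expn0 => _; rewrite double_gt0.
 by move=> h; rewrite expnS mul2n leq_double ltnW.
pose k (j : nat) := minn N (2 ^ j.+2).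
have k0 j : (0 < k j <= N)%N by rewrite /k leq_min N0 expn_gt0/= geq_minl.
pose G j : R := sparse_exp eta N (k j) / n%:R.
have G0 j : 0 <= G j by rewrite divr_ge0// mulr_ge0 ?powR_ge0.
pose s j := Num.sqrt (G j).
have s0 j : 0 <= s j by exact: sqrtr_ge0.
have s2 j : s j ^+ 2 = G j by rewrite sqr_sqrtr.
have smono i j : (i <= j)%N -> s i <= s j.
 move=> ij; rewrite ler_wsqrtr// ler_pM2r ?invr_gt0//.
 apply: ler_wpM2r; first exact: powR_ge0.
 have h : 0 <= 1 - eta by rewrite subr_ge0; case/andP: eta1 => _ /ltW.
 apply: (ge0_ler_powR h); rewrite ?nnegrE// ler_nat /k leq_min geq_minl/=.
 by rewrite (leq_trans (geq_minr _ _))// leq_exp2l.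
have e00 : 0 <= e by rewrite mulr_ge0 ?powR_ge0.
have sumS : \sum_(j < J.+1) rho ^+ j * s j <= C1 * e by exact: hC1.
have def j (S : {set I}) x : (#|S| <= k j)%N -> supp_in S x ->
  `|defect w x| <= n%:R * (E * (s j + s j ^+ 2)) * sq_norm x.
 move=> Sk xS; have /andP[kj0 kjN] := k0 j.
 have t0 : 0 <= D * (Num.sqrt (n%:R * sparse_exp eta N (k j)) + sparse_exp eta N (k j)).
  by rewrite mulr_ge0 ?(ltW D0)// addr_ge0 ?sqrtr_ge0// mulr_ge0 ?powR_ge0.
 have := sparse_defect kj0 t0 (fun z zk => hw (k j) z (k0 j) zk) Sk xS.
 move=> /le_trans; apply; apply: ler_wpM2r; first exact: sq_norm_ge0.
 have gE : sparse_exp eta N (k j) = n%:R * s j ^+ 2.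
  by rewrite s2 /G mulrC divfK// gt_eqF.
 have -> : Num.sqrt (n%:R * sparse_exp eta N (k j)) = n%:R * s j.
  by rewrite gE [_ * (_ * _)]mulrA -expr2 -exprMn sqrtr_sqr ger0_norm// mulr_ge0// ltW.
 rewrite gE /E le_eqVlt; apply/orP; left; apply/eqP; ring.
clearbody E.
have rowbound j (S : {set I}) x : (#|S| <= k j)%N -> supp_in S x ->
  l2 (fun l => rdot (w l) x) <= Num.sqrt n%:R * (1 + E) * (1 + s j) * l2 x.
 move=> Sk xS; apply: l2_le.
  apply: mulr_ge0 (l2_ge0 x); apply: mulr_ge0; last by rewrite addr_ge0.
  by apply: mulr_ge0; [exact: sqrtr_ge0|rewrite addr_ge0// ltW].
 have -> : sq_norm (fun l => rdot (w l) x) = defect w x + n%:R * sq_norm x.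
  by rewrite /defect subrK.
 rewrite !exprMn sqr_sqrtr ?(ltW n0R)// l2_sq.
 have := def j S x Sk xS; rewrite ler_norml => /andP[_ h].
 apply: (le_trans (lerD h (lexx _))).
 have f : E * (s j + s j ^+ 2) + 1 <= (1 + E) ^+ 2 * (1 + s j) ^+ 2.
  have u1 : 0 <= E * s j by rewrite mulr_ge0// ltW.
  have u2 : 0 <= E * s j ^+ 2 by rewrite mulr_ge0 ?sqr_ge0// ltW.
  have u3 := sqr_ge0 (E * (1 + s j)); have u4 := s0 j; have u5 := sqr_ge0 (s j).
  rewrite -exprMn (_ : (1 + E) * (1 + s j) = (1 + s j) + E * (1 + s j)); last by ring.
  rewrite sqrrD; move: u1 u2 u3 u4 u5 (ltW E0); move: (s j) (E); clear => a b.
  move=> *; lra.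
 have -> : n%:R * (E * (s j + s j ^+ 2)) * sq_norm x + n%:R * sq_norm x =
   n%:R * ((E * (s j + s j ^+ 2) + 1) * sq_norm x) by ring.
 have -> : n%:R * (1 + E) ^+ 2 * (1 + s j) ^+ 2 * sq_norm x =
   n%:R * ((1 + E) ^+ 2 * (1 + s j) ^+ 2 * sq_norm x) by rewrite !mulrA.
 apply: ler_wpM2l; first exact: ltW.
 by apply: ler_wpM2r; first exact: sq_norm_ge0.
have rdot_sum e' (xs : nat -> I -> R) (P : pred 'I_J.+1) :
  rdot e' (fun i => \sum_(j < J.+1 | P j) xs j i) = \sum_(j < J.+1 | P j) rdot e' (xs j).
 rewrite /rdot exchange_big/=; apply: eq_bigr => i _; by rewrite mulr_sumr.
have rp j : 0 < rho ^+ j by rewrite exprn_gt0// powR_gt0.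
split.
 move=> x x1 kx; have [xs [S [xE xS cS mS lS]]] := level_blocks eta01 NJ x1.
 pose P (j : 'I_J.+1) := s j <= c0.
 pose h i := \sum_(j < J.+1 | P j) xs j i; pose t i := \sum_(j < J.+1 | ~~ P j) xs j i.
 have xht i : x i = h i + t i by rewrite xE (bigID P).
 have tailS : \sum_(j < J.+1 | ~~ P j) rho ^+ j * s j <= C1 * e.
  apply: le_trans sumS; rewrite [leRHS](bigID P)/= lerDr.
  by apply: sumr_ge0 => j _; rewrite mulr_ge0// ltW.
 have Sk j : (j <= J)%N -> (#|S j| <= k j)%N.
  move=> jJ; rewrite /k leq_min max_card/= (leq_trans (cS j jJ))// leq_exp2l//.
 have lt : l2 t <= (C1 / c0) * e.
  apply: le_trans (l2_sum _ _ _) _; rewrite mulrAC ler_pdivlMr//.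
  apply: le_trans tailS; rewrite mulr_suml; apply: ler_sum => j; rewrite /P -ltNge => cj.
  apply: ler_pM; rewrite ?l2_ge0// ltW//.
 have lGt : l2 (fun l => rdot (w l) t) <= Num.sqrt n%:R * (K1 * C1 * e).
  have -> : (fun l => rdot (w l) t) = fun l => \sum_(j < J.+1 | ~~ P j) rdot (w l) (xs j).
   by apply/funext => l; exact: rdot_sum.
  apply: le_trans (l2_sum _ _ (fun (j : 'I_J.+1) (l : 'I_n) => rdot (w l) (xs j))) _.
  rewrite -[K1 * C1 * e]mulrA.
  have q0 : 0 <= Num.sqrt n%:R * K1 by rewrite mulr_ge0 ?sqrtr_ge0// ltW.
  rewrite [leRHS]mulrA; apply: le_trans (ler_wpM2l q0 tailS).
  rewrite mulr_sumr; apply: ler_sum => j; rewrite /P -ltNge => cj.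
  have jJ : (j <= J)%N by rewrite -ltnS.
  apply: (le_trans (rowbound j (S j) (xs j) (Sk j jJ) (xS j))).
  rewrite /K1 -!mulrA; apply: ler_wpM2l; first exact: sqrtr_ge0.
  apply: ler_wpM2l; first by rewrite addr_ge0// ltW.
  rewrite [rho ^+ j * _]mulrC mulrA; apply: ler_pM; rewrite ?l2_ge0 ?addr_ge0//.
  rewrite mulrDl mul1r; apply: lerD => //.
  by rewrite ler_pdivlMl// mulr1 ltW.
 have lh : sq_norm h <= 2 * (K1 * C1 * e) ^+ 2.
  have [/existsP[j0 Pj0]|/existsPn nP] := boolP [exists j, P j]; last first.
   rewrite /sq_norm big1; first by rewrite mulr_ge0// sqr_ge0.
   by move=> i _; rewrite /h big_pred0 ?expr0n// => j; rewrite (negbTE (nP j)).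
  (* The largest level of the head: as the sets S j are nested, S j1 carries all of h. *)
  pose j1 := [arg max_(j > j0 | P j) (j : nat)].
  have [Pj1 mj1] : P j1 /\ forall j, P j -> (j <= j1)%N.
   by rewrite /j1; case: arg_maxnP => // j Pj mj; split.
  have hS : supp_in (S j1) h.
   move=> i iS; rewrite /h big1// => j Pj; apply: xS.
   apply: contra iS; apply: fintype.subsetP; apply: mS; exact: mj1.
  have := def j1 (S j1) h (Sk j1 (ltn_ord j1)) hS.
  have : E * (s j1 + s j1 ^+ 2) <= 2^-1.
   apply: le_trans cE; apply: ler_wpM2l; first exact: ltW.
   by apply: lerD => //; rewrite lerXn2r ?nnegrE// ltW.
  set z := E * _ => z1; clearbody z.
  rewrite ler_norml => /andP[+ _]; rewrite /defect => d1.
  have qh : qform w h <= n%:R * (K1 * C1 * e) ^+ 2.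
   (* The rows annihilate h + t, so their products with head and tail are opposite. *)
   have -> : qform w h = sq_norm (fun l => rdot (w l) t).
    rewrite /qform /sq_norm; apply: eq_bigr => l _.
    have : rdot (w l) h + rdot (w l) t = 0.
     rewrite -(kx l) /rdot -big_split/=; apply: eq_bigr => i _.
     by rewrite xht mulrDr.
    by move/eqP; rewrite addr_eq0 => /eqP ->; rewrite sqrrN.
   rewrite -l2_sq (le_trans (lerXn2r 2 _ _ lGt)) ?nnegrE ?l2_ge0//.
    by apply: mulr_ge0 (sqrtr_ge0 _) _; apply: mulr_ge0 => //; apply/ltW/mulr_gt0.
   by rewrite exprMn sqr_sqrtr ?(ltW n0R).
  have z2 : n%:R * z * sq_norm h <= n%:R * (2^-1 * sq_norm h).
   rewrite -mulrA; apply: ler_wpM2l; first exact: ltW.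
   by apply: ler_wpM2r; [exact: sq_norm_ge0|].
  rewrite -(ler_pM2l n0R); move: d1 z2 qh; set Q := qform w h; set A := (_ * e) ^+ 2.
  set U := sq_norm h; rewrite [n%:R * (2^-1 * U)]mulrCA [n%:R * (2 * A)]mulrCA.
  move: (n%:R * z * U) (n%:R * A) (n%:R * U) => *; lra.
 have lt2 : sq_norm t <= ((C1 / c0) * e) ^+ 2.
  by rewrite -l2_sq lerXn2r ?nnegrE ?l2_ge0// mulr_ge0// divr_ge0// ltW.
 have : sq_norm x <= 2 * (sq_norm h + sq_norm t).
  rewrite /sq_norm -big_split/= mulr_sumr; apply: ler_sum => i _; rewrite xht.
  by have := sqr_ge0 (h i - t i); move: (h i) (t i); clear => a b; nra.
 have Cbe : 0 <= C2 * (2 * ((1 - rho)^-1 * C1) + C1 ^+ 2) * e ^+ 2.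
  by rewrite mulr_ge0 ?sqr_ge0// ltW.
 rewrite /C [(_ + C2 * _) * e ^+ 2]mulrDl.
 have -> : 2 * (2 * (K1 * C1) ^+ 2 + (C1 / c0) ^+ 2) * e ^+ 2 =
   2 * (2 * (K1 * C1 * e) ^+ 2 + (C1 / c0 * e) ^+ 2) by rewrite !exprMn; ring.
 move: lh lt2 Cbe; set a1 := _ ^+ 2; set a2 := _ ^+ 2; set a3 := C2 * _ * _.
 by move: (sq_norm x) (sq_norm h) (sq_norm t) a1 a2 a3; clear => *; lra.
move=> x y x1 y1.
have [xs [S [xE xS cS mS lS]]] := level_blocks eta01 NJ x1.
have [ys [T [yE yT cT mT lT]]] := level_blocks eta01 NJ y1.
pose dB (u v : I -> R) := dot u v - n%:R^-1 * bform w u v.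
have dBC u v : dB u v = dB v u.
 rewrite /dB /dot /bform; congr (_ - _ * _); apply: eq_bigr => i _; exact: mulrC.
have pair i j (S1 S2 : {set I}) u v : (i <= j)%N -> (j <= J)%N ->
  (#|S1| <= 2 ^ i.+1)%N -> (#|S2| <= 2 ^ j.+1)%N -> supp_in S1 u -> supp_in S2 v ->
  l2 u <= rho ^+ i -> l2 v <= rho ^+ j ->
  `|dB u v| <= C2 * (s i + s j + s i * s j) * (rho ^+ i * rho ^+ j).
 move=> ij jJ c1 c2 uS vS lu lv.
 set a := rho ^+ i in lu *; set b := rho ^+ j in lv *.
 have a0 : 0 < a by exact: rp.
 have b0 : 0 < b by exact: rp.
 (* For s_j <= 1 the defect s_j + s_j^2 is of order s_j, and polarization applies on the union of
    the two supports. For s_j > 1 the square would be too large; the scalar product and the form are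
    then estimated separately, and s_j absorbs the constant terms. *)
 have [sj1|sj1] := leP (s j) 1.
  have Uk : (#|S1 :|: S2| <= k j)%N.
   rewrite /k leq_min max_card/= (leq_trans (leq_card_setU _ _))//.
   rewrite expnS mul2n -addnn leq_add// (leq_trans c1)// leq_exp2l//.
  (* This parameter brings both squared norms below a b. *)
  pose tt := Num.sqrt (b / a).
  have tt0 : 0 < tt by rewrite sqrtr_gt0 divr_gt0.
  have tt2 : tt ^+ 2 = b / a by rewrite sqr_sqrtr// divr_ge0// ltW.
  have uU : supp_in (S1 :|: S2) u by move=> l; rewrite inE negb_or => /andP[/uS].
  have vU : supp_in (S1 :|: S2) v by move=> l; rewrite inE negb_or => /andP[_ /vS].
  have := defect_polar w u v (lt0r_neq0 tt0).
  have := def j _ _ Uk (supp_inD tt tt^-1 uU vU).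
  have := def j _ _ Uk (supp_inD tt (- tt^-1) uU vU).
  have := sq_normD u v tt tt^-1.
  set X := sq_norm _; set Y := sq_norm (fun=> _ + _).
  set z := E * _; set dX := defect w _; set dY := defect w (fun=> _ + _).
  move=> XY hY hX pol.
  have XY2 : X + Y <= 4 * (a * b).
   rewrite XY exprVn tt2 invf_div -!l2_sq.
   have h1 : b / a * l2 u ^+ 2 <= a * b.
    have -> : a * b = b / a * a ^+ 2 by field; rewrite gt_eqF.
    apply: ler_wpM2l; first by rewrite divr_ge0// ltW.
    by rewrite lerXn2r ?nnegrE ?l2_ge0// ltW.
   have h2 : a / b * l2 v ^+ 2 <= a * b.
    have -> : a * b = a / b * b ^+ 2 by field; rewrite gt_eqF.
    apply: ler_wpM2l; first by rewrite divr_ge0// ltW.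
    by rewrite lerXn2r ?nnegrE ?l2_ge0// ltW.
   by move: h1 h2; clear; lra.
  have -> : dB u v = n%:R^-1 * 4^-1 * (dX - dY).
   by rewrite -[dX - dY]opprB pol /dB; field; rewrite gt_eqF.
  rewrite normrM ger0_norm; last by rewrite mulr_ge0// invr_ge0// ltW.
  rewrite -[leLHS]mulrA ler_pdivrMl// ler_pdivrMl//.
  have d1 : `|dX - dY| <= n%:R * z * (4 * (a * b)).
   apply: (le_trans (ler_normB _ _)); apply: (le_trans (lerD hY hX)).
   rewrite -mulrDr addrC; apply: ler_wpM2l => //.
   by apply: mulr_ge0; [exact: ltW|apply: mulr_ge0; [exact: ltW|rewrite addr_ge0// sqr_ge0]].
  apply: (le_trans d1).
  have -> : n%:R * z * (4 * (a * b)) = 4 * (n%:R * (z * (a * b))) by ring.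
  do 2 (apply: ler_wpM2l; first by rewrite ?ltW).
  apply: ler_wpM2r; first by rewrite mulr_ge0// ltW.
  rewrite /z /C2; move: (s0 i) (s0 j) sj1 E0; move: (s i) (s j) (E); clear => p q c p0 q0 q1 c0.
  have qq : q ^+ 2 <= q by rewrite expr2 ler_piMr.
  have := mulr_ge0 p0 q0.
  have : c * q ^+ 2 <= c * q by rewrite ler_pM2l.
  have : 0 <= (1 + c) ^+ 2 * (p + p * q) by rewrite mulr_ge0 ?sqr_ge0// addr_ge0// mulr_ge0.
  have : 0 <= c ^+ 2 * q by rewrite mulr_ge0 ?sqr_ge0.
  have : 0 <= c * q by rewrite mulr_ge0// ltW.
  by move=> *; lra.
 have ki : (#|S1| <= k i)%N by rewrite /k leq_min max_card/= (leq_trans c1)// leq_exp2l.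
 have kj : (#|S2| <= k j)%N by rewrite /k leq_min max_card/= (leq_trans c2)// leq_exp2l.
 have h1 := rowbound i S1 u ki uS; have h2 := rowbound j S2 v kj vS.
 have hB : `|bform w u v| <= n%:R * ((1 + E) ^+ 2 * ((1 + s i) * (1 + s j))) * (a * b).
  apply: (le_trans (dot_le (fun l => rdot (w l) u) (fun l => rdot (w l) v))).
  apply: (le_trans (ler_pM (l2_ge0 _) (l2_ge0 _) h1 h2)).
  have -> : forall (z c p q g f : R), z * c * p * g * (z * c * q * f) = z ^+ 2 * (c ^+ 2 * (p * q)) * (g * f).
   by move=> *; ring.
  rewrite sqr_sqrtr ?(ltW n0R)//; apply: ler_wpM2l.
   by apply: mulr_ge0; [exact: ltW|apply: mulr_ge0; [exact: sqr_ge0|apply: mulr_ge0; exact: addr_ge0]].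
  by apply: ler_pM; rewrite ?l2_ge0.
 have hd : `|dot u v| <= a * b.
  by apply: (le_trans (dot_le u v)); apply: ler_pM; rewrite ?l2_ge0.
 apply: (le_trans (ler_normB _ _)); rewrite normrM ger0_norm ?invr_ge0 ?(ltW n0R)//.
 have hB' : n%:R^-1 * `|bform w u v| <= (1 + E) ^+ 2 * ((1 + s i) * (1 + s j)) * (a * b).
  by rewrite ler_pdivrMl// [leRHS]mulrA.
 apply: (le_trans (lerD hd hB')); rewrite -[X in X + _]mul1r -mulrDl.
 apply: ler_wpM2r; first by rewrite mulr_ge0// ltW.
 have : 1 <= (1 + E) ^+ 2 by rewrite exprn_ege1// lerDl ltW.
 rewrite /C2; move: (s0 i) (s0 j) (ltW sj1); move: (s i) (s j) (_ ^+ 2); clear => p q c p0 q0 q1 c1.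
 have := mulr_ge0 p0 q0; set pq := p * q => pq0.
 have -> : (1 + p) * (1 + q) = 1 + p + q + pq by rewrite /pq; ring.
 have : c * (1 + 1 + p + q + pq) <= c * (3 * (p + q + pq)).
  by rewrite ler_wpM2l ?(le_trans _ c1)//; lra.
 lra.
have pairs i j : (i <= J)%N -> (j <= J)%N -> `|dB (xs i) (ys j)| <=
  C2 * (s i + s j + s i * s j) * (rho ^+ i * rho ^+ j).
 move=> iJ jJ; have [ij|/ltnW ji] := leqP i j.
  by apply: (pair i j (S i) (T j)) => //; [exact: cS|exact: cT].
 rewrite dBC [s i + _]addrC [s i * _]mulrC [rho ^+ i * _]mulrC.
 by apply: (pair j i (T j) (S i)) => //; [exact: cT|exact: cS].
have dBE : dB x y = \sum_(i < J.+1) \sum_(j < J.+1) dB (xs i) (ys j).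
 have -> : x = fun l => \sum_(i < J.+1) xs i l by apply/funext.
 have -> : y = fun l => \sum_(i < J.+1) ys i l by apply/funext.
 rewrite /dB; under [RHS]eq_bigr do rewrite sumrB -mulr_sumr.
 rewrite sumrB -mulr_sumr; congr (_ - _ * _).
  rewrite /dot; under [RHS]eq_bigr do rewrite exchange_big/=.
  rewrite exchange_big/=; apply: eq_bigr => l _; rewrite mulr_suml.
  by apply: eq_bigr => i _; rewrite mulr_sumr.
 rewrite /bform; under [RHS]eq_bigr do rewrite exchange_big/=.
 rewrite exchange_big/=; apply: eq_bigr => l _.
 rewrite !(rdot_sum _ _ xpredT) mulr_suml.
 by apply: eq_bigr => i _; rewrite mulr_sumr.
rewrite -/(dB x y) dBE.
apply: (le_trans (ler_norm_sum _ _ _)).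
apply: (@le_trans _ _ (\sum_(i < J.+1) \sum_(j < J.+1) C2 * (s i + s j + s i * s j) * (rho ^+ i * rho ^+ j))).
 apply: ler_sum => i _; apply: (le_trans (ler_norm_sum _ _ _)).
 by apply: ler_sum => j _; apply: pairs; rewrite -ltnS.
set Sg := \sum_(j < J.+1) rho ^+ j * s j in sumS.
set Sr := \sum_(j < J.+1) rho ^+ j.
have -> : \sum_(i < J.+1) \sum_(j < J.+1) C2 * (s i + s j + s i * s j) * (rho ^+ i * rho ^+ j) =
  C2 * (2 * (Sr * Sg) + Sg ^+ 2).
 transitivity (\sum_(i < J.+1) C2 * ((rho ^+ i * s i) * Sr + rho ^+ i * Sg + (rho ^+ i * s i) * Sg)).
  apply: eq_bigr => i _; rewrite /Sr /Sg !mulr_sumr -!big_split/= mulr_sumr.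
  by apply: eq_bigr => j _; ring.
 by rewrite -mulr_sumr !big_split/= -!mulr_suml -/Sr -/Sg; congr (_ * _); ring.
have Sg0 : 0 <= Sg by apply: sumr_ge0 => j _; rewrite mulr_ge0// ltW.
have Sr0 : 0 <= Sr by apply: sumr_ge0 => j _; rewrite ltW.
have Sr1 : Sr <= (1 - rho)^-1 by exact: sum_geom.
have h1 : Sr * Sg <= (1 - rho)^-1 * (C1 * e) by apply: ler_pM.
have h2 : Sg ^+ 2 <= (C1 * e) ^+ 2.
 by rewrite lerXn2r ?nnegrE// mulr_ge0// ltW.
have h3 : C2 * (2 * (Sr * Sg) + Sg ^+ 2) <= C2 * (2 * ((1 - rho)^-1 * (C1 * e)) + (C1 * e) ^+ 2).
 by apply: ler_wpM2l; [exact: ltW|apply: lerD => //; apply: ler_wpM2l].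
apply: (le_trans h3).
rewrite /C [(_ + C2 * _) * _]mulrDl.
have ee0 : 0 <= e + e ^+ 2 by rewrite addr_ge0// sqr_ge0.
apply: ler_wpDl; first by apply: mulr_ge0 => //; exact: ltW.
rewrite -mulrA; apply: ler_wpM2l; first exact: ltW.
have -> : forall (a b f : R), (2 * (a * b) + b ^+ 2) * (f + f ^+ 2) =
  2 * (a * (b * f)) + (b * f) ^+ 2 + (2 * (a * b) * f ^+ 2 + b ^+ 2 * f).
 by move=> *; ring.
rewrite lerDl addr_ge0// mulr_ge0 ?sqr_ge0// mulr_ge0// mulr_ge0// ltW//.
Qed.

End SparseForms.

(** * The Hahn-Banach theorem in finite dimension *)

Section HahnBanach.
Variables (R : realType) (V : lmodType R).

Definition sublinear (N : V -> R) :=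
 (forall x y, N (x + y) <= N x + N y) /\ (forall c x, 0 <= c -> N (c *: x) = c * N x).

(** A pair (s, c) encodes the constraint f(s) >= c on a linear functional f below N. The constraints
    form a convex cone, and each is compatible with N. *)
Definition cone_below (S : set (V * R)) (N : V -> R) :=
 [/\ S (0, 0), forall s c s' c', S (s, c) -> S (s', c') -> S (s + s', c + c'),
   forall t s c, 0 <= t -> S (s, c) -> S (t *: s, t * c) & forall s c, S (s, c) -> c <= N s].

(** The largest sublinear functional below N whose value at -s is at most -c for every pair (s, c)
    of S. *)
Definition infconv (N : V -> R) (S : set (V * R)) (y : V) : R :=
 inf [set N (y + s.1) - s.2 | s in S].

Lemma sublinear0 N : sublinear N -> N 0 = 0.
Proof. by case=> _ NZ; rewrite -(scale0r 0) NZ// mul0r. Qed.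

Lemma sublinear_opp N x : sublinear N -> - N (- x) <= N x.
Proof.
move=> sN; rewrite lerNl -subr_ge0 opprK -(sublinear0 sN) -(addNr x).
exact: (proj1 sN).
Qed.

Section InfConv.
Variables (N : V -> R) (S : set (V * R)).
Hypotheses (sN : sublinear N) (cS : cone_below S N).

Lemma infconv_lb y : has_lbound [set N (y + s.1) - s.2 | s in S].
Proof.
exists (- N (- y)) => _ [[s c] Ss <-] /=.
have [_ _ _ /(_ _ _ Ss) h] := cS.
have := proj1 sN (y + s) (- y); rewrite addrAC subrr add0r; move: h; clear; lra.
Qed.

Lemma infconv_le y s c : S (s, c) -> infconv N S y <= N (y + s) - c.
Proof. by move=> Ss; apply: (ge_inf (infconv_lb y)); exists (s, c). Qed.

Lemma infconv_ge y b : (forall s c, S (s, c) -> b <= N (y + s) - c) -> b <= infconv N S y.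
Proof.
move=> h; apply: lb_le_inf; first by exists (N (y + 0) - 0), (0, 0) => //; case: cS.
by move=> _ [[s c] Ss <-]; exact: h.
Qed.

Lemma infconv_sublinear : sublinear (infconv N S).
Proof.
have [S0 SD SZ SN] := cS.
have scale c x : 0 < c -> c * infconv N S x <= infconv N S (c *: x).
 move=> c0; apply: infconv_ge => s d Ss; rewrite -ler_pdivlMl//.
 have Ss' := SZ c^-1 _ _ (ltW (etrans (invr_gt0 c) c0)) Ss.
 apply: le_trans (infconv_le x Ss') _.
 have -> : N (x + c^-1 *: s) = c^-1 * N (c *: x + s).
  by rewrite -(proj2 sN) ?invr_ge0 ?(ltW c0)// scalerDr scalerA mulVf ?gt_eqF// scale1r.
 by rewrite mulrBr.
split=> [x y|c x].
 rewrite -lerBlDr; apply: infconv_ge => s c Ss.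
 rewrite lerBlDr -lerBlDl; apply: infconv_ge => s' c' Ss'.
 rewrite lerBlDl (le_trans (infconv_le (x + y) (SD _ _ _ _ Ss Ss')))//.
 rewrite addrACA; have := proj1 sN (x + s) (y + s'); lra.
rewrite le_eqVlt => /orP[/eqP <-|c0].
 rewrite scale0r mul0r; apply/eqP; rewrite eq_le; apply/andP; split.
  by rewrite (le_trans (infconv_le 0 S0))// addr0 sublinear0// subr0.
 by apply: infconv_ge => s c' Ss; rewrite add0r subr_ge0; exact: SN.
apply/eqP; rewrite eq_le scale// andbT.
have ci : 0 < c^-1 by rewrite invr_gt0.
have := scale c^-1 (c *: x) ci; rewrite scalerA mulVf ?gt_eqF// scale1r.
by rewrite ler_pdivrMl.
Qed.

Lemma infconv_leN y : infconv N S y <= N y.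
Proof. by case: cS => S0 _ _ _; rewrite (le_trans (infconv_le y S0))// addr0 subr0. Qed.

Lemma infconv_opp s c : S (s, c) -> infconv N S (- s) <= - c.
Proof. by move=> Ss; rewrite (le_trans (infconv_le (- s) Ss))// addNr sublinear0// sub0r. Qed.

End InfConv.

(** The cone is the ray of (e, N e). Every linear functional below the new N' is then forced to take
    the value N e at e. *)
Lemma sublinear_linearize N e : sublinear N -> exists N', [/\ sublinear N',
 forall y, N' y <= N y & N' (- e) <= - N e].
Proof.
move=> sN; pose S : set (V * R) := [set s | exists2 t, 0 <= t & s = (t *: e, t * N e)].
have cS : cone_below S N.
 split=> [|s c s' c' [t t0 [-> ->]] [t' t0' [-> ->]]|u s c u0 [t t0 [-> ->]]|s c [t t0 [-> ->]]].
 - by exists 0 => //; rewrite scale0r mul0r.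
 - by exists (t + t'); rewrite ?addr_ge0// scalerDl mulrDl.
 - by exists (u * t); rewrite ?mulr_ge0// scalerA mulrA.
 - by rewrite (proj2 sN).
exists (infconv N S); split; first exact: infconv_sublinear.
 exact: infconv_leN.
by apply: (infconv_opp sN cS); exists 1 => //; rewrite scale1r mul1r.
Qed.

Lemma sublinear_linearize_seq (es : seq V) N : sublinear N -> exists N', [/\ sublinear N',
 forall y, N' y <= N y & forall e, e \in es -> N' (- e) <= - N' e].
Proof.
elim: es N => [|e es IH] N sN; first by exists N.
have [N1 [sN1 le1 h1]] := sublinear_linearize e sN.
have [N2 [sN2 le2 h2]] := IH _ sN1; exists N2; split => //.
 by move=> y; exact: le_trans (le2 y) (le1 y).
move=> f; rewrite inE => /orP[/eqP ->|]; last exact: h2.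
by rewrite (le_trans (le2 _))// (le_trans h1)// lerN2 (le_trans (le2 _)).
Qed.

End HahnBanach.

(** Linearizing along x0 fixes the value there; linearizing along the finitely many unit vectors
    afterwards makes the whole functional linear. *)
Lemma hahn_banach_fin (R : realType) (I : finType) (N : (I -> R) -> R) (x0 : I -> R) :
 sublinear N -> exists f : I -> R, (forall y, dot f y <= N y) /\ N x0 <= dot f x0.
Proof.
move=> sN; have [N1 [sN1 le1 h1]] := sublinear_linearize x0 sN.
pose d (i : I) : I -> R := fun j => (j == i)%:R.
have [N2 [sN2 le2 h2]] := sublinear_linearize_seq [seq d i | i <- enum I] sN1.
have lin i : N2 (- d i) <= - N2 (d i).
 by apply: h2; apply: map_f; rewrite mem_enum.
have up y : N2 y <= dot (fun i => N2 (d i)) y.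
 have yE : y = \sum_(i <- enum I) y i *: d i.
  apply/funext => j; rewrite fct_sumE big_enum/= (bigD1 j)//= big1.
   by transitivity (y j * d j j); [rewrite /d eqxx mulr1|rewrite addr0].
  by move=> i ij; transitivity (y i * d i j); rewrite // /d eq_sym (negbTE ij) mulr0.
 rewrite {1}yE /dot -big_enum/=; elim: (enum I) => [|i s IH].
  by rewrite !big_nil sublinear0.
 rewrite !big_cons (le_trans (proj1 sN2 _ _))//; apply: lerD => //.
 have [y0|y0] := leP 0 (y i); first by rewrite (proj2 sN2)// mulrC.
 have -> : y i *: d i = (- y i) *: (- d i) by rewrite scalerN scaleNr opprK.
 have y0' : 0 <= - y i by rewrite oppr_ge0 ltW.
 rewrite (proj2 sN2)// [leRHS]mulrC -[leRHS]mulrNN.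
 exact: ler_wpM2l y0' _ _ (lin i).
have dotN f y : dot f (- y) = - dot f y.
 by rewrite /dot -sumrN; apply: eq_bigr => i _; rewrite mulrN.
exists (fun i => N2 (d i)); split.
 move=> y; apply: le_trans (le1 y); apply: le_trans (le2 y).
 by have := up (- y); rewrite dotN lerNr => /le_trans; apply; exact: sublinear_opp.
apply: le_trans (up x0); apply: le_trans (sublinear_opp x0 sN2).
by rewrite lerNr; apply: le_trans (le2 _) h1.
Qed.

(** * Duality and interpolation for finite l_p norms *)

Section LpDuality.
Variables (R : realType).
Implicit Types (I : finType) (a b B : R).

Lemma holder_dot a b I (x y : I -> R) : 1 < a -> a^-1 + b^-1 = 1 ->
 \sum_i `|x i| `^ a <= 1 -> \sum_i `|y i| `^ b <= 1 -> `|dot x y| <= 1.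
Proof.
move=> a1 ab hx hy; have a0 : 0 < a by apply: lt_trans a1.
have b0 : 0 < b.
 rewrite -invr_gt0 -(addKr a^-1 b^-1) ab addrC subr_gt0 invf_lt1//.
rewrite (le_trans (ler_norm_sum _ _ _))//.
rewrite (@le_trans _ _ (\sum_i (`|x i| `^ a / a + `|y i| `^ b / b)))//.
 by apply: ler_sum => i _; rewrite normrM; exact: conjugate_powR.
rewrite big_split/= -!mulr_suml -ab; apply: lerD; by rewrite ler_piMl// invr_ge0 ltW.
Qed.

Lemma lpn_eq0 a I (x : I -> R) : 1 < a -> \sum_i `|x i| `^ a = 0 -> forall i, x i = 0.
Proof.
move=> a1 /psumr_eq0P h i; have := h (fun i _ => powR_ge0 _ _) i isT.
by move/eqP; rewrite powR_eq0 normr_eq0 => /andP[/eqP].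
Qed.

Lemma holder_lpn a b I (x y : I -> R) : 1 < a -> a^-1 + b^-1 = 1 ->
 \sum_i `|y i| `^ b <= 1 -> dot x y <= lpn a%:E x.
Proof.
move=> a1 ab hy; have a0 : 0 < a by apply: lt_trans a1.
have S0 : 0 <= \sum_i `|x i| `^ a by apply: sumr_ge0 => i _; exact: powR_ge0.
have [E|E] := eqVneq (\sum_i `|x i| `^ a) 0.
 by rewrite /dot big1 ?lpn_ge0// => i _; rewrite (lpn_eq0 a1 E) mul0r.
have L0 : 0 < lpn a%:E x by rewrite /= powR_gt0// lt_def E.
have h : lpn a%:E (fun i => (lpn a%:E x)^-1 * x i) <= 1.
 rewrite lpnZ ?lee_fin ?(ltW a1)// ger0_norm ?invr_ge0 ?(ltW L0)// mulVf// gt_eqF//.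
rewrite (lpn_le1P _ a0) in h.
have := holder_dot a1 ab h hy; rewrite ler_norml => /andP[_].
have -> : dot (fun i => (lpn a%:E x)^-1 * x i) y = (lpn a%:E x)^-1 * dot x y.
 by rewrite /dot mulr_sumr; apply: eq_bigr => i _; rewrite mulrA.
by rewrite ler_pdivrMl// mulr1.
Qed.

(** The extremal vector of Holder's inequality, sign(x_i) |x_i|^(a-1) S^(-1/b) with S the sum of the
    |x_i|^a, is admissible. *)
Lemma lpn_dual a b I (x : I -> R) B : 1 < a -> a^-1 + b^-1 = 1 -> 0 <= B ->
 (forall y, \sum_i `|y i| `^ b <= 1 -> dot x y <= B) -> lpn a%:E x <= B.
Proof.
move=> a1 ab B0 h; have a0 : 0 < a by apply: lt_trans a1.
have bi : b^-1 = 1 - a^-1 by rewrite -ab addrAC subrr add0r.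
have b0 : 0 < b by rewrite -invr_gt0 bi subr_gt0 invf_lt1.
have bE : b * (a - 1) = a.
 have -> : b = (1 - a^-1)^-1 by rewrite -bi invrK.
 field; rewrite subr_eq0 gt_eqF// gt_eqF//.
set S := \sum_i `|x i| `^ a.
have S0 : 0 <= S by apply: sumr_ge0 => i _; exact: powR_ge0.
have [E|E] := eqVneq S 0; first by rewrite /= -/S E powR0// invr_eq0 gt_eqF.
have Sp : 0 < S by rewrite lt_def E.
pose y i := Num.sg (x i) * (`|x i| `^ (a - 1) * S `^ (- b^-1)).
have y1 : \sum_i `|y i| `^ b <= 1.
 apply: (@le_trans _ _ (\sum_i S^-1 * `|x i| `^ a)); last by rewrite -mulr_sumr mulVf.
 apply: ler_sum => i _; rewrite /y normrM normr_sg [`|_ * _|]ger0_norm ?mulr_ge0 ?powR_ge0//.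
 case: eqP => [->|_] /=.
  by rewrite mul0r powR0 ?gt_eqF// mulr_ge0 ?powR_ge0 ?invr_ge0.
 rewrite mul1r powRM ?powR_ge0// -!powRrM mulNr mulVf ?gt_eqF// powR_inv1// mulrC.
 by rewrite [(a - 1) * b]mulrC bE.
have := h y y1.
have -> : dot x y = S `^ a^-1; last by [].
have -> : dot x y = S * S `^ (- b^-1).
 rewrite /dot /S mulr_suml; apply: eq_bigr => i _.
 rewrite /y mulrCA mulrA -normrEsg mulrA; congr (_ * _).
 have [->|x0] := eqVneq `|x i| 0; first by rewrite mul0r powR0// gt_eqF.
 by rewrite -{1}[`|x i|]powRr1// -powRD ?x0 ?implybT// addrC subrK.
by rewrite -{1}[S]powRr1// -powRD ?E ?implybT//; congr (_ `^ _); rewrite bi; ring.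
Qed.

(** Minkowski's inequality, read off from the dual description of the norm. *)
Lemma lpnD a I (x y : I -> R) : 1 < a ->
 lpn a%:E (fun i => x i + y i) <= lpn a%:E x + lpn a%:E y.
Proof.
move=> a1; pose b := (1 - a^-1)^-1; have ab : a^-1 + b^-1 = 1 by rewrite invrK addrC subrK.
apply: (lpn_dual a1 ab); first by rewrite addr_ge0 ?lpn_ge0.
move=> z z1; have -> : dot (fun i => x i + y i) z = dot x z + dot y z.
 by rewrite /dot -big_split/=; apply: eq_bigr => i _; rewrite mulrDl.
by apply: lerD; apply: holder_lpn z1.
Qed.

Lemma lpn2 I (x : I -> R) : lpn 2%:E x = l2 x.
Proof.
rewrite /= powR12_sqrt; last by apply: sumr_ge0 => i _; exact: powR_ge0.
by congr Num.sqrt; apply: eq_bigr => i _; rewrite powR_mulrn// real_normK ?num_real.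
Qed.

Lemma weighted_amgm (u v l : R) : 0 <= u -> 0 <= v -> 0 < l < 1 ->
 u `^ (1 - l) * v `^ l <= (1 - l) * u + l * v.
Proof.
move=> u0 v0 /andP[l0 l1]; have l1' : 0 < 1 - l by rewrite subr_gt0.
have := @conjugate_powR R (u `^ (1 - l)) (v `^ l) (1 - l)^-1 l^-1
 (powR_ge0 _ _) (powR_ge0 _ _).
rewrite !invr_gt0 !invrK subrK => /(_ l1' l0 erefl).
by rewrite -!powRrM !divff ?gt_eqF// !powRr1// [u * _]mulrC [v * _]mulrC.
Qed.

(** The equation for mu covers two situations: mu = 1 if b >= 2, where the l_2 bound alone suffices,
    and otherwise mu is the exponent of interpolation between l_a and l_2. *)
Lemma lpn_interp a b I (x : I -> R) (e mu : R) : 1 < a -> a <= b -> a < 2 -> 0 < e ->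
 lpn a%:E x <= 1 -> sq_norm x <= e ^+ 2 ->
 mu * (a^-1 - 2^-1) = Num.min (a^-1 - b^-1) (a^-1 - 2^-1) -> lpn b%:E x <= e `^ mu.
Proof.
move=> a1 ab a2 e0 xa x2; have a0 : 0 < a by apply: lt_trans a1.
have b0 : 0 < b by apply: lt_le_trans ab.
have d0 : 0 < a^-1 - 2^-1 by rewrite subr_gt0 ltf_pV2 ?posrE.
have [b2|b2] := leP 2 b.
 rewrite min_r; last by rewrite lerB// lef_pV2 ?posrE.
 move=> h; have -> : mu = 1 by apply: (mulIf (lt0r_neq0 d0)); rewrite mul1r.
 have s2 : lpn 2%:E (fun i => e^-1 * x i) <= 1.
  rewrite lpnZ ?lee_fin ?ler1n// lpn2 ger0_norm ?invr_ge0 ?(ltW e0)//.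
  by rewrite ler_pdivrMl// mulr1; apply: l2_le => //; exact: ltW.
 have : lpn b%:E (fun i => e^-1 * x i) <= 1.
  by apply: lpn_le_lpn s2; rewrite lee_fin ?ler1n.
 rewrite lpnZ ?lee_fin; last by rewrite (le_trans _ b2)// ler1n.
 by rewrite ger0_norm ?invr_ge0 ?(ltW e0)// ler_pdivrMl// mulr1 powRr1// ltW.
rewrite min_l; last by rewrite lerB// lef_pV2 ?posrE// ltW.
move=> muE; have [E|ab'] := eqVneq a b.
 suff -> : mu = 0 by rewrite powRr0 -E.
 by apply: (mulIf (lt0r_neq0 d0)); rewrite muE -E subrr mul0r.
have {}ab : a < b by rewrite lt_neqAle ab'.
have a20 : 0 < 2 - a by rewrite subr_gt0.
(* Chosen so that b = (1 - l) a + 2 l; the weighted mean inequality is applied in each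
   coordinate. *)
pose l := (b - a) / (2 - a).
have l01 : 0 < l < 1.
 by rewrite /l divr_gt0 ?subr_gt0//= ltr_pdivrMr// mul1r ltrD2r.
have muE' : mu = 2 * l / b.
 apply: (mulIf (lt0r_neq0 d0)); rewrite muE /l; field.
 by rewrite !gt_eqF.
have pt i : `|x i| `^ b <= e `^ (2 * l) * ((1 - l) * `|x i| `^ a + l * (x i ^+ 2 / e ^+ 2)).
 have e2 : 0 < e ^+ 2 by rewrite exprn_gt0.
 have x20 : 0 <= x i ^+ 2 / e ^+ 2 by rewrite divr_ge0 ?sqr_ge0 ?ltW.
 have := weighted_amgm (powR_ge0 `|x i| a) x20 l01.
 rewrite -(ler_pM2l (powR_gt0 (2 * l) e0)); apply: le_trans.
 rewrite -powRrM -[x i ^+ 2]real_normK ?num_real// -expr_div_n -[_ ^+ 2]powR_mulrn ?divr_ge0 ?(ltW e0)//.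
 rewrite -powRrM powRM ?invr_ge0 ?(ltW e0)//.
 have -> : e^-1 `^ (2%:R * l) = (e `^ (2 * l))^-1.
  by rewrite -powR_inv1 ?(ltW e0)// -powRrM mulN1r powRN.
 have [->|x0] := eqVneq `|x i| 0.
  by rewrite powR0 ?gt_eqF// !mulr_ge0 ?powR_ge0// invr_ge0 powR_ge0.
 rewrite mulrCA [e `^ _ * _]mulrCA divff ?gt_eqF ?powR_gt0// mulr1.
 rewrite -powRD ?x0 ?implybT// le_eqVlt; apply/orP; left; apply/eqP; congr (_ `^ _).
 by rewrite /l; field; rewrite gt_eqF.
have sb : \sum_i `|x i| `^ b <= e `^ (2 * l).
 apply: (le_trans (ler_sum _ (fun i _ => pt i))).
 rewrite -mulr_sumr ler_piMr ?powR_ge0// big_split/= -!mulr_sumr -mulr_suml.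
 have s1 : \sum_i `|x i| `^ a <= 1 by rewrite -lpn_le1P.
 have s2 : (\sum_i x i ^+ 2) / e ^+ 2 <= 1 by rewrite ler_pdivrMr ?exprn_gt0// mul1r.
 case/andP: l01 => l0 l1.
 have h1 : (1 - l) * \sum_i `|x i| `^ a <= 1 - l by rewrite ler_piMr// subr_ge0 ltW.
 have h2 : l * ((\sum_i x i ^+ 2) / e ^+ 2) <= l by rewrite ler_piMr// ltW.
 by move: h1 h2; clear; lra.
rewrite /= muE' powRrM; apply: ge0_ler_powR; rewrite ?invr_ge0 ?nnegrE ?powR_ge0 ?(ltW b0)//.
by apply: sumr_ge0 => i _; exact: powR_ge0.
Qed.

End LpDuality.

(** * Widths of finite-dimensional balls *)

Section FiniteWidths.
Variable R : realType.

(** Upper bounds are kept as a relation with an explicit error E, which avoids infima and lets the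
    approximating vectors and functionals be transported to function spaces. *)
Definition fd_width (k : width_kind) (p q : \bar R) (I : finType) (n : nat) (E : R) : Prop :=
 match k with
 | WKolmogorov => exists v : 'I_n -> I -> R, forall x, lpn p x <= 1 ->
   exists c : 'I_n -> R, lpn q (fun i => x i - \sum_k c k * v k i) <= E
 | WLinear => exists v l : 'I_n -> I -> R, forall x, lpn p x <= 1 ->
   lpn q (fun i => x i - \sum_k dot (l k) x * v k i) <= E
 | WGelfand => exists l : 'I_n -> I -> R, forall x, lpn p x <= 1 ->
   (forall k, dot (l k) x = 0) -> lpn q x <= E
 end.

Lemma fd_width_le k p q (I : finType) n (E E' : R) : E <= E' ->
 fd_width k p q I n E -> fd_width k p q I n E'.
Proof.
move=> EE; case: k => /=.
- by move=> [v h]; exists v => x /h[c hc]; exists c; exact: le_trans EE.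
- by move=> [v [l h]]; exists v, l => x /h hc; exact: le_trans EE.
- by move=> [l h]; exists l => x xp /(h x xp) hc; exact: le_trans EE.
Qed.

Lemma fd_width1 k (p q : \bar R) (I : finType) n : (1 <= p)%E -> (p <= q)%E ->
 fd_width k p q I n 1.
Proof.
move=> p1 pq; have h (x : I -> R) : lpn p x <= 1 -> lpn q x <= 1 by exact: lpn_le_lpn.
case: k => /=.
- exists (fun _ _ => 0) => x xp; exists (fun=> 0).
 rewrite (_ : (fun i => _) = x) ?h//; apply/funext => i.
 by rewrite big1 ?subr0// => j _; rewrite mulr0.
- exists (fun _ _ => 0), (fun _ _ => 0) => x xp.
 rewrite (_ : (fun i => _) = x) ?h//; apply/funext => i.
 by rewrite big1 ?subr0// => j _; rewrite mulr0.
- by exists (fun _ _ => 0) => x xp _; exact: h.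
Qed.

Lemma lpn_mono (p q : \bar R) (I : finType) (x : I -> R) (B : R) : (1 <= p)%E -> (p <= q)%E ->
 0 < B -> lpn p x <= B -> lpn q x <= B.
Proof.
move=> p1 pq B0; have q1 := le_trans p1 pq.
have sc r : (1 <= r)%E -> (lpn r x <= B) = (lpn r (fun i => B^-1 * x i) <= 1).
 by move=> r1; rewrite lpnZ// ger0_norm ?invr_ge0 ?(ltW B0)// ler_pdivrMl// mulr1.
by rewrite !sc//; exact: lpn_le_lpn.
Qed.

Lemma fd_width_full k (p q : \bar R) (I : finType) n : (1 <= q)%E -> (#|I| <= n)%N ->
 fd_width k p q I n 0.
Proof.
move=> q1 In; pose d (j : 'I_n) (i : I) : R := (enum_rank i == j :> nat)%:R.
have q0 : lpn q (fun=> 0 : R) = 0 :> R.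
 by move=> J; have := @lpnZ R q J (fun=> 0) 0 q1; rewrite normr0 !mul0r.
have rk (i : I) : (enum_rank i < n)%N by rewrite (leq_trans (ltn_ord _)).
have dd (x : I -> R) (i : I) : dot (d (Ordinal (rk i))) x = x i.
 rewrite /dot (bigD1 i)//= /d eqxx mul1r big1 ?addr0// => j ji.
 case: eqP; last by rewrite mul0r.
 by move=> /= /val_inj/enum_rank_inj E; rewrite E eqxx in ji.
have rec (x : I -> R) i : \sum_k dot (d k) x * d k i = x i.
 rewrite (bigD1 (Ordinal (rk i)))//= dd {1}/d eqxx mulr1 big1 ?addr0// => j ji.
 rewrite [d j i]/d; case: eqP; last by rewrite mulr0.
 by move=> E; move: ji; rewrite -val_eqE/= E eqxx.
case: k => /=.
- exists d => x _; exists (fun j => dot (d j) x).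
 by rewrite (_ : (fun i => _) = fun=> 0) ?q0//; apply/funext => i; rewrite rec subrr.
- exists d, d => x _.
 by rewrite (_ : (fun i => _) = fun=> 0) ?q0//; apply/funext => i; rewrite rec subrr.
- exists d => x _ h; rewrite (_ : x = fun=> 0) ?q0//.
 by apply/funext => i; rewrite -dd h.
Qed.

(** The kernel of the random rows meets the l_a ball in a set of small l_2 norm, by [sign_forms]
    with eta = 1 - 1/a; interpolation with the l_a bound itself gives l_b. *)
Lemma gelfand_core (a b mu : R) : 1 < a < 2 -> a <= b ->
 mu * (a^-1 - 2^-1) = Num.min (a^-1 - b^-1) (a^-1 - 2^-1) ->
 exists2 C : R, 0 < C & forall (I : finType) n, (0 < #|I|)%N -> (0 < n)%N ->
 exists l : 'I_n -> I -> R, forall x, lpn a%:E x <= 1 -> (forall k, dot (l k) x = 0) ->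
  lpn b%:E x <= C * (n%:R `^ (- 2^-1) * #|I|%:R `^ (1 - a^-1)) `^ mu.
Proof.
move=> /andP[a1 a2] ab muE; have a0 : 0 < a by apply: lt_trans a1.
have eta : 0 < 1 - a^-1 < 2^-1.
 have h1 : a^-1 < 1 by rewrite invf_lt1.
 have h2 : 2^-1 < a^-1 by rewrite ltf_pV2 ?posrE.
 by apply/andP; split; move: h1 h2; clear; lra.
have [C0 C00 hC] := sign_forms eta.
exists (Num.sqrt C0 `^ mu); first by rewrite powR_gt0 ?sqrtr_gt0.
move=> I n I0 n0; have [w [hw _]] := hC I n I0 n0.
exists (fun k i => sgn R (w k i)) => x xa xk.
have e0 : 0 < n%:R `^ (- 2^-1) * #|I|%:R `^ (1 - a^-1) :> R.
 by rewrite mulr_gt0// powR_gt0// ltr0n.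
rewrite -powRM ?sqrtr_ge0 ?(ltW e0)//.
apply: (@lpn_interp _ a) => //; first by rewrite mulr_gt0// sqrtr_gt0.
rewrite exprMn sqr_sqrtr ?(ltW C00)//; apply: hw => //.
by rewrite opprB addrC subrK invrK -lpn_le1P.
Qed.

(** The distance of x to the span is sublinear. A linear functional supporting it at x has dual norm
    at most 1 and vanishes on the span, so the Gelfand bound for the conjugate exponents applies to
    it. The factor 2 pays for an infimum, which yields an approximant only below a strict
    inequality. *)
Lemma kolmogorov_dual (p q p' q' : R) (I : finType) n (l : 'I_n -> I -> R) (E : R) :
 1 < p -> 1 < q -> p^-1 + p'^-1 = 1 -> q^-1 + q'^-1 = 1 -> 1 < p' -> 1 < q' -> 0 < E ->
 (forall y, lpn q'%:E y <= 1 -> (forall k, dot (l k) y = 0) -> lpn p'%:E y <= E) ->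
 forall x, lpn p%:E x <= 1 ->
  exists c : 'I_n -> R, lpn q%:E (fun i => x i - \sum_k c k * l k i) <= 2 * E.
Proof.
move=> p1 q1 pp qq p'1 q'1 E0 h x xp.
have p0 : 0 < p by apply: lt_trans p1.
have q0 : 0 < q by apply: lt_trans q1.
pose N (y : I -> R) := lpn q%:E y.
have sN : sublinear N.
 split=> [y z|c y c0]; first exact: lpnD.
 by rewrite /N -[in RHS](ger0_norm c0) -lpnZ// lee_fin ltW.
(* The span paired with the value 0: its infimal convolution with the norm is the distance to the
   span. *)
pose S : set ((I -> R) * R) := [set s | exists c : 'I_n -> R,
  s = ((fun i => \sum_k c k * l k i), 0)].
have cS : cone_below S N.
 split=> [|s c s' c' [a [-> ->]] [a' [-> ->]]|t s c t0 [a [-> ->]]|s c [a [-> ->]]].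
 - by exists (fun=> 0); congr pair; apply/funext => i; rewrite big1// => k _; rewrite mul0r.
 - exists (fun k => a k + a' k); rewrite addr0; congr pair; apply/funext => i.
  by rewrite -[LHS]big_split/=; apply: eq_bigr => k _; rewrite mulrDl.
 - exists (fun k => t * a k); rewrite mulr0; congr pair; apply/funext => i.
  transitivity (t * \sum_k a k * l k i); first by [].
  by rewrite mulr_sumr; apply: eq_bigr => k _; rewrite mulrA.
 - exact: lpn_ge0.
have [f [fN fx]] := hahn_banach_fin x (infconv_sublinear sN cS).
have f1 : lpn q'%:E f <= 1.
 apply: (@lpn_dual _ q' q); rewrite // 1?addrC// => y y1.
 apply: le_trans (fN y) _; apply: le_trans (infconv_leN sN cS y) _.
 by rewrite /N lpn_le1P.
have fk k : dot (l k) f = 0.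
 have dC y : dot y f = dot f y by apply: eq_bigr => i _; rewrite mulrC.
 have key (t : R) : dot f (- (fun i => t * l k i)) <= 0.
  apply: le_trans (fN _) _; rewrite -oppr0; apply: (infconv_opp sN cS).
  exists (fun k' => (k' == k)%:R * t); congr pair; apply/funext => i.
  rewrite (bigD1 k)//= eqxx mul1r big1 ?addr0// => k' /negbTE ->; by rewrite !mul0r.
 have e t : dot f (- (fun i => t * l k i)) = - (t * dot f (l k)).
  by rewrite /dot mulr_sumr -sumrN; apply: eq_bigr => i _; rewrite mulrN mulrCA.
 have h1 := key 1; have h2 := key (-1); rewrite !e in h1 h2.
 by rewrite dC; apply/eqP; rewrite eq_le; apply/andP; split; move: h1 h2; clear; lra.
have p1s : \sum_i `|x i| `^ p <= 1 by rewrite -lpn_le1P.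
have fE : dot f x <= E.
 apply: le_trans (h f f1 fk); apply: (@holder_lpn _ p' p) => //; by rewrite addrC.
have : infconv N S x < 2 * E.
 apply: le_lt_trans fx _; apply: le_lt_trans fE _; by rewrite ltr_pMl// ltr1n.
case/inf_lt; first by exists (N (x + 0) - 0), (0, 0) => //; case: cS.
move=> _ [[s c] [a [-> ->]] <-]; rewrite [X in _ - X]/= subr0 => /ltW ha.
exists (fun k => - a k); rewrite /N in ha; rewrite (_ : (fun i => _) = x + (fun i => \sum_k a k * l k i))//.
by apply/funext => i; congr (_ + _); rewrite -sumrN; apply: eq_bigr => k _; rewrite mulNr opprK.
Qed.

Lemma conj_fin (P : R) : 1 < P -> hoelder_conjugate P%:E = ((1 - P^-1)^-1)%:E.
Proof.
move=> P1; have P0 : 0 < P by apply: lt_trans P1.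
rewrite /hoelder_conjugate/= eqe gt_eqF//= inver subr_eq0 gt_eqF//= -EFinM; congr EFin.
by field; rewrite !gt_eqF ?subr_gt0.
Qed.

(** One random matrix with rows r_k serves all three widths. Gelfand widths use the l_2 bound on its
    kernel, Kolmogorov widths use this for the conjugate exponents, and linear widths use that the
    mean of the r_k r_k^T is close to the identity as a bilinear form on an l_a ball. *)
Lemma fd_width_random k (P Q mu : R) : 1 < P -> P < Q -> 2 < qhat k P%:E Q%:E ->
 let h := qhat k P%:E Q%:E in
 mu * (2^-1 - h^-1) = Num.min (P^-1 - Q^-1) (2^-1 - h^-1) ->
 exists2 C : R, 1 <= C & forall (I : finType) n, (0 < #|I|)%N -> (0 < n)%N ->
  fd_width k P%:E Q%:E I n (C * (n%:R `^ (- 2^-1) * #|I|%:R `^ h^-1) `^ mu).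
Proof.
move=> P1 PQ h2 h; have P0 : 0 < P by apply: lt_trans P1.
have Q1 : 1 < Q by apply: lt_trans PQ.
have Q0 : 0 < Q by apply: lt_trans PQ.
have Pi1 : P^-1 < 1 by rewrite invf_lt1.
have Qi1 : Q^-1 < 1 by rewrite invf_lt1.
have PQi : Q^-1 < P^-1 by rewrite ltf_pV2 ?posrE.
have Qi0 : 0 < Q^-1 by rewrite invr_gt0.
have conjgt (a : R) : 0 < a < 1 -> 1 < (1 - a)^-1.
 by move=> /andP[a0 a1]; rewrite invf_gt1 ?subr_gt0// gtrBl.
have P'1 := conjgt P^-1 ltac:(by rewrite invr_gt0 P0).
have Q'1 := conjgt Q^-1 ltac:(by rewrite Qi0).
have lt2i (a : R) : 0 < a -> 2 < a^-1 -> a < 2^-1.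
 by move=> a0 ha; rewrite -[a]invrK ltf_pV2 ?posrE ?invr_gt0.
have hE : h = qhat k P%:E Q%:E by [].
rewrite -hE in h2; clearbody h => muE.
case: k hE => hE; rewrite /= in hE.
- subst h; have Qh : Q^-1 < 2^-1 by rewrite ltf_pV2 ?posrE.
 have ha : 1 < (1 - Q^-1)^-1 < 2.
  by rewrite Q'1/= invf_plt ?posrE ?subr_gt0//; move: Qh; clear; lra.
 have hab : (1 - Q^-1)^-1 <= (1 - P^-1)^-1.
  by rewrite lef_pV2 ?posrE ?subr_gt0// lerB// ltW.
 have muE' : mu * ((1 - Q^-1)^-1^-1 - 2^-1) =
   Num.min ((1 - Q^-1)^-1^-1 - (1 - P^-1)^-1^-1) ((1 - Q^-1)^-1^-1 - 2^-1).
  rewrite !invrK.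
  have -> : 1 - Q^-1 - 2^-1 = 2^-1 - Q^-1 by field; rewrite gt_eqF.
  by rewrite muE; congr Num.min; ring.
 have [C C0 hC] := gelfand_core ha hab muE'.
 exists (2 * C + 1); first by rewrite lerDr mulr_ge0// ltW.
 move=> I n I0 n0; have [l hl] := hC I n I0 n0.
 set E := C * _ in hl; have E0 : 0 < E by rewrite mulr_gt0// powR_gt0// mulr_gt0// powR_gt0// ltr0n.
 exists l => x xP.
 have := @kolmogorov_dual P Q (1 - P^-1)^-1 (1 - Q^-1)^-1 I n l E P1 Q1.
 rewrite !invrK => /(_ ltac:(ring) ltac:(ring) P'1 Q'1 E0 hl x xP)[c hc].
 exists c; apply: le_trans hc _; rewrite /E invrK opprB [1 + (_ - 1)]addrC subrK mulrA.
 apply: ler_wpM2r; first exact: powR_ge0.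
 by rewrite lerDl.
- rewrite conj_fin//= in hE.
 have hQ : h <= Q by rewrite hE ge_min lexx.
 have hP : h <= (1 - P^-1)^-1 by rewrite hE ge_min lexx orbT.
 have h0 : 0 < h by apply: lt_trans h2.
 have hi : h^-1 < 2^-1 by rewrite ltf_pV2 ?posrE.
 have Qhi : Q^-1 <= h^-1 by rewrite lef_pV2 ?posrE.
 have Phi : 1 - P^-1 <= h^-1 by rewrite -[leLHS]invrK lef_pV2 ?posrE// invr_gt0 subr_gt0.
 (* If h = Q then 1/P >= 1 - 1/h > 1/2, and if h is conjugate to P then 1/Q <= 1/h < 1/2. In both
    cases the second term is the minimum. *)
 have mu1 : mu = 1.
  have d0 : 2^-1 - h^-1 != 0 by rewrite gt_eqF// subr_gt0.
  apply: (mulIf d0); rewrite mul1r muE min_r//.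
  have [hq|hp] : h = Q \/ h = (1 - P^-1)^-1 by rewrite hE /Num.min; case: ifP; [left|right].
   have : h^-1 = Q^-1 by rewrite hq.
   by move: Phi hi; clear; lra.
  have : h^-1 = 1 - P^-1 by rewrite hp invrK.
  by move: Qhi hi; clear; lra.
 have h1' : 1 < h by apply: lt_trans h2; rewrite ltr1n.
 have eta : 0 < h^-1 < 2^-1 by rewrite invr_gt0 h0.
 have [C C0 hC] := sign_forms eta.
 exists (2 * C + 1); first by rewrite lerDr mulr_ge0// ltW.
 move=> I n I0 n0; have [w [_ hw]] := hC I n I0 n0.
 rewrite mu1; set e := n%:R `^ (- 2^-1) * #|I|%:R `^ h^-1 in hw *.
 have e0 : 0 < e by rewrite mulr_gt0// powR_gt0// ltr0n.
 rewrite powRr1 ?ltW//.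
 (* For e >= 1 the zero operator is good enough; for e < 1 the term e^2 of the bilinear bound is
    absorbed by e. *)
 have [e1|e1] := leP 1 e.
  apply: fd_width_le (@fd_width1 WLinear P%:E Q%:E I n _ _); rewrite ?lee_fin ?(ltW P1) ?(ltW PQ)//.
  rewrite mulrDl mul1r (le_trans e1)// lerDr; apply: mulr_ge0 (ltW e0).
  by rewrite mulr_ge0// ltW.
 exists (fun k i => sgn R (w k i)), (fun k i => n%:R^-1 * sgn R (w k i)) => x xP.
 (* The exponent conjugate to h. Since P <= a, x lies in the l_a ball, and by duality the l_h norm
    of the error is tested against the same ball. *)
 pose a := (1 - h^-1)^-1; have ai : a^-1 = 1 - h^-1 by rewrite invrK.
 have a1 : 1 < a by apply: conjgt; rewrite invr_gt0 h0 invf_lt1.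
 have xa : lpn a%:E x <= 1.
  apply: (@lpn_le_lpn _ P%:E) xP; rewrite lee_fin ?(ltW P1)//.
  rewrite -[P]invrK lef_pV2 ?posrE ?subr_gt0 ?invr_gt0 ?invf_lt1//.
  by move: Phi; clear; lra.
 set B := 2 * C * e.
 have zB : lpn h%:E (fun i => x i - \sum_k dot (fun i => n%:R^-1 * sgn R (w k i)) x * sgn R (w k i)) <= B.
  apply: (@lpn_dual _ h a) => //; first by rewrite ai; ring.
   by rewrite !mulr_ge0// ltW.
  move=> y y1; apply: (@le_trans _ _ (C * (e + e ^+ 2))); last first.
   rewrite /B [2 * C]mulrC -mulrA ler_pM2l//.
   have : e ^+ 2 <= e by rewrite expr2 ler_piMr// ltW.
   by clear; lra.
  apply: le_trans (hw x y _ y1); last first.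
   by rewrite -lpn_le1P ?invr_gt0 ?subr_gt0 ?invf_lt1.
  apply: le_trans (ler_norm _); rewrite le_eqVlt; apply/orP; left; apply/eqP.
  rewrite /dot; under eq_bigr do rewrite mulrBl; rewrite sumrB; congr (_ - _).
  under eq_bigr do rewrite mulr_suml; rewrite exchange_big/= /bform mulr_sumr.
  apply: eq_bigr => k _.
  have -> : \sum_i n%:R^-1 * sgn R (w k i) * x i = n%:R^-1 * rdot (w k) x.
   by rewrite /rdot mulr_sumr; apply: eq_bigr => i _; rewrite mulrA.
  rewrite [rdot (w k) y]/rdot; move: (rdot (w k) x) => u.
  by rewrite !mulr_sumr; apply: eq_bigr => i _; ring.
 have B0 : 0 < B by apply: mulr_gt0 => //; apply: mulr_gt0.
 have h1E : (1%:E <= h%:E)%E by rewrite lee_fin ltW.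
 have hQE : (h%:E <= Q%:E)%E by rewrite lee_fin.
 apply: (le_trans (lpn_mono h1E hQE B0 zB)).
 by rewrite /B ler_pM2r// lerDl.
- rewrite conj_fin//= in hE; subst h.
 have Ph : 1 - P^-1 < 2^-1 by apply: lt2i; rewrite ?subr_gt0.
 have ha : 1 < P < 2.
  rewrite P1/= -[P]invrK -[2]invrK ltf_pV2 ?posrE ?invr_gt0//.
  by move: Ph; clear; lra.
 have muE' : mu * (P^-1 - 2^-1) = Num.min (P^-1 - Q^-1) (P^-1 - 2^-1).
  move: muE; rewrite invrK.
  by have -> : 2^-1 - (1 - P^-1) = P^-1 - 2^-1 by field; rewrite gt_eqF.
 have [C C0 hC] := gelfand_core ha (ltW PQ) muE'.
 exists (C + 1); first by rewrite lerDr ltW.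
 move=> I n I0 n0; have [l hl] := hC I n I0 n0.
 exists l => x xP xk; apply: le_trans (hl x xP xk) _.
 by rewrite invrK; apply: ler_wpM2r; [exact: powR_ge0|rewrite lerDl].
Qed.

End FiniteWidths.

(** * Dyadic strips and the boxes attached to a point *)

Section Grid.
Variable R : realType.

Definition hp (k : nat) : R := 2^-1 ^+ k.

Lemma hp_gt0 k : 0 < hp k. Proof. by rewrite exprn_gt0// invr_gt0. Qed.

Lemma hp_ge0 k : 0 <= hp k. Proof. exact: ltW (hp_gt0 k). Qed.

Lemma hpS k : hp k = 2 * hp k.+1.
Proof. by rewrite /hp exprS mulrA mulfV// mul1r. Qed.

Lemma hpD a b : hp (a + b) = hp a * hp b. Proof. exact: exprD. Qed.

Lemma hpV k : (hp k)^-1 = (2 ^ k)%:R.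
Proof. by rewrite /hp exprVn invrK natrX. Qed.

Lemma hp_le a b : (a <= b)%N -> hp b <= hp a.
Proof. by move=> ab; apply: ler_wiXn2l => //; rewrite ?invr_ge0// invf_le1 ?ler1n. Qed.

Lemma hp_le1 k : hp k <= 1. Proof. by rewrite (hp_le (leq0n k)). Qed.

Lemma truncn_grid (y : R) k : 0 <= y ->
 (Num.truncn (y / hp k))%:R * hp k <= y < ((Num.truncn (y / hp k))%:R + 1) * hp k.
Proof.
move=> y0; have := truncn_itv (divr_ge0 y0 (hp_ge0 k)).
by rewrite ler_pdivlMr ?hp_gt0// ltr_pdivrMr ?hp_gt0// natr1.
Qed.

(** Indices on nested dyadic grids: this makes the parent of a cell depend on the index of the cell
    alone. *)
Lemma truncn_coarse (y : R) k l : 0 <= y ->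
 Num.truncn (y / hp k) = (Num.truncn (y / hp (k + l)) %/ 2 ^ l)%N.
Proof.
move=> y0; have e : y / hp k * (2 ^ l)%:R = y / hp (k + l).
 by rewrite -hpV hpD invfM mulrA.
have yk0 : 0 <= y / hp k by rewrite divr_ge0// hp_ge0.
have l0 : (0 < 2 ^ l)%N by rewrite expn_gt0.
have l0R : 0 < (2 ^ l)%:R :> R by rewrite ltr0n.
apply/truncn_def => //.
have /andP[h1 h2] := truncn_itv (divr_ge0 y0 (hp_ge0 (k + l))).
rewrite -e in h1 h2 *; set u := Num.truncn _ in h1 h2 *.
apply/andP; split.
 rewrite -(ler_pM2r l0R) -natrM; apply: le_trans h1.
 by rewrite ler_nat leq_trunc_div.
rewrite -(ltr_pM2r l0R) -natrM; apply: lt_le_trans h2 _.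
by rewrite ler_nat ltn_ceil.
Qed.

Lemma truncn_lt_pow (y : R) k : 0 <= y < 1 -> (Num.truncn (y / hp k) < 2 ^ k)%N.
Proof.
move=> /andP[y0 y1]; rewrite -(ltr_nat R) -hpV.
rewrite -(ltr_pM2r (hp_gt0 k)) mulVf ?gt_eqF ?hp_gt0//.
by have /andP[h _] := truncn_grid k y0; apply: le_lt_trans h _.
Qed.

Lemma strip_ex (y : R) : y < 2 -> exists k, y < 2 - hp k.
Proof.
move=> y2; have d0 : 0 < 2 - y by rewrite subr_gt0.
exists (Num.truncn (2 - y)^-1).+1; rewrite ltrBrDl -ltrBrDr.
rewrite -[ltRHS]invrK -[ltLHS]invrK ltf_pV2 ?posrE ?invr_gt0 ?hp_gt0// hpV.
rewrite (lt_le_trans (truncnS_gt _))// ler_nat ltnW// ltn_expl//.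
Qed.

(** The strips accumulate at the top level 2. The default value 0 is taken only for y >= 2, outside
    the domain. *)
Definition strip (y : R) : nat :=
 if pselect (exists k, y < 2 - hp k) is left h then ex_minn h else 0%N.

Lemma strip_lt y : y < 2 -> y < 2 - hp (strip y).
Proof.
move=> /strip_ex h; rewrite /strip; case: pselect => // h'.
by case: ex_minnP.
Qed.

Lemma strip_ge y k : y < 2 -> (k < strip y)%N -> 2 - hp k <= y.
Proof.
move=> /strip_ex h; rewrite /strip; case: pselect => // h'.
case: ex_minnP => n _ mn kn; rewrite leNgt; apply/negP => /mn.
by rewrite leqNgt kn.
Qed.

Definition kap i (y : R) : nat := minn i (strip y).
(** The height, truncated at distance 2 * 2^-i below the top level. At level i all points of the
    uppermost strips thus share one vertical index, and their boxes do not follow them to the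
    boundary. *)
Definition zeta i (y : R) : R := Num.min y (2 - 2 * hp i).

Lemma kap_par i y : kap i y = minn i (kap i.+1 y).
Proof. by rewrite /kap minnA (minn_idPl (leqnSn i)). Qed.

Lemma zeta_ge i y : 0 <= y < 2 -> 2 - 2 * hp (kap i y) <= zeta i y.
Proof.
move=> /andP[y0 y2]; rewrite /zeta le_min; apply/andP; split; last first.
 by rewrite lerB// ler_pM2l// hp_le// geq_minl.
rewrite /kap; case: (posnP (minn i (strip y))) => [->|].
 by rewrite /hp expr0 mulr1 subrr.
case E : (minn _ _) => [//|k] _; rewrite -hpS; apply: strip_ge => //.
by rewrite -E geq_minr.
Qed.

Lemma zeta_lt i y : 0 <= y < 2 -> zeta i y <= 2 - hp (kap i y).
Proof.
move=> /andP[y0 y2]; rewrite /zeta /kap; case: (leqP i (strip y)) => h.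
 rewrite ge_min; apply/orP; right; rewrite lerB// ler_peMl ?hp_ge0// ler1n//.
by rewrite ge_min ltW// strip_lt.
Qed.

Lemma zeta_ge0 i y : 0 <= y < 2 -> 0 <= zeta i y.
Proof.
move=> y02; apply: le_trans (zeta_ge i y02).
by rewrite subr_ge0 -[leRHS]mulr1 ler_pM2l// hp_le1.
Qed.

Lemma zeta_ge1 i y : 0 <= y < 2 -> (0 < kap i y)%N -> 1 <= zeta i y.
Proof.
move=> y02 k0; apply: le_trans (zeta_ge i y02).
have := hp_le k0; rewrite /hp expr1; lra.
Qed.

Lemma zeta_const i y : 0 <= y < 2 -> (i <= kap i.+1 y)%N -> zeta i y = 2 - 2 * hp i.
Proof.
move=> y02 h; apply/eqP; rewrite eq_le {1}/zeta ge_min lexx orbT/=.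
have := zeta_ge i y02; rewrite (_ : kap i y = i)//.
by rewrite kap_par; apply/minn_idPl.
Qed.

Lemma zeta_id i y : 0 <= y < 2 -> (kap i.+1 y < i)%N -> zeta i y = y /\ zeta i.+1 y = y.
Proof.
move=> /andP[y0 y2] h.
have s : (strip y < i)%N by move: h; rewrite /kap /minn; case: ifP => //; lia.
have y1 : y <= 2 - 2 * hp i.
 apply: ltW; apply: lt_le_trans (strip_lt y2) _; rewrite lerB//.
 by case: i s {h} => // i s; rewrite -hpS hp_le.
split; rewrite /zeta min_l// (le_trans y1)// lerB// ler_pM2l// hp_le//.
Qed.

Lemma zeta_step i y : 0 <= zeta i.+1 y - zeta i y <= hp i.
Proof.
rewrite /zeta (_ : 2 * hp i.+1 = hp i); last by rewrite [RHS]hpS.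
have := hp_ge0 i; move: (hp i) => h; clear => h0.
by rewrite /Num.min; do 2 case: ltP => ?; apply/andP; split; lra.
Qed.

Lemma zeta_near i y : 0 <= y < 2 -> 0 <= y - zeta i y <= 2 * hp i.
Proof.
have := hp_ge0 i; rewrite /zeta /Num.min => h0 /andP[? ?].
by case: ltP => ?; apply/andP; split; lra.
Qed.

Section Boxes.
Variables (m : nat) (sigma : R).
Hypothesis sigma_ge1 : 1 <= sigma.
Implicit Types (x w : 'rV[R]_m.+1) (j : 'I_m.+1) (z : 'I_m.+1 -> nat).

(** An integer in (sigma k, sigma k + 1], so that the horizontal sides are dyadic and grids of
    different strips are nested. *)
Definition hexp (k : nat) : nat := (Num.truncn (sigma * k%:R)).+1.

Lemma sigma_ge0 : 0 <= sigma. Proof. by apply: le_trans sigma_ge1. Qed.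

Lemma hexp_bound k : sigma * k%:R <= (hexp k)%:R <= sigma * k%:R + 1.
Proof.
have := truncn_itv (mulr_ge0 sigma_ge0 (ler0n R k)); rewrite /hexp -natr1.
by move=> /andP[h1 h2]; rewrite ltW//= lerD2r.
Qed.

Lemma hexp_step k : (hexp k <= hexp k.+1 <= hexp k + (Num.truncn sigma).+2)%N.
Proof.
have /andP[a1 a2] := hexp_bound k; have /andP[b1 b2] := hexp_bound k.+1.
have t := truncnS_gt sigma.
apply/andP; split.
 rewrite /hexp ltnS; apply: le_truncn; rewrite ler_wpM2l ?sigma_ge0// ler_nat//.
rewrite -(ler_nat R) natrD -natr1.
move: a1 b2 t; rewrite -[k.+1%:R]natr1 mulrDr mulr1; set s := sigma * _; set u := _.+1%:R.
by clear; lra.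
Qed.

(* the vertical side of a box of level [i] is [hp i.+2], the horizontal one
  [hp (cexp i k j)], where [k] is the strip of the box, cut off at [i] *)
Definition cexp (i k : nat) j : nat :=
 if j == ord_max then i.+2 else (hexp k + 2 + (i - k))%N.
Definition side i k j : R := hp (cexp i k j).
Definition key i x j : nat :=
 Num.truncn ((if j == ord_max then zeta i (x ord0 ord_max) else x ord0 j) /
  side i (kap i (x ord0 ord_max)) j).
(** The box is the grid box of the cell lowered by three vertical sides, except in the strip k = 0,
    where the unit cube leaves room. Averaging takes place in the box, evaluation in the cell. *)
Definition corner i k z j : R :=
 (z j)%:R * side i k j - (if (j == ord_max) && (0 < k)%N then 3 * side i k j else 0).
(** The index of the parent, computed from the index of the cell. For i <= k the parent lies in its
    uppermost strip, where the vertical index is the constant one dictated by [zeta]. *)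
Definition par_key i k z j : nat :=
 if (j == ord_max) && (i <= k)%N then Num.truncn ((2 - 2 * hp i) / hp i.+2)
 else (z j %/ 2 ^ (cexp i.+1 k j - cexp i (minn i k) j))%N.

Lemma side_gt0 i k j : 0 < side i k j. Proof. exact: hp_gt0. Qed.

Lemma cexp_step i k j : (k <= i.+1)%N ->
 (cexp i (minn i k) j <= cexp i.+1 k j <= cexp i (minn i k) j + (Num.truncn sigma).+3)%N.
Proof.
rewrite /cexp => ki; case: eqP => _; first by rewrite leqnSn/= addnS ltnS; lia.
have [ki'|ki'] := leqP k i; first by lia.
have -> : k = i.+1 by lia.
have /andP[] := hexp_step i; lia.
Qed.

Lemma side_step i k j : (k <= i.+1)%N ->
 side i.+1 k j <= side i (minn i k) j <= (2 ^ (Num.truncn sigma).+3)%:R * side i.+1 k j.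
Proof.
move=> /(cexp_step j)/andP[h1 h2]; rewrite /side hp_le//=.
rewrite -hpV ler_pdivlMl ?hp_gt0// mulrC -hpD hp_le//.
Qed.

Section InBox.
Variable x : 'rV[R]_m.+1.
Let y := x ord0 ord_max.
Hypotheses (x01 : forall j, j != ord_max -> 0 < x ord0 j < 1) (y02 : 0 <= y < 2).

Lemma par_keyE i j : par_key i (kap i.+1 y) (key i.+1 x) j = key i x j.
Proof.
have ki : (kap i.+1 y <= i.+1)%N by exact: geq_minl.
have /andP[c1 c2] := cexp_step j ki.
rewrite /par_key /key -/y -kap_par /side; rewrite -kap_par in c1.
set d := (cexp i.+1 _ j - _)%N.
have cE : cexp i.+1 (kap i.+1 y) j = (cexp i (kap i y) j + d)%N by rewrite subnKC.
rewrite cE.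
case: (eqVneq j ord_max) => [jm|jm] /=; last first.
 rewrite -truncn_coarse// ltW//; by have /andP[] := x01 jm.
case: (leqP i (kap i.+1 y)) => ik.
 by by rewrite zeta_const// /cexp jm eqxx.
have [z1 z2] := zeta_id y02 ik.
by rewrite z1 z2 -truncn_coarse//; case/andP: y02.
Qed.

Lemma key_grid i j :
 let k := kap i y in let t := if j == ord_max then zeta i y else x ord0 j in
 (key i x j)%:R * side i k j <= t < ((key i x j)%:R + 1) * side i k j.
Proof.
rewrite /= /key -/y /side; apply: truncn_grid.
by case: (eqVneq j ord_max) => jm; [exact: zeta_ge0|have /andP[/ltW] := x01 jm].
Qed.

Lemma corner_hor i j : j != ord_max ->
 [/\ 0 <= corner i (kap i y) (key i x) j,
   corner i (kap i y) (key i x) j <= x ord0 j,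
   x ord0 j < corner i (kap i y) (key i x) j + side i (kap i y) j &
   corner i (kap i y) (key i x) j + side i (kap i y) j <= 1].
Proof.
move=> jm; have := key_grid i j; rewrite /corner (negbTE jm)/= subr0 => /andP[h1 h2]; split => //.
- by rewrite mulr_ge0// hp_ge0.
- by move: h2; rewrite mulrDl mul1r.
have x1 : 0 <= x ord0 j < 1 by have /andP[/ltW -> ->] := x01 jm.
rewrite /key (negbTE jm) -/y /side -[X in _ + X]mul1r -mulrDl -ler_pdivlMr ?hp_gt0// mul1r [leRHS]hpV.
by rewrite natr1 ler_nat truncn_lt_pow.
Qed.

(** For k > 0 the lowered box ends at least two vertical sides below [zeta], the margin that is
    turned into horizontal room at the boundary. For k = 0 it stays below height 1, where Omega is a
    full cube. *)
Lemma corner_ver i : let k := kap i y in let a := corner i k (key i x) ord_max in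
 [/\ 0 <= a, zeta i y - 4 * hp i.+2 <= a, a <= zeta i y,
   (0 < k)%N -> a + hp i.+2 <= zeta i y - 2 * hp i.+2 &
   k = 0%N -> a + hp i.+2 <= 1].
Proof.
move=> k a; have := key_grid i ord_max; rewrite eqxx/=.
have sE : side i k ord_max = hp i.+2 by rewrite /side /cexp eqxx.
rewrite -/k sE; have h0 := hp_gt0 i.+2.
have -> : a = (key i x ord_max)%:R * hp i.+2 - (if (0 < k)%N then 3 * hp i.+2 else 0).
 by rewrite /a /corner eqxx sE.
set u := (key _ _ _)%:R; rewrite mulrDl mul1r => /andP[h1 h2].
case: (posnP k) => k0; split => //; rewrite ?subr0.
- by rewrite mulr_ge0// ltW.
- by lra.
- exact: h1.
- move=> _; have zi : zeta i y < 1.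
  have := zeta_lt i y02; rewrite -/k k0 /hp expr0 => h.
  rewrite lt_neqAle; apply/andP; split; last by lra.
  apply/eqP => z1; have := strip_lt (proj2 (andP y02)).
  move: k0; rewrite /k /kap /minn; case: ltnP => is0 k0.
   by move: z1; rewrite k0 /zeta /hp expr0 mulr1 subrr /Num.min; case: ltP; lra.
  rewrite k0 /hp expr0; have : zeta i y <= y by rewrite /zeta ge_min lexx.
  by rewrite z1; lra.
 rewrite -[X in _ + X]mul1r -mulrDl -ler_pdivlMr// mul1r [leRHS]hpV natr1 ler_nat /key eqxx -/y -/k sE.
 by apply: truncn_lt_pow; rewrite zeta_ge0.
- have z1 := zeta_ge1 y02 k0; have i0 : (0 < i)%N by apply: leq_trans k0 (geq_minl _ _).
 have : hp i.+2 <= 8^-1.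
  by apply: le_trans (@hp_le 3 i.+2 _) _; rewrite ?ltnS// /hp exprVn -natrX.
 by lra.
- by lra.
- by lra.
- by move=> _; lra.
- by move=> k00; rewrite k00 in k0.
Qed.

(** In the vertical direction 12 = 4 + 8: the corner is at most four sides below [zeta i y], and
    this is at most 2 * 2^-i, that is eight sides, below y. *)
Lemma corner_near i j : `|x ord0 j - corner i (kap i y) (key i x) j| <= 12 * side i (kap i y) j.
Proof.
have s0 := side_gt0 i (kap i y) j.
case: (eqVneq j ord_max) => [->|jm]; last first.
 have [_ h1 h2 _] := corner_hor i jm.
 by rewrite ger0_norm ?subr_ge0//; lra.
have [_ h1 h2 _ _] := corner_ver i; rewrite /side /cexp eqxx.
have /andP[z1 z2] := zeta_near i y02.
have e : hp i = 4 * hp i.+2 by rewrite (hpS i) (hpS i.+1); ring.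
by rewrite -/y; rewrite e in z2; rewrite ger0_norm; lra.
Qed.

Lemma corner_step i j :
 `|corner i.+1 (kap i.+1 y) (key i.+1 x) j - corner i (kap i y) (key i x) j| <=
  (20 + 2 ^ (Num.truncn sigma).+3)%:R * side i.+1 (kap i.+1 y) j.
Proof.
set k := kap i.+1 y; have ki : (k <= i.+1)%N by exact: geq_minl.
have s0 := side_gt0 i.+1 k j.
case: (eqVneq j ord_max) => [->|jm].
 have [_ a1 a2 _ _] := corner_ver i; have [_ b1 b2 _ _] := corner_ver i.+1.
 have /andP[z1 z2] := zeta_step i y.
 rewrite -/k in b1 b2; rewrite /side /cexp eqxx natrD mulrDl.
 have q0 : 0 <= (2 ^ (Num.truncn sigma).+3)%:R * hp i.+3 by rewrite mulr_ge0// hp_ge0.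
 have e : hp i = 8 * hp i.+3 by rewrite (hpS i) (hpS i.+1) (hpS i.+2); ring.
 have e2 : hp i.+2 = 2 * hp i.+3 by rewrite (hpS i.+2).
 move: a1 a2 b1 b2 z1 z2 q0; rewrite e e2 ler_norml.
 by move: (hp_gt0 i.+3) => *; apply/andP; split; lra.
have [_ a1 a2 _] := corner_hor i jm; have [_ b1 b2 _] := corner_hor i.+1 jm.
have /andP[_ s1] := side_step j ki; rewrite -kap_par in s1.
have t0 : 0 <= 20 * side i.+1 k j by rewrite mulr_ge0// ltW.
have u0 : side i.+1 k j <= (2 ^ (Num.truncn sigma).+3)%:R * side i.+1 k j.
 by rewrite ler_peMl ?(ltW s0)// ler1n expn_gt0.
rewrite natrD mulrDl ler_norml; rewrite -/k in b1 b2.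
by apply/andP; split; lra.
Qed.

End InBox.

End Boxes.

End Grid.

(** * Counting boxes and bounded overlap *)

Section Overlap.

(** Two indices close to the same real centre differ by at most 2K in each coordinate. Subtracting
    the coordinatewise minimum over A injects A into a cube with 2K + 1 points per edge. *)
Lemma box_count (R : realType) (d : nat) (T : finType) (A : {pred T}) (z : T -> 'I_d -> nat)
  (c : 'I_d -> R) (K : nat) :
 (forall t t', z t =1 z t' -> t = t') ->
 (forall t j, t \in A -> `|(z t j)%:R - c j| <= K%:R) -> (#|A| <= (K.*2.+1) ^ d)%N.
Proof.
move=> zinj zc; have [t0 At0|A0] := pickP [pred t in A]; last by rewrite eq_card0// => t; exact: A0.
pose b j := z [arg min_(t < t0 in A) z t j] j.
have bP t j : t \in A -> (b j <= z t j)%N /\ (z t j - b j < K.*2.+1)%N.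
 move=> At; rewrite /b; case: arg_minnP => // u Au mu.
 split; first exact: mu.
 rewrite ltnS -(ler_nat R) natrB ?mu//.
 have := zc t j At; have := zc u j Au; rewrite !ler_norml => /andP[h1 h2] /andP[h3 h4].
 by rewrite -addnn natrD; lra.
pose F t : {ffun 'I_d -> 'I_(K.*2.+1)} := [ffun j => inord (z t j - b j)].
have Finj : {in A &, injective F}.
 move=> t t' At At' E; apply: zinj => j.
 have [b1 b2] := bP t j At; have [b3 b4] := bP t' j At'.
 have := congr1 (fun f : {ffun _ -> _} => val (f j)) E; rewrite !ffunE /= !inordK//.
 by move=> e; rewrite -(subnK b1) -(subnK b3) e.
rewrite -(card_in_image Finj) (leq_trans (max_card _))//.
by rewrite card_ffun !card_ord.
Qed.

Local Open Scope ereal_scope.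

Lemma overlap_sum (R : realType) (d : measure_display) (T : measurableType d)
  (mu : {measure set T -> \bar R}) (I : finType) (E : I -> set T) (D : set T) (K : nat)
  (F : T -> \bar R) :
 (forall i, measurable (E i)) -> measurable D -> (forall i, E i `<=` D) ->
 measurable_fun D F -> (forall x, D x -> 0 <= F x) ->
 (forall x, (#|[pred i | `[< E i x >]]| <= K)%N) ->
 \sum_i \int[mu]_(x in E i) F x <= K%:R%:E * \int[mu]_(x in D) F x.
Proof.
move=> mE mD ED mF F0 hK.
have -> : \sum_i \int[mu]_(x in E i) F x = \sum_i \int[mu]_(x in D) (F \_ (E i)) x.
 apply: eq_bigr => i _; rewrite -integral_mkcondl; congr (integral _ _ _).
 by rewrite setIidl//; exact: ED.
have mFE i : measurable_fun D (F \_ (E i)).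
 apply/measurable_restrict => //; apply: measurable_funS mF => //; exact: subIsetl.
rewrite -ge0_integral_sum//; last first.
 by move=> i x Dx; rewrite patchE; case: ifPn => // _; exact: F0.
rewrite -ge0_integralZl//.
apply: ge0_le_integral => //.
- by move=> x Dx; apply: sume_ge0 => i _; rewrite patchE; case: ifPn => // _; exact: F0.
- exact: emeasurable_sum.
- exact: measurable_funeM.
move=> x Dx; rewrite (bigID (fun i => `[< E i x >]))/= [X in _ + X]big1 ?adde0; last first.
 move=> i /asboolPn Ex; rewrite patchE; case: ifPn => // /set_mem//.
rewrite (eq_bigr (fun=> F x)); last by move=> i /asboolP Ex; rewrite patchE mem_set.
have -> : (\sum_(i | `[< E i x >]) F x = (\sum_(i | `[< E i x >]) 1%:E) * F x)%E.
 by rewrite ge0_sume_distrl//; apply: eq_bigr => i _; rewrite mul1e.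
rewrite sumEFin sumr_const.
by apply: lee_wpmul2r; [exact: F0|rewrite lee_fin ler_nat; exact: (hK x)].
Qed.

End Overlap.

Section RowNorm.
Variable R : realType.
Variable n : nat.
Implicit Types x y : 'rV[R]_n.

Lemma rv_norm_leP x b : 0 <= b -> reflect (forall j, `|x ord0 j| <= b) (`|x| <= b).
Proof.
move=> b0; have -> : `|x| = mx_norm x by [].
rewrite mx_normrE; apply: (iffP idP).
 by move=> /bigmax_leP[_ h] j; exact: (h (ord0, j)).
by move=> h; apply/bigmax_leP; split => // -[i j] _ /=; rewrite ord1.
Qed.

Lemma rv_coord_le x j : `|x ord0 j| <= `|x|.
Proof. by move: j; apply/rv_norm_leP. Qed.

End RowNorm.

(** * Numerical inequalities for positions and numbers of boxes *)

Section HullNumbers.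
Variable R : realType.
Implicit Types a b c v w y z l : R.

Lemma hull_num1 c v z z1 : c + 2 * v <= z - 2 * (2 * v) -> 0 <= z1 - z -> 0 < v ->
 c + 2 * v <= z1 - 2 * v.
Proof. lra. Qed.

Lemma hull_num2 c v z1 : c <= 0 -> v = 8^-1 -> 1 <= z1 -> c + 2 * v <= z1 - 2 * v.
Proof. move=> ? -> ?; lra. Qed.

Lemma hull_num3 w y z v : w < z - 2 * v -> y < 2 -> z <= y -> 0 < v ->
 [/\ w < 2, 0 <= 2 - w, 0 <= 2 - y, 0 <= 2 - z + 2 * v & 2 - z + 2 * v <= 2 - w].
Proof. by move=> *; split; lra. Qed.

Lemma hull_num4 a b c l (Z S T : R) : a <= b + c -> b < Z -> c <= l -> Z + l <= S ->
 S <= T -> a < T.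
Proof. lra. Qed.

Lemma hull_num5 w : w < 1 -> 1 < 2 - w.
Proof. lra. Qed.

Lemma minn_eq0l (i k : nat) : minn i k = 0%N -> (0 < k)%N -> i = 0%N.
Proof. lia. Qed.

End HullNumbers.

Lemma hull_num6 (R : realType) (a1 a2 h1 h2 P D w : R) :
 Num.min a1 a2 + h2 / 4 <= w -> w <= Num.max (a1 + h1) (a2 + h2) - h2 / 4 ->
 D * h2 + 20 * h2 = P * h2 -> h2 <= h1 -> h1 <= D * h2 -> 0 < h2 -> `|a2 - a1| <= P * h2 ->
 `|w - a2| <= P * h2 + P * h2.
Proof.
rewrite /Num.min /Num.max !ler_norml.
by case: ltP => ?; case: ltP => ? ? ? ? ? ? ? /andP[? ?]; apply/andP; split; lra.
Qed.

Lemma count_num1 (R : realType) (z v ze u hk D K : R) : 0 < v -> u = 2 * hk -> hk = D * v ->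
 2 - u <= ze -> ze <= 2 - hk -> (D + 1) * v <= K * v -> z * v <= ze < (z + 1) * v ->
 `|z - (2 - u) / v| <= K.
Proof.
move=> v0 uE hE z1 z2 hK /andP[z3 z4].
have -> : z - (2 - u) / v = (z * v - (2 - u)) / v by field; rewrite gt_eqF.
rewrite normrM normfV (gtr0_norm v0) ler_pdivrMr// ler_norml.
by rewrite !mulrDl !mul1r in hK z4; apply/andP; split; lra.
Qed.

Lemma count_num2 (R : realType) (z h x w de D K : R) : 0 < h -> `|x - w| < 3 * de ->
 de <= D * h -> (3 * D + 1) * h <= K * h -> z * h <= x < (z + 1) * h ->
 `|z - w / h| <= K.
Proof.
move=> h0 xw dD hK /andP[z3 z4].
have -> : z - w / h = (z * h - w) / h by field; rewrite gt_eqF.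
rewrite normrM normfV (gtr0_norm h0) ler_pdivrMr// ler_norml.
move: xw; rewrite ltr_norml => /andP[? ?].
by rewrite !mulrDl !mul1r in hK z4; apply/andP; split; lra.
Qed.

Lemma hull_num7 (R : realType) (z h u w P : R) : `|w - (z - u)| <= P * h -> 0 <= u <= 3 * h ->
 `|z - w| <= (P + 3) * h.
Proof.
by rewrite !ler_norml mulrDl => /andP[? ?] /andP[? ?]; apply/andP; split; lra.
Qed.

Lemma count_num3 (R : realType) (b z u : R) : 2 - u <= z -> z <= b -> 2 - b <= u.
Proof. lra. Qed.

Lemma count_num4 (R : realType) (a b c d : R) : a <= b + c -> b < 2 * d -> c < d -> a < 3 * d.
Proof. lra. Qed.

Lemma count_num5 (R : realType) (e S T : R) (s k t : R) : e <= s * k + 1 -> s < S ->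
 s - k * s <= S + 3 + t - (e + 2 + t).
Proof. lra. Qed.

Lemma count_num6 (R : realType) (cs b T M P : R) : 0 <= P -> 0 <= T ->
 cs * (b * T * M) * P <= (b * M * cs + 1) * (P * T).
Proof.
move=> P0 T0; rewrite mulrDl mul1r (_ : cs * (b * T * M) * P = b * M * cs * (P * T)); last by ring.
by rewrite lerDl mulr_ge0.
Qed.

Lemma count_nat1 S t : ((2 ^ (S + 5 + t)).*2.+1 <= 2 ^ (S + 7) * 2 ^ t)%N.
Proof.
rewrite -expnD (_ : (S + 7 + t = (S + 5 + t).+2)%N); last by lia.
by have := expn_gt0 2 (S + 5 + t); rewrite !expnS; lia.
Qed.

Lemma count_nat2 S t : (2 ^ t.+2 + 1 <= 2 ^ (S + 5 + t))%N.
Proof.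
rewrite (@leq_trans (2 ^ t.+3))//; last by rewrite leq_exp2l//; lia.
by rewrite [leqRHS]expnS; have := expn_gt0 2 t.+2; lia.
Qed.

Lemma count_nat3 S t : (3 * 2 ^ (S + 3 + t) + 1 <= 2 ^ (S + 5 + t))%N.
Proof.
rewrite (_ : (S + 5 + t = (S + 3 + t).+2)%N); last by lia.
by have := expn_gt0 2 (S + 3 + t); rewrite !expnS; lia.
Qed.

(** * L_p norms and local integrals *)

Section LpTools.
Variables (R : realType) (n : nat).
Local Notation leb := (lebesgue_rV R n).
Implicit Types (Omega D : set 'rV[R]_n) (f g : 'rV[R]_n -> R).

Lemma Lp_norm_fin_measurable Omega p f : (Lp_norm Omega p f < +oo)%E -> measurable_on Omega f.
Proof. by rewrite /Lp_norm; case: asboolP. Qed.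

Lemma Lp_norm_le_measurable Omega p f (A : R) : (Lp_norm Omega p f <= A%:E)%E ->
 measurable_on Omega f.
Proof. by move=> h; apply: (@Lp_norm_fin_measurable Omega p); apply: le_lt_trans h (ltry _). Qed.

Lemma measurable_onP Omega f : measurable Omega -> measurable_on Omega f ->
 measurable_fun Omega f.
Proof. by move=> mO mf; exact: measurable_onS mf mO (@subset_refl _ _). Qed.

Lemma measurable_on_funP Omega f : measurable Omega -> measurable_fun Omega f ->
 measurable_on Omega f.
Proof. by move=> mO mf; apply/(measurable_restrictT _ mO). Qed.

Lemma Lp_norm_le_int Omega f (r A : R) : 0 < r -> 0 <= A -> measurable_on Omega f ->
 (Lp_norm Omega r%:E f <= A%:E)%E =
 (\int[leb]_(x in Omega) (`|f x| `^ r)%:E <= (A `^ r)%:E)%E.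
Proof.
move=> r0 A0 mf; rewrite /Lp_norm asboolT//.
have -> : (\int[leb]_(x in Omega) (`|f x| `^ r)%:E =
  'N[leb]_(r%:E)[EFin \o f \_ Omega] `^ r)%E.
 rewrite poweR_Lnorm ?gt_eqF// [LHS]integral_mkcond; apply: eq_integral => x _.
 rewrite /= -poweR_EFin /= !patchE; case: ifPn => //.
 by rewrite /= normr0 powR0// gt_eqF.
have N0 := Lnorm_ge0 leb r%:E (EFin \o f \_ Omega).
rewrite -poweR_EFin; apply/idP/idP => h.
 apply: gt0_ler_poweR => //; first exact: ltW.
 - by rewrite in_itv/= leey N0.
 - by rewrite in_itv/= leey lee_fin A0.
rewrite leNgt; apply/negP => h2.
have : (A%:E `^ r < 'N[leb]_(r%:E)[EFin \o f \_ Omega] `^ r)%E.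
 move: N0 h2; case: ('N[leb]_(r%:E)[EFin \o f \_ Omega])%E => [u| |]//=.
  rewrite !lee_fin lte_fin => u0 Au; rewrite lte_fin; apply: gt0_ltr_powR => //.
 by move=> _ _; rewrite ifF ?ltry// gt_eqF.
by rewrite ltNge h.
Qed.

Lemma Lp_norm_le_ae Omega f (A : R) : 0 <= A -> measurable_on Omega f ->
 (Lp_norm Omega +oo f <= A%:E)%E <->
 {ae leb, forall x, Omega x -> `|f x| <= A}.
Proof.
move=> A0 mf; rewrite /Lp_norm asboolT// unlock.
have e : {ae leb, forall x, Omega x -> `|f x| <= A} <->
  {ae leb, forall x, ((abse \o (EFin \o f \_ Omega)) x <= A%:E)%E}.
 split; apply: filterS => x /=; rewrite patchE; case: ifPn => //.
 - by move=> /set_mem xO /(_ xO).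
 - by rewrite normr0 lee_fin.
 - by move=> /negP xO _ /mem_set.
rewrite e; case: ifPn => [_|h]; first by split => /ess_sup_inf.ess_supP.
(* The remaining case is a space of measure 0, where the norm is 0 by convention. *)
split=> _; last by rewrite lee_fin.
have h0 : leb setT = 0%E by apply/eqP; rewrite eq_le measure_ge0 andbT leNgt.
by exists setT; split.
Qed.

Lemma Lp_norm_ae_le Omega p f g : measurable Omega -> (1 <= p)%E -> measurable_on Omega f ->
 measurable_on Omega g -> {ae leb, forall x, Omega x -> `|f x| <= `|g x|} ->
 (Lp_norm Omega p f <= Lp_norm Omega p g)%E.
Proof.
move=> mO p1 mf mg fg; have := Lp_norm_ge0 Omega p g.
case E : (Lp_norm Omega p g) => [A| |]// A0; last by rewrite leey.
case: p p1 E => [r| |]// p1 E.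
 have r0 : 0 < r by apply: (@lt_le_trans _ _ 1).
 have EA : (Lp_norm Omega r%:E g <= A%:E)%E by rewrite E.
 rewrite Lp_norm_le_int// in EA; rewrite Lp_norm_le_int//; apply: le_trans EA.
 have mpow h : measurable_on Omega h -> measurable_fun Omega (fun x => (`|h x| `^ r)%:E).
  move=> mh; apply/measurable_EFinP.
  apply: (@measurableT_comp _ _ _ _ _ _ (fun t : R => t `^ r)); first exact: measurable_powR.
  by apply: measurableT_comp => //; exact: measurable_onP.
 apply: ae_ge0_le_integral => //; try exact: mpow.
 by apply: filterS fg => x h xO; rewrite lee_fin ge0_ler_powR ?nnegrE ?h// ltW.
have EA : (Lp_norm Omega +oo g <= A%:E)%E by rewrite E.
apply/Lp_norm_le_ae => //; have /(Lp_norm_le_ae A0 mg) := EA.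
apply: filterS2 fg => x h1 h2 xO; exact: le_trans (h1 xO) (h2 xO).
Qed.

Lemma powR_split (a r : R) : 0 < a -> a `^ r = a * a `^ (r - 1).
Proof.
move=> a0; rewrite -{2}(powRr1 (ltW a0)) -(@powRD _ a 1 (r - 1)) ?subrKC//.
by rewrite (gt_eqF a0) implybT.
Qed.

Lemma powRVl (a r : R) : 0 <= a -> a^-1 `^ r = (a `^ r)^-1.
Proof. by move=> a0; rewrite -powR_inv1// -powRrM mulN1r powRN. Qed.

Lemma coef_lp_num (X V l t r : R) : 0 < X -> 0 < V -> 0 < r -> l = X / (2 * V) ->
 X / 2 <= l `^ (1 - r) * t -> X `^ r <= 2 `^ r * V `^ (r - 1) * t.
Proof.
move=> X0 V0 r0 lE h; have l0 : 0 < l by rewrite lE divr_gt0// mulr_gt0.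
have h1 : X / 2 * l `^ (r - 1) <= t.
 by rewrite -(opprB 1 r) powRN ler_pdivrMr ?powR_gt0// [leRHS]mulrC.
have -> : X `^ r = 2 `^ r * V `^ (r - 1) * (X / 2 * l `^ (r - 1)).
 rewrite lE [in RHS]powRM ?invr_ge0 ?mulr_ge0 ?ltW// powRVl ?mulr_ge0 ?ltW//.
 rewrite (@powRM _ 2)// ?ltW// (powR_split r X0) (@powR_split 2 r)//.
 by field; rewrite ?gt_eqF ?powR_gt0.
by rewrite ler_wpM2l// mulr_ge0// powR_ge0.
Qed.

(** Either u <= l, or u <= u (u/l)^(r-1). The threshold l is left free for an optimization in
    [coef_lp]. *)
Lemma young_split (u l r : R) : 0 <= u -> 0 < l -> 1 <= r -> u <= l + l `^ (1 - r) * u `^ r.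
Proof.
move=> u0 l0 r1; have [ul|lu] := leP u l.
 by rewrite ler_wpDr// mulr_ge0// powR_ge0.
rewrite ler_wpDl ?(ltW l0)//; have u1 : 0 < u by apply: lt_trans lu.
have -> : l `^ (1 - r) * u `^ r = u * (u / l) `^ (r - 1).
 rewrite powRM ?invr_ge0 ?ltW// -powR_inv1 ?ltW// -powRrM mulN1r opprB.
 by rewrite (powR_split r u1); ring.
by rewrite ler_peMr// powR_ge1 ?subr_ge0// ler_pdivlMr// mul1r ltW.
Qed.

(** The local inequality X_i <= 2 V^(1 - 1/p) |g|_p on E_i, summed with bounded overlap. It comes
    from Young's inequality with the threshold X_i/(2V), which absorbs half of X_i; hence the factor
    2. *)
Lemma coef_lp p (I : finType) (E : I -> set 'rV[R]_n) Omega (K : nat) (V A : R) g (X : I -> R) :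
 (1 <= p)%E -> (0 < K)%N -> 0 < V -> 0 <= A ->
 (forall i, measurable (E i)) -> (forall i, E i `<=` Omega) -> measurable Omega ->
 (forall x, (#|[pred i | `[< E i x >]]| <= K)%N) -> (forall i, (leb (E i) <= V%:E)%E) ->
 (Lp_norm Omega p g <= A%:E)%E -> (forall i, 0 <= X i) ->
 (forall i, ((X i)%:E <= \int[leb]_(x in E i) `|g x|%:E)%E) ->
 lpn p X <= 2 * K%:R * V `^ (1 - recip p) * A.
Proof.
move=> p1 K0 V0 A0 mE EO mO ovl EV gA X0 hX.
have mg := Lp_norm_le_measurable gA; have mgO := measurable_onP mO mg.
have mgE i : measurable_fun (E i) g by apply: measurable_funS mgO.
have mag i : measurable_fun (E i) (fun x => `|g x|%:E).
 by apply/measurable_EFinP; exact: measurableT_comp.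
case: p p1 gA => [r| |]// p1 gA; last first.
 have /(Lp_norm_le_ae A0 mg) gae := gA; rewrite /lpn /= recipy subr0 powRr1 ?(ltW V0)//.
 have XA i : X i <= A * V.
  rewrite -lee_fin; apply: le_trans (hX i) _.
  apply: (@le_trans _ _ (\int[leb]_(x in E i) (cst A%:E) x)%E).
   apply: ae_ge0_le_integral => //.
   by apply: filterS gae => x h /EO xO; rewrite lee_fin h.
  rewrite integral_cst// EFinM; apply: lee_wpmul2l; [by rewrite lee_fin|exact: EV].
 apply/bigmax_leP; split.
  by rewrite !mulr_ge0 ?(ltW V0).
 move=> i _; rewrite ger0_norm//; apply: le_trans (XA i) _.
 have h2 : 1 <= 2 * K%:R :> R by rewrite -natrM ler1n muln_gt0.
 by rewrite -mulrA (mulrC V) ler_peMl// mulr_ge0 ?(ltW V0).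
have r1 : 1 <= r by exact: p1.
have r0 : 0 < r by apply: lt_le_trans r1.
have gA' := gA; rewrite Lp_norm_le_int// in gA'.
have mpow : measurable_fun Omega (fun x => (`|g x| `^ r)%:E).
 apply/measurable_EFinP.
 apply: (@measurableT_comp _ _ _ _ _ _ (fun t : R => t `^ r)); first exact: measurable_powR.
 exact: measurableT_comp.
have Jle : (\sum_i \int[leb]_(x in E i) (`|g x| `^ r)%:E <= (K%:R * A `^ r)%:E)%E.
 apply: le_trans (overlap_sum leb mE mO EO mpow _ ovl) _.
  by move=> x _; rewrite lee_fin powR_ge0.
 by rewrite EFinM lee_wpmul2l// lee_fin.
have J0 i : (0 <= \int[leb]_(x in E i) (`|g x| `^ r)%:E)%E.
 by apply: integral_ge0 => x _; rewrite lee_fin powR_ge0.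
have Jfin i : (\int[leb]_(x in E i) (`|g x| `^ r)%:E \is a fin_num)%E.
 rewrite ge0_fin_numE//; apply: le_lt_trans (ltry (K%:R * A `^ r)); apply: le_trans Jle.
 by rewrite (bigD1 i)//= leeDl// sume_ge0.
pose t i := fine (\int[leb]_(x in E i) (`|g x| `^ r)%:E)%E.
have tE i : ((t i)%:E = \int[leb]_(x in E i) (`|g x| `^ r)%:E)%E by rewrite fineK.
have t0 i : 0 <= t i by rewrite -lee_fin tE.
have st : \sum_i t i <= K%:R * A `^ r.
 by rewrite -lee_fin -sumEFin (eq_bigr _ (fun i _ => tE i)).
have Xt i : X i `^ r <= 2 `^ r * V `^ (r - 1) * t i.
 have := X0 i; rewrite le_eqVlt => /orP[/eqP <-|Xi0].
  by rewrite powR0 ?gt_eqF// !mulr_ge0// powR_ge0.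
 pose l := X i / (2 * V).
 have l0 : 0 < l by rewrite divr_gt0// mulr_gt0.
 apply: (@coef_lp_num _ V l _ _ Xi0 V0 r0 erefl).
 have : X i <= l * V + l `^ (1 - r) * t i.
  rewrite -lee_fin; apply: le_trans (hX i) _.
  have mpowE : measurable_fun (E i) (fun x => (`|g x| `^ r)%:E) by apply: measurable_funS mpow.
  apply: (@le_trans _ _ (\int[leb]_(x in E i) (l%:E + (l `^ (1 - r))%:E * (`|g x| `^ r)%:E))%E).
   apply: ge0_le_integral => //.
   - by apply: emeasurable_funD => //; apply: measurable_funeM.
   by move=> x _; rewrite -EFinM -EFinD lee_fin young_split.
  rewrite ge0_integralD//; last 3 first.
  - by move=> x _; rewrite lee_fin ltW.
  - by move=> x _; rewrite -EFinM lee_fin mulr_ge0// powR_ge0.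
  - exact: measurable_funeM.
  rewrite ge0_integralZl//; last first.
  - by rewrite lee_fin powR_ge0.
  rewrite (_ : (\int[leb]_(_ in E i) l%:E = l%:E * leb (E i))%E); last by exact: integral_cst.
  rewrite EFinD -tE -EFinM; apply: leeD => //.
  rewrite (_ : (l * V)%:E = (l%:E * V%:E)%E)//.
  by apply: lee_wpmul2l; [rewrite lee_fin ltW|exact: EV].
 have lV : l * V = X i / 2 by rewrite /l; field; rewrite gt_eqF.
 by rewrite lV => hh; rewrite {1}(splitr (X i)) lerD2l in hh.
rewrite /lpn /= recip_fin ?gt_eqF//.
apply: (@le_trans _ _ ((2 `^ r * V `^ (r - 1) * (K%:R * A `^ r)) `^ r^-1)).
 apply: ge0_ler_powR; rewrite ?nnegrE ?invr_ge0 ?(ltW r0)//.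
 - by apply: sumr_ge0 => i _; rewrite powR_ge0.
 - by rewrite !mulr_ge0 ?powR_ge0.
 apply: (@le_trans _ _ (\sum_i 2 `^ r * V `^ (r - 1) * t i)).
  by apply: ler_sum => i _; rewrite ger0_norm.
 by rewrite -mulr_sumr ler_wpM2l// mulr_ge0// powR_ge0.
rewrite !powRM ?mulr_ge0 ?powR_ge0// -!powRrM divff ?gt_eqF// !powRr1//.
have -> : (r - 1) / r = 1 - r^-1 by rewrite mulrBl mul1r divff ?gt_eqF.
rewrite mulrA; apply: ler_wpM2r => //; rewrite -!mulrA; apply: ler_wpM2l => //.
rewrite mulrC; apply: ler_wpM2r; first exact: powR_ge0.
rewrite -{2}(@powRr1 _ K%:R)//; apply: ler_powR; first by rewrite ler1n.
by rewrite invf_le1.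
Qed.

End LpTools.

(** * Averaged Taylor polynomials in Lagrange form *)

Section Interpolation.
Variables (R : realType) (n : nat).
Local Notation leb := (lebesgue_rV R n).
Implicit Types (Omega : set 'rV[R]_n) (f : 'rV[R]_n -> R) (a h b l x : 'I_n -> R).

Definition own_box a h : set 'rV[R]_n := cbox (fun i => a i + h i / 4) (fun i => a i + 3 * h i / 4).

Lemma taylor_integrable Omega s f a h x : measurable Omega -> L1loc Omega f ->
 (forall i, 0 < h i) -> own_box a h `<=` Omega ->
 leb.-integrable Omega (EFin \o (fun y => f y * taylor_tensor s a h x y)).
Proof.
by move=> mO lf h0 bO; apply: L1loc_test_integrable => //; exact: taylor_tensor_test.
Qed.

Lemma taylor_lagrange Omega s f a h b l x : measurable Omega -> L1loc Omega f ->
 (forall i, 0 < h i) -> own_box a h `<=` Omega -> (forall i, 0 < l i) ->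
 taylor Omega s f a h x = \sum_(nu : {ffun 'I_n -> 'I_s.+1})
  taylor Omega s f a h (fun j => b j + l j * (nu j)%:R) *
  \prod_j (lagrange_nat R (nu j)).[(x j - b j) / l j].
Proof.
move=> mO lf h0 bO l0; rewrite /taylor.
have -> : (fun y => f y * taylor_tensor s a h x y) = (fun y => \sum_(nu : {ffun 'I_n -> 'I_s.+1})
  (\prod_j (lagrange_nat R (nu j)).[(x j - b j) / l j]) *
  (f y * taylor_tensor s a h (fun j => b j + l j * (nu j)%:R) y)).
 apply/funext => y; rewrite /taylor_tensor /tensor.
 rewrite (eq_bigr _ (fun i _ => taylor_ker_lagrange s (a i) (h i) (b i) (x i) (y ord0 i) (l0 i))).
 rewrite bigA_distr_bigA mulr_sumr; apply: eq_bigr => nu _.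
 by rewrite big_split/=; ring.
rewrite Rintegral_sum//; last first.
 move=> nu; exact: (integrableZl mO _
  (taylor_integrable s (fun j => b j + l j * (nu j)%:R) mO lf h0 bO)).
apply: eq_bigr => nu _; rewrite RintegralZl// 1?mulrC//.
exact: taylor_integrable.
Qed.

Lemma taylor_bound s (K : R) : exists2 C, 0 <= C & forall Omega f a h x,
 measurable Omega -> L1loc Omega f -> (forall i, 0 < h i) ->
 (forall i, `|x i - a i| <= K * h i) -> own_box a h `<=` Omega ->
 `|taylor Omega s f a h x| <= C * (\prod_i h i)^-1 * \int[leb]_(y in own_box a h) `|f y|.
Proof.
have [C C0 hC] := taylor_ker_bound s K; exists (C ^+ n); first exact: exprn_ge0.
move=> Omega f a h x mO lf h0 xa bO.
have P0 : 0 < \prod_i h i by apply: prodr_gt0.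
apply: Rint_mul_le => //.
- exact: cbox_compact.
- by rewrite mulr_ge0 ?exprn_ge0// invr_ge0 ltW.
- exact: taylor_integrable.
- move=> y _; rewrite /taylor_tensor /tensor normr_prod.
 apply: (@le_trans _ _ (\prod_i (C / h i))).
  by apply: ler_prod => i _; rewrite normr_ge0 hC.
 by rewrite prodf_div prodr_const card_ord.
move=> y /existsNP[i hi]; rewrite /taylor_tensor /tensor (bigD1 i)//= taylor_ker_eq0 ?mul0r//.
by move/negP : hi; rewrite negb_and -!ltNge.
Qed.

Lemma taylorD Omega s f g a h x : measurable Omega -> L1loc Omega f -> L1loc Omega g ->
 (forall i, 0 < h i) -> own_box a h `<=` Omega ->
 taylor Omega s (f + g) a h x = taylor Omega s f a h x + taylor Omega s g a h x.
Proof.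
move=> mO lf lg h0 bO; rewrite /taylor -RintegralD//; try exact: taylor_integrable.
by apply: eq_Rintegral => y _; rewrite mulrDl.
Qed.

Lemma taylorZ Omega s f (c : R) a h x : measurable Omega -> L1loc Omega f ->
 (forall i, 0 < h i) -> own_box a h `<=` Omega ->
 taylor Omega s (c *: f) a h x = c * taylor Omega s f a h x.
Proof.
move=> mO lf h0 bO; rewrite /taylor -RintegralZl//; last exact: taylor_integrable.
by apply: eq_Rintegral => y _; rewrite mulrA.
Qed.

Lemma horner_continuous (p : {poly R}) : continuous (horner p).
Proof.
move=> x; apply: differentiable_continuous; apply/derivable1_diffP.
exact: derivable_horner.
Qed.

Lemma lagrange_nat_bound s (K : R) : exists2 M, 1 <= M &
 forall (i : 'I_s) (x : R), `|x| <= K -> `|(@lagrange_nat R s i).[x]| <= M.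
Proof.
have /choice[M hM] : forall i : 'I_s, exists M, 0 <= M /\
  forall x : R, `|x| <= K -> `|(@lagrange_nat R s i).[x]| <= M.
 move=> i; have [M M0 hM] := continuous_bounded_itv K (@horner_continuous (@lagrange_nat R s i)).
 by exists M.
exists (1 + \sum_i M i).
 by rewrite lerDl sumr_ge0// => i _; have [] := hM i.
move=> i x xK; have [Mi0 /(_ _ xK) h] := hM i; apply: le_trans h _.
rewrite (bigD1 i)//= addrCA lerDl addr_ge0// sumr_ge0// => j _.
by have [] := hM j.
Qed.

End Interpolation.

(** * Sums with few nonzero terms *)

Section SparseSums.
Variables (R : realType) (I : finType).
Implicit Types (u : I -> R).

Lemma sum_le_max u (N : nat) : (forall i, 0 <= u i) -> (#|[pred i | u i != 0%R]| <= N)%N ->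
 \sum_i u i <= N%:R * \big[Num.max/0]_i u i.
Proof.
move=> u0 uN; rewrite (bigID [pred i | u i != 0])/= [X in _ + X]big1 ?addr0; last first.
 by move=> i; rewrite negbK => /eqP.
apply: (@le_trans _ _ (\sum_(i | u i != 0) \big[Num.max/0]_i u i)).
 by apply: ler_sum => i _; exact: le_bigmax.
rewrite sumr_const -[leLHS]mulr_natl; apply: ler_wpM2r; last by rewrite ler_nat.
by elim/big_ind : _ => // x y x0 y0; rewrite le_max x0.
Qed.

Lemma max_powR_le u (r : R) : 0 < r -> (forall i, 0 <= u i) ->
 (\big[Num.max/0]_i u i) `^ r <= \sum_i u i `^ r.
Proof.
move=> r0 u0; elim/big_ind : _ => [|x y hx hy|i _].
- by rewrite powR0 ?gt_eqF// sumr_ge0// => i _; exact: powR_ge0.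
- by rewrite /Num.max; case: ifP.
by rewrite (bigD1 i)//= lerDl sumr_ge0// => j _; exact: powR_ge0.
Qed.

Lemma lpn_le_card (p : \bar R) (v : I -> R) (b : R) : (1 <= p)%E -> 0 <= b ->
 (forall i, `|v i| <= b) -> lpn p v <= #|I|.+1%:R * b.
Proof.
move=> p1 b0 hb; have N1 : 1 <= #|I|.+1%:R :> R by rewrite ler1n.
case: p p1 => [r| |]// p1; last first.
 rewrite /lpn; apply/bigmax_leP; split; first by rewrite mulr_ge0.
 by move=> i _; apply: le_trans (hb i) _; rewrite ler_peMl.
have r1 : 1 <= r by exact: p1.
have r0 : 0 < r by apply: lt_le_trans r1.
have rV0 : 0 <= r^-1 by rewrite invr_ge0 ltW.
rewrite /lpn; apply: (@le_trans _ _ ((#|I|.+1%:R * b `^ r) `^ r^-1)).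
 apply: ge0_ler_powR; rewrite ?nnegrE ?mulr_ge0 ?powR_ge0//.
  by apply: sumr_ge0 => i _; rewrite powR_ge0.
 apply: (@le_trans _ _ (\sum_(i : I) b `^ r)).
  by apply: ler_sum => i _; rewrite ge0_ler_powR ?nnegrE// ltW.
 rewrite sumr_const -[leLHS]mulr_natl; apply: ler_wpM2r; first exact: powR_ge0.
 by rewrite ler_nat.
rewrite powRM ?powR_ge0// -powRrM divff ?gt_eqF// powRr1// ler_wpM2r//.
rewrite -{2}(@powRr1 _ #|I|.+1%:R)//; apply: ler_powR => //.
by rewrite invf_le1.
Qed.

End SparseSums.

(** * Integrals of tensor products *)

Section TensorIntegral.
Variable R : realType.
Local Open Scope ereal_scope.

Lemma tensor_cons n (F : 'I_n.+1 -> R -> R) (z : R) (v : 'rV[R]_n) :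
 tensor F (rV_cons (z, v)) = (F ord0 z * tensor (fun i => F (lift ord0 i)) v)%R.
Proof.
rewrite /tensor big_ord_recl /rV_cons !mxE unlift_none/=; congr (_ * _)%R.
by apply: eq_bigr => i _; rewrite mxE liftK.
Qed.

Lemma tensor_measurable n (F : 'I_n -> R -> R) : (forall i, measurable_fun setT (F i)) ->
 measurable_fun setT (tensor F).
Proof.
move=> mF; apply: measurable_prod => i _; apply: measurableT_comp => //.
exact: measurable_coord.
Qed.

(** Induction on the dimension: [lebesgue_rV] is the image of a product measure, so the step is a
    change of variables followed by Fubini's theorem. *)
Lemma tensor_integral n (F : 'I_n -> R -> R) (c : 'I_n -> R) :
 (forall i, lebesgue_measure.-integrable setT (EFin \o F i)) ->
 (forall i, \int[lebesgue_measure]_y (F i y)%:E = (c i)%:E) ->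
 (lebesgue_rV R n).-integrable setT (EFin \o tensor F) /\
 \int[lebesgue_rV R n]_x (tensor F x)%:E = (\prod_i c i)%:E.
Proof.
elim: n F c => [|n IH] F c iF hF.
 have e : EFin \o tensor F = cst 1 by apply/funext => x /=; rewrite /tensor big_ord0.
 split; first by rewrite e; apply: finite_measure_integrable_cst.
 by rewrite (_ : (fun x => _) = cst 1)// integral_cst//= diracT mul1e big_ord0.
have [iT hT] := IH _ (fun i => c (lift ord0 i)) (fun i => iF (lift ord0 i)) (fun i => hF (lift ord0 i)).
set T := tensor (fun i => F (lift ord0 i)) in iT hT.
have mF i : measurable_fun setT (F i) by have /measurable_int/measurable_EFinP := iF i.
have mT : measurable_fun setT T by apply: tensor_measurable.
pose G (z : R * 'rV[R]_n) := (F ord0 z.1 * T z.2)%R.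
have mG : measurable_fun setT (EFin \o G).
 apply/measurable_EFinP; apply: measurable_funM.
  by apply: measurableT_comp => //.
 by apply: measurableT_comp => //.
have TA : \int[lebesgue_rV R n]_y `|(T y)%:E| < +oo by case/integrableP : iT.
have iG : (lebesgue_measure \x lebesgue_rV R n).-integrable setT (EFin \o G).
 apply/integrable12ltyP => //.
 have -> : (fun x => \int[lebesgue_rV R n]_y `|(EFin \o G) (x, y)|) =
   (fun x => (\int[lebesgue_rV R n]_y `|(T y)%:E|) * `|(F ord0 x)%:E|).
  apply/funext => x; rewrite muleC -ge0_integralZl//.
  - by apply: eq_integral => y _; rewrite /G/= normrM EFinM.
  - by apply: measurableT_comp => //; exact: measurable_int iT.
 rewrite ge0_integralZl//.
 - rewrite lte_mul_pinfty ?integral_ge0//; first by rewrite ge0_fin_numE ?integral_ge0.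
  by case/integrableP : (iF ord0).
 - by apply: measurableT_comp => //; exact: measurable_int (iF ord0).
 - exact: integral_ge0.
have eG : (EFin \o tensor F) \o @rV_cons R n = EFin \o G.
 by apply/funext => -[z v]; rewrite /= tensor_cons.
have mTF : measurable_fun setT (EFin \o tensor F).
 by apply/measurable_EFinP; exact: tensor_measurable.
have mc : measurable_fun [set: measurableTypeR R * 'rV[R]_n] (@rV_cons R n) := @measurable_rV_cons R n.
split.
 apply/integrableP; split => //.
 have := @ge0_integral_pushforward _ _ _ _ R _ mc (lebesgue_measure \x lebesgue_rV R n)
  setT (fun x => `|(EFin \o tensor F) x|) measurableT _ _.
 rewrite preimage_setT => ->//.
 - by case/integrableP : iG => _; rewrite -eG.
 - exact: measurableT_comp.
have := @integral_pushforward _ _ _ _ R _ mc (lebesgue_measure \x lebesgue_rV R n)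
  setT (EFin \o tensor F) mTF _ measurableT.
rewrite preimage_setT eG => /(_ iG) ->.
rewrite -integral12_prod_meas1// big_ord_recl EFinM -(hF ord0) muleC -integralZl//.
 by apply: eq_integral => x _; rewrite /fubini_F/= -hT [RHS]muleC -integralZl.
exact: (iF ord0).
Qed.

End TensorIntegral.

Import HBSimple.

(** * Density of Lipschitz functions in L_1 *)

Section LipschitzDensity.
Variables (R : realType) (n : nat).
Local Notation leb := (lebesgue_rV R n).
Implicit Types (f g h : 'rV[R]_n -> R) (U A : set 'rV[R]_n).

Definition lipschitz_fun h := exists L : R, forall x y, `|h x - h y| <= L * `|x - y|.

Lemma lipschitz_continuous h : lipschitz_fun h -> continuous h.
Proof.
move=> [L hL] x V /nbhs_ballP[e /= e0 eV]; apply/nbhs_ballP.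
have L1 : 0 < `|L| + 1 by rewrite ltr_wpDl.
exists (e / (`|L| + 1)) => /=; first by rewrite divr_gt0.
move=> y; rewrite -ball_normE /= => xy; apply: eV; rewrite -ball_normE /=.
apply: le_lt_trans (hL x y) _.
apply: (@le_lt_trans _ _ ((`|L| + 1) * `|x - y|)).
 by rewrite ler_wpM2r// (le_trans (ler_norm L))// lerDl.
by rewrite mulrC -ltr_pdivlMr.
Qed.

Lemma lipschitz_cst (c : R) : lipschitz_fun (fun=> c).
Proof. by exists 0 => x y; rewrite subrr normr0 mul0r. Qed.

Lemma lipschitzD h g : lipschitz_fun h -> lipschitz_fun g -> lipschitz_fun (fun x => h x + g x).
Proof.
move=> [L hL] [L' hL']; exists (L + L') => x y.
rewrite (_ : _ - _ = (h x - h y) + (g x - g y)); last by ring.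
by rewrite mulrDl (le_trans (ler_normD _ _))// lerD.
Qed.

Lemma lipschitzZ (c : R) h : lipschitz_fun h -> lipschitz_fun (fun x => c * h x).
Proof.
move=> [L hL]; exists (`|c| * L) => x y.
by rewrite -mulrBr normrM -mulrA ler_wpM2l.
Qed.

Lemma dist_to_ge0 (x : 'rV[R]_n) A : A !=set0 -> 0 <= dist_to x A.
Proof.
move=> [a Aa]; apply: lb_le_inf; first by exists `|x - a|; exists a.
by move=> _ [y _ <-].
Qed.

Lemma dist_to_lip (x y : 'rV[R]_n) A : A !=set0 -> dist_to x A <= dist_to y A + `|x - y|.
Proof.
move=> A0; rewrite -lerBlDr; apply: lb_le_inf; first by have [a Aa] := A0; exists `|y - a|; exists a.
move=> _ [a Aa <-]; rewrite lerBlDr; apply: (@le_trans _ _ `|x - a|).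
 by apply: ge_inf; [exists 0 => _ [b _ <-]|exists a].
have -> : x - a = (x - y) + (y - a) by rewrite addrA subrK.
by rewrite [leRHS]addrC ler_normD.
Qed.

Lemma dist_to_gt0 (x : 'rV[R]_n) U : open U -> U x -> (~` U) !=set0 -> 0 < dist_to x (~` U).
Proof.
move=> oU Ux nU; have /nbhs_ballP[e /= e0 eU] : nbhs x U by exact: open_nbhs_nbhs.
apply: lt_le_trans e0 _; apply: lb_le_inf; first by have [a Aa] := nU; exists `|x - a|; exists a.
move=> _ [y nUy <-]; rewrite leNgt; apply/negP => h; apply: nUy; apply: eU.
by rewrite -ball_normE.
Qed.

(** Lipschitz functions that increase with k to the indicator of an open set U. *)
Definition bump U (k : nat) (x : 'rV[R]_n) : R := Num.min 1 (k%:R * dist_to x (~` U)).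

Lemma bump_lipschitz U k : (~` U) !=set0 -> lipschitz_fun (bump U k).
Proof.
move=> nU; exists k%:R => x y.
have key (u v : 'rV[R]_n) : bump U k u <= bump U k v + k%:R * `|u - v|.
 rewrite /bump addrC -lerBlDl le_min; apply/andP; split.
  by rewrite lerBlDl (@le_trans _ _ 1) ?ge_min ?lexx// lerDr mulr_ge0.
 rewrite lerBlDl (@le_trans _ _ (k%:R * dist_to u (~` U))) ?ge_min ?lexx ?orbT//.
 by rewrite -mulrDr ler_wpM2l// addrC dist_to_lip.
rewrite ler_norml; apply/andP; split; last by rewrite lerBlDl key.
by rewrite lerNl opprB lerBlDl distrC key.
Qed.

Lemma bump_cvg U x : open U -> (~` U) !=set0 -> (bump U k x @[k --> \oo] --> (\1_U x : R)).
Proof.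
move=> oU nU; rewrite indicE; have [Ux|nUx] := pselect (U x).
 rewrite mem_set//=; apply/cvgrPdist_le => e e0.
 have d0 := dist_to_gt0 oU Ux nU.
 exists (Num.truncn (dist_to x (~` U))^-1).+1 => // k /= hk.
 suff -> : bump U k x = 1 by rewrite subrr normr0 ltW.
 apply/eqP; rewrite eq_le ge_min lexx/= le_min lexx/=.
 rewrite -ler_pdivrMr// mul1r; apply: ltW; apply: lt_le_trans (truncnS_gt _) _.
 by rewrite ler_nat.
rewrite memNset//=; have -> : (fun k => bump U k x) = (fun=> 0); last exact: cvg_cst.
apply/funext => k; rewrite /bump; have -> : dist_to x (~` U) = 0.
 apply/eqP; rewrite eq_le dist_to_ge0// andbT; apply: ge_inf; first by exists 0 => _ [b _ <-].
 by exists x; rewrite ?subrr ?normr0.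
by rewrite mulr0; apply/eqP; rewrite eq_le ge_min lexx orbT le_min lexx ler01.
Qed.

Section Density.
Variable E : set 'rV[R]_n.
Hypotheses (mE : measurable E) (finE : (leb E < +oo)%E).

Definition l1dist f g : \bar R := (\int[leb]_(x in E) `|f x - g x|%:E)%E.

Definition lip_approx f := measurable_fun E f /\
 forall e : R, 0 < e -> exists2 h, lipschitz_fun h & (l1dist f h <= e%:E)%E.

Lemma lipschitz_measurable h D : lipschitz_fun h -> measurable_fun D h.
Proof.
move=> lh; apply: measurable_funTS; apply: continuous_measurable_rV.
exact: lipschitz_continuous.
Qed.

Lemma l1dist_measurable f g : measurable_fun E f -> measurable_fun E g ->
 measurable_fun E (fun x => `|f x - g x|%:E).
Proof.
by move=> mf mg; apply/measurable_EFinP; apply: measurableT_comp => //; exact: measurable_funB.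
Qed.

Lemma l1dist_tri f g h : measurable_fun E f -> measurable_fun E g -> measurable_fun E h ->
 (l1dist f h <= l1dist f g + l1dist g h)%E.
Proof.
move=> mf mg mh; rewrite /l1dist -ge0_integralD//; try exact: l1dist_measurable.
apply: ge0_le_integral => //; try exact: l1dist_measurable.
 by apply: emeasurable_funD; exact: l1dist_measurable.
move=> x _; rewrite -EFinD lee_fin (_ : f x - h x = (f x - g x) + (g x - h x)) ?ler_normD//.
by rewrite addrA subrK.
Qed.

Lemma lip_approx_lim f : measurable_fun E f ->
 (forall e : R, 0 < e -> exists2 g, lip_approx g & (l1dist f g <= e%:E)%E) -> lip_approx f.
Proof.
move=> mf hf; split => // e e0; have e20 : 0 < e / 2 by rewrite divr_gt0.
have [g [mg hg] fg] := hf _ e20; have [h lh gh] := hg _ e20; exists h => //.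
apply: le_trans (l1dist_tri mf mg (lipschitz_measurable lh)) _.
by rewrite (splitr e) EFinD leeD.
Qed.

Lemma lip_approxD f g : lip_approx f -> lip_approx g -> lip_approx (fun x => f x + g x).
Proof.
move=> [mf hf] [mg hg]; split; first exact: measurable_funD.
move=> e e0; have e20 : 0 < e / 2 by rewrite divr_gt0.
have [h lh fh] := hf _ e20; have [k lk gk] := hg _ e20.
exists (fun x => h x + k x); first exact: lipschitzD.
have mh := @lipschitz_measurable h E lh; have mk := @lipschitz_measurable k E lk.
apply: (@le_trans _ _ (l1dist f h + l1dist g k)%E); last by rewrite (splitr e) EFinD leeD.
rewrite /l1dist -ge0_integralD//; try exact: l1dist_measurable.
apply: ge0_le_integral => //.
- by apply: l1dist_measurable; exact: measurable_funD.
- by apply: emeasurable_funD; exact: l1dist_measurable.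
move=> x _; rewrite -EFinD lee_fin.
by rewrite (_ : f x + g x - (h x + k x) = (f x - h x) + (g x - k x)) ?ler_normD//; ring.
Qed.

Lemma lip_approxZ (c : R) f : lip_approx f -> lip_approx (fun x => c * f x).
Proof.
move=> [mf hf]; split; first by apply: measurable_funM => //; exact: measurable_cst.
move=> e e0; have c0 : 0 < `|c| + 1 by rewrite ltr_wpDl.
have e20 : 0 < e / (`|c| + 1) by rewrite divr_gt0.
have [h lh fh] := hf _ e20; exists (fun x => c * h x); first exact: lipschitzZ.
have mh := @lipschitz_measurable h E lh.
apply: (@le_trans _ _ ((`|c| + 1)%:E * l1dist f h)%E); last first.
 rewrite (_ : e = (`|c| + 1) * (e / (`|c| + 1))); last by rewrite mulrC divfK// gt_eqF.
 by rewrite EFinM; apply: lee_wpmul2l => //; rewrite lee_fin ltW.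
rewrite /l1dist -ge0_integralZl//; last exact: l1dist_measurable.
apply: ge0_le_integral => //.
- by apply: l1dist_measurable => //; apply: measurable_funM => //; exact: measurable_cst.
- by apply: measurable_funeM; exact: l1dist_measurable.
by move=> x _; rewrite -EFinM lee_fin -mulrBr normrM ler_wpM2r// lerDl.
Qed.

Lemma lip_approx_lipschitz h : lipschitz_fun h -> lip_approx h.
Proof.
move=> lh; split; first exact: lipschitz_measurable.
move=> e e0; exists h => //; rewrite /l1dist integral0_eq ?lee_fin ?ltW// => x _.
by rewrite subrr normr0.
Qed.

Lemma lip_approx_dct (f_ : nat -> 'rV[R]_n -> R) f : (forall k, lip_approx (f_ k)) ->
 (forall x, f_ k x @[k --> \oo] --> f x) -> (forall k x, `|f_ k x| <= 1) -> lip_approx f.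
Proof.
move=> hf cf bf; have mf : measurable_fun E f.
 apply: (@measurable_fun_cvg _ _ _ _ (fun k => f_ k)) => [k|x _]; last exact: cf.
 by have [] := hf k.
apply: lip_approx_lim => // e e0.
have i1 : leb.-integrable E (cst (1%:E)).
 by apply/integrableP; split => //; rewrite integral_cst//= normr1 mul1e.
have mk k : measurable_fun E (EFin \o f_ k) by apply/measurable_EFinP; have [] := hf k.
have mF : measurable_fun E (EFin \o f) by apply/measurable_EFinP.
have c2 : {ae leb, forall x, E x -> (EFin \o f_ k) x @[k --> \oo] --> (EFin \o f) x}.
 by apply: aeW => x _; apply/fine_cvgP; split; [exact: nearW|exact: cf].
have b2 : {ae leb, forall x k, E x -> (`|(EFin \o f_ k) x| <= cst 1%:E x)%E}.
 by apply: aeW => x k _; exact: bf.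
have [_ h _] := dominated_convergence mE mk mF c2 i1 b2.
have /fine_cvgP[_ /cvgrPdist_le/(_ e e0)] := h.
have /fine_cvgP[[N1 _ hN1] _] := h.
move=> [N2 _ hN2]; pose N := maxn N1 N2; exists (f_ N) => //.
have h1 := hN1 N (leq_maxl _ _); have h2 := hN2 N (leq_maxr _ _).
have e1 : l1dist f (f_ N) = (\int[leb]_(x in E) `|(f_ N x)%:E - (f x)%:E|)%E.
 by apply: eq_integral => x _; rewrite -EFinB/= distrC.
rewrite e1 -[leLHS]fineK// lee_fin; move: h2; rewrite sub0r normrN /=.
exact: le_trans (ler_norm _).
Qed.

(** Dynkin's theorem: open sets are stable under intersection and are reached by [bump]; complements
    follow by linearity, disjoint countable unions by dominated convergence. *)
Lemma lip_approx_indic A : measurable A -> lip_approx (\1_A : 'rV[R]_n -> R).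
Proof.
move=> mA; have := mA.
have openI : setI_closed (@open 'rV[R]_n) by move=> U V; exact: openI.
have h01 (B : set 'rV[R]_n) x : `|\1_B x : R| <= 1.
 by rewrite indicE; case: (_ \in _); rewrite ?normr1 ?normr0.
apply: (@dynkin_induction _ 'rV[R]_n (@open 'rV[R]_n)
 (fun A => lip_approx (\1_A : 'rV[R]_n -> R))) => //.
- by rewrite indicT; apply: lip_approx_lipschitz; exact: lipschitz_cst.
- move=> U oU; have [U0|nU] := eqVneq (~` U) set0.
  rewrite -(setCK U) U0 setC0 indicT; apply: lip_approx_lipschitz; exact: lipschitz_cst.
 have {}nU : (~` U) !=set0 by apply/set0P.
 apply: (@lip_approx_dct (bump U)).
 - by move=> k; apply: lip_approx_lipschitz; exact: bump_lipschitz.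
 - by move=> x; exact: bump_cvg.
 move=> k x; rewrite ger0_norm; first by rewrite /bump ge_min lexx.
 by rewrite /bump le_min ler01 mulr_ge0// dist_to_ge0.
- move=> S mS hS.
 rewrite (_ : \1_(~` S) = (fun x => 1 + -1 * \1_S x)); last first.
  by apply/funext => x; rewrite !indicE in_setC; case: (_ \in _) => /=; ring.
 apply: lip_approxD; first by apply: lip_approx_lipschitz; exact: lipschitz_cst.
 exact: lip_approxZ.
move=> F mF tF hF.
pose f_ N x : R := \sum_(k < N) \1_(F k) x.
have fE x j N : F j x -> f_ N x = (j < N)%N%:R.
 move=> Fj; rewrite /f_ (eq_bigr (fun k : 'I_N => (val k == j)%:R)); last first.
  move=> k _; rewrite indicE; congr (_%:R); congr nat_of_bool.
  apply/idP/eqP => [/set_mem Fk|-> ]; last exact: mem_set.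
  by apply: (tF k j I I); exists x.
 have [jN|Nj] := ltnP j N.
  rewrite (bigD1 (Ordinal jN))//= eqxx big1 ?addr0// => k kj.
  by rewrite (_ : (val k == j) = false)//; apply: contraNF kj => /eqP kj; apply/eqP/val_inj.
 rewrite big1// => k _; rewrite (_ : (val k == j) = false)//.
 by apply/negbTE; rewrite neq_ltn (leq_trans (ltn_ord k) Nj).
have f0 x N : (forall j, ~ F j x) -> f_ N x = 0.
 by move=> h; rewrite /f_ big1// => k _; rewrite indicE memNset.
apply: (@lip_approx_dct f_).
- move=> N; rewrite /f_; elim: N => [|N IH].
  rewrite (_ : (fun x => _) = (fun=> 0)); last by apply/funext => x; rewrite big_ord0.
  by apply: lip_approx_lipschitz; exact: lipschitz_cst.
 rewrite (_ : (fun x => _) = (fun x => \sum_(k < N) \1_(F k) x + \1_(F N) x)).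
  exact: lip_approxD.
 by apply/funext => x; rewrite big_ord_recr.
- move=> x; have [[j Fj]|nF] := pselect (exists j, F j x).
  have -> : \1_(\bigcup_k F k) x = 1 :> R by rewrite indicE mem_set//; exists j.
  apply/cvgrPdist_le => e e0; exists j.+1 => // k /= jk.
  by rewrite (fE x j)// jk subrr normr0 ltW.
 have h j : ~ F j x by move=> Fj; apply: nF; exists j.
 have -> : \1_(\bigcup_k F k) x = 0 :> R by rewrite indicE memNset// => -[j _ Fj]; exact: (h j).
 rewrite (_ : (fun k => _) = (fun=> 0)); first exact: cvg_cst.
 by apply/funext => k; rewrite f0.
move=> N x; have [[j Fj]|nF] := pselect (exists j, F j x).
 by rewrite (fE x j)//; case: (_ < _)%N; rewrite ?normr1 ?normr0.
by rewrite f0 ?normr0// => j Fj; apply: nF; exists j.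
Qed.

Lemma lip_approx_finite_range (g : 'rV[R]_n -> R) : finite_set (range g) ->
 (forall y, measurable (g @^-1` [set y])) -> lip_approx g.
Proof.
move=> /finite_seqP[ys' ys'E] mg; pose ys := undup ys'.
have gys x : g x \in ys.
 by rewrite mem_undup; have : range g (g x) by [exists x]; rewrite ys'E.
have -> : g = (fun x => \sum_(y <- ys) y * \1_(g @^-1` [set y]) x).
 apply/funext => x; rewrite (bigD1_seq (g x)) ?undup_uniq//= indicE mem_set// mulr1.
 rewrite big1 ?addr0// => y yx; rewrite indicE memNset ?mulr0// => /= h.
 by rewrite h eqxx in yx.
elim: {gys}ys => [|y ys IH].
 rewrite (_ : (fun x => _) = (fun=> 0)); last by apply/funext => x; rewrite big_nil.
 by apply: lip_approx_lipschitz; exact: lipschitz_cst.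
rewrite (_ : (fun x => _) = (fun x => y * \1_(g @^-1` [set y]) x +
 \sum_(y <- ys) y * \1_(g @^-1` [set y]) x)); last by apply/funext => x; rewrite big_cons.
by apply: lip_approxD => //; apply: lip_approxZ; apply: lip_approx_indic.
Qed.

Lemma lip_approx_integrable f : leb.-integrable E (EFin \o f) -> lip_approx f.
Proof.
move=> intf; have mf : measurable_fun E f by have /measurable_int/measurable_EFinP := intf.
have [g [ig cg hg]] := approximation_sfun_integrable mE intf.
apply: lip_approx_lim => // e e0.
have /fine_cvgP[[N1 _ hN1] /cvgrPdist_le/(_ e e0)[N2 _ hN2]] := hg.
pose N := maxn N1 N2; have h1 := hN1 N (leq_maxl _ _); have h2 := hN2 N (leq_maxr _ _).
exists (g N).
 move: (g N) => gN; apply: lip_approx_finite_range; first exact: fimfunP.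
 by move=> y; exact: measurable_sfunP.
have -> : l1dist f (HBSimple.SimpleFun.sort (g N)) =
  (\int[leb]_(z in E) `|(EFin \o f) z - (HBSimple.SimpleFun.sort (g N) z)%:E|)%E.
 by apply: eq_integral => x _; rewrite -EFinB.
rewrite -[leLHS]fineK// lee_fin; move: h2; rewrite sub0r normrN /=.
exact: le_trans (ler_norm _).
Qed.

End Density.

End LipschitzDensity.

(** * Auxiliary inequalities for boxes, powers and weights *)

Lemma box_num1 (R : realType) (c h : R) : c + 3 * h / 4 + h / 4 <= c + h.
Proof. lra. Qed.

Lemma box_num2 (R : realType) (a h h1 : R) : h1 <= h -> a + 3 * h / 4 + h1 / 4 <= a + h.
Proof. lra. Qed.

Lemma box_num3 (R : realType) (h h1 : R) : h1 <= h -> h1 / 4 <= h / 4.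
Proof. lra. Qed.

Lemma lebesgue_cbox (R : realType) n (lo hi : 'I_n -> R) : (forall j, lo j <= hi j) ->
 lebesgue_rV R n (cbox lo hi) = (\prod_j (hi j - lo j))%:E.
Proof.
move=> lh; have := @lebesgue_rV_box R n (\row_j lo j) (\row_j hi j).
rewrite (_ : [set v | _] = cbox lo hi).
 move=> ->; last by move=> j; rewrite !mxE.
 by congr EFin; apply: eq_bigr => j _; rewrite !mxE.
by apply/seteqP; split => x h j; have := h j; rewrite !mxE.
Qed.

Lemma lpn_le_abs (R : realType) (p : \bar R) (I : finType) (v w : I -> R) : (1 <= p)%E ->
 (forall i, `|v i| <= w i) -> lpn p v <= lpn p w.
Proof.
move=> p1 vw; have w0 i : 0 <= w i by apply: le_trans (vw i).
case: p p1 => [r| |]// p1.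
 have r0 : 0 < r by apply: (@lt_le_trans _ _ 1).
 apply: ge0_ler_powR; rewrite ?nnegrE ?invr_ge0 ?(ltW r0) ?sumr_ge0//.
 by apply: ler_sum => i _; rewrite ge0_ler_powR ?nnegrE ?(ltW r0)// (ger0_norm (w0 i)).
apply/bigmax_leP; split => [|i _]; first exact: (@lpn_ge0 _ +oo%E).
by apply: le_trans (vw i) _; apply: le_trans (ler_norm _) (le_bigmax _ _ _).
Qed.

Lemma synth_num (R : realType) (r a b V S : R) : 1 <= r -> 0 <= a -> 1 <= b -> 0 < V -> 0 <= S ->
 a `^ r * S * (b * V) <= (a * b * V `^ r^-1 * S `^ r^-1) `^ r.
Proof.
move=> r1 a0 b1 V0 S0; have r0 : 0 < r by apply: lt_le_trans r1.
have b0 : 0 <= b by apply: le_trans b1.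
have p1 : 0 <= V `^ r^-1 by exact: powR_ge0.
have p2 : 0 <= S `^ r^-1 by exact: powR_ge0.
rewrite (powRM r (mulr_ge0 (mulr_ge0 a0 b0) p1) p2) (powRM r (mulr_ge0 a0 b0) p1) (powRM r a0 b0).
rewrite -!powRrM mulVf ?gt_eqF// (powRr1 (ltW V0)) (powRr1 S0).
rewrite (_ : a `^ r * S * (b * V) = a `^ r * b * V * S); last by ring.
rewrite ler_wpM2r// ler_wpM2r ?(ltW V0)// ler_wpM2l ?powR_ge0//.
by rewrite -{1}(powRr1 b0) ler_powR.
Qed.

Lemma box_num4 (R : realType) (h : R) : 0 < h -> h / 4 + h / 4 <= h.
Proof. lra. Qed.

Lemma box_num5 (R : realType) (S P b : R) : b <= P + P -> S + b <= S + P + P + 1.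
Proof. lra. Qed.

Lemma cexp_num (i k h : nat) : (k <= h)%N -> (i <= h + 2 + (i.+1 - k))%N.
Proof. lia. Qed.

Lemma dco_num (R : realType) (x c p lo hi h h' S P K : R) : 0 < h -> h <= h' -> 0 <= S -> 0 <= P ->
 `|x| <= S -> `|c - p| <= P * h -> `|lo - c| <= (P + P) * h -> `|hi - c| <= (P + P) * h ->
 K = S + P + P + 1 ->
 [/\ `|c + h * x - c| <= K * h, `|c + h * x - p| <= K * h',
   `|c + h * x - lo| <= K * h & `|c + h * x - hi| <= K * h].
Proof.
move=> h0 hh S0 P0 xS cp lc hc KE.
have Xh : `|h * x| <= S * h by rewrite normrM (gtr0_norm h0) mulrC ler_wpM2r ?(ltW h0).
have tri (y : R) b : `|y - c| <= b * h -> b <= P + P -> `|c + h * x - y| <= K * h.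
 move=> yb bP; have -> : c + h * x - y = h * x - (y - c) by ring.
 apply: le_trans (ler_normB _ _) _; apply: (@le_trans _ _ (S * h + b * h)); first exact: lerD.
 rewrite -mulrDl ler_wpM2r ?(ltW h0)// KE; exact: box_num5.
have K0 : 0 <= K by rewrite KE !addr_ge0.
split.
- by apply: (@tri c 0); rewrite ?subrr ?normr0 ?mul0r// addr_ge0.
- apply: (@le_trans _ _ (K * h)); last by rewrite ler_wpM2l.
 by apply: (@tri p P); rewrite 1?distrC// lerDl.
- exact: tri lc _.
- exact: tri hc _.
Qed.

Lemma own_num (R : realType) (x c w h : R) : `|x - c| <= 12 * h -> c + h / 4 <= w <= c + 3 * h / 4 ->
 0 < h -> `|w - x| <= 13 * h.
Proof. by rewrite !ler_norml => /andP[? ?] /andP[? ?] ?; apply/andP; split; lra. Qed.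

Lemma conv_num1 (R : realType) (x0 x w de h : R) : `|x - x0| <= de -> `|w - x| <= 13 * h ->
 13 * h <= de -> `|w - x0| <= 2 * de.
Proof. by rewrite !ler_norml => /andP[? ?] /andP[? ?] ?; apply/andP; split; lra. Qed.

Lemma cexp_num2 (i k k0 h : nat) : (k <= k0)%N -> (i - k0 <= h + 2 + (i - k))%N.
Proof. lia. Qed.

Lemma hp_small (R : realType) (c : R) : 0 < c -> exists n, forall k, (n <= k)%N -> hp R k <= c.
Proof.
move=> c0; exists (Num.truncn c^-1).+1 => k nk; apply: le_trans (hp_le _ nk) _.
rewrite -[hp _ _]invrK hpV -[leRHS]invrK lef_pV2 ?posrE ?ltr0n ?expn_gt0 ?invr_gt0//.
apply: ltW; apply: lt_le_trans (truncnS_gt _) _; rewrite ler_nat.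
exact/ltnW/ltn_expl.
Qed.

Lemma tail_num (R : realType) (u v w a : R) : u < w - a -> w <= u + v -> a <= v.
Proof. lra. Qed.

(** Left continuity of the power, for use where partial sums reach every number below t but perhaps
    not t itself. *)
Lemma powR_sup_le (R : realType) (t r : R) (L : \bar R) : 0 < r -> 0 <= t -> (0 <= L)%E ->
 (forall a, 0 <= a -> a < t -> ((a `^ r)%:E <= L)%E) -> ((t `^ r)%:E <= L)%E.
Proof.
move=> r0 t0 L0 h; case: L L0 h => [L| |]// L0 h; last by rewrite leey.
rewrite lee_fin leNgt; apply/negP => Lt; rewrite lee_fin in L0.
have at_ : L `^ r^-1 < t.
 rewrite ltNge; apply/negP => tL.
 have : t `^ r <= (L `^ r^-1) `^ r by apply: ge0_ler_powR; rewrite ?nnegrE ?powR_ge0 ?(ltW r0).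
 by rewrite -powRrM mulVf ?gt_eqF// powRr1// leNgt Lt.
have [a1 a2] : L `^ r^-1 < (L `^ r^-1 + t) / 2 /\ (L `^ r^-1 + t) / 2 < t.
 by have := midf_lt at_; split; [exact: (midf_lt at_).1|exact: (midf_lt at_).2].
have a0 : 0 <= (L `^ r^-1 + t) / 2 by rewrite divr_ge0// addr_ge0// powR_ge0.
have := h _ a0 a2; rewrite lee_fin leNgt => /negP; apply.
have : (L `^ r^-1) `^ r < ((L `^ r^-1 + t) / 2) `^ r.
 by apply: gt0_ltr_powR; rewrite ?nnegrE ?powR_ge0.
by rewrite -powRrM mulVf ?gt_eqF// powRr1.
Qed.

(** * Sums in L_p, local integrability and weak derivatives *)

Section LpExtra.
Variables (R : realType) (n : nat) (Omega : set 'rV[R]_n).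
Hypothesis mO : measurable Omega.
Local Notation leb := (lebesgue_rV R n).

Lemma Lp_norm_sum p (I : Type) (t : seq I) (F : I -> 'rV[R]_n -> R) (B : I -> R) : (1 <= p)%E ->
 (forall i, (Lp_norm Omega p (F i) <= (B i)%:E)%E) ->
 (Lp_norm Omega p (fun x => \sum_(i <- t) F i x)%R <= (\sum_(i <- t) B i)%R%:E)%E.
Proof.
move=> p1 hF; elim: t => [|i t IH].
 rewrite (_ : (fun x => _) = 0); first by rewrite Lp_norm0// big_nil.
 by apply/funext => x; rewrite big_nil.
rewrite (_ : (fun x => _) = F i + (fun x => \sum_(j <- t) F j x)); last first.
 by apply/funext => x; rewrite big_cons.
rewrite big_cons EFinD; apply: le_trans (Lp_normD _ _ _ p1) _.
exact: leeD (hF i) IH.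
Qed.

Lemma Lp_norm_abs p f : (1 <= p)%E -> measurable_on Omega f ->
 (Lp_norm Omega p (fun x => `|f x|)%R <= Lp_norm Omega p f)%E.
Proof.
move=> p1 mf; apply: Lp_norm_ae_le => //; last by apply: aeW => x _; rewrite normr_id.
by apply: measurable_on_funP => //; apply: measurableT_comp => //; exact: measurable_onP.
Qed.

Lemma Lp_norm_L1loc p f : (1 <= p)%E -> (leb Omega < +oo)%E -> (Lp_norm Omega p f < +oo)%E ->
 L1loc Omega f.
Proof.
move=> p1 fin Np; have mf := Lp_norm_fin_measurable Np.
split=> // K cK KO; have mK := compact_measurable_rV cK.
have mfO := measurable_onP mO mf.
have ma : measurable_fun Omega (fun x => `|f x|%:E).
 by apply/measurable_EFinP; exact: measurableT_comp.
apply: (@le_lt_trans _ _ (\int[leb]_(x in Omega) `|f x|%:E)%E).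
 by apply: ge0_subset_integral.
have := Lp_norm_ge0 Omega p f; case E : (Lp_norm Omega p f) Np => [A| |]// _ A0.
rewrite lee_fin in A0.
have EA : (Lp_norm Omega p f <= A%:E)%E by rewrite E.
case: p p1 {E} EA => [r| |]// p1 EA; last first.
 have /(Lp_norm_le_ae A0 mf) h := EA.
 apply: (@le_lt_trans _ _ (\int[leb]_(x in Omega) (cst A%:E) x)%E).
  by apply: ae_ge0_le_integral => //; apply: filterS h => x h xO; rewrite lee_fin h.
 by rewrite integral_cst//; apply: lte_mul_pinfty.
have r1 : 1 <= r by exact: p1.
have r0 : 0 < r by apply: lt_le_trans r1.
rewrite Lp_norm_le_int// in EA.
have mpow : measurable_fun Omega (fun x => (`|f x| `^ r)%:E).
 apply/measurable_EFinP.
 apply: (@measurableT_comp _ _ _ _ _ _ (fun t : R => t `^ r)); first exact: measurable_powR.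
 exact: measurableT_comp.
apply: (@le_lt_trans _ _ (\int[leb]_(x in Omega) (1%:E + (`|f x| `^ r)%:E))%E).
 apply: ge0_le_integral => //; first by apply: emeasurable_funD.
 move=> x _; rewrite -EFinD lee_fin; have := young_split (normr_ge0 (f x)) ltr01 r1.
 by rewrite (_ : 1 `^ (1 - r) = 1) ?mul1r// powR1.
rewrite ge0_integralD//.
rewrite (_ : (\int[leb]_(_ in Omega) 1%:E = 1%:E * leb Omega)%E); last by exact: integral_cst.
by rewrite mul1e lte_add_pinfty//; apply: le_lt_trans EA (ltry _).
Qed.

(** The norm of a weak derivative is an infimum, possibly not attained by any choice; the bound 2 in
    place of 1 makes room for a choice in each direction. *)
Lemma sobolev_class_partials r p f : (1 <= p)%E -> (grad_norm Omega r p f <= 1)%E ->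
 exists2 g : 'I_n -> 'rV[R]_n -> R, forall j, weak_partial Omega (pure_index r j) f (g j) &
  (Lp_norm Omega p (fun x => \sum_j `|g j x|)%R <= (2 * n%:R)%:E)%E.
Proof.
move=> p1 hg.
have /choice[g hgj] : forall j : 'I_n, exists g, weak_partial Omega (pure_index r j) f g /\
  (Lp_norm Omega p g <= 2%:E)%E.
 move=> j; pose a : {ffun 'I_n -> 'I_r.+1} := [ffun i => inord (pure_index r j i)].
 have aE i : (a i : nat) = pure_index r j i.
  by rewrite ffunE inordK// ltnS /pure_index; case: ifP.
 have ar : (\sum_i a i == r)%N by rewrite (eq_bigr _ (fun i _ => aE i)) sum_pure_index.
 have : (weak_norm Omega p (fun i => a i) f <= 1)%E.
  by apply: le_trans hg; rewrite /grad_norm; exact: le_bigmax_cond.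
 rewrite (_ : (fun i => _) = pure_index r j); last by apply/funext => i; exact: aE.
 move=> h1; have : (weak_norm Omega p (pure_index r j) f < 2%:E)%E.
  by apply: le_lt_trans h1 _; rewrite lte_fin ltr1n.
 by move=> /ereal_inf_lt[_ [g wg <-] h2]; exists g; split => //; exact: ltW.
exists g; first by move=> j; have [] := hgj j.
apply: le_trans (_ : (\sum_(j < n) 2)%R%:E <= _)%E; last first.
 by rewrite sumr_const card_ord lee_fin -[_ *+ _]mulr_natr.
apply: Lp_norm_sum => // j; have [wg h] := hgj j.
apply: (@le_trans _ _ (Lp_norm Omega p (g j))) => //; apply: Lp_norm_abs => //.
exact: Lp_norm_le_measurable h.
Qed.

End LpExtra.

Lemma weight_num (R : realType) (k T H sg M S del : R) : H <= sg * k + 1 -> 0 <= M -> 0 <= del ->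
 - (k + T + 2 + M * (H + 2 + T)) * - del + - (k + T - 1) * S <=
 (2 + 3 * M) * del + S + - ((S - (sg * M + 1) * del) * k + (S - (M + 1) * del) * T).
Proof.
move=> h M0 d0; have : M * H * del <= M * (sg * k + 1) * del by rewrite ler_wpM2r// ler_wpM2l.
by lra.
Qed.

Lemma geom_small (R : realType) (a e : R) : 0 <= a < 1 -> 0 < e -> exists n, a ^+ n <= e.
Proof.
move=> /andP[a0 a1] e0; have a1' : `|a| < 1 by rewrite ger0_norm.
have /cvgrPdist_le/(_ _ e0)[N _ hN] := cvg_expr a1'.
by exists N; have := hN N (leqnn N); rewrite sub0r normrN ger0_norm// exprn_ge0.
Qed.

(** Bernoulli's inequality. It lets the geometric decay absorb the number i + 2 of strips of level i
    + 1. *)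
Lemma poly_geom (R : realType) (b : R) (i : nat) : 1 < b -> i.+2%:R <= ((b - 1)^-1 + 1) * b ^+ i.+1.
Proof.
move=> b1; have b0 : 0 < b - 1 by rewrite subr_gt0.
have bern (j : nat) : 1 + j%:R * (b - 1) <= b ^+ j.
 elim: j => [|j IH]; first by rewrite mul0r addr0 expr0.
 have h := ler_wpM2l (ltW (lt_trans ltr01 b1)) IH.
 rewrite exprS; apply: le_trans h; rewrite -natr1 -subr_ge0.
 rewrite (_ : _ - _ = j%:R * (b - 1) ^+ 2); last by ring.
 by rewrite mulr_ge0// exprn_ge0// ltW.
have h := bern i.+1.
have h1 : 1 <= b ^+ i.+1 by rewrite exprn_ege1// ltW.
rewrite -natr1 mulrDl mul1r; apply: lerD => //.
rewrite -(ler_pM2r b0) [_^-1 * _]mulrC -mulrA mulVf ?gt_eqF// mulr1.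
by apply: le_trans h; rewrite lerDr.
Qed.

Lemma two_powR_gt1 (R : realType) (x : R) : 0 < x -> 1 < 2 `^ x.
Proof. by move=> x0; have := gt0_ltr_powR x0 => /(_ 1 2); rewrite powR1; apply; rewrite ?nnegrE ?ltr1n. Qed.

Lemma two_powR_nat (R : realType) (x : R) (i : nat) :
 2 `^ (- (x * i%:R)) = 2 `^ (- (x / 2)) ^+ i * 2 `^ (- (x / 2)) ^+ i.
Proof.
rewrite -expr2 -exprM -powR_mulrn ?powR_ge0// -powRrM; congr (_ `^ _).
by rewrite natrM; field.
Qed.

Lemma geom_tail (R : realType) (a D : R) (B : nat -> R) (I M : nat) : 0 <= a < 1 -> 0 <= D ->
 (forall i, B i <= D * a ^+ i.+1) -> \sum_(I <= i < M) B i <= D / (1 - a) * a ^+ I.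
Proof.
move=> a01 D0 hB; have /andP[a0 a1] := a01.
apply: (@le_trans _ _ (\sum_(I <= i < M) D * a ^+ i.+1)); first by apply: ler_sum => i _.
rewrite -mulr_sumr -{1}[I]add0n big_addn big_mkord.
rewrite (eq_bigr (fun i : 'I_(M - I) => a * a ^+ I * a ^+ i)); last first.
 by move=> i _; rewrite exprS exprD mulrA mulrAC.
rewrite -mulr_sumr -[leRHS]mulrA; apply: ler_wpM2l => //.
rewrite -[leLHS]mulrA [leLHS]mulrCA [leRHS]mulrC; apply: ler_wpM2l; first exact: exprn_ge0.
have hg := sum_geom (M - I) a01; apply: le_trans hg.
by rewrite ler_piMl ?(ltW a1)//; apply: sumr_ge0 => i _; rewrite exprn_ge0.
Qed.

(** Functionals on functions rather than on classes of functions. Linearity on locally integrable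
    functions and boundedness in L_q are what lets them descend to [Lp_space]. *)
Definition good_functional (R : realType) m (Omega : set 'rV[R]_m.+1) (q : \bar R)
 (l : ('rV[R]_m.+1 -> R) -> R) :=
 [/\ forall f g, L1loc Omega f -> L1loc Omega g -> l (f + g) = l f + l g,
   forall c f, L1loc Omega f -> l (c *: f) = c * l f &
   exists2 B : R, 0 <= B & forall f A, 0 <= A -> (Lp_norm Omega q f <= A%:E)%E -> `|l f| <= B * A].

(** * Widths of operators on a class of functions *)

Section ClassWidths.
Variables (R : realType) (m : nat) (Omega : set 'rV[R]_m.+1) (q : \bar R).
Local Notation func := ('rV[R]_m.+1 -> R).
Hypothesis q1 : (1 <= q)%E.
Local Notation good := (good_functional Omega q).
Local Notation Nq := (Lp_norm Omega q).
Variable W : set func.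
Implicit Types (f g : func) (N : nat) (E : R) (U : func -> func).

(** Approximation of the operator U on the class W. Unlike the width of a set, this is subadditive
    in U: ranks and errors add up, so blocks can be treated separately. *)
Definition op_width (k : width_kind) N E U : Prop :=
 match k with
 | WKolmogorov => exists2 v : 'I_N -> func, forall j, (Nq (v j) < +oo)%E &
   forall f, W f -> exists c : 'I_N -> R, (Nq (fun x => U f x - \sum_j c j * v j x)%R <= E%:E)%E
 | WLinear => exists (v : 'I_N -> func) (l : 'I_N -> func -> R),
   [/\ forall j, (Nq (v j) < +oo)%E, forall j, good (l j) &
   forall f, W f -> (Nq (fun x => U f x - \sum_j l j f * v j x)%R <= E%:E)%E]
 | WGelfand => exists2 l : 'I_N -> func -> R, forall j, good (l j) &
   forall f, W f -> (forall j, l j f = 0) -> (Nq (U f) <= E%:E)%E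
 end.

Definition app_fam T N1 N2 (u : 'I_N1 -> T) (v : 'I_N2 -> T) (j : 'I_(N1 + N2)) : T :=
 match fintype.split j with inl a => u a | inr b => v b end.

Lemma app_faml T N1 N2 (u : 'I_N1 -> T) (v : 'I_N2 -> T) a : app_fam u v (lshift N2 a) = u a.
Proof. by rewrite /app_fam (unsplitK (inl a)). Qed.

Lemma app_famr T N1 N2 (u : 'I_N1 -> T) (v : 'I_N2 -> T) b : app_fam u v (rshift N1 b) = v b.
Proof. by rewrite /app_fam (unsplitK (inr b)). Qed.

Lemma app_famP T N1 N2 (u : 'I_N1 -> T) (v : 'I_N2 -> T) (P : T -> Prop) :
 (forall a, P (u a)) -> (forall b, P (v b)) -> forall j, P (app_fam u v j).
Proof. by move=> hu hv j; rewrite /app_fam; case: fintype.split. Qed.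

Lemma Lp_norm_add f g (A B : R) : (Nq f <= A%:E)%E -> (Nq g <= B%:E)%E ->
 (Nq (fun x => f x + g x)%R <= (A + B)%:E)%E.
Proof. by move=> hf hg; apply: le_trans (Lp_normD Omega f g q1) _; rewrite EFinD; exact: leeD. Qed.

Lemma op_width_add k N1 N2 E1 E2 U1 U2 : op_width k N1 E1 U1 -> op_width k N2 E2 U2 ->
 op_width k (N1 + N2) (E1 + E2) (fun f x => U1 f x + U2 f x).
Proof.
have comb (f1 f2 : func) (c1 : 'I_N1 -> R) (c2 : 'I_N2 -> R) v1 v2 :
  (Nq (fun x => f1 x - \sum_j c1 j * v1 j x)%R <= E1%:E)%E ->
  (Nq (fun x => f2 x - \sum_j c2 j * v2 j x)%R <= E2%:E)%E ->
  (Nq (fun x => f1 x + f2 x - \sum_j app_fam c1 c2 j * app_fam v1 v2 j x)%R <= (E1 + E2)%:E)%E.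
 move=> h1 h2; have := Lp_norm_add h1 h2; congr (Nq _ <= _)%E; apply/funext => x.
 rewrite addrACA -opprD; congr (_ - _); rewrite big_split_ord /=.
 by congr (_ + _); apply: eq_bigr => j _; rewrite ?app_faml ?app_famr.
case: k => /=.
- move=> [v1 f1 h1] [v2 f2 h2]; exists (app_fam v1 v2); first exact: (app_famP (P := fun v => (Nq v < +oo)%E)).
 move=> f Wf; have [c1 hc1] := h1 f Wf; have [c2 hc2] := h2 f Wf.
 by exists (app_fam c1 c2); exact: comb.
- move=> [v1 [l1 [f1 g1 h1]]] [v2 [l2 [f2 g2 h2]]]; exists (app_fam v1 v2), (app_fam l1 l2); split.
 + exact: (app_famP (P := fun v => (Nq v < +oo)%E)).
 + exact: (app_famP (P := good)).
 move=> f Wf; have := comb _ _ _ _ _ _ (h1 f Wf) (h2 f Wf).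
 congr (Nq _ <= _)%E; apply/funext => x; congr (_ - _); apply: eq_bigr => j _; congr (_ * _).
 by rewrite /app_fam; case: fintype.split.
move=> [l1 g1 h1] [l2 g2 h2]; exists (app_fam l1 l2); first exact: (app_famP (P := good)).
move=> f Wf l0; apply: Lp_norm_add.
 by apply: h1 => // j; have := l0 (lshift N2 j); rewrite app_faml.
by apply: h2 => // j; have := l0 (rshift N1 j); rewrite app_famr.
Qed.

Lemma good_functional0 : good (fun=> 0).
Proof.
split; [by move=> f g _ _; rewrite addr0|by move=> c f _; rewrite mulr0|].
by exists 0 => // f A A0 _; rewrite normr0 mul0r.
Qed.

Lemma good_functionalD l l' : good l -> good l' -> good (fun f => l f + l' f).
Proof.
move=> [lD lZ [B B0 lB]] [lD' lZ' [B' B0' lB']]; split => [f g lf lg|c f lf|].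
- by rewrite lD// lD'// addrACA.
- by rewrite lZ// lZ'// mulrDr.
exists (B + B'); first exact: addr_ge0.
by move=> f A A0 fA; apply: le_trans (ler_normD _ _) _; rewrite mulrDl lerD ?lB ?lB'.
Qed.

Lemma good_functionalZ a l : good l -> good (fun f => a * l f).
Proof.
move=> [lD lZ [B B0 lB]]; split => [f g lf lg|c f lf|].
- by rewrite lD// mulrDr.
- by rewrite lZ// mulrCA.
exists (`|a| * B); first by rewrite mulr_ge0.
by move=> f A A0 fA; rewrite normrM -mulrA ler_wpM2l// lB.
Qed.

Lemma good_functional_dot (I : finType) (a : I -> R) (l : I -> func -> R) :
 (forall i, good (l i)) -> good (fun f => dot a (fun i => l i f)).
Proof.
move=> gl; rewrite /dot; elim: (index_enum I) => [|i t IH].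
 by rewrite (_ : (fun f => _) = fun=> 0); [exact: good_functional0|apply/funext => f; rewrite big_nil].
rewrite (_ : (fun f => _) = fun f => a i * l i f + \sum_(j <- t) a j * l j f); last first.
 by apply/funext => f; rewrite big_cons.
by apply: good_functionalD => //; exact: good_functionalZ.
Qed.

Lemma op_width_zero k N E U : (forall f, W f -> (Nq (U f) <= E%:E)%E) -> op_width k N E U.
Proof.
have z f (c : 'I_N -> R) (v : 'I_N -> func) : (forall j x, c j * v j x = 0) ->
  (fun x => U f x - \sum_j c j * v j x) = U f.
 by move=> h; apply/funext => x; rewrite big1 ?subr0.
have n0 : (Nq (fun=> 0%R) < +oo)%E by rewrite Lp_norm0 ?ltry.
move=> h; case: k => /=.
- exists (fun=> fun=> 0) => // f Wf; exists (fun=> 0); rewrite z; first exact: h.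
 by move=> j x; rewrite mulr0.
- exists (fun=> fun=> 0), (fun=> fun=> 0); split => //; first by move=> _; exact: good_functional0.
 by move=> f Wf; rewrite z; [exact: h|move=> j x; rewrite mulr0].
by exists (fun=> fun=> 0) => [_|f Wf _]; [exact: good_functional0|exact: h].
Qed.

Lemma op_width_pad k N N' E U : (N <= N')%N -> op_width k N E U -> op_width k N' E U.
Proof.
move=> NN h; rewrite -(subnKC NN).
have z : op_width k (N' - N) 0 (fun _ _ => 0).
 by apply: op_width_zero => f _; rewrite Lp_norm0.
have := op_width_add h z; rewrite addr0 (_ : (fun f x => _) = U)//.
by apply/funext => f; apply/funext => x; rewrite addr0.
Qed.

Section Block.
Variables (I : finType) (phi : I -> func) (co : func -> I -> R).
Hypothesis (phiN : forall i, (Nq (phi i) < +oo)%E) (coG : forall i, good (fun f => co f i)).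
Local Notation S v := (fun x => \sum_i v i * phi i x).

Lemma Lp_norm_synth_fin (v : I -> R) : (Nq (S v) < +oo)%E.
Proof.
apply: (@le_lt_trans _ _ (\sum_i (`|v i| * fine (Nq (phi i))))%R%:E); last exact: ltry.
apply: Lp_norm_sum => // i; rewrite (_ : (fun x => _) = v i *: phi i)//.
by rewrite Lp_normZ// EFinM fineK// ge0_fin_numE// Lp_norm_ge0.
Qed.

(** For a block whose coefficients are not bounded on the class: rank #|I| reproduces it, or
    annihilates it in the Gelfand case, without error. *)
Lemma op_width_exact k : op_width k #|I| 0 (fun f => S (co f)).
Proof.
have e (c : I -> R) x : \sum_i c i * phi i x = \sum_(j < #|I|) c (enum_val j) * phi (enum_val j) x.
 by rewrite (reindex _ (onW_bij _ (@enum_val_bij I))).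
have z : Nq (fun=> 0%R) = 0%E by rewrite Lp_norm0.
case: k => /=.
- exists (fun j => phi (enum_val j)) => // f _; exists (fun j => co f (enum_val j)).
 by rewrite (_ : (fun x : 'rV[R]_m.+1 => _) = fun=> 0%R) ?z//; apply/funext => x; rewrite e subrr.
- exists (fun j => phi (enum_val j)), (fun j f => co f (enum_val j)); split => // f _.
 by rewrite (_ : (fun x : 'rV[R]_m.+1 => _) = fun=> 0%R) ?z//; apply/funext => x; rewrite e subrr.
exists (fun j f => co f (enum_val j)) => // f _ h.
rewrite (_ : (fun x : 'rV[R]_m.+1 => _) = fun=> 0%R) ?z//; apply/funext => x; rewrite e big1// => j _.
by rewrite h mul0r.
Qed.

(** Synthesis is bounded from l_q to L_q and the coefficients of the class lie in the unit ball of
    l_p, so a finite-dimensional approximation is transported with the factor w. *)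
Lemma op_width_block k (p : \bar R) n E (w : R) : 0 <= w ->
 (forall v, (Nq (S v) <= (w * lpn q v)%:E)%E) -> (forall f, W f -> lpn p (co f) <= 1) ->
 fd_width k p q I n E -> op_width k n (w * E) (fun f => S (co f)).
Proof.
move=> w0 hS hco hE.
have comb (a : I -> R) (c : 'I_n -> R) (v : 'I_n -> I -> R) :
  (lpn q (fun i => a i - \sum_j c j * v j i) <= E) ->
  (Nq (fun x => S a x - \sum_j c j * S (v j) x)%R <= (w * E)%:E)%E.
 move=> h; apply: le_trans (_ : (w * lpn q (fun i => a i - \sum_j c j * v j i))%:E <= _)%E; last first.
  by rewrite lee_fin ler_wpM2l.
 apply: le_trans (hS _); rewrite le_eqVlt; apply/orP; left; apply/eqP; congr (Nq _); apply/funext => x.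
 rewrite (eq_bigr (fun j => \sum_i c j * v j i * phi i x)); last first.
  by move=> j _; rewrite mulr_sumr; apply: eq_bigr => i _; rewrite mulrA.
 rewrite exchange_big -sumrB; apply: eq_bigr => i _.
 by rewrite mulrBl mulr_suml.
case: k hE => /=.
- move=> [v hv]; exists (fun j => S (v j)); first by move=> j; exact: Lp_norm_synth_fin.
 by move=> f /hco /hv[c hc]; exists c; exact: comb.
- move=> [v [l hv]]; exists (fun j => S (v j)), (fun j f => dot (l j) (co f)); split.
 + by move=> j; exact: Lp_norm_synth_fin.
 + by move=> j; exact: good_functional_dot.
 by move=> f /hco /hv hc; exact: comb.
move=> [l hl]; exists (fun j f => dot (l j) (co f)); first by move=> j; exact: good_functional_dot.
move=> f /hco h1 h2; apply: le_trans (hS _) _; rewrite lee_fin ler_wpM2l//.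
exact: hl.
Qed.

End Block.

Lemma op_width_le k N E E' U : E <= E' -> op_width k N E U -> op_width k N E' U.
Proof.
move=> EE; have tr (x : \bar R) : (x <= E%:E)%E -> (x <= E'%:E)%E.
 by move=> h; apply: le_trans h _; rewrite lee_fin.
case: k => /=.
- by move=> [v hv h]; exists v => // f /h[c hc]; exists c; exact: tr.
- by move=> [v [l [hv hl h]]]; exists v, l; split => // f /h hc; exact: tr.
by move=> [l hl h]; exists l => // f Wf l0; apply: tr; exact: h.
Qed.

End ClassWidths.

Lemma bounded_linear_cont (R : realType) (V W : normedModType R) (f : {linear V -> W}) (K : R) :
 (forall x, `|f x| <= K * `|x|) -> continuous f.
Proof.
move=> h; apply/linear_bounded_continuous/linear_boundedP.
exists K; split; first exact: num_real.
by move=> r Kr x; apply: le_trans (h x) _; apply: ler_wpM2r => //; exact: ltW.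
Qed.

(** * Passage to the normed quotient spaces *)

Section NormedQuot.
Variables (R : realType) (V : lmodType R) (N : eseminorm V).
Implicit Types (u w : normed_quot N).

(** Representatives are chosen without regard to the linear structure and are compatible with it
    only up to vectors of seminorm 0. *)
Lemma rep_linear (a : R) u w : N (rep (a *: u + w) - (a *: rep u + rep w)) = 0%E.
Proof.
have e : a *: u + w = class_of (a *: repr u + repr w : esn_dom N).
 by rewrite class_ofD class_ofZ !class_of_repr.
rewrite {1}e; exact: rep_class.
Qed.

Lemma norm_class (x : esn_dom N) : (`|class_of x|%:E)%E = N (esn_val x).
Proof. exact: nq_norm_class. Qed.

Lemma class_of_sum n (c : 'I_n -> R) (x : 'I_n -> esn_dom N) :
 class_of (\sum_j c j *: x j) = \sum_j c j *: class_of (x j).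
Proof.
have e0 : class_of (0 : esn_dom N) = 0.
 by have := class_ofD (0 : esn_dom N) 0; rewrite addr0 => /eqP; rewrite -subr_eq0 opprD addNKr oppr_eq0 => /eqP.
apply: (big_ind2 (fun (y : esn_dom N) z => class_of y = z)) => //.
 by move=> y1 z1 y2 z2 <- <-; rewrite class_ofD.
by move=> j _; rewrite class_ofZ.
Qed.

Lemma norm_sub_sum u n (c : 'I_n -> R) (x : 'I_n -> esn_dom N) :
 (`|u - \sum_j c j *: class_of (x j)|%:E)%E = N (rep u - \sum_j c j *: esn_val (x j)).
Proof.
have v0 : esn_val (0 : esn_dom N) = 0 by [].
have -> : \sum_j c j *: esn_val (x j) = esn_val (\sum_j c j *: x j).
 apply/esym; apply: (big_ind2 (fun (y : esn_dom N) z => esn_val y = z)) => //.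
 by move=> y1 z1 y2 z2 <- <-.
rewrite -class_of_sum -{1}[u]class_of_repr.
have -> : class_of (repr u) - class_of (\sum_j c j *: x j) = class_of (repr u - \sum_j c j *: x j).
 by rewrite -[X in _ - X]scale1r -scaleNr -[X in _ + X]class_ofZ -class_ofD scaleN1r.
by rewrite norm_class.
Qed.

End NormedQuot.

Section Classes.
Variables (R : realType) (m : nat) (Omega : set 'rV[R]_m.+1) (q : \bar R).
Local Notation func := ('rV[R]_m.+1 -> R).
Local Notation leb := (lebesgue_rV R m.+1).
Hypotheses (mO : measurable Omega) (finO : (leb Omega < +oo)%E) (q1 : (1 <= q)%E).
Local Notation good := (good_functional Omega q).
Local Notation Nq := (Lp_norm Omega q).
Local Notation X := (Lp_space Omega q1).
Implicit Types (f g : func) (N : nat) (E : R) (u w : X).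

Lemma Lp_rep_fin u : (Nq (rep u) < +oo)%E.
Proof. by have := normed_quot_normE u; rewrite /= => <-; exact: ltry. Qed.

Lemma Lp_rep_L1loc u : L1loc Omega (rep u).
Proof. exact: Lp_norm_L1loc (Lp_rep_fin u). Qed.

(** The defect of linearity of [rep] has L_q norm 0, and boundedness makes the functional vanish on
    it. *)
Lemma good_rep_linear l (a : R) u w : good l -> l (rep (a *: u + w)) = a * l (rep u) + l (rep w).
Proof.
move=> [lD lZ [B B0 lB]].
have lu := Lp_rep_L1loc u; have lw := Lp_rep_L1loc w.
have laz : L1loc Omega (a *: rep u) by exact: L1locZ.
have lz : L1loc Omega (a *: rep u + rep w) by exact: L1locD.
have h := rep_linear a u w; set d := _ - _ in h.
have ld : L1loc Omega d.
 apply: (Lp_norm_L1loc mO q1 finO); have -> : Nq d = 0%E by exact: h.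
 exact: ltry.
have -> : rep (a *: u + w) = d + (a *: rep u + rep w) by rewrite /d subrK.
have l0 : l d = 0.
 have dle : (Nq d <= 0%:E)%E by rewrite le_eqVlt; apply/orP; left; apply/eqP; exact: h.
 by apply/eqP; rewrite -normr_le0; apply: le_trans (lB d 0 (lexx _) dle) _; rewrite mulr0.
by rewrite lD// l0 add0r lD// lZ.
Qed.

Lemma good_rep_bound l : good l -> exists2 B : R, 0 <= B & forall u, `|l (rep u)| <= B * `|u|.
Proof.
move=> [_ _ [B B0 lB]]; exists B => // u; apply: lB => //.
by rewrite le_eqVlt; apply/orP; left; apply/eqP/esym; exact: normed_quot_normE.
Qed.

Definition Lp_dom f (h : (Nq f < +oo)%E) : esn_dom (Lp_eseminorm Omega q1) :=
 @EsnDom _ _ (Lp_eseminorm Omega q1) f h.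

Lemma Lp_norm_sub_sum u N (c : 'I_N -> R) (v : 'I_N -> func) (h : forall j, (Nq (v j) < +oo)%E) :
 (`|u - \sum_j c j *: class_of (Lp_dom (h j))|%:E)%E = Nq (fun x => rep u x - \sum_j c j * v j x).
Proof.
rewrite norm_sub_sum; congr (Nq _); apply/funext => x.
by rewrite /= fct_sumE.
Qed.

Variables (r : nat) (p : \bar R).
Local Notation W := (sobolev_class Omega r p).

Theorem op_width_width k N E : 0 <= E -> op_width Omega q W k N E (fun f => f) ->
 (width k N (sobolev_class_in Omega r p q1) <= E%:E)%E.
Proof.
move=> E0; case: k => /=.
- move=> [v hv h]; pose w j := class_of (Lp_dom (hv j)).
 apply: le_trans (ereal_inf_lbound _) _; first by exists (span_of w); [exists w|reflexivity].
 apply: ge_ereal_sup => _ [u Wu <-]; have [c hc] := h _ Wu.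
 apply: le_trans (ereal_inf_lbound _) _.
  by exists (\sum_j c j *: w j); [exists c|reflexivity].
 by rewrite Lp_norm_sub_sum.
- move=> [v [l [hv hl h]]]; pose w j : X := class_of (Lp_dom (hv j)).
 pose A (u : X) : X := \sum_j l j (rep u) *: w j.
 have Al : linear A.
  move=> a u1 u2; rewrite /A scaler_sumr -big_split; apply: eq_bigr => j _.
  by rewrite (good_rep_linear _ _ _ (hl j)) scalerDl scalerA.
 pose A' : {linear X -> X} := HB.pack A (GRing.isLinear.Build R X X *:%R A Al).
 have Ac : continuous A'.
  have /choice[B hB] : forall j, exists B : R, 0 <= B /\ forall u, `|l j (rep u)| <= B * `|u|.
   by move=> j; have [B B0 hB] := good_rep_bound (hl j); exists B.
  apply: (@bounded_linear_cont _ _ _ A' (\sum_j B j * `|w j|)) => u.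
  rewrite /= /A; apply: le_trans (ler_norm_sum _ _ _) _; rewrite mulr_suml.
  apply: ler_sum => j _; rewrite normrZ mulrAC ler_wpM2r//; by have [_] := hB j.
 apply: le_trans (ereal_inf_lbound _) _.
  exists A'; last reflexivity; split => //; exists w => _ [u _ <-].
  by exists (fun j => l j (rep u)).
 apply: ge_ereal_sup => _ [u Wu <-].
 by rewrite /= /A Lp_norm_sub_sum; exact: h.
move=> [l hl h].
have Ll j : linear (fun u : X => l j (rep u) : R^o) by move=> a u1 u2; exact: (good_rep_linear _ _ _ (hl j)).
pose l' j : {linear X -> R^o} := HB.pack (fun u : X => l j (rep u) : R^o)
 (GRing.isLinear.Build R X R^o *:%R _ (Ll j)).
have lc j : continuous (l' j).
 by have [B _ hB] := good_rep_bound (hl j); exact: (@bounded_linear_cont _ _ _ (l' j) B).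
apply: le_trans (ereal_inf_lbound _) _; first by exists l' => //; reflexivity.
apply: ge_ereal_sup => _ [->|[u [Wu hu] <-]]; first by rewrite lee_fin.
by rewrite normed_quot_normE; exact: h.
Qed.

End Classes.

(** With truncated subtraction, (v - w) + (w - v) is the distance of v and w, and each value is
    taken at most twice. *)
Lemma dist_sum (R : realType) (a : R) (V w : nat) : 0 <= a < 1 ->
 \sum_(v < V) a ^+ ((v - w) + (w - v)) <= 2 * (1 - a)^-1.
Proof.
move=> a01; have /andP[a0 a1] := a01.
have pos n : 0 <= \sum_(j < n) a ^+ j by apply: sumr_ge0 => j _; exact: exprn_ge0.
suff : \sum_(v < V) a ^+ ((v - w) + (w - v)) <= \sum_(j < w.+1) a ^+ j + \sum_(j < V) a ^+ j.
 move=> h; apply: le_trans h _; have := lerD (sum_geom w.+1 a01) (sum_geom V a01).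
 by rewrite -[X in _ <= X]mulr2n mulr_natl.
elim: w V => [|w IH] V.
 rewrite (eq_bigr (fun j : 'I_V => a ^+ j)) ?lerDr//; by move=> j _; rewrite subn0 sub0n addn0.
case: V => [|V]; first by rewrite !big_ord0 addr0.
rewrite big_ord_recl /= [X in _ <= X + _]big_ord_recr /= [X in _ <= _ + X]big_ord_recl /= sub0n subn0 add0n expr0.
have := IH V; rewrite (eq_bigr (fun v : 'I_V => a ^+ (v.+1 - w.+1 + (w.+1 - v.+1)))) => [h|v _]; last by rewrite !subSS.
rewrite [leRHS]addrAC [leRHS]addrC addrC addrC; apply: lerD => //.
apply: le_trans h _; rewrite lerD2l.
case: V => [|V]; first by rewrite !big_ord0 addr0.
rewrite big_ord_recl expr0 lerD2l; apply: (@le_trans _ _ (\sum_(i < V) a ^+ i.+1)) => //.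
by rewrite [leRHS]big_ord_recr /= lerDl exprn_ge0.
Qed.

(** Uniformity in y is the point. Replacing y/B by its integer part changes the distance by at most
    1 and costs the factor 1/a. *)
Lemma unif_sum (R : realType) (B c : R) : 0 < B -> 0 < c ->
 exists2 K : R, 0 < K & forall (y : R) (V : nat), \sum_(v < V) 2 `^ (- (c * `|B * v%:R - y|)) <= K.
Proof.
move=> B0 c0; pose a := 2 `^ (- (c * B)); have cB : 0 < c * B by rewrite mulr_gt0.
have a0 : 0 < a by rewrite powR_gt0.
have a1 : a < 1 by rewrite /a powRN invf_lt1 ?powR_gt0//; exact: two_powR_gt1.
have a01 : 0 <= a < 1 by rewrite (ltW a0).
exists (a^-1 * (2 * (1 - a)^-1)); first by rewrite !mulr_gt0 ?invr_gt0 ?subr_gt0.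
move=> y V; pose z := y / B; pose w := Num.truncn z.
have dist (v : nat) : ((v - w) + (w - v))%:R - 1 <= `|v%:R - z|.
 have e : ((v - w) + (w - v))%:R = `|v%:R - w%:R| :> R.
  have [vw|/ltnW vw] := leqP v w.
   by rewrite (eqP vw) add0n natrB// distrC ger0_norm// subr_ge0 ler_nat.
  by rewrite (eqP vw) addn0 natrB// ger0_norm// subr_ge0 ler_nat.
 rewrite e; have [z0|z0] := leP 0 z.
  have /andP[h1 h2] := truncn_itv z0; rewrite -/w in h1 h2.
  rewrite lerBlDr; apply: le_trans (ler_distD z _ _) _; rewrite lerD2l.
  by rewrite ger0_norm ?subr_ge0// lerBlDl natr1 ltW.
 have w0 : w = 0%N by apply/truncn0Pn; rewrite -ltNge; apply: lt_trans z0 ltr01.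
 rewrite w0 subr0 lerBlDr; apply: (@le_trans _ _ `|v%:R - z|); last by rewrite lerDl.
 by rewrite !ger0_norm ?lerDl ?oppr_ge0 ?(ltW z0)// addr_ge0 ?oppr_ge0 ?(ltW z0).
have := dist_sum V w a01; rewrite -(ler_pM2l (_ : 0 < a^-1)) ?invr_gt0// => h.
apply: le_trans h; rewrite mulr_sumr; apply: ler_sum => v _.
have -> : `|B * v%:R - y| = B * `|v%:R - z|.
 by rewrite -{2}(gtr0_norm B0) -normrM mulrBr [B * z]mulrC divfK ?gt_eqF.
rewrite mulrA -mulNr powRrM -/a.
have -> : a^-1 * a ^+ (v - w + (w - v)) = a `^ ((v - w + (w - v))%:R - 1).
 by rewrite powRD ?(gt_eqF a0) ?implybT// powR_mulrn ?(ltW a0)// powR_inv1 ?(ltW a0)// mulrC.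
by apply: ger_powR => //; rewrite a0 (ltW a1).
Qed.

(** However the line y runs through the quadrant, the sum over v is bounded by [unif_sum] and the
    sum over u is geometric. *)
Lemma alloc_sum (R : realType) (B c : R) : 0 < B -> 0 < c ->
 exists2 K : R, 0 < K & forall (y : nat -> R) (U V : nat),
  \sum_(u < U) \sum_(v < V) 2 `^ (- (c * (u%:R + `|B * v%:R - y u|))) <= K.
Proof.
move=> B0 c0; have [K K0 hK] := unif_sum B0 c0.
pose a := 2 `^ (- c); have a0 : 0 < a by rewrite powR_gt0.
have a1 : a < 1 by rewrite /a powRN invf_lt1 ?powR_gt0//; exact: two_powR_gt1.
have a01 : 0 <= a < 1 by rewrite (ltW a0).
exists (K * (1 - a)^-1); first by rewrite mulr_gt0// invr_gt0 subr_gt0.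
move=> y U V; have := sum_geom U a01; rewrite -(ler_pM2l K0) => h; apply: le_trans h.
rewrite mulr_sumr; apply: ler_sum => u _.
rewrite (eq_bigr (fun v : 'I_V => a ^+ u * 2 `^ (- (c * `|B * v%:R - y u|)))).
 by rewrite -mulr_sumr mulrC; apply: ler_wpM2r; [exact: exprn_ge0 (ltW a0)|exact: hK].
move=> v _; rewrite mulrDr opprD powRD ?pnatr_eq0 ?implybT//; congr (_ * _).
by rewrite -mulNr powRrM powR_mulrn// ltW.
Qed.

Lemma tri_sum (R : realType) (F : nat -> nat -> R) (n : nat) : (forall u v, 0 <= F u v) ->
 \sum_(i < n) \sum_(k < i.+1) F k (i - k)%N <= \sum_(k < n) \sum_(t < n) F k t.
Proof.
move=> F0; elim: n F F0 => [|n IH] F F0; first by rewrite !big_ord0.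
rewrite (eq_bigr (fun i : 'I_n.+1 => F 0%N i + \sum_(k < i) F k.+1 (i - k.+1)%N)); last first.
 by move=> i _; rewrite big_ord_recl subn0.
rewrite big_split /= [X in _ <= X]big_ord_recl; apply: lerD => //.
rewrite big_ord_recl big_ord0 add0r.
apply: (@le_trans _ _ (\sum_(i < n) \sum_(k < i.+1) F k.+1 (i - k)%N)) => //.
apply: le_trans (IH (fun k t => F k.+1 t) (fun u v => F0 _ _)) _.
apply: ler_sum => k _; rewrite big_ord_recr /= lerDl; exact: F0.
Qed.

(** * Allocation of budgets to blocks *)

Section Allocation.
Variables (R : realType) (fdw : finType -> nat -> R -> Prop).

(** The block (u, v) has about 2^(A u + B v) coordinates and weight 2^-(rho u + tau v); lam is the
    logarithm of the total budget, and B v = y lam u is the critical line. Budgets and weighted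
    errors both decay at rate c in u and in the distance to that line. *)
Definition allocation (A B rho tau C1 theta : R) := exists (c C : R) (y : R -> nat -> R),
 [/\ 0 < c, 0 < C & forall (lam : R) (u v : nat) (I : finType), 0 <= lam ->
  #|I|%:R <= C1 * 2 `^ (A * u%:R + B * v%:R) ->
  exists n E, [/\ fdw I n E, 0 <= E,
   n%:R <= C * 2 `^ (lam - c * (u%:R + `|B * v%:R - y lam u|)) &
   2 `^ (- (rho * u%:R + tau * v%:R)) * E <=
   C * 2 `^ (- (theta * lam + c * (u%:R + `|B * v%:R - y lam u|)))]].

End Allocation.

Lemma alloc_num_full (R : realType) (c e lam u x X : R) : c <= e -> c <= 1 -> 0 <= u ->
 x <= 0 -> X = lam - e * u + x -> X <= lam - c * (u + `|x|).
Proof.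
move=> ce c1 u0 x0 ->; rewrite ler0_norm//.
have h1 := ler_wpM2r u0 ce; have h2 : c * - x <= 1 * - x by rewrite ler_wpM2r// oppr_ge0.
by lra.
Qed.

Lemma alloc_num_none (R : realType) (c e s g th L rho u v A B lam x : R) :
 0 <= u -> 0 <= x -> c <= s -> c <= g - th * e -> th = s * L ->
 rho = g + A * s -> B * v = x + (L * (lam - e * u) - A * u) ->
 - (rho * u + s * B * v) <= - (th * lam + c * (u + `|x|)).
Proof.
move=> u0 x0 cs cg thE rhoE Bv; subst th rho; rewrite ger0_norm// -mulrA Bv.
have h1 := ler_wpM2r u0 cg; have h2 := ler_wpM2r x0 cs.
by rewrite lerN2; lra.
Qed.

Lemma alloc_num_budget (R : realType) (c e e' lam u x : R) : c <= e -> c <= e' -> 0 <= u -> 0 <= x ->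
 lam - e * u - e' * x <= lam - c * (u + x).
Proof. by move=> ce ce' u0 x0; have h1 := ler_wpM2r u0 ce; have h2 := ler_wpM2r x0 ce'; lra. Qed.

Lemma alloc_num_right (R : realType) (c e e' s g th rho u v A B lam x M1 M2 : R) :
 0 <= u -> 0 <= x -> c <= s - M2 - M1 * e' -> c <= g - th * e -> th = s - M2 + M1 ->
 rho = g + A * s -> B * v = x + ((lam - e * u) - A * u) ->
 - (rho * u + s * B * v) - (M1 * (lam - e * u - e' * x) - M2 * (A * u + B * v)) <=
 - (th * lam + c * (u + x)).
Proof.
move=> u0 x0 cs cg thE rhoE Bv; subst th rho; rewrite -[s * B * v]mulrA Bv.
have h1 := ler_wpM2r u0 cg; have h2 := ler_wpM2r x0 cs.
by lra.
Qed.

Lemma alloc_num_left (R : realType) (c e e' s g th rho u v A B lam x M1 M2 L : R) :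
 0 <= u -> 0 <= x -> c <= M2 - s - M1 * e' -> c <= g - th * e -> th = s * L -> M1 = M2 * L ->
 rho = g + A * s -> B * v = - x + (L * (lam - e * u) - A * u) ->
 - (rho * u + s * B * v) - (M1 * (lam - e * u - e' * x) - M2 * (A * u + B * v)) <=
 - (th * lam + c * (u + x)).
Proof.
move=> u0 x0 cs cg thE M1E rhoE Bv; subst th rho; rewrite -[s * B * v]mulrA Bv.
have h1 := ler_wpM2r u0 cg; have h2 := ler_wpM2r x0 cs.
rewrite M1E in h2 *; by lra.
Qed.

Lemma alloc_num_ent (R : realType) (c e e' s g th rho u v A B lam x K dl : R) :
 0 <= u -> 0 <= x -> c <= s - dl * e' - K * (1 + e') -> c <= g - th * e -> th = s + dl ->
 rho = g + A * s -> B * v = x + ((lam - e * u) - A * u) ->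
 - (rho * u + s * B * v) + (- (dl * (lam - e * u - e' * x)) + K * (A * u + B * v - (lam - e * u - e' * x))) <=
 - (th * lam + c * (u + x)).
Proof.
move=> u0 x0 cs cg thE rhoE Bv; subst th rho; rewrite -[s * B * v]mulrA Bv.
have h1 := ler_wpM2r u0 cg; have h2 := ler_wpM2r x0 cs.
by lra.
Qed.

Lemma alloc_num_ent' (R : realType) (c e e' s g th rho u v A B lam x K dl : R) :
 0 <= u -> 0 <= x -> c <= K * (1 - e') - s - dl * e' -> c <= g - th * e -> th = s + dl ->
 rho = g + A * s -> B * v = - x + ((lam - e * u) - A * u) ->
 - (rho * u + s * B * v) + (- (dl * (lam - e * u - e' * x)) + K * (A * u + B * v - (lam - e * u - e' * x))) <=
 - (th * lam + c * (u + x)).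
Proof.
move=> u0 x0 cs cg thE rhoE Bv; subst th rho; rewrite -[s * B * v]mulrA Bv.
have h1 := ler_wpM2r u0 cg; have h2 := ler_wpM2r x0 cs.
by lra.
Qed.

Lemma min_pos (R : realType) (a b : R) : 0 < a -> 0 < b -> exists c, [/\ 0 < c, c <= a & c <= b].
Proof. by move=> a0 b0; exists (Num.min a b); rewrite lt_min a0 b0 !ge_min !lexx orbT. Qed.

(** A budget that decreases like 2^(-e u) costs th * e in the exponent of the error; the surplus g
    in the decay of the weights must pay for it. *)
Lemma small_factor (R : realType) (g th : R) : 0 < g -> 0 <= th -> exists2 e, 0 < e & 0 < g - th * e.
Proof.
move=> g0 t0; have h : 0 < th + 1 by rewrite ltr_wpDl.
exists (g / (th + 1)); first by rewrite divr_gt0.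
by rewrite subr_gt0 mulrCA gtr_pMr// ltr_pdivrMr// mul1r ltrDl.
Qed.

(** * Regimes of the allocation *)

Section Cases.
Variables (R : realType) (fdw : finType -> nat -> R -> Prop).
Hypothesis fdw_full : forall I : finType, fdw I #|I| 0.
Hypothesis fdw_none : forall I : finType, fdw I 0 1.
Variables (A B rho s g C1 : R).
Hypotheses (A0 : 0 <= A) (B0 : 0 < B) (s0 : 0 < s) (g0 : 0 < g) (rhoE : rho = g + A * s) (C10 : 0 < C1).
Let pwle (x y : R) : x <= y -> 2 `^ x <= 2 `^ y.
Proof. by move=> xy; apply: ler_powR => //; rewrite ler1n. Qed.
Let pwD (x y : R) : 2 `^ x * 2 `^ y = 2 `^ (x + y).
Proof. by rewrite powRD// pnatr_eq0 implybT. Qed.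

(** Blocks below the line are reproduced exactly, those above it are dropped. A block of size N has
    weight 2^(-g u) N^(-s), so on the line, where N is about the budget n, dropping costs n^(-s). *)
Lemma allocation_none : allocation fdw A B rho (s * B) C1 s.
Proof.
have [e e0 ge] := small_factor g0 (ltW s0).
have [c1 [c10 ce c1l]] := min_pos e0 ltr01.
have [c2 [c20 cs cg]] := min_pos s0 ge.
have [c [c0 cc1 cc2]] := min_pos c10 c20.
exists c, (C1 + 1), (fun lam u => 1 * (lam - e * u%:R) - A * u%:R); split => //.
 by rewrite ltr_wpDl// ltW.
move=> lam u v I lam0 hI; set x := B * v%:R - _.
have Bv : B * v%:R = x + (1 * (lam - e * u%:R) - A * u%:R) by rewrite subrK.
have [x0|x0] := leP x 0.
 exists #|I|, 0; split => //; last by rewrite mulr0 mulr_ge0 ?powR_ge0// addr_ge0// ltW.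
 apply: le_trans hI _; apply: ler_pM; rewrite ?powR_ge0 ?(ltW C10) ?lerDl//; apply: pwle.
 apply: alloc_num_full (le_trans cc1 ce) (le_trans cc1 c1l) (ler0n _ _) x0 _.
 by rewrite Bv mul1r addrCA subrKC addrC.
exists 0%N, 1; split => //; first by rewrite mulr_ge0 ?powR_ge0// addr_ge0// ltW.
rewrite mulr1; apply: (@le_trans _ _ (1 * 2 `^ (- (s * lam + c * (u%:R + `|x|))))); last first.
 by rewrite ler_wpM2r ?powR_ge0// lerDr ltW.
rewrite mul1r; apply: pwle.
apply: (alloc_num_none (ler0n _ u) (ltW x0) (le_trans cc2 cs) (le_trans cc2 cg) _ rhoE Bv).
by rewrite mulr1.
Qed.

Variables (M1 M2 Cr : R).
Hypotheses (M10 : 0 < M1) (M20 : 0 <= M2) (Cr0 : 0 < Cr).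
Hypothesis fdw_mid : forall (I : finType) (X L : R), 0 <= X -> #|I|%:R <= C1 * 2 `^ X ->
 exists n E, [/\ fdw I n E, 0 <= E, n%:R <= Cr * 2 `^ L & E <= Cr * 2 `^ (- (M1 * L - M2 * X))].

(** For s > M2 the weighted error N^(M2 - s) n^(-M1) decreases in the block size N. Blocks with N
    below n are reproduced exactly, so the worst case is N = n. *)
Lemma allocation_right : 0 < s - M2 -> allocation fdw A B rho (s * B) C1 (s - M2 + M1).
Proof.
move=> sM; have th0 : 0 <= s - M2 + M1 by rewrite ltW// addr_gt0.
have [e e0 ge] := small_factor g0 th0.
have [e' e'0 ge'] := small_factor sM (ltW M10).
have [c1 [c10 ce c1l]] := min_pos e0 ltr01.
have [c2 [c20 cs cg]] := min_pos ge' ge.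
have [c3 [c30 c31 c32]] := min_pos c10 c20.
have [c [c0 cc3 ce']] := min_pos c30 e'0.
have cc1 : c <= c1 by exact: le_trans c31.
have cc2 : c <= c2 by exact: le_trans c32.
(* On this line the block size 2^(A u + B v) equals the reduced budget 2^(lam - e u). *)
exists c, (C1 + Cr), (fun lam u => (lam - e * u%:R) - A * u%:R); split => //.
 by rewrite addr_gt0.
move=> lam u v I lam0 hI; set x := B * v%:R - _.
have Bv : B * v%:R = x + ((lam - e * u%:R) - A * u%:R) by rewrite subrK.
have [x0|x0] := leP x 0.
 exists #|I|, 0; split => //; last by rewrite mulr0 mulr_ge0 ?powR_ge0// ltW ?addr_gt0.
 apply: le_trans hI _; apply: ler_pM; rewrite ?powR_ge0 ?(ltW C10) ?lerDl ?(ltW Cr0)//; apply: pwle.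
 apply: alloc_num_full (le_trans cc1 ce) (le_trans cc1 c1l) (ler0n _ _) x0 _.
 by rewrite Bv addrCA subrKC addrC.
have X0 : 0 <= A * u%:R + B * v%:R by rewrite addr_ge0 ?mulr_ge0// ltW.
have [n [E [h1 h2 h3 h4]]] := fdw_mid (lam - e * u%:R - e' * x) X0 hI.
exists n, E; split => //.
 apply: le_trans h3 _; apply: ler_pM; rewrite ?powR_ge0 ?(ltW Cr0) ?lerDr ?(ltW C10)//; apply: pwle.
 by rewrite (gtr0_norm x0); apply: alloc_num_budget (le_trans cc1 ce) ce' (ler0n _ _) (ltW x0).
apply: le_trans (ler_wpM2l (powR_ge0 _ _) h4) _; rewrite mulrCA pwD.
apply: ler_pM; rewrite ?powR_ge0 ?(ltW Cr0) ?lerDr ?(ltW C10)//; apply: pwle.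
rewrite (gtr0_norm x0).
exact: (alloc_num_right (ler0n _ u) (ltW x0) (le_trans cc2 cs) (le_trans cc2 cg) erefl rhoE Bv).
Qed.

(** For s < M2 the weighted error grows with N until the bound for the block reaches 1, at N = n^L.
    Larger blocks are dropped, and the worst weight is n^(-s L). *)
Lemma allocation_left (L : R) : 0 < L -> M1 = M2 * L -> 0 < M2 - s ->
 allocation fdw A B rho (s * B) C1 (s * L).
Proof.
move=> L0 M1E sM; have th0 : 0 <= s * L by rewrite ltW// mulr_gt0.
have [e e0 ge] := small_factor g0 th0.
have [e' e'0 ge'] := small_factor sM (ltW M10).
have [c1 [c10 ce cs']] := min_pos e0 s0.
have [c2 [c20 cs cg]] := min_pos ge' ge.
have [c3 [c30 c31 c32]] := min_pos c10 c20.
have [c [c0 cc3 ce']] := min_pos c30 e'0.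
have cc1 : c <= c1 by exact: le_trans c31.
have cc2 : c <= c2 by exact: le_trans c32.
exists c, (1 + Cr), (fun lam u => L * (lam - e * u%:R) - A * u%:R); split => //.
 by rewrite addr_gt0.
move=> lam u v I lam0 hI; set x := B * v%:R - _.
have Bv : B * v%:R = x + (L * (lam - e * u%:R) - A * u%:R) by rewrite subrK.
have [x0|x0] := leP 0 x.
 exists 0%N, 1; split => //; first by rewrite mulr_ge0 ?powR_ge0// addr_ge0// ltW.
 rewrite mulr1; apply: (@le_trans _ _ (1 * 2 `^ (- (s * L * lam + c * (u%:R + `|x|))))); last first.
  by rewrite ler_wpM2r ?powR_ge0// lerDl ltW.
 rewrite mul1r; apply: pwle.
 exact: (alloc_num_none (ler0n _ u) x0 (le_trans cc1 cs') (le_trans cc2 cg) erefl rhoE Bv).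
have X0 : 0 <= A * u%:R + B * v%:R by rewrite addr_ge0 ?mulr_ge0// ltW.
have x0' : 0 <= - x by rewrite oppr_ge0 ltW.
have Bv' : B * v%:R = - (- x) + (L * (lam - e * u%:R) - A * u%:R) by rewrite opprK.
have [n [E [h1 h2 h3 h4]]] := fdw_mid (lam - e * u%:R - e' * (- x)) X0 hI.
exists n, E; split => //.
 apply: le_trans h3 _; apply: ler_pM; rewrite ?powR_ge0 ?(ltW Cr0) ?lerDr//; apply: pwle.
 by rewrite (ltr0_norm x0); apply: alloc_num_budget (le_trans cc1 ce) ce' (ler0n _ _) x0'.
apply: le_trans (ler_wpM2l (powR_ge0 _ _) h4) _; rewrite mulrCA pwD.
apply: ler_pM; rewrite ?powR_ge0 ?(ltW Cr0) ?lerDr//; apply: pwle.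
rewrite (ltr0_norm x0).
exact: (alloc_num_left (ler0n _ u) x0' (le_trans cc2 cs) (le_trans cc2 cg) erefl M1E rhoE Bv').
Qed.

End Cases.

Section EntropyCase.
Variables (R : realType) (fdw : finType -> nat -> R -> Prop).
Variables (A B rho s g C1 dl : R).
Hypotheses (A0 : 0 <= A) (B0 : 0 < B) (s0 : 0 < s) (g0 : 0 < g) (rhoE : rho = g + A * s) (C10 : 0 < C1).
Hypothesis dl0 : 0 <= dl.
Hypothesis fdw_ent : forall K1 K2 : R, 0 < K1 -> 0 < K2 -> exists2 Cr, 0 < Cr &
 forall (I : finType) (X L : R), 0 <= X -> #|I|%:R <= C1 * 2 `^ X ->
 exists n E, [/\ fdw I n E, 0 <= E, n%:R <= Cr * 2 `^ L &
   E <= Cr * 2 `^ (- (dl * L) + (if L <= X then K1 else K2) * (X - L))].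
Let pwle (x y : R) : x <= y -> 2 `^ x <= 2 `^ y.
Proof. by move=> xy; apply: ler_powR => //; rewrite ler1n. Qed.
Let pwD (x y : R) : 2 `^ x * 2 `^ y = 2 `^ (x + y).
Proof. by rewrite powRD// pnatr_eq0 implybT. Qed.

(** Coverings are used on both sides of the line N = n. For N > n the loss (N/n)^K1 must stay below
    the decay N^(-s) of the weight, whence K1 = s/4. For N < n the gain (N/n)^K2 must beat the
    weights, which grow as N decreases, whence the large K2. *)
Lemma allocation_entropy : allocation fdw A B rho (s * B) C1 (s + dl).
Proof.
have th0 : 0 <= s + dl by rewrite addr_ge0// ltW.
have [e e0 ge] := small_factor g0 th0.
have s20 : 0 < s / 2 by rewrite divr_gt0.
have [e1 e10 ge1] := small_factor s20 dl0.
have e20 : 0 < 2^-1 :> R by rewrite invr_gt0.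
have [e' [e'0 e'1 e'2]] := min_pos e10 e20.
pose K1 := s / 4; pose K2 := 2 * (s + dl + 1).
have K10 : 0 < K1 by rewrite divr_gt0.
have K20 : 0 < K2 by rewrite mulr_gt0// ltr_wpDl.
have [Cr Cr0 hfd] := fdw_ent K10 K20.
have [k1 k10 hk1] : exists2 k, 0 < k & k <= s - dl * e' - K1 * (1 + e').
 exists (s / 8); first by rewrite divr_gt0.
 have h1 : dl * e' <= dl * e1 by rewrite ler_wpM2l.
 have h2 : K1 * (1 + e') <= K1 * (3 / 2).
  by apply: ler_wpM2l; [exact: ltW|move: e'2; lra].
 by move: h1 h2 ge1 s0; rewrite /K1; lra.
have hk2 : 1 / 2 <= K2 * (1 - e') - s - dl * e'.
 have h1 : dl * e' <= dl * 2^-1 by rewrite ler_wpM2l.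
 have h2 : K2 * 2^-1 <= K2 * (1 - e').
  by apply: ler_wpM2l; [exact: ltW|move: e'2; lra].
 by move: h1 h2 dl0; rewrite /K2; lra.
have h12 : 0 < 1 / 2 :> R by rewrite divr_gt0.
have [c1 [c10 ce cg]] := min_pos e0 ge.
have [c2 [c20 ck1 ck2]] := min_pos k10 h12.
have [c3 [c30 c31 c32]] := min_pos c10 c20.
have [c [c0 cc3 ce']] := min_pos c30 e'0.
have cc1 : c <= c1 by exact: le_trans c31.
have cc2 : c <= c2 by exact: le_trans c32.
exists c, Cr, (fun lam u => (lam - e * u%:R) - A * u%:R); split => //.
move=> lam u v I lam0 hI; set x := B * v%:R - _.
have Bv : B * v%:R = x + ((lam - e * u%:R) - A * u%:R) by rewrite subrK.
have X0 : 0 <= A * u%:R + B * v%:R by rewrite addr_ge0 ?mulr_ge0// ltW.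
have XE : A * u%:R + B * v%:R = x + (lam - e * u%:R) by rewrite Bv addrCA subrKC.
have [n [E [h1 h2 h3 h4]]] := hfd _ _ (lam - e * u%:R - e' * `|x|) X0 hI.
exists n, E; split => //.
 apply: le_trans h3 _; rewrite ler_wpM2l ?(ltW Cr0)//; apply: pwle.
 by apply: alloc_num_budget (le_trans cc1 ce) ce' (ler0n _ _) (normr_ge0 _).
apply: le_trans (ler_wpM2l (powR_ge0 _ _) h4) _; rewrite mulrCA pwD.
rewrite ler_wpM2l ?(ltW Cr0)//; apply: pwle.
have [x0|x0] := leP 0 x.
 rewrite (ger0_norm x0); have -> : lam - e * u%:R - e' * x <= A * u%:R + B * v%:R.
  rewrite XE addrC lerD2r -subr_ge0 opprK; by rewrite addr_ge0// mulr_ge0// ltW.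
 exact: (alloc_num_ent (ler0n _ u) x0 (le_trans (le_trans cc2 ck1) hk1) (le_trans cc1 cg) erefl rhoE Bv).
have x0' : 0 <= - x by rewrite oppr_ge0 ltW.
have Bv' : B * v%:R = - (- x) + ((lam - e * u%:R) - A * u%:R) by rewrite opprK.
rewrite (ltr0_norm x0); have -> : (lam - e * u%:R - e' * - x <= A * u%:R + B * v%:R) = false.
 apply/negbTE; rewrite -ltNge XE addrC ltrD2l mulrN opprK -subr_gt0.
 rewrite -{2}[x]mul1r -mulrBl nmulr_lgt0// subr_lt0; apply: le_lt_trans e'2 _.
 by rewrite invf_lt1// ltr1n.
exact: (alloc_num_ent' (ler0n _ u) x0' (le_trans (le_trans cc2 ck2) hk2) (le_trans cc1 cg) erefl rhoE Bv').
Qed.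

End EntropyCase.

(** * Finite-dimensional estimates in powers of two *)

Section TwoPowers.
Variable R : realType.
Implicit Types (x y a L X : R).

Lemma two_powR_le x y : x <= y -> 2 `^ x <= 2 `^ y :> R.
Proof. by move=> xy; apply: ler_powR => //; rewrite ler1n. Qed.

Lemma two_powRD x y : 2 `^ (x + y) = 2 `^ x * 2 `^ y :> R.
Proof. by rewrite powRD// pnatr_eq0 implybT. Qed.

Lemma two_powR_ge1 x : 0 <= x -> 1 <= 2 `^ x :> R.
Proof. by move=> x0; have := two_powR_le x0; rewrite powRr0. Qed.

Lemma two_powR_lt1 L : 2 `^ L < 1 :> R -> L < 0.
Proof. by apply: contraTT; rewrite -!leNgt => /two_powR_ge1. Qed.

Lemma two_powR_le_inv x y : 2 `^ x <= 2 `^ y :> R -> x <= y.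
Proof.
apply: contraTT; rewrite -!ltNge => yx; have h : 0 < x - y by rewrite subr_gt0.
by rewrite -[x](subrK y) two_powRD ltr_pMl ?powR_gt0// two_powR_gt1.
Qed.

Lemma powR_two_le y X a : 0 <= a -> 0 <= y -> y <= 2 `^ X -> y `^ a <= 2 `^ (X * a).
Proof. by move=> a0 y0 yX; rewrite powRrM ge0_ler_powR ?nnegrE ?powR_ge0. Qed.

Lemma powR_two_ge y L a : 0 <= a -> 2 `^ L <= y -> y `^ (- a) <= 2 `^ (- (a * L)).
Proof.
move=> a0 yL; have y0 : 0 < y by apply: lt_le_trans yL; rewrite powR_gt0.
rewrite !powRN lef_pV2 ?posrE ?powR_gt0// mulrC powRrM ge0_ler_powR ?nnegrE ?powR_ge0//.
exact: ltW.
Qed.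

Lemma two_powR_log y : 0 < y -> exists c : R, y = 2 `^ c.
Proof.
move=> y0; have l2 : ln 2 != 0 :> R by rewrite gt_eqF// ln_gt0// ltr1n.
exists (ln y / ln 2); rewrite /powR pnatr_eq0 /= divfK// lnK// posrE.
Qed.

Lemma two_powR_log_ge1 y : 1 <= y -> exists2 c : R, 0 <= c & y = 2 `^ c.
Proof.
move=> y1; have [c yE] := two_powR_log (lt_le_trans ltr01 y1).
exists c => //; rewrite leNgt; apply/negP => c0; move: y1; rewrite yE leNgt => /negP; apply.
rewrite -(opprK c) powRN invf_lt1 ?powR_gt0//; apply: two_powR_gt1.
by rewrite oppr_gt0.
Qed.

Lemma truncn_two_powR L : 1 <= 2 `^ L :> R ->
 [/\ (0 < Num.truncn (2 `^ L : R))%N, (Num.truncn (2 `^ L : R))%:R <= 2 `^ L :> R &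
   2 `^ (L - 1) <= (Num.truncn (2 `^ L : R))%:R :> R].
Proof.
move=> L1; have n0 : (0 < Num.truncn (2 `^ L : R))%N by rewrite truncn_gt0.
split => //; first by rewrite truncn_le powR_ge0.
have /andP[_ h] := truncn_itv (powR_ge0 2 L).
rewrite two_powRD powR_inv1// ler_pdivrMr// mulr_natr mulr2n; apply: le_trans (ltW h) _.
by rewrite -natr1 lerD2l ler1n.
Qed.

End TwoPowers.

(** The exponents X and L are real and L may be negative: empty blocks and budgets below 1 are
    treated apart, otherwise n is the integer part of 2^L and the rounding goes into [Cr]. *)
Lemma fd_width_mid (R : realType) k (P Q mu C1 : R) : 1 < P -> P < Q -> 2 < qhat k P%:E Q%:E ->
 let h := qhat k P%:E Q%:E in 0 < mu -> 0 < C1 ->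
 mu * (2^-1 - h^-1) = Num.min (P^-1 - Q^-1) (2^-1 - h^-1) ->
 exists2 Cr : R, 0 < Cr & forall (I : finType) (X L : R), 0 <= X -> #|I|%:R <= C1 * 2 `^ X ->
  exists n E, [/\ fd_width k P%:E Q%:E I n E, 0 <= E, n%:R <= Cr * 2 `^ L &
   E <= Cr * 2 `^ (- (mu / 2 * L - mu / h * X))].
Proof.
move=> P1 PQ h2 h mu0 C10 hmu; have [C C1' hC] := fd_width_random P1 PQ h2 hmu.
have h0 : 0 < h by apply: lt_trans h2.
have P1e : (1 <= P%:E)%E by rewrite lee_fin ltW.
have PQe : (P%:E <= Q%:E)%E by rewrite lee_fin ltW.
have Q1e : (1 <= Q%:E)%E by exact: le_trans PQe.
have [c c0 hc] : exists2 c : R, 0 <= c & C1 <= 2 `^ c.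
 have m1 : 1 <= Num.max 1 C1 by rewrite le_max lexx.
 have [c c0 ce] := two_powR_log_ge1 m1.
 by exists c => //; rewrite -ce le_max lexx orbT.
pose Cr := C * 2 `^ (mu / 2 + mu / h * c).
have m20 : 0 <= mu / 2 by apply: divr_ge0 => //; exact: ltW.
have mh0 : 0 <= mu / h by apply: divr_ge0; exact: ltW.
have hpos : 0 <= mu / 2 + mu / h * c by apply: addr_ge0 => //; exact: mulr_ge0.
have Cr1 : 1 <= Cr by rewrite -[1]mulr1; apply: ler_pM => //; exact: two_powR_ge1.
have Cr0 : 0 < Cr by apply: lt_le_trans Cr1.
exists Cr => // I X L X0 hI.
have [I0|I0] := posnP #|I|.
 exists 0%N, 0; split => //; last 2 first.
 - by rewrite mulr_ge0 ?powR_ge0// ltW.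
 - by rewrite mulr_ge0 ?powR_ge0// ltW.
 by apply: fd_width_full => //; rewrite I0.
have [L1|L1] := ltP (2 `^ L) 1.
 exists 0%N, 1; split => //; first exact: fd_width1.
  by rewrite mulr_ge0 ?powR_ge0// ltW.
 rewrite -[leLHS]mulr1; apply: ler_pM => //; apply: two_powR_ge1.
 rewrite opprB subr_ge0; apply: (@le_trans _ _ 0); last exact: mulr_ge0.
 by apply: mulr_ge0_le0 => //; apply: ltW; exact: two_powR_lt1.
have [n0 nl nu] := truncn_two_powR L1; set n := Num.truncn _ in n0 nl nu.
exists n, (C * (n%:R `^ (- 2^-1) * #|I|%:R `^ h^-1) `^ mu); split; first exact: hC.
- by rewrite mulr_ge0 ?powR_ge0// (le_trans ler01).
- by apply: le_trans nl _; rewrite ler_peMl ?powR_ge0.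
have hN : #|I|%:R <= 2 `^ (c + X) :> R.
 by apply: le_trans hI _; rewrite two_powRD ler_wpM2r ?powR_ge0.
have e1 := powR_two_ge (_ : 0 <= 2^-1) nu; have e2 := powR_two_le (_ : 0 <= h^-1) _ hN.
rewrite /Cr -[leRHS]mulrA ler_wpM2l ?(le_trans ler01 C1')// -two_powRD.
apply: (@le_trans _ _ (2 `^ ((- (2^-1 * (L - 1)) + (c + X) * h^-1) * mu))).
 apply: powR_two_le; rewrite ?mulr_ge0 ?powR_ge0 ?(ltW mu0)//.
 rewrite two_powRD; apply: ler_pM; rewrite ?powR_ge0//; first by apply: e1; rewrite invr_ge0.
 by apply: e2; rewrite ?invr_ge0 ?ler0n// ltW.
apply: two_powR_le; rewrite le_eqVlt; apply/orP; left; apply/eqP.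
by field; rewrite gt_eqF.
Qed.

Definition fd_cover (R : realType) (p q : \bar R) (I : finType) (n : nat) (E : R) : Prop :=
 exists s : seq {ffun I -> R}, (size s <= 2 ^ n)%N /\
  forall v : I -> R, lpn p v <= 1 -> exists2 c, c \in s & lpn q (fun i => v i - c i) <= E.

Lemma fd_cover1 (R : realType) (p q : \bar R) (I : finType) (E : R) :
 (forall v : I -> R, lpn p v <= 1 -> lpn q v <= E) -> fd_cover p q I 0 E.
Proof.
move=> h; exists [:: [ffun=> 0]]; split => // v v1; exists [ffun=> 0]; first by rewrite mem_head.
by rewrite (_ : (fun i => _) = v); [exact: h|apply/funext => i; rewrite ffunE subr0].
Qed.

Lemma cover_num_lt (R : realType) (dl L X K K2 c n N : R) : 0 <= K -> 0 <= K2 -> 0 <= c -> 0 <= dl ->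
 (L <= X \/ L - 1 <= c + X) ->
 - (dl * (L - 1)) + (c + X - (L - 1)) * K <=
  (dl + (K + K2) * (c + 1)) + (- (dl * L) + (if L <= X then K else K2) * (X - L)).
Proof.
move=> K0 K20 c0 d0 h; have [LX|XL] := leP L X.
 have h1 : 0 <= K2 * (c + 1) by rewrite mulr_ge0// addr_ge0.
 by move: h1; lra.
have {}h : L - 1 <= c + X by case: h => // h; move: (lt_le_trans XL h); rewrite ltxx.
have h1 : 0 <= K2 * (c + 1 + (X - L)) by rewrite mulr_ge0//; move: h; lra.
have h2 : 0 <= K * (L - X) by rewrite mulr_ge0// subr_ge0 ltW.
by move: h1 h2; lra.
Qed.

(** Joins the regimes n <= N and n > N of the entropy bounds; their multiples A n of the budget are
    absorbed in [Cr]. The test [L <= X] may disagree with the comparison of n and N, but only within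
    a bounded range of exponents. *)
Lemma entropy_mid (R : realType) (p q : \bar R) (C1 K1 K2 : R) : (1 <= p)%E -> (p <= q)%E -> 0 < C1 ->
 0 < K1 -> 0 < K2 -> exists2 Cr : R, 0 < Cr &
 forall (I : finType) (X L : R), 0 <= X -> #|I|%:R <= C1 * 2 `^ X ->
 exists n E, [/\ fd_cover p q I n E, 0 <= E, n%:R <= Cr * 2 `^ L &
   E <= Cr * 2 `^ (- ((recip p - recip q) * L) + (if L <= X then K1 else K2) * (X - L))].
Proof.
move=> p1 pq C10 K10 K20; have q1 := le_trans p1 pq.
have [A [C hs]] := entropy_lp_small p1 pq K10.
have [A' hl] := entropy_lp_large p1 pq (ltW K20).
set dl := recip p - recip q in hs hl *.
have dl0 : 0 <= dl by rewrite subr_ge0 recip_le.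
have [c c0 hc] : exists2 c : R, 0 <= c & C1 <= 2 `^ c.
 have m1 : 1 <= Num.max 1 C1 by rewrite le_max lexx.
 have [c c0 ce] := two_powR_log_ge1 m1.
 by exists c => //; rewrite -ce le_max lexx orbT.
pose C' := Num.max 1 C; have C'1 : 1 <= C' by rewrite le_max lexx.
pose T := C' * 2 `^ (dl + (K1 + K2) * (c + 1)).
have T1 : 1 <= T.
 by rewrite -[1]mulr1; apply: ler_pM => //; apply: two_powR_ge1; rewrite addr_ge0// mulr_ge0 ?addr_ge0// ltW.
pose Cr := T + (A + A')%:R; have TCr : T <= Cr by rewrite lerDl.
have Cr1 : 1 <= Cr by apply: le_trans TCr.
have Cr0 : 0 < Cr by apply: lt_le_trans Cr1.
exists Cr => // I X L X0 hI.
have [I0|I0] := posnP #|I|.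
 exists 0%N, 0; split => //; try by rewrite mulr_ge0 ?powR_ge0// ltW.
 apply: fd_cover1 => v _; rewrite -(mulr0 #|I|.+1%:R); apply: lpn_le_card => // i.
 by have := card0_eq I0 i; rewrite inE.
have [L1|L1] := ltP (2 `^ L) 1.
 have L0 := two_powR_lt1 L1.
 exists 0%N, 1; split => //; first by apply: fd_cover1 => v; exact: lpn_le_lpn.
  by rewrite mulr_ge0 ?powR_ge0// ltW.
 rewrite -[leLHS]mulr1; apply: ler_pM => //; apply: two_powR_ge1.
 have LX : L <= X by apply: le_trans X0; exact: ltW.
 by rewrite LX addr_ge0// ?oppr_ge0 ?mulr_ge0_le0 ?(ltW L0)// mulr_ge0 ?subr_ge0 ?(ltW K10).
have [n0 nl nu] := truncn_two_powR L1; set n := Num.truncn _ in n0 nl nu.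
have nR0 : 0 < n%:R :> R by rewrite ltr0n.
have hN : #|I|%:R <= 2 `^ (c + X) :> R.
 by apply: le_trans hI _; rewrite two_powRD ler_wpM2r ?powR_ge0.
have e1 := powR_two_ge dl0 nu.
have er : #|I|%:R / n%:R <= 2 `^ (c + X - (L - 1)) :> R.
 rewrite two_powRD powRN; apply: ler_pM => //.
 by rewrite lef_pV2 ?posrE ?powR_gt0.
have r0 : 0 <= #|I|%:R / n%:R :> R by rewrite divr_ge0.
have ek K : 0 <= K -> (#|I|%:R / n%:R) `^ K <= 2 `^ ((c + X - (L - 1)) * K) :> R.
 by move=> K0; apply: powR_two_le.
have [nI|In] := leqP n #|I|.
 have [s [ss hv]] := hs I n n0 nI.
 exists (A * n)%N, (C' * n%:R `^ (- dl) * (#|I|%:R / n%:R) `^ K1); split.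
 - exists s; split => // v v1; have [d ds hd] := hv v v1; exists d => //; apply: le_trans hd _.
  by rewrite ler_wpM2r ?powR_ge0// ler_wpM2r ?powR_ge0// le_max lexx orbT.
 - by rewrite !mulr_ge0 ?powR_ge0// (le_trans ler01).
 - rewrite natrM; apply: ler_pM => //; rewrite /Cr natrD addrCA lerDl addr_ge0//.
  by rewrite (le_trans ler01).
 apply: (@le_trans _ _ (T * 2 `^ (- (dl * L) + (if L <= X then K1 else K2) * (X - L)))); last first.
  by rewrite ler_wpM2r ?powR_ge0.
 rewrite /T -!mulrA ler_wpM2l ?(le_trans ler01)// -two_powRD.
 apply: le_trans (ler_pM _ _ e1 (ek K1 (ltW K10))) _; rewrite ?powR_ge0//.
 rewrite -two_powRD; apply: two_powR_le; apply: cover_num_lt => //; try exact: ltW.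
 by right; apply/two_powR_le_inv/(le_trans nu)/(le_trans _ hN); rewrite ler_nat.
have [s [ss hv]] := hl I n I0 (ltnW In).
exists (A' * n)%N, (n%:R `^ (- dl) * (#|I|%:R / n%:R) `^ K2); split.
- by exists s.
- by rewrite !mulr_ge0 ?powR_ge0.
- rewrite natrM; apply: ler_pM => //; rewrite /Cr natrD addrA lerDr addr_ge0//.
 by rewrite (le_trans ler01).
apply: (@le_trans _ _ (T * 2 `^ (- (dl * L) + (if L <= X then K1 else K2) * (X - L)))); last first.
 by rewrite ler_wpM2r ?powR_ge0.
apply: (@le_trans _ _ (2 `^ (dl + (K1 + K2) * (c + 1)) * 2 `^ (- (dl * L) + (if L <= X then K1 else K2) * (X - L)))); last first.
 by rewrite ler_wpM2r ?powR_ge0// /T ler_peMl ?powR_ge0.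
rewrite -two_powRD; have [LX|XL] := leP L X.
 apply: (@le_trans _ _ (2 `^ (- (dl * (L - 1))) * 1)).
  apply: ler_pM; rewrite ?powR_ge0//; apply: powR_le1; last exact: ltW.
  by rewrite r0 ler_pdivrMr// mul1r ler_nat ltnW.
 rewrite mulr1; apply: two_powR_le.
 have h1 : 0 <= (K1 + K2) * (c + 1) by rewrite mulr_ge0 ?addr_ge0// ltW.
 have h2 : 0 <= K1 * (X - L) by rewrite mulr_ge0 ?subr_ge0// ltW.
 by move: h1 h2; clear; lra.
apply: le_trans (ler_pM _ _ e1 (ek K2 (ltW K20))) _; rewrite ?powR_ge0//.
rewrite -two_powRD; apply: two_powR_le.
have h1 : 0 <= K1 * (c + 1) by rewrite mulr_ge0 ?addr_ge0// ltW.
by move: h1; clear; lra.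
Qed.

(** * Summation over the quadrant and assembly of the blocks *)

Section Balanced.
Variables (R : realType) (fdw : finType -> nat -> R -> Prop).

(** An allocation after summation. The constant depends neither on lam, nor on the cut U, nor on the
    blocks themselves, of which only the sizes are bounded. *)
Definition balanced (A B rho tau C1 theta : R) := exists2 C : R, 0 < C &
 forall lam, 0 <= lam -> forall I : nat -> nat -> finType,
 (forall k t, #|I k t|%:R <= C1 * 2 `^ (A * k%:R + B * t%:R)) ->
 exists (n : nat -> nat -> nat) (E : nat -> nat -> R),
 [/\ forall k t, fdw (I k t) (n k t) (E k t), forall k t, 0 <= E k t,
   forall U, \sum_(k < U) \sum_(t < U) (n k t)%:R <= C * 2 `^ lam &
   forall U, \sum_(k < U) \sum_(t < U) 2 `^ (- (rho * k%:R + tau * t%:R)) * E k t <=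
    C * 2 `^ (- (theta * lam))].

(** Exchanging the two directions lets one allocation lemma serve whether k or t is the direction
    that decides the exponent. *)
Lemma balanced_swap A B rho tau C1 theta : balanced A B rho tau C1 theta ->
 balanced B A tau rho C1 theta.
Proof.
move=> [C C0 h]; exists C => // lam lam0 I hI.
have hI' k t : #|I t k|%:R <= C1 * 2 `^ (A * k%:R + B * t%:R) by rewrite addrC.
have [n [E [h1 h2 h3 h4]]] := h lam lam0 (fun k t => I t k) hI'.
exists (fun k t => n t k), (fun k t => E t k); split => // U; first by rewrite exchange_big; exact: h3.
apply: le_trans (h4 U); rewrite exchange_big le_eqVlt; apply/orP; left; apply/eqP.
by apply: eq_bigr => i _; apply: eq_bigr => t _; rewrite [_ + rho * _]addrC.
Qed.

Lemma allocation_balanced A B rho tau C1 theta : 0 < B -> allocation fdw A B rho tau C1 theta ->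
 balanced A B rho tau C1 theta.
Proof.
move=> B0 [c [C [y [c0 C0 h]]]]; have [K K0 hK] := alloc_sum B0 c0.
exists (C * K); first by rewrite mulr_gt0.
move=> lam lam0 I hI.
have /choice[nE hnE] : forall kt : nat * nat, exists nE : nat * R,
  [/\ fdw (I kt.1 kt.2) nE.1 nE.2, 0 <= nE.2,
   nE.1%:R <= C * 2 `^ (lam - c * (kt.1%:R + `|B * kt.2%:R - y lam kt.1|)) &
   2 `^ (- (rho * kt.1%:R + tau * kt.2%:R)) * nE.2 <=
   C * 2 `^ (- (theta * lam + c * (kt.1%:R + `|B * kt.2%:R - y lam kt.1|)))].
 by move=> [k t]; have [n [E hh]] := h lam k t (I k t) lam0 (hI k t); exists (n, E).
exists (fun k t => (nE (k, t)).1), (fun k t => (nE (k, t)).2); split => [k t|k t|U|U].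
- by have [] := hnE (k, t).
- by have [] := hnE (k, t).
- rewrite mulrAC; apply: le_trans (ler_wpM2l _ (hK (y lam) U U)); last by rewrite mulr_ge0 ?powR_ge0// ltW.
 rewrite mulr_sumr; apply: ler_sum => k _; rewrite mulr_sumr; apply: ler_sum => t _.
 have [_ _ h3 _] := hnE (k : nat, t : nat); apply: le_trans h3 _.
 by rewrite two_powRD mulrA.
rewrite mulrAC; apply: le_trans (ler_wpM2l _ (hK (y lam) U U)); last by rewrite mulr_ge0 ?powR_ge0// ltW.
rewrite mulr_sumr; apply: ler_sum => k _; rewrite mulr_sumr; apply: ler_sum => t _.
have [_ _ _ h4] := hnE (k : nat, t : nat); apply: le_trans h4 _.
by rewrite opprD two_powRD mulrA.
Qed.

End Balanced.

Section Assembly.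
Variables (R : realType) (X : Type) (P : nat -> R -> ((X -> R) -> X -> R) -> Prop).
Hypothesis P0 : P 0 0 (fun _ _ => 0).
Hypothesis Padd : forall N1 N2 E1 E2 U1 U2, P N1 E1 U1 -> P N2 E2 U2 ->
 P (N1 + N2) (E1 + E2) (fun f x => U1 f x + U2 f x).

Lemma approx_sum (T : Type) (t : seq T) (n : T -> nat) (E : T -> R) (U : T -> (X -> R) -> X -> R) :
 (forall b, P (n b) (E b) (U b)) ->
 P (\sum_(b <- t) n b) (\sum_(b <- t) E b) (fun f x => \sum_(b <- t) U b f x).
Proof.
move=> h; elim: t => [|b t IH].
 rewrite !big_nil (_ : (fun f x => _) = fun _ _ => 0)//.
 by apply/funext => f; apply/funext => x; rewrite big_nil.
rewrite !big_cons (_ : (fun f x => _) = fun f x => U b f x + \sum_(b <- t) U b f x).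
 exact: Padd.
by apply/funext => f; apply/funext => x; rewrite big_cons.
Qed.

Variables (fdw : finType -> nat -> R -> Prop) (N0 : nat) (A B rho tau C1 C2 theta : R).
Variables (I : nat -> nat -> finType) (G : nat -> nat -> (X -> R) -> X -> R).
Hypothesis C20 : 0 < C2.
Hypothesis hI : forall i k, (k <= i)%N -> #|I i k|%:R <= C1 * 2 `^ (A * k%:R + B * (i - k)%:R).
Hypothesis hblock : forall i k n E, (k <= i)%N -> 0 <= E -> fdw (I i k) n E ->
 P (n + N0 * (i == 0))%N (C2 * 2 `^ (- (rho * k%:R + tau * (i - k)%:R)) * E) (G i k).
Hypothesis htail : forall e : R, 0 < e -> exists I0,
 P 0 e (fun f x => f x - \sum_(i < I0.+1) \sum_(k < i.+1) G i k f x).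

(** Additivity of P is the only structure used, so the argument serves widths and coverings alike.
    The levels beyond I0 are put into the error; I0 may depend on lam because the budgets are
    summable over all levels. *)
Lemma assemble : balanced fdw A B rho tau C1 theta -> exists2 C : R, 0 < C & forall lam, 0 <= lam ->
 exists N E, [/\ P N E (fun f => f), 0 <= E, N%:R <= C * 2 `^ lam & E <= C * 2 `^ (- (theta * lam))].
Proof.
move=> [C C0 hC]; exists ((C + N0%:R) + (C2 * C + 1)); first by rewrite ltr_pwDr ?addr_ge0 ?(ltW C0)// ltr_wpDl// mulr_ge0// ltW.
move=> lam lam0; have hI' k t : #|I (k + t)%N k|%:R <= C1 * 2 `^ (A * k%:R + B * t%:R).
 by have := hI (leq_addr t k); rewrite addKn.
have [n [E [h1 h2 h3 h4]]] := hC lam lam0 (fun k t => I (k + t)%N k) hI'.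
have [I0 hI0] := htail (powR_gt0 (- (theta * lam)) (ltr0Sn R 1)).
(* N0 is spent at level 0 only; it is the price of reproducing that level exactly. *)
pose n' i k := (n k (i - k) + N0 * (i == 0))%N.
pose E' i k := C2 * 2 `^ (- (rho * k%:R + tau * (i - k)%:R)) * E k (i - k)%N.
have hb (i : 'I_I0.+1) : P (\sum_(k < i.+1) n' i k) (\sum_(k < i.+1) E' i k) (fun f x => \sum_(k < i.+1) G i k f x).
 apply: approx_sum => k; have ki : (k <= i)%N by rewrite -ltnS.
 by apply: hblock => //; have := h1 k (i - k)%N; rewrite subnKC.
have := Padd (approx_sum (index_enum _) hb) hI0.
rewrite addn0 (_ : (fun f x => _) = (fun f => f)); last first.
 by apply/funext => f; apply/funext => x; rewrite addrC subrK.
set N := (\sum_(i <- _) _)%N; set F := \sum_(i <- _) _; move=> hP.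
have F0 : 0 <= F by apply: sumr_ge0 => i _; apply: sumr_ge0 => k _; rewrite !mulr_ge0 ?powR_ge0// ltW.
have l1 : 1 <= 2 `^ lam by exact: two_powR_ge1.
exists N, (F + 2 `^ (- (theta * lam))); split => //; first by rewrite addr_ge0 ?powR_ge0.
 apply: (@le_trans _ _ ((C + N0%:R) * 2 `^ lam)); last first.
  by rewrite ler_wpM2r ?powR_ge0// lerDl addr_ge0// mulr_ge0// ltW.
 rewrite /N natr_sum (eq_bigr (fun i : 'I_I0.+1 => \sum_(k < i.+1) (n k (i - k)%N)%:R +
   (\sum_(k < i.+1) N0 * ((i : nat) == 0))%N%:R)); last first.
  by move=> i _; rewrite natr_sum natr_sum -big_split; apply: eq_bigr => k _; rewrite natrD.
 rewrite big_split mulrDl; apply: lerD.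
  apply: le_trans (h3 I0.+1); apply: (@tri_sum _ (fun k t => (n k t)%:R)) => u v; exact: ler0n.
 rewrite big_ord_recl big_ord_recl big_ord0 big1 ?addr0 => [|i _]; last by rewrite big1// => k _; rewrite muln0.
 by rewrite /= muln1 addn0 addr0 ler_peMr.
apply: (@le_trans _ _ ((C2 * C + 1) * 2 `^ (- (theta * lam)))); last first.
 by rewrite ler_wpM2r ?powR_ge0// lerDr addr_ge0// ltW.
rewrite mulrDl mul1r lerD2r -mulrA; apply: le_trans (ler_wpM2l (ltW C20) (h4 I0.+1)).
rewrite mulr_sumr (eq_bigr (fun k : 'I_I0.+1 => \sum_(t < I0.+1) (C2 * 2 `^ (- (rho * k%:R + tau * t%:R)) * E k t))).
 apply: (@tri_sum _ (fun k t => C2 * 2 `^ (- (rho * k%:R + tau * t%:R)) * E k t)) => u v.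
 by rewrite !mulr_ge0 ?powR_ge0// ltW.
by move=> k _; rewrite mulr_sumr; apply: eq_bigr => t _; rewrite mulrA.
Qed.

(** lam is chosen by n = 2 C 2^lam. The factor 2 yields N <= n/2 <= n - 1, as entropy numbers count
    2^(n-1) centres. *)
Lemma assemble_eventually (w : nat -> \bar R) :
 (forall N n E, (N <= n.-1)%N -> 0 <= E -> P N E (fun f => f) -> (w n <= E%:E)%E) ->
 balanced fdw A B rho tau C1 theta -> eventually_bounded w theta.
Proof.
move=> hw /assemble[C C0 hC]; have C20' : 0 < 2 * C by rewrite mulr_gt0.
exists (C * (2 * C) `^ theta); first by rewrite mulr_gt0 ?powR_gt0.
exists (Num.truncn (2 * C)).+2 => n nn.
have nC : 2 * C <= n%:R.
 have /andP[_ h] := truncn_itv (ltW C20'); apply: le_trans (ltW h) _; rewrite ler_nat.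
 exact: leq_trans nn.
have n1 : 1 <= n%:R / (2 * C) by rewrite ler_pdivlMr// mul1r.
have [lam lam0 lamE] := two_powR_log_ge1 n1.
have [N [E [hP E0 hN hE]]] := hC lam lam0.
have n2 : (2 <= n)%N by apply: leq_trans nn.
have Nn : (N <= n.-1)%N.
 rewrite -(ler_nat R); apply: le_trans hN _; rewrite -lamE.
 rewrite (_ : C * _ = n%:R / 2); last by field; rewrite gt_eqF.
 clear -n2; case: n n2 => [|[|n]]// _; rewrite /= ler_pdivrMr// -natrM ler_nat.
 by rewrite muln2 -addnn addSn ltnS addnS ltnS leq_addr.
apply: le_trans (hw N n E Nn E0 hP) _; rewrite lee_fin; apply: le_trans hE _.
rewrite -mulrA ler_wpM2l ?(ltW C0)//.
have -> : 2 `^ (- (theta * lam)) = (2 `^ lam) `^ (- theta) by rewrite -powRrM mulrN mulrC.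
have iC : 0 <= (2 * C)^-1 by rewrite invr_ge0 ltW.
have -> : (2 `^ lam) `^ (- theta) = n%:R `^ (- theta) * (2 * C)^-1 `^ (- theta) by rewrite -lamE powRM.
rewrite mulrC; apply: ler_wpM2r; first exact: powR_ge0.
by rewrite -powR_inv1 ?(ltW C20')// -powRrM mulN1r opprK.
Qed.

End Assembly.

(** * Coverings of images of a class *)

Section Covers.
Variables (R : realType) (m : nat) (Omega : set 'rV[R]_m.+1) (q : \bar R).
Local Notation func := ('rV[R]_m.+1 -> R).
Hypothesis q1 : (1 <= q)%E.
Local Notation Nq := (Lp_norm Omega q).
Variable W : set func.
Implicit Types (f g : func) (N : nat) (E : R) (U : func -> func).

(** Centres are indexed by a finite type, so that the sum of two operators uses the product type. *)
Definition op_cover N E U : Prop := exists (T : finType) (v : T -> func),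
 [/\ (#|T| <= 2 ^ N)%N, forall t, (Nq (v t) < +oo)%E &
  forall f, W f -> exists t, (Nq (fun x => U f x - v t x)%R <= E%:E)%E].

Lemma op_cover_add N1 N2 E1 E2 U1 U2 : op_cover N1 E1 U1 -> op_cover N2 E2 U2 ->
 op_cover (N1 + N2) (E1 + E2) (fun f x => U1 f x + U2 f x).
Proof.
move=> [T1 [v1 [c1 f1 h1]]] [T2 [v2 [c2 f2 h2]]].
exists (T1 * T2)%type, (fun t x => v1 t.1 x + v2 t.2 x); split.
- by rewrite card_prod expnD leq_mul.
- by move=> t; apply: le_lt_trans (Lp_normD Omega _ _ q1) _; rewrite lte_add_pinfty.
move=> f Wf; have [t1 ht1] := h1 f Wf; have [t2 ht2] := h2 f Wf; exists (t1, t2).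
have := Lp_norm_add q1 ht1 ht2; congr (Nq _ <= _)%E; apply/funext => x /=.
by rewrite opprD addrACA.
Qed.

Lemma op_cover_zero E U : (forall f, W f -> (Nq (U f) <= E%:E)%E) -> op_cover 0 E U.
Proof.
move=> h; exists unit, (fun _ _ => 0); split; first by rewrite card_unit.
 by move=> _; rewrite Lp_norm0// ltry.
move=> f Wf; exists tt; rewrite (_ : (fun x => _) = U f); first exact: h.
by apply/funext => x; rewrite subr0.
Qed.

Lemma op_cover_block (I : finType) (phi : I -> func) (co : func -> I -> R) (p : \bar R) n E (w : R) :
 0 <= w -> (forall i, (Nq (phi i) < +oo)%E) ->
 (forall v, (Nq (fun x => \sum_i v i * phi i x)%R <= (w * lpn q v)%:E)%E) ->
 (forall f, W f -> lpn p (co f) <= 1) ->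
 fd_cover p q I n E -> op_cover n (w * E) (fun f x => \sum_i co f i * phi i x).
Proof.
move=> w0 phiN hS hco [s [ss hs]].
exists 'I_(size s), (fun (t : 'I_(size s)) x => \sum_i (nth [ffun=> 0] s t) i * phi i x); split.
- by rewrite card_ord.
- by move=> t; exact: Lp_norm_synth_fin.
move=> f /hco /hs[c cs hc]; have ht : (index c s < size s)%N by rewrite index_mem.
exists (Ordinal ht) => /=; rewrite nth_index//; apply: le_trans (_ : (w * lpn q (fun i => co f i - c i))%:E <= _)%E; last first.
 by rewrite lee_fin ler_wpM2l.
apply: le_trans (hS _); rewrite le_eqVlt; apply/orP; left; apply/eqP; congr (Nq _); apply/funext => x.
by rewrite -sumrB; apply: eq_bigr => i _; rewrite mulrBl.
Qed.

End Covers.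

(** * The embedding operator and its entropy numbers *)

Section Embedding.
Variables (R : realType) (m r : nat) (Omega : set 'rV[R]_m.+1) (p q : \bar R).
Local Notation leb := (lebesgue_rV R m.+1).
Hypotheses (mO : measurable Omega) (p1 : (1 <= p)%E) (q1 : (1 <= q)%E).
Local Notation Nq := (Lp_norm Omega q).
Local Notation X := (sobolev_space Omega r p1).
Local Notation Y := (Lp_space Omega q1).
Local Notation W1 := [set f | sobolev_class Omega r p f /\ (Lp_norm Omega p f <= 1)%E].

Lemma sobolev_norm_le1 f : (sobolev_norm Omega r p f <= 1)%E -> W1 f.
Proof.
rewrite /sobolev_norm; case: asboolP => // lf h; have g0 := grad_norm_ge0 Omega r p f.
have n0 := Lp_norm_ge0 Omega p f; split; last by apply: le_trans h; rewrite leeDr.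
by split=> //; apply: le_trans h; rewrite leeDl.
Qed.

Lemma norm_class_sub (V : lmodType R) (N : eseminorm V) (x y : esn_dom N) :
 (`|class_of x - class_of y|%:E)%E = N (esn_val x - esn_val y).
Proof.
have -> : class_of x - class_of y = class_of (x - y).
 by rewrite -[X in _ - X]scale1r -scaleNr -[X in _ + X]class_ofZ -class_ofD scaleN1r.
exact: norm_class.
Qed.

Section Bounded.
Variable (K : R).
Hypotheses (K0 : 0 <= K) (hK : forall f, W1 f -> (Nq f <= K%:E)%E).

(** Homogeneity carries the bound from the unit ball to radius b. As b may be 0, this is done for b
    + e' with e' tending to 0. *)
Lemma sobolev_Lp_bound f (b : R) : (sobolev_norm Omega r p f <= b%:E)%E -> (Nq f <= (K * b)%:E)%E.
Proof.
have pos (a : R) g : 0 < a -> (sobolev_norm Omega r p g <= a%:E)%E -> (Nq g <= (K * a)%:E)%E.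
 move=> a0 ha; have h : (sobolev_norm Omega r p (a^-1 *: g) <= 1)%E.
  rewrite sobolev_normZ// ger0_norm ?invr_ge0 ?(ltW a0)//.
  apply: le_trans (lee_wpmul2l _ ha) _; first by rewrite lee_fin invr_ge0 ltW.
  by rewrite -EFinM mulVf ?gt_eqF.
 have := hK (sobolev_norm_le1 h); rewrite Lp_normZ// ger0_norm ?invr_ge0 ?(ltW a0)//.
 by rewrite lee_pdivrMl// -EFinM mulrC.
move=> hb; have b0 : 0 <= b by rewrite -lee_fin; apply: le_trans hb; exact: sobolev_norm_ge0.
apply/lee_addgt0Pr => e e0; pose e' := e / (K + 1).
have K1 : 0 < K + 1 by rewrite ltr_wpDl.
have e'0 : 0 < e' by rewrite divr_gt0.
have := pos (b + e') f (ltr_wpDl b0 e'0); rewrite EFinD => h.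
apply: le_trans (h _) _; first by apply: le_trans hb _; rewrite leeDl// lee_fin ltW.
rewrite -!EFinD lee_fin mulrDr lerD2l /e' mulrCA ger_pMr// ler_pdivrMr// mul1r.
by rewrite lerDl.
Qed.

Lemma rep_Lp_bound (u : X) : (Nq (rep u) <= (K * `|u|)%:E)%E.
Proof. by apply: sobolev_Lp_bound; have := normed_quot_normE u; rewrite /= => ->. Qed.

Lemma rep_Lp_fin (u : X) : (Nq (rep u) < +oo)%E.
Proof. exact: le_lt_trans (rep_Lp_bound u) (ltry _). Qed.

Definition embedding (u : X) : Y := class_of (Lp_dom q1 (rep_Lp_fin u)).

Lemma embedding_linear : linear embedding.
Proof.
move=> a u v; rewrite /embedding.
rewrite -[X in _ = X + _]class_ofZ -[RHS]class_ofD.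
apply/class_ofP => /=; apply/eqP; rewrite eq_le Lp_norm_ge0 andbT.
have h : (sobolev_norm Omega r p (rep (a *: u + v) - (a *: rep u + rep v))%R <= 0%:E)%E.
 by rewrite le_eqVlt; apply/orP; left; apply/eqP; exact: (rep_linear a u v).
by have := sobolev_Lp_bound h; rewrite mulr0.
Qed.

Lemma embedding_norm (u : X) : (`|embedding u|%:E)%E = Nq (rep u).
Proof. exact: norm_class. Qed.

Lemma embedding_ae (u : X) : ae_eq leb Omega (rep (embedding u)) (rep u).
Proof.
have h : Nq (rep (embedding u) - rep u) = 0%E by have := rep_class (Lp_dom q1 (rep_Lp_fin u)).
have mf : measurable_on Omega (rep (embedding u) - rep u).
 by apply: (@Lp_norm_fin_measurable _ _ _ q); rewrite h ltry.
have q0 : (0%R < q)%E by apply: lt_le_trans q1.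
move: h; rewrite /Lp_norm asboolT// => h.
have mE : measurable_fun setT (EFin \o (rep (embedding u) - rep u) \_ Omega).
 exact/measurable_EFinP.
have := Lnorm_eq0_eq0 mE q0 h; apply: filterS => x /(_ I) + Ox.
by rewrite /= patchE mem_set// => -[] /eqP; rewrite subr_eq0 => /eqP.
Qed.

End Bounded.

(** E may be 0 whereas entropy numbers use positive radii; the radius E + e with arbitrary e > 0 is
    admissible. *)
Lemma entropy_le (Id : {linear X -> Y}) N n E : 0 <= E -> (N <= n.-1)%N ->
 (forall u, exists h : (Nq (rep u) < +oo)%E, Id u = class_of (Lp_dom q1 h)) ->
 op_cover Omega q W1 N E (fun f => f) -> (entropy_number Id n <= E%:E)%E.
Proof.
move=> E0 Nn hId [T [v [cT hv h]]]; apply/lee_addgt0Pr => e e0.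
apply: ereal_inf_lbound; exists (E + e) => //; split; first by rewrite ltr_wpDl.
pose L : seq Y := [seq (class_of (Lp_dom q1 (hv t)) : Y) | t <- enum T].
exists (fun i => nth 0 L i) => _ [u /= u1 <-].
have [|t ht] := h (rep u).
 by apply: sobolev_norm_le1; have := normed_quot_normE u; rewrite /= => <-; rewrite lee_fin.
have tn : (enum_rank t < 2 ^ n.-1)%N.
 by apply: leq_trans (ltn_ord _) (leq_trans cT _); rewrite leq_exp2l.
exists (Ordinal tn) => //=; have [hu ->] := hId u.
have -> : nth 0 L (enum_rank t) = class_of (Lp_dom q1 (hv t)).
 by rewrite (nth_map t) ?nth_enum_rank// -cardE ltn_ord.
rewrite -lee_fin norm_class_sub; apply: le_trans ht _; by rewrite lee_fin lerDl ltW.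
Qed.

End Embedding.

(** * Geometry of the graph domain *)

Section Operators.
Variables (R : realType) (m : nat) (sigma : R) (Omega : set 'rV[R]_m.+1) (Gamma : set 'rV[R]_m).
Hypothesis sigma_ge1 : 1 <= sigma.
Hypothesis GammaQ : Gamma `<=` [set y : 'rV[R]_m | forall i, 0 <= y ord0 i <= 1].
Hypothesis Gamma0 : Gamma !=set0.
Hypothesis OmegaE : Omega = [set x | (forall i, 0 < first_coords x ord0 i < 1) /\
     0 < x ord0 ord_max < 2 - dist_to (first_coords x) Gamma `^ sigma^-1].

Let sigma_gt0 : 0 < sigma. Proof. by apply: lt_le_trans sigma_ge1. Qed.

Let dist_lb (u : 'rV[R]_m) : has_lbound [set `|u - y| | y in Gamma].
Proof. by exists 0 => _ [y _ <-]. Qed.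

Let dist_ne (u : 'rV[R]_m) : [set `|u - y| | y in Gamma] !=set0.
Proof. by case: Gamma0 => y Gy; exists `|u - y|, y. Qed.

Lemma dist_ge0 u : 0 <= dist_to u Gamma.
Proof. by apply: lb_le_inf => // _ [y _ <-]. Qed.

Lemma dist_le u y : Gamma y -> dist_to u Gamma <= `|u - y|.
Proof. by move=> Gy; apply: ge_inf => //; exists y. Qed.

Lemma dist_adh u b : dist_to u Gamma < b -> exists2 y, Gamma y & `|u - y| < b.
Proof. by case/inf_lt => // _ [y Gy <-] yb; exists y. Qed.

Lemma dist_lip u v : dist_to v Gamma <= dist_to u Gamma + `|v - u|.
Proof.
apply/ler_addgt0Pr => e e0; have [y Gy uy] : exists2 y, Gamma y & `|u - y| < dist_to u Gamma + e.
 by apply: dist_adh; rewrite ltrDl.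
rewrite (le_trans (dist_le v Gy))//.
have := ler_normD (v - u) (u - y); rewrite addrA subrK; lra.
Qed.

Lemma dist_le1 (u : 'rV[R]_m) : (forall i, 0 <= u ord0 i <= 1) -> dist_to u Gamma <= 1.
Proof.
move=> u1; have [y Gy] := Gamma0; rewrite (le_trans (dist_le u Gy))//.
apply/rv_norm_leP => // j; rewrite !mxE ler_norml.
by have := u1 j; have := GammaQ Gy j => /andP[? ?] /andP[? ?]; apply/andP; split; lra.
Qed.

Lemma widen_neq (i : 'I_m) : widen_ord (leqnSn m) i != ord_max.
Proof. by rewrite -val_eqE/= neq_ltn ltn_ord. Qed.

Lemma neq_widen (j : 'I_m.+1) : j != ord_max -> exists i : 'I_m, j = widen_ord (leqnSn m) i.
Proof.
move=> jm; have jlt : (j < m)%N by have := ltn_ord j; rewrite ltnS leq_eqVlt -val_eqE/= in jm *; case/orP => //; rewrite (negbTE jm).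
by exists (Ordinal jlt); apply: val_inj.
Qed.

Lemma first_norm_le (x : 'rV[R]_m.+1) b : 0 <= b ->
 (forall j, j != ord_max -> `|x ord0 j| <= b) -> `|first_coords x| <= b.
Proof. by move=> b0 h; apply/rv_norm_leP => // i; rewrite mxE; apply/h/widen_neq. Qed.

Lemma first_coordsB (x w : 'rV[R]_m.+1) : first_coords x - first_coords w = first_coords (x - w).
Proof. by apply/rowP => i; rewrite !mxE. Qed.

(** The graph condition raised to the power sigma: the distance to Gamma, a Lipschitz function, is
    compared with (2 - x_d)^sigma. *)
Lemma OmegaP x : Omega x <-> [/\ forall j, j != ord_max -> 0 < x ord0 j < 1,
 0 < x ord0 ord_max < 2 & dist_to (first_coords x) Gamma < (2 - x ord0 ord_max) `^ sigma].
Proof.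
have d0 := dist_ge0 (first_coords x).
have rt : dist_to (first_coords x) Gamma = (dist_to (first_coords x) Gamma `^ sigma^-1) `^ sigma.
 by rewrite -powRrM mulVf ?gt_eqF// powRr1.
rewrite OmegaE /=; split => [[x01 /andP[y0 y2]]|[x01 /andP[y0 y2] dx]].
 split.
 - by move=> j /neq_widen[i ->]; have := x01 i; rewrite mxE.
 - rewrite y0/= (lt_le_trans y2)// gerBl powR_ge0//.
 - rewrite [ltLHS]rt; apply: gt0_ltr_powR; rewrite ?nnegrE ?powR_ge0//.
   by rewrite subr_ge0 ltW// (lt_le_trans y2)// gerBl powR_ge0.
  by rewrite ltrBrDr -ltrBrDl.
split; first by move=> i; rewrite mxE; apply/x01/widen_neq.
rewrite y0/= ltrBrDr -ltrBrDl ltNge; apply/negP => h.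
move: dx; rewrite [ltLHS]rt ltNge => /negP; apply.
by apply: (ge0_ler_powR (ltW sigma_gt0)); rewrite ?nnegrE ?powR_ge0// subr_ge0 ltW.
Qed.

(** Omega is the union over c > 0 of sets whose points keep a vertical margin c and have distance to
    Gamma below the constant c^sigma; in each of these the conditions are Lipschitz in x. *)
Lemma Omega_open : open Omega.
Proof.
pose V (c : R) := [set x : 'rV[R]_m.+1 | [/\ forall j, j != ord_max -> 0 < x ord0 j < 1,
 0 < x ord0 ord_max < 2 - c & dist_to (first_coords x) Gamma < c `^ sigma]].
have -> : Omega = \bigcup_(c in [set c | 0 < c]) V c.
 apply/seteqP; split => x.
  move=> /OmegaP[x01 /andP[y0 y2] dx].
  have r0 : 0 <= dist_to (first_coords x) Gamma `^ sigma^-1 by exact: powR_ge0.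
  have d0 := dist_ge0 (first_coords x).
  have r1 : dist_to (first_coords x) Gamma `^ sigma^-1 < 2 - x ord0 ord_max.
   have -> : 2 - x ord0 ord_max = ((2 - x ord0 ord_max) `^ sigma) `^ sigma^-1.
    by rewrite -powRrM divff ?gt_eqF// powRr1// subr_ge0 ltW.
   apply: gt0_ltr_powR; rewrite ?invr_gt0 ?nnegrE ?powR_ge0//.
  pose c := (dist_to (first_coords x) Gamma `^ sigma^-1 + (2 - x ord0 ord_max)) / 2.
  have c1 : dist_to (first_coords x) Gamma `^ sigma^-1 < c by rewrite /c; lra.
  have c2 : c < 2 - x ord0 ord_max by rewrite /c; lra.
  have c0 : 0 < c by apply: le_lt_trans c1.
  exists c => //; split => //; first by rewrite y0/= ltrBrDr -ltrBrDl.
  have {1}-> : dist_to (first_coords x) Gamma = (dist_to (first_coords x) Gamma `^ sigma^-1) `^ sigma.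
   by rewrite -powRrM mulVf ?gt_eqF// powRr1.
  by apply: gt0_ltr_powR; rewrite ?nnegrE ?(ltW c0).
 move=> [c c0 [x01 /andP[y0 y2] dx]]; apply/OmegaP; split => //.
  by rewrite y0/= (lt_trans y2)// gtrBl.
 apply: lt_le_trans dx _; apply: (ge0_ler_powR (ltW sigma_gt0)); rewrite ?nnegrE ?(ltW c0)//.
  by rewrite subr_ge0 ltW// (lt_trans y2)// gtrBl.
 by rewrite lerBrDr -lerBrDl ltW.
apply: bigcup_open => c _; rewrite openE => x [x01 /andP[y0 y2] dx].
pose e := Num.min (Num.min (x ord0 ord_max) (2 - c - x ord0 ord_max))
 (Num.min (c `^ sigma - dist_to (first_coords x) Gamma)
  (\big[Num.min/1]_(j | j != ord_max) Num.min (x ord0 j) (1 - x ord0 j))).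
have e0 : 0 < e.
 rewrite !lt_min !subr_gt0 y0 y2 dx/=.
 by elim/big_ind : _ => [//|a b a0 b0|j jm]; rewrite lt_min ?a0// subr_gt0; exact: x01.
apply/nbhs_ballP; exists e => //= w; rewrite -ball_normE /= => xw.
have wj j : `|x ord0 j - w ord0 j| < e.
 by apply: le_lt_trans xw; have := rv_coord_le (x - w) j; rewrite !mxE.
have eP : [/\ e <= x ord0 ord_max, e <= 2 - c - x ord0 ord_max &
 e <= c `^ sigma - dist_to (first_coords x) Gamma].
 by split; rewrite /e !ge_min lexx ?orbT.
have eH j : j != ord_max -> e <= x ord0 j /\ e <= 1 - x ord0 j.
 move=> jm; have h : e <= Num.min (x ord0 j) (1 - x ord0 j).
  by rewrite /e ge_min; apply/orP; right; rewrite ge_min; apply/orP; right; apply: bigmin_le_cond.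
 by split; apply: le_trans h _; rewrite ge_min lexx ?orbT.
case: eP => e1 e2 e3; split.
- move=> j jm; have [h1 h2] := eH j jm; have := wj j; rewrite ltr_distl => /andP[? ?].
 by apply/andP; split; lra.
- have := wj ord_max; rewrite ltr_distl => /andP[? ?]; by apply/andP; split; lra.
have := dist_lip (first_coords x) (first_coords w); rewrite first_coordsB.
have : `|first_coords (w - x)| <= `|x - w|.
 by rewrite distrC; apply: first_norm_le => // j _; exact: rv_coord_le.
by lra.
Qed.

Lemma Omega_measurable : measurable Omega.
Proof. exact: open_measurable_rV Omega_open. Qed.

(** The hull of the boxes of a cell and of its parent, shrunk by a quarter of the smaller side. It
    still contains the supports of both kernels, by the margins of [smooth_step]. *)
Definition hull_lo i k z j : R :=
 Num.min (corner sigma i (minn i k) (@par_key R m sigma i k z) j) (corner sigma i.+1 k z j)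
  + side sigma i.+1 k j / 4.
Definition hull_hi i k z j : R :=
 Num.max (corner sigma i (minn i k) (@par_key R m sigma i k z) j + side sigma i (minn i k) j)
  (corner sigma i.+1 k z j + side sigma i.+1 k j) - side sigma i.+1 k j / 4.

Lemma hull_num (A1 A2 H1 H2 X W : R) : 0 <= A1 -> A1 <= X -> X < A1 + H1 -> A1 + H1 <= 1 ->
 0 <= A2 -> A2 <= X -> X < A2 + H2 -> A2 + H2 <= 1 -> 0 < H2 -> H2 <= H1 ->
 Num.min A1 A2 + H2 / 4 <= W -> W <= Num.max (A1 + H1) (A2 + H2) - H2 / 4 ->
 0 < W < 1 /\ `|W - X| < H1.
Proof.
move=> a1 a2 a3 a4 b1 b2 b3 b4 h2 h12; rewrite ltr_norml /Num.min /Num.max.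
case: (ltP A1 A2) => ?; case: (ltP (A1 + H1) (A2 + H2)) => ? ? ?; split; apply/andP; split; lra.
Qed.

Section HullBox.
Variables (x : 'rV[R]_m.+1) (i : nat).
Hypothesis Ox : Omega x.
Let y := x ord0 ord_max.
Let k := kap i.+1 y.

Lemma Omega_x01 : forall j, j != ord_max -> 0 < x ord0 j < 1.
Proof. by case/OmegaP : Ox. Qed.

Lemma Omega_y02 : 0 <= y < 2.
Proof. by case/OmegaP : Ox => _ /andP[/ltW y0 y2] _; rewrite y0. Qed.

Lemma par_cornerE j :
 corner sigma i (minn i k) (par_key sigma i k (key sigma i.+1 x)) j =
 corner sigma i (kap i y) (key sigma i x) j.
Proof.
by rewrite /corner (par_keyE sigma_ge1 Omega_x01 Omega_y02) -kap_par.
Qed.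

(** From (1 + v/s)^sigma >= 1 + v/s. Going down by v at distance s from the top level enlarges the
    admissible distance to Gamma by at least v s^(sigma - 1). *)
Lemma bernoulli_power (s v l : R) : 0 < s -> 0 <= v -> l <= v * s `^ (sigma - 1) ->
 s `^ sigma + l <= (s + v) `^ sigma.
Proof.
move=> s0 v0 lv; have vs0 : 0 <= v / s by rewrite divr_ge0// ltW.
have -> : (s + v) `^ sigma = s `^ sigma * (1 + v / s) `^ sigma.
 rewrite -powRM ?(ltW s0) ?addr_ge0//; congr (_ `^ _); field; by rewrite gt_eqF.
have bern : 1 + v / s <= (1 + v / s) `^ sigma.
 rewrite -[leLHS]powRr1 ?addr_ge0//; apply: ler_powR => //; by rewrite lerDl.
apply: (@le_trans _ _ (s `^ sigma * (1 + v / s))); last first.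
 by apply: ler_wpM2l bern; exact: powR_ge0.
rewrite mulrDr mulr1 lerD2l (le_trans lv)//.
have -> : s `^ sigma = s `^ (sigma - 1) * s.
 by rewrite -[X in _ * X]powRr1 ?(ltW s0)// -powRD ?(gt_eqF s0) ?implybT// subrK.
rewrite le_eqVlt; apply/orP; left; apply/eqP; field; by rewrite gt_eqF.
Qed.

Lemma zeta_next_ge : hp R (kap i y) <= 2 - zeta i.+1 y.
Proof.
have [/eqP ik|ik] := boolP (kap i y == i).
 rewrite ik lerBrDl -lerBrDr /zeta ge_min; apply/orP; right.
 by rewrite [X in _ <= _ - X]hpS lexx.
have := zeta_lt i.+1 Omega_y02; rewrite -/k.
have -> : k = kap i y.
 rewrite kap_par -/k; apply/esym/minn_idPr; rewrite leqNgt; apply/negP => ki.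
 by move: ik; rewrite kap_par -/k (minn_idPl (ltnW ki)) eqxx.
by lra.
Qed.

(** With k = [kap i y] the exponent of the side is at least sigma k + 2 + (i - k) = (i + 2) + (sigma
    - 1) k, and 2^-k is at most 2 - [zeta]. So the side fits the gain of [bernoulli_power] with v =
    2^-(i+2). *)
Lemma hor_side_le (j : 'I_m.+1) : j != ord_max -> side sigma i (kap i y) j <=
 hp R i.+2 * (2 - zeta i.+1 y) `^ (sigma - 1).
Proof.
move=> jm; have s1 : 0 <= sigma - 1 by rewrite subr_ge0.
apply: (@le_trans _ _ (hp R i.+2 * hp R (kap i y) `^ (sigma - 1))); last first.
 apply: ler_wpM2l; first exact: hp_ge0.
 apply: (ge0_ler_powR s1); rewrite ?nnegrE ?hp_ge0//; last exact: zeta_next_ge.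
 by apply: le_trans zeta_next_ge; exact: hp_ge0.
have ki : (kap i y <= i)%N by exact: geq_minl.
rewrite /side /cexp (negbTE jm); set K := kap i y in ki *.
have hpE a : hp R a = 2 `^ (- a%:R) by rewrite powRN powR_mulrn// /hp exprVn.
rewrite !hpE -powRrM -powRD ?pnatr_eq0 ?implybT//; apply: ler_powR; first by rewrite ler1n.
have /andP[h _] := hexp_bound sigma_ge1 K.
rewrite !natrD natrB// -[i.+2%:R]natr1 -[i.+1%:R]natr1.
by lra.
Qed.

(** Horizontally a point of the hull is within one side of the parent box from x; for k > 0 it is at
    least 2^-(i+2) below [zeta], and this descent pays for the horizontal move by [bernoulli_power].
    For k = 0 the hull lies below height 1, where every horizontal position in the unit cube is
    allowed. *)
Lemma hull_sub : cbox (hull_lo i k (key sigma i.+1 x)) (hull_hi i k (key sigma i.+1 x)) `<=` Omega.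
Proof.
move=> w hw; have x01 := Omega_x01; have y02 := Omega_y02.
have ki : (k <= i.+1)%N by exact: geq_minl.
have hw' j : Num.min (corner sigma i (kap i y) (key sigma i x) j)
   (corner sigma i.+1 k (key sigma i.+1 x) j) + side sigma i.+1 k j / 4 <= w ord0 j /\
  w ord0 j <= Num.max (corner sigma i (kap i y) (key sigma i x) j + side sigma i (kap i y) j)
   (corner sigma i.+1 k (key sigma i.+1 x) j + side sigma i.+1 k j) - side sigma i.+1 k j / 4.
 by have := hw j; rewrite /hull_lo /hull_hi par_cornerE -kap_par => /andP[].
have s0 (j : 'I_m.+1) : 0 < side sigma i.+1 k j by exact: side_gt0.
have wj j : j != ord_max -> 0 < w ord0 j < 1 /\ `|w ord0 j - x ord0 j| < side sigma i (kap i y) j.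
 move=> jm; have [a1 a2 a3 a4] := corner_hor sigma x01 y02 i jm.
 have [b1 b2 b3 b4] := corner_hor sigma x01 y02 i.+1 jm.
 have /andP[s1 _] := side_step sigma_ge1 j ki; rewrite -kap_par in s1.
 have [w1 w2] := hw' j; exact: (hull_num a1 a2 a3 a4 b1 b2 b3 b4 (s0 j) s1 w1 w2).
have [a1 _ a2 a3 a4] := corner_ver sigma x01 y02 i.
have [b1 _ b2 b3 b4] := corner_ver sigma x01 y02 i.+1.
have [w1 w2] := hw' ord_max; move: (s0 ord_max) w1 w2.
have sE i' k' : side sigma i' k' (@ord_max m) = hp R i'.+2 by rewrite /side /cexp eqxx.
rewrite !sE => h0 w1 w2.
have h2 : hp R i.+2 = 2 * hp R i.+3 by exact: hpS.
have wd0 : 0 < w ord0 ord_max.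
 apply: lt_le_trans w1; rewrite ltr_pwDr ?divr_gt0//.
 by rewrite le_min a1 b1.
have dw : dist_to (first_coords w) Gamma <= dist_to (first_coords x) Gamma + `|first_coords (w - x)|.
 by have := dist_lip (first_coords x) (first_coords w); rewrite first_coordsB.
case/OmegaP : (Ox) => _ _ dx; rewrite -/y in dx.
have w01 : forall j, j != ord_max -> 0 < w ord0 j < 1 by move=> j /wj[].
case: (posnP k) => k0.
 have k0' : kap i y = 0%N by rewrite kap_par -/k k0 minn0.
 have w1' : w ord0 ord_max < 1.
  apply: le_lt_trans w2 _; rewrite ltrBlDr; apply: (@le_lt_trans _ _ 1); last by rewrite ltrDl divr_gt0.
  by rewrite ge_max a4// b4.
 apply/OmegaP; split => //; first by rewrite wd0/= (lt_trans w1')// ltr1n.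
 apply: (@le_lt_trans _ _ 1).
  by apply: dist_le1 => i'; rewrite mxE; have /andP[/ltW -> /ltW ->] := w01 _ (widen_neq i').
 have e1 : 1 `^ sigma = 1 :> R by rewrite powR1.
 have w21 := hull_num5 w1'; rewrite -[ltLHS]e1.
 by apply: gt0_ltr_powR; rewrite ?nnegrE// ltW// (lt_trans ltr01).
have wz : w ord0 ord_max < zeta i.+1 y - 2 * hp R i.+3.
 apply: le_lt_trans w2 _; rewrite ltrBlDr; apply: (@le_lt_trans _ _ (zeta i.+1 y - 2 * hp R i.+3)); last first.
  by rewrite ltrDl divr_gt0.
 rewrite ge_max (b3 k0) andbT; have [k1|k1] := posnP (kap i y); last first.
  have a3' := a3 k1; have /andP[z1 _] := zeta_step i y; rewrite h2 -/y in a3' *.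
  exact: hull_num1 a3' z1 h0.
 (* The parent has strip 0 although the cell has not: this happens only through the cut at i = 0,
    where [zeta] is 0 and the parent box starts at the bottom. *)
 have i0 : i = 0%N by apply: (minn_eq0l _ k0); rewrite -kap_par.
 have z1 := zeta_ge1 Omega_y02 k0.
 have h8 : hp R i.+3 = 8^-1 by rewrite i0 /hp exprVn -natrX.
 have a2' : corner sigma i (kap i y) (key sigma i x) ord_max <= zeta i y by [].
 have zi0 : zeta i y = 0.
  rewrite i0 /zeta /hp expr0 mulr1 subrr; apply/min_idPr; by case/andP: Omega_y02.
 by rewrite h2; apply: hull_num2; rewrite -?zi0.
have z2 : zeta i.+1 y <= y by rewrite /zeta ge_min lexx.
have y2 := proj2 (andP Omega_y02); rewrite -/y in y2.
have [n1 n2 n3 n4 n5] := hull_num3 wz y2 z2 h0; rewrite -h2 in n4 n5.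
apply/OmegaP; split => //; first by rewrite wd0.
have [j jm|nj] := pickP (fun j : 'I_m.+1 => j != ord_max); last first.
 have -> : dist_to (first_coords w) Gamma = dist_to (first_coords x) Gamma.
  have m0 (i' : 'I_m) : False by have := widen_neq i'; rewrite nj.
  by congr dist_to; apply/rowP => i'.
 apply: lt_le_trans dx _; apply: (ge0_ler_powR (ltW sigma_gt0)); rewrite ?nnegrE//.
 apply: le_trans n5; apply: (@le_trans _ _ (2 - zeta i.+1 y)); last by rewrite lerDl hp_ge0.
 by rewrite lerB.
have sd (j' : 'I_m.+1) : j' != ord_max -> side sigma i (kap i y) j' = side sigma i (kap i y) j.
 by move=> jm'; rewrite /side /cexp (negbTE jm) (negbTE jm').
have fn : `|first_coords (w - x)| <= side sigma i (kap i y) j.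
 apply: first_norm_le; first by rewrite ltW// side_gt0.
 by move=> j' jm'; rewrite !mxE -(sd j' jm') ltW//; case: (wj j' jm').
have z0 : 0 < 2 - zeta i.+1 y by apply: lt_le_trans zeta_next_ge; exact: hp_gt0.
have dx' : dist_to (first_coords x) Gamma < (2 - zeta i.+1 y) `^ sigma.
 apply: lt_le_trans dx _; apply: (ge0_ler_powR (ltW sigma_gt0)); rewrite ?nnegrE ?(ltW z0)//.
 by rewrite lerB.
have bern := bernoulli_power z0 (hp_ge0 R i.+2) (hor_side_le jm).
have mono : (2 - zeta i.+1 y + hp R i.+2) `^ sigma <= (2 - w ord0 ord_max) `^ sigma.
 by apply: (ge0_ler_powR (ltW sigma_gt0)); rewrite ?nnegrE.
exact: hull_num4 dw dx' fn bern mono.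
Qed.

End HullBox.

(** * Cells and their number *)

Implicit Types (x w : 'rV[R]_m.+1) (i k t : nat) (j : 'I_m.+1).

(** A bound for all indices occurring in Omega; its role is to make the cells of a strip a finite
    type. *)
Definition key_max i k : nat := 2 ^ (hexp sigma k + i + 5).
Definition in_cell i k (z : 'I_m.+1 -> nat) x :=
 [/\ Omega x, kap i (x ord0 ord_max) = k & forall j, key sigma i x j = z j].
(** Only nonempty cells are kept: their number is bounded through the h-set condition, and a point
    [cpt] of each cell carries statements about points over to cells. *)
Definition cell i k := {z : {ffun 'I_m.+1 -> 'I_(key_max i k)} |
 `[< exists x, in_cell i k (fun j => z j) x >]}.
Definition ckey i k (c : cell i k) (j : 'I_m.+1) : nat := val c j.
Definition cset i k (c : cell i k) : set 'rV[R]_m.+1 := [set x | in_cell i k (ckey c) x].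

Lemma cpt_ex i k (c : cell i k) : exists x, cset c x.
Proof. by case: c => z hz; have /asboolP := hz. Qed.

Definition cpt i k (c : cell i k) : 'rV[R]_m.+1 := sval (cid (cpt_ex c)).

Lemma cptP i k (c : cell i k) : cset c (cpt c).
Proof. exact: (svalP (cid (cpt_ex c))). Qed.

Lemma ckey_inj i k (c c' : cell i k) : ckey c =1 ckey c' -> c = c'.
Proof. by move=> h; apply/val_inj/ffunP => j; apply/val_inj/h. Qed.

Lemma cset_inj i k (c c' : cell i k) x : cset c x -> cset c' x -> c = c'.
Proof. by move=> [_ _ h] [_ _ h']; apply: ckey_inj => j; rewrite -h h'. Qed.

Lemma key_lt x i j : Omega x -> (key sigma i x j < key_max i (kap i (x ord0 ord_max)))%N.
Proof.
move=> Ox; have x01 := Omega_x01 Ox.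
have y02 := Omega_y02 Ox.
have := key_grid sigma x01 y02 i j; cbv zeta; set k := kap i _.
set t := (if _ then _ else _) => /andP[h1 _].
have t2 : t < 2.
 rewrite /t; case: eqVneq => jm; last first.
  by have /andP[_ h] := x01 _ jm; rewrite (lt_trans h)// ltr1n.
 by case/andP: y02 => _; apply: le_lt_trans; rewrite /zeta ge_min lexx.
rewrite -(ltr_nat R); have s0 := side_gt0 sigma i k j.
have : (key sigma i x j)%:R < 2 / side sigma i k j.
 by rewrite ltr_pdivlMr//; apply: le_lt_trans h1 t2.
move=> /lt_le_trans; apply; rewrite /side hpV -natrM ler_nat /key_max -expnS leq_exp2l//.
rewrite /cexp; case: ifP => _; lia.
Qed.

Lemma cell_of x i : Omega x -> exists c : cell i (kap i (x ord0 ord_max)), cset c x.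
Proof.
move=> Ox; set k := kap i _.
pose z : {ffun 'I_m.+1 -> 'I_(key_max i k)} := [ffun j => Ordinal (key_lt i j Ox)].
have zP : in_cell i k (fun j => z j) x by split => // j; rewrite ffunE.
have hz : `[< exists x, in_cell i k (fun j => z j) x >] by apply/asboolP; exists x.
by exists (exist _ z hz).
Qed.

Lemma strip_leE (y : R) k : y < 2 -> (strip y <= k)%N = (y < 2 - hp R k).
Proof.
move=> y2; apply/idP/idP => h.
 by apply: lt_le_trans (strip_lt y2) _; rewrite lerB// hp_le.
by rewrite leqNgt; apply/negP => /(strip_ge y2); rewrite leNgt h.
Qed.

Lemma measurable_xd_lt (b : R) : measurable [set x : 'rV[R]_m.+1 | x ord0 ord_max < b].
Proof.
rewrite -[X in measurable X]setTI (_ : [set x | _] = (fun x : 'rV[R]_m.+1 => x ord0 ord_max) @^-1` `]-oo, b[).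
 exact: measurable_coord.
by apply/seteqP; split => x; rewrite /= in_itv.
Qed.

Lemma kap_measurable i k : measurable [set x | Omega x /\ kap i (x ord0 ord_max) = k].
Proof.
have mO := Omega_measurable.
have y2 x : Omega x -> x ord0 ord_max < 2.
 by move=> /(Omega_y02)/andP[].
have sle n : measurable (Omega `&` [set x | (strip (x ord0 ord_max) <= n)%N]).
 rewrite (_ : _ `&` _ = Omega `&` [set x | x ord0 ord_max < 2 - hp R n]).
  apply: measurableI => //; exact: measurable_xd_lt.
 by apply/seteqP; split => x /= [Ox h]; split => //; rewrite ?strip_leE ?y2// in h *.
have kle n : measurable (Omega `&` [set x | (kap i (x ord0 ord_max) <= n)%N]).
 have [ni|ni] := leqP i n.
  rewrite (_ : _ `&` _ = Omega)//; apply/seteqP; split => [x []//|x Ox]; split => //=.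
  by rewrite /kap geq_min ni.
 rewrite (_ : _ `&` _ = Omega `&` [set x | (strip (x ord0 ord_max) <= n)%N])//.
 by apply/seteqP; split => x /= [Ox]; rewrite /kap geq_min (leqNgt i) ni/=.
case: k => [|k].
 rewrite (_ : [set x | _] = Omega `&` [set x | (kap i (x ord0 ord_max) <= 0)%N])//.
 by apply/seteqP; split => x /= [Ox]; rewrite leqn0 => /eqP.
rewrite (_ : [set x | _] = (Omega `&` [set x | (kap i (x ord0 ord_max) <= k.+1)%N]) `\`
  (Omega `&` [set x | (kap i (x ord0 ord_max) <= k)%N])).
 exact: measurableD.
apply/seteqP; split => x /=.
 by move=> [Ox ->]; split => // -[_]; rewrite ltnn.
move=> [[Ox h1] h2]; split => //; apply/eqP; rewrite eqn_leq h1/= ltnNge.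
by apply/negP => h; apply: h2.
Qed.

Lemma cset_measurable i k (c : cell i k) : measurable (cset c).
Proof.
pose T j x : R := if j == ord_max then zeta i (x ord0 ord_max) else x ord0 j.
have mT j : measurable_fun setT (T j).
 rewrite /T; case: eqP => _; last exact: measurable_coord.
 apply: measurable_minr; [exact: measurable_coord|exact: measurable_cst].
pose B j := T j @^-1` `[(ckey c j)%:R * side sigma i k j, ((ckey c j)%:R + 1) * side sigma i k j[.
have mB j : measurable (B j) by rewrite -[X in measurable X]setTI; exact: mT.
rewrite (_ : cset c = [set x | Omega x /\ kap i (x ord0 ord_max) = k] `&` \bigcap_j B j).
 apply: measurableI; first exact: kap_measurable.
 by apply: fin_bigcap_measurable.
apply/seteqP; split => x.
 move=> [Ox kx zx]; split => // j _; rewrite /B/= in_itv/= -zx -kx.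
 exact: (key_grid sigma (Omega_x01 Ox) (Omega_y02 Ox)).
move=> [[Ox kx] hB]; split => // j; have := hB j I; rewrite /B/= in_itv/= /key kx.
rewrite -ler_pdivlMr ?side_gt0// -ltr_pdivrMr ?side_gt0// natr1 => h.
apply/truncn_def => //.
Qed.

Let S := (Num.truncn sigma).+1.

Lemma cell_near i k (c : cell i k) x j : cset c x ->
 `|x ord0 j - corner sigma i k (ckey c) j| <= 12 * side sigma i k j.
Proof.
move=> [Ox kx zx].
have := corner_near sigma (Omega_x01 Ox) (Omega_y02 Ox) i j.
by rewrite kx /corner zx.
Qed.

Definition pcorner i k (z : 'I_m.+1 -> nat) := corner sigma i (minn i k) (par_key sigma i k z).
Definition pside i k := @side R m sigma i (minn i k).
Definition pconst : nat := 20 + 2 ^ S.+2.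

Lemma eq_corner i k (z z' : 'I_m.+1 -> nat) : z =1 z' -> corner sigma i k z =1 corner sigma i k z'.
Proof. by move=> zz j; rewrite /corner zz. Qed.

Lemma eq_pcorner i k (z z' : 'I_m.+1 -> nat) : z =1 z' -> pcorner i k z =1 pcorner i k z'.
Proof. by move=> zz; apply: eq_corner => j; rewrite /par_key zz. Qed.

Lemma cell_kap i k (c : cell i k) : (k <= i)%N.
Proof. by have [_ h _] := cptP c; rewrite -h geq_minl. Qed.

Lemma cell_step i k (c : cell i.+1 k) j :
 `|corner sigma i.+1 k (ckey c) j - pcorner i k (ckey c) j| <= pconst%:R * side sigma i.+1 k j.
Proof.
have [Ox kx zx] := cptP c.
have := corner_step sigma_ge1 (Omega_x01 Ox) (Omega_y02 Ox) i j.
rewrite -(par_cornerE i Ox) kx.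
by rewrite (eq_corner _ _ zx) -(eq_pcorner i k zx).
Qed.

Lemma cell_hull_sub i k (c : cell i.+1 k) :
 cbox (hull_lo i k (ckey c)) (hull_hi i k (ckey c)) `<=` Omega.
Proof.
have [Ox kx zx] := cptP c.
have := hull_sub (i := i) Ox; rewrite kx => h w hw; apply: h => j.
by have := hw j; rewrite /hull_lo /hull_hi /corner /par_key !zx.
Qed.

Lemma hull_near i k (c : cell i.+1 k) w j :
 cbox (hull_lo i k (ckey c)) (hull_hi i k (ckey c)) w ->
 `|w ord0 j - corner sigma i.+1 k (ckey c) j| <= (pconst + pconst)%:R * side sigma i.+1 k j.
Proof.
move=> /(_ j); rewrite /hull_lo /hull_hi -/(pcorner i k (ckey c)) -/(pside i k) => /andP[w1 w2].
have st := cell_step c j; have s0 := side_gt0 sigma i.+1 k j.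
have /andP[s1 s2] := side_step sigma_ge1 j (cell_kap c); rewrite -/(pside i k j) -/S in s1 s2.
have e : (2 ^ S.+2)%:R * side sigma i.+1 k j + 20 * side sigma i.+1 k j = pconst%:R * side sigma i.+1 k j.
 by rewrite -mulrDl -natrD addnC.
by rewrite natrD mulrDl; exact: hull_num6 w1 w2 e s1 s2 s0 st.
Qed.

Lemma hull_overlap i k w :
 (#|[pred c : cell i.+1 k | `[< cbox (hull_lo i k (ckey c)) (hull_hi i k (ckey c)) w >]]| <=
  ((pconst + pconst + 3).*2.+1) ^ m.+1)%N.
Proof.
apply: (@box_count R m.+1 _ _ (@ckey i.+1 k) (fun j => w ord0 j / side sigma i.+1 k j)).
 exact: ckey_inj.
move=> c j hin; have hw : cbox (hull_lo i k (ckey c)) (hull_hi i k (ckey c)) w.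
 by apply/asboolP; exact: hin.
have s0 := side_gt0 sigma i.+1 k j.
have := hull_near j hw; rewrite /corner; set u := (if _ then _ else _).
have u3 : 0 <= u <= 3 * side sigma i.+1 k j.
 by rewrite /u; case: ifP => _; rewrite ?lexx ?mulr_ge0 ?(ltW s0).
have -> : (ckey c j)%:R - w ord0 j / side sigma i.+1 k j =
  ((ckey c j)%:R * side sigma i.+1 k j - w ord0 j) / side sigma i.+1 k j.
 by field; rewrite gt_eqF.
rewrite normrM normfV (gtr0_norm s0) ler_pdivrMr// (natrD _ (pconst + pconst)) => h.
exact: hull_num7 h u3.
Qed.

(** Each cell lies over a point at distance at most [de], of order 2^(-sigma k), from Gamma. Balls
    of radius [de] around nearby points of Gamma have measure at least [de]^theta/cs, a given point
    belongs to at most a constant times 2^(t d) of them, and the total mass of mu is finite. *)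
Lemma cell_count (theta : R) : 0 <= theta -> h_set (fun u : R => u `^ theta) Gamma ->
 exists2 C : R, 0 < C & forall k t,
  #|{: cell (k + t) k}|%:R <= C * 2 `^ (sigma * theta * k%:R + m.+1%:R * t%:R).
Proof.
move=> th0 [_ _ _ _ [cs [mu [cs1 _ hmu]]]].
have cs0 : 0 < cs by apply: lt_le_trans cs1.
have muT : (mu setT < +oo)%E by apply: fin_num_fun_lty => //; exact: fin_num_measure.
pose MT := fine (mu setT); have MTE : MT%:E = mu setT by rewrite fineK// ge0_fin_numE.
have MT0 : 0 <= MT by rewrite fine_ge0.
pose B : nat := 2 ^ (S + 7).
pose C := (B ^ m.+1)%:R * MT * cs + 1.
have C0 : 0 < C by rewrite ltr_wpDl// !mulr_ge0// ltW.
exists C => // k t; set i := (k + t)%N.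
pose u : R := 2 * hp R k; have u0 : 0 < u by rewrite mulr_gt0// hp_gt0.
(* The radius is cut at 1, the range of the bounds on mu; distances to Gamma from the unit cube are
   at most 1 anyway. *)
pose de : R := Num.min 1 (u `^ sigma).
have de0 : 0 < de by rewrite lt_min ltr01 powR_gt0.
have de1 : de <= 1 by rewrite ge_min lexx.
have distx (c : cell i k) : exists2 y, Gamma y & `|first_coords (cpt c) - y| < 2 * de.
 have [Ox kx _] := cptP c; apply: dist_adh.
 case/(OmegaP) : (Ox) => x01 /andP[y0 y2] dx.
 have y02 := Omega_y02 Ox.
 have d1 : dist_to (first_coords (cpt c)) Gamma <= de.
  rewrite /de le_min; apply/andP; split.
   apply: dist_le1 => // i'; rewrite mxE.
   by have /andP[/ltW -> /ltW ->] := x01 _ (widen_neq i').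
  apply: le_trans (ltW dx) _; apply: ge0_ler_powR; rewrite ?nnegrE ?(ltW u0)//.
  - by apply: le_trans sigma_ge1.
  - by rewrite subr_ge0 ltW.
  have := zeta_ge i y02; rewrite kx -/u => h.
  have hz : zeta i (cpt c ord0 ord_max) <= cpt c ord0 ord_max by rewrite /zeta ge_min lexx.
  exact: count_num3 h hz.
 by apply: le_lt_trans d1 _; rewrite ltr_pMl// ltr1n.
have /choice[yc hyc] : forall c : cell i k, exists y, Gamma y /\ `|first_coords (cpt c) - y| < 2 * de.
 by move=> c; have [y Gy hy] := distx c; exists y.
pose E (c : cell i k) := ball (yc c) de.
have mE c : measurable (E c) by apply: open_measurable_rV; exact: ball_open.
pose K : nat := 2 ^ (S + 5 + t).
have hpowS : u `^ sigma <= (2 ^ (S + 3 + t))%:R * hp R (hexp sigma k + 2 + t).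
 have hpE a : hp R a = 2 `^ (- a%:R) by rewrite powRN powR_mulrn// /hp exprVn.
 have -> : u = 2 `^ (1 - k%:R).
  by rewrite /u hpE powRD ?pnatr_eq0 ?implybT// powRr1.
 rewrite natrX -powR_mulrn// hpE -powRD ?pnatr_eq0 ?implybT// -powRrM.
 apply: ler_powR; first by rewrite ler1n.
 have /andP[_ h] := hexp_bound sigma_ge1 k.
 have h2 := truncnS_gt sigma; rewrite -/S in h2.
 rewrite !natrD mulrBl mul1r; exact: count_num5.
have ovl (w : 'rV[R]_m) : (#|[pred c | `[< E c w >]]| <= B ^ m.+1 * (2 ^ t) ^ m.+1)%N.
 have wc c : E c w -> `|first_coords (cpt c) - w| < 3 * de.
  rewrite /E -ball_normE /= => h; have [_ h2] := hyc c.
  have h3 := ler_normD (first_coords (cpt c) - yc c) (yc c - w); rewrite addrA subrK in h3.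
  exact: count_num4 h3 h2 h.
 pose pr (j : 'I_m.+1) : R := oapp (fun j' : 'I_m => w ord0 j') 0 (insub (val j)).
 pose cc (j : 'I_m.+1) : R := if j == ord_max then (2 - u) / hp R i.+2 else pr j / side sigma i k j.
 apply: leq_trans (_ : (K.*2.+1) ^ m.+1 <= _)%N; last first.
  rewrite -expnMn leq_exp2r// /B; exact: count_nat1.
 apply: (@box_count R m.+1 _ _ (@ckey i k) cc); first exact: ckey_inj.
 move=> c j hin; have Ec : E c w by apply/asboolP; exact: hin.
 have xw := wc c Ec; have [Ox kx zx] := cptP c.
 have y02 := Omega_y02 Ox.
 have := key_grid sigma (Omega_x01 Ox) y02 i j.
 rewrite kx zx; have s0 := side_gt0 sigma i k j; rewrite /cc.
 have tk : (i - k = t)%N by rewrite /i addKn.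
 case: (eqVneq j ord_max) => jm.
  have sE : side sigma i k j = hp R i.+2 by rewrite /side /cexp jm eqxx.
  rewrite sE in s0 *; have z1 := zeta_ge i y02; have z2 := zeta_lt i y02.
  rewrite kx -/u in z1 z2.
  have e1 : hp R k = (2 ^ t.+2)%:R * hp R i.+2.
   by rewrite /i -2!addnS hpD -hpV; field; rewrite gt_eqF// hp_gt0.
  have uE : u = 2 * hp R k by [].
  have K1 : (2 ^ t.+2 + 1 <= K)%N by exact: count_nat2.
  have K1R : ((2 ^ t.+2)%:R + 1) * hp R i.+2 <= K%:R * hp R i.+2.
   by rewrite ler_pM2r// natr1 -addn1 ler_nat.
  exact: count_num1 s0 uE e1 z1 z2 K1R.
 have sE : side sigma i k j = hp R (hexp sigma k + 2 + t) by rewrite /side /cexp (negbTE jm) tk.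
 have [j' jE] := neq_widen jm.
 have prE : pr j = w ord0 j'.
  by rewrite /pr jE; case: insubP => /= [j'' _ /val_inj -> //|]; rewrite ltn_ord.
 have xj : `|cpt c ord0 j - w ord0 j'| < 3 * de.
  by apply: le_lt_trans xw; have := rv_coord_le (first_coords (cpt c) - w) j'; rewrite !mxE -jE.
 have dle : de <= (2 ^ (S + 3 + t))%:R * side sigma i k j.
  by rewrite sE; apply: le_trans hpowS; rewrite /de ge_min lexx orbT.
 have K1R : (3 * (2 ^ (S + 3 + t))%:R + 1) * side sigma i k j <= K%:R * side sigma i k j.
  rewrite ler_pM2r// -natrM natr1 -addn1 ler_nat; exact: count_nat3.
 rewrite prE; exact: count_num2 s0 xj dle K1R.
pose N : R := #|{: cell i k}|%:R.
have hN : N * (cs^-1 * de `^ theta) <= (B ^ m.+1 * (2 ^ t) ^ m.+1)%:R * MT.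
 rewrite -lee_fin !EFinM MTE.
 have := @overlap_sum R _ _ mu (cell i k) E setT (B ^ m.+1 * (2 ^ t) ^ m.+1) (cst 1%E) mE measurableT
  (fun c => @subsetT _ (E c)) (measurable_cst _) (fun _ _ => lee01) ovl.
 rewrite integral_cst// mul1e => h; apply: le_trans h.
 rewrite (eq_bigr (fun c => mu (E c))); last by move=> c _; rewrite integral_cst// mul1e.
 apply: (@le_trans _ _ (\sum_(c : cell i k) (cs^-1 * de `^ theta)%:E)%E).
  by rewrite sumEFin sumr_const -EFinM lee_fin -mulr_natl.
 apply: lee_sum => c _; have [Gy _] := hyc c.
 by have /andP[] := hmu (yc c) de Gy ltac:(by rewrite de0).
have dth : 2 `^ (- (sigma * theta * k%:R)) <= de `^ theta.
 have -> : 2 `^ (- (sigma * theta * k%:R)) = (hp R k `^ sigma) `^ theta.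
  rewrite -powRrM /hp exprVn -powR_mulrn// -powRN -powRrM; congr (_ `^ _); ring.
 have sg0 : 0 <= sigma by apply: le_trans sigma_ge1.
 apply: ge0_ler_powR; rewrite ?nnegrE ?powR_ge0 ?(ltW de0)//.
 rewrite /de le_min powR_le1 ?hp_ge0 ?hp_le1//=.
 apply: ge0_ler_powR; rewrite ?nnegrE ?hp_ge0 ?(ltW u0)//.
 by rewrite ler_peMl ?hp_ge0// ler1n.
have P0 : 0 < 2 `^ (sigma * theta * k%:R) :> R by rewrite powR_gt0.
have N0 : 0 <= N by [].
have hN2 : N * 2 `^ (- (sigma * theta * k%:R)) <= cs * ((B ^ m.+1 * (2 ^ t) ^ m.+1)%:R * MT).
 rewrite -ler_pdivrMl//; apply: le_trans hN; rewrite mulrCA ler_wpM2l//.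
 by rewrite ler_wpM2l// invr_ge0 ltW.
rewrite powRN ler_pdivrMr// in hN2; apply: le_trans hN2 _.
rewrite powRD ?pnatr_eq0 ?implybT//.
have -> : 2 `^ (m.+1%:R * t%:R) = ((2 ^ t) ^ m.+1)%:R :> R.
 by rewrite -expnM mulnC natrX -powR_mulrn// natrM.
rewrite natrM.
have T0 : 0 <= ((2 ^ t) ^ m.+1)%:R :> R by [].
exact: count_num6 (ltW P0) T0.
Qed.

(** * Piecewise polynomial approximation on the cells *)

Variable s : nat.

Implicit Types f g : 'rV[R]_m.+1 -> R.
Local Notation side := (@side R m sigma).
Local Notation leb := (lebesgue_rV R m.+1).

Definition nodes := {ffun 'I_m.+1 -> 'I_s.+1}.
Definition idx i k := (cell i k * nodes)%type.
Definition ccorner i k (c : cell i k) j := corner sigma i k (ckey c) j.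
Definition node i k (u : idx i k) j := ccorner u.1 j + side i k j * (u.2 j)%:R.
Definition lag i k (u : idx i k) x : R :=
 \prod_j (lagrange_nat R (u.2 j)).[(x ord0 j - ccorner u.1 j) / side i k j].
Definition basis i k (u : idx i k) x : R := \1_(cset u.1) x * lag u x.
Definition synth i k (v : idx i k -> R) x : R := \sum_u v u * basis u x.
Definition tco i k f (u : idx i k) : R := taylor Omega s f (ccorner u.1) (side i k) (node u).
(** The parent's polynomial evaluated at the nodes of the child, so that both coefficients of a
    difference refer to the same nodes. *)
Definition pco i k f (u : idx i.+1 k) : R :=
 taylor Omega s f (pcorner i k (ckey u.1)) (pside i k) (node u).
Definition dco i k f (u : idx i.+1 k) : R := tco f u - pco f u.
Definition approx i f x : R := \sum_(k < i.+1) synth (@tco i k f) x.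
Definition vol i k : R := \prod_j side i k j.

Let mO : measurable Omega := Omega_measurable.

Lemma vol_gt0 i k : 0 < vol i k.
Proof. by apply: prodr_gt0 => j _; exact: side_gt0. Qed.

Lemma pside_gt0 i k j : 0 < pside i k j.
Proof. exact: side_gt0. Qed.

Lemma own_box_hull i k (c : cell i.+1 k) : own_box (ccorner c) (side i.+1 k) `<=`
 cbox (hull_lo i k (ckey c)) (hull_hi i k (ckey c)).
Proof.
move=> w hw j; have := hw j; rewrite /hull_lo /hull_hi -/(ccorner c j).
have s0 := side_gt0 sigma i.+1 k j.
move=> /andP[w1 w2].
apply/andP; split; first by apply: le_trans w1; rewrite lerD2r ge_min lexx orbT.
apply: le_trans w2 _; rewrite -lerBlDr opprK.
apply: (@le_trans _ _ (ccorner c j + side i.+1 k j)); last by rewrite le_max lexx orbT.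
exact: box_num1.
Qed.

Lemma pbox_hull i k (c : cell i.+1 k) :
 own_box (pcorner i k (ckey c)) (pside i k) `<=`
 cbox (hull_lo i k (ckey c)) (hull_hi i k (ckey c)).
Proof.
move=> w hw j; have := hw j; rewrite /hull_lo /hull_hi -/(ccorner c j).
have s0 := side_gt0 sigma i.+1 k j; have /andP[s1 _] := side_step sigma_ge1 j (cell_kap c).
rewrite -/(pcorner i k (ckey c) j) -/(pside i k j).
rewrite -/(pside i k j) in s1.
set a := pcorner _ _ _ _; set h := pside _ _ _ in s1 *; move=> /andP[w1 w2].
apply/andP; split.
 apply: le_trans w1; apply: lerD; first by rewrite ge_min lexx.
 exact: box_num3.
apply: le_trans w2 _; rewrite -lerBlDr opprK.
apply: (@le_trans _ _ (a + h)); last by rewrite le_max lexx.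
exact: box_num2.
Qed.

Lemma pbox_sub i k (c : cell i.+1 k) :
 own_box (pcorner i k (ckey c)) (pside i k) `<=` Omega.
Proof.
move=> w /pbox_hull; exact: cell_hull_sub.
Qed.

Lemma cell_parent i k k' (c : cell i k) (c' : cell i.+1 k') x : cset c x -> cset c' x ->
 minn i k' = k /\ pcorner i k' (ckey c') =1 ccorner c.
Proof.
move=> [Ox kx zx] [_ kx' zx']; have kk : minn i k' = k by rewrite -kx' -kap_par kx.
split=> // j; rewrite /ccorner -(eq_corner i k zx) -[in RHS]kx.
rewrite -(par_cornerE i Ox) kx' /pcorner.
by apply: eq_corner => j'; rewrite /par_key zx'.
Qed.

(** Every cell is the parent of some cell one level finer, and the hull of that cell, which lies in
    Omega, contains the support of the parent's kernel. *)
Lemma own_box_sub i k (c : cell i k) : own_box (ccorner c) (side i k) `<=` Omega.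
Proof.
have cx := cptP c; have [Ox _ _] := cx.
have [c' c'x] := cell_of i.+1 Ox.
have [kk e] := cell_parent cx c'x; have := pbox_sub (c := c').
apply: subset_trans => w hw j; have := hw j.
by rewrite e /pside kk.
Qed.

Lemma basis_in i k (u : idx i k) x : cset u.1 x -> basis u x = lag u x.
Proof. by move=> h; rewrite /basis indicE mem_set// mul1r. Qed.

Lemma basis_out i k (u : idx i k) x : ~ cset u.1 x -> basis u x = 0.
Proof. by move=> h; rewrite /basis indicE memNset// mul0r. Qed.

Lemma synth_in i k (v : idx i k -> R) (c : cell i k) x : cset c x ->
 synth v x = \sum_nu v (c, nu) * lag (c, nu) x.
Proof.
move=> cx; rewrite /synth (eq_bigr (fun u : idx i k => v (u.1, u.2) * basis (u.1, u.2) x)); last by case.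
rewrite -(pair_bigA _ (fun c nu => v (c, nu) * @basis i k (c, nu) x))/= (bigD1 c)//=.
rewrite [X in _ + X]big1 ?addr0; last first.
 move=> c' cc'; rewrite big1// => nu _; rewrite basis_out ?mulr0// => c'x.
 by move/eqP : cc'; apply; exact: cset_inj c'x cx.
by apply: eq_bigr => nu _; rewrite basis_in.
Qed.

Lemma synth_out i k (v : idx i k -> R) x : (forall c : cell i k, ~ cset c x) -> synth v x = 0.
Proof. by move=> h; rewrite /synth big1// => u _; rewrite basis_out ?mulr0. Qed.

Lemma synth_out_kap i k (v : idx i k -> R) x : kap i (x ord0 ord_max) != k -> synth v x = 0.
Proof. by move=> h; apply: synth_out => c [_ kx _]; rewrite kx eqxx in h. Qed.

Lemma synthE i k (V : forall k, idx i k -> R) (c : cell i k) x : cset c x ->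
 \sum_(k' < i.+1) synth (@V k') x = \sum_nu V k (c, nu) * lag (c, nu) x.
Proof.
move=> cx; have ki : (k < i.+1)%N by rewrite ltnS (cell_kap c).
have [_ kx _] := cx.
rewrite (bigD1 (Ordinal ki))//= [X in _ + X]big1 ?addr0; first exact: synth_in.
move=> k' kk'; apply: synth_out_kap; rewrite kx; apply: contra kk' => /eqP e.
by apply/eqP/val_inj.
Qed.

Lemma approxE i k (c : cell i k) f x : L1loc Omega f -> cset c x ->
 approx i f x = taylor Omega s f (ccorner c) (side i k) (fun j => x ord0 j).
Proof.
move=> lf cx; rewrite /approx (synthE (fun k => @tco i k f) cx).
rewrite (taylor_lagrange s (ccorner c) (l := side i k) _ mO lf)//.
- by move=> j; exact: side_gt0.
- exact: own_box_sub.
- by move=> j; exact: side_gt0.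
Qed.

(** On a cell of level i + 1 both approximations are polynomials of degree at most s in each
    coordinate, hence their difference is determined by its values at the nodes of that cell. *)
Lemma approx_step i f x : L1loc Omega f -> Omega x ->
 approx i.+1 f x - approx i f x = \sum_(k < i.+2) synth (@dco i k f) x.
Proof.
move=> lf Ox; have [c cx] := cell_of i Ox.
have [c' c'x] := cell_of i.+1 Ox.
rewrite (synthE (fun k => @dco i k f) c'x) (approxE lf cx).
rewrite [approx i.+1 f x](synthE (fun k => @tco i.+1 k f) c'x).
have [kk e] := cell_parent cx c'x.
have <- : pcorner i (kap i.+1 (x ord0 ord_max)) (ckey c') = ccorner c by apply/funext.
rewrite -kk -/(pside i _).
rewrite (taylor_lagrange s (ccorner c') (l := side i.+1 (kap i.+1 (x ord0 ord_max))) _ mO lf)//.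
- rewrite -sumrB; apply: eq_bigr => nu _; rewrite -mulrBl; congr (_ * _).
- by move=> j; exact: side_gt0.
- exact: pbox_sub.
- by move=> j; exact: side_gt0.
Qed.

Lemma approx_telescope I f x : L1loc Omega f -> Omega x ->
 approx I f x = approx 0 f x + \sum_(i < I) \sum_(k < i.+2) synth (@dco i k f) x.
Proof.
move=> lf Ox; elim: I => [|I IH]; first by rewrite big_ord0 addr0.
by rewrite big_ord_recr/= addrA -IH -approx_step// addrC subrK.
Qed.

Lemma lag_bound : exists2 B : R, 1 <= B & forall i k (u : idx i k) x, cset u.1 x -> `|lag u x| <= B.
Proof.
have [M M1 hM] := @lagrange_nat_bound R s.+1 12; exists (M ^+ m.+1); first exact: exprn_ege1.
move=> i k u x ux; rewrite /lag normr_prod -[X in M ^+ X](card_ord m.+1) -prodr_const.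
apply: ler_prod => j _; rewrite normr_ge0; apply: hM.
have s0 := side_gt0 sigma i k j.
rewrite normrM normfV (gtr0_norm s0) ler_pdivrMr//.
exact: cell_near.
Qed.

Lemma basis_measurable i k (u : idx i k) : measurable_fun setT (basis u).
Proof.
apply: measurable_funM; first by apply: measurable_indic; exact: cset_measurable.
apply: measurable_prod => j _.
apply: (@measurableT_comp _ _ _ _ _ _ (horner (lagrange_nat R (u.2 j)))).
 by apply: continuous_measurable_fun; exact: horner_continuous.
apply: measurable_funM; last exact: measurable_cst.
by apply: measurable_funB; [exact: measurable_coord|exact: measurable_cst].
Qed.

Lemma synth_measurable i k (v : idx i k -> R) : measurable_fun setT (synth v).
Proof.
by apply: measurable_sum => u; apply: measurable_funM; [exact: measurable_cst|exact: basis_measurable].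
Qed.

Lemma measurable_onW f : measurable_fun setT f -> measurable_on Omega f.
Proof. by move=> mf; apply: measurable_on_funP => //; apply: measurable_funS mf. Qed.

Lemma near_box_measure i k (c : 'I_m.+1 -> R) (K : R) : 0 <= K ->
 leb (cbox (fun j => c j - K * side i k j) (fun j => c j + K * side i k j)) =
 ((2 * K) ^+ m.+1 * vol i k)%:E.
Proof.
move=> K0; rewrite lebesgue_cbox; last first.
 move=> j; have := side_gt0 sigma i k j => s0.
 by rewrite lerBlDr -addrA lerDl addr_ge0// mulr_ge0// ltW.
have -> : (2 * K) ^+ m.+1 = \prod_(j < m.+1) (2 * K) by rewrite prodr_const card_ord.
congr EFin; rewrite /vol -big_split/=.
by apply: eq_bigr => j _; ring.
Qed.

Lemma cset_measure i k (c : cell i k) : (leb (cset c) <= (24 ^+ m.+1 * vol i k)%:E)%E.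
Proof.
have -> : 24 = 2 * 12 :> R by ring.
rewrite -(near_box_measure i k (ccorner c))//; apply: le_measure; rewrite ?inE//.
- exact: cset_measurable.
- exact: cbox_measurable.
move=> x cx j; have := cell_near j cx.
by rewrite ler_distl.
Qed.

Lemma card_cset i k x : (#|[pred u : idx i k | `[< cset u.1 x >]]| <= #|{: nodes}|)%N.
Proof.
have [[c cx]|nx] := pselect (exists c : cell i k, cset c x); last first.
 rewrite eq_card0// => u; apply/negbTE/negP => hu; apply: nx; exists u.1.
 by apply/asboolP; exact: hu.
apply: leq_trans (_ : #|[pred u : idx i k | u.1 == c]| <= _)%N.
 apply: subset_leq_card; apply/fintype.subsetP => u hu; rewrite inE; apply/eqP.
 have h : cset u.1 x by apply/asboolP; exact: hu.
 exact: cset_inj h cx.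
apply: leq_trans (leq_image_card (fun nu : nodes => (c, nu) : idx i k) predT).
apply/subset_leq_card/fintype.subsetP => -[c' nu]; rewrite inE /= => /eqP ->.
by apply/mapP; exists nu; rewrite ?mem_enum.
Qed.

(** At each point at most (s + 1)^d basis functions are nonzero, and all are uniformly bounded
    because a cell stays within 12 sides of its corner. *)
Lemma synth_Lp q : (1 <= q)%E -> exists2 C : R, 0 < C & forall i k (v : idx i k -> R),
 (Lp_norm Omega q (synth v) <= (C * vol i k `^ recip q * lpn q v)%:E)%E.
Proof.
move=> q1; have [B B1 hB] := lag_bound; have B0 : 0 < B by apply: lt_le_trans B1.
pose N := #|{: nodes}|.
have N0 : (0 < N)%N by apply/card_gt0P; exists [ffun=> ord0].
have NB0 : 0 < N%:R * B by rewrite mulr_gt0// ltr0n.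
pose C := N%:R * B * 24 ^+ m.+1.
have C0 : 0 < C by rewrite mulr_gt0// exprn_gt0.
exists C => // i k v.
pose u x (t : idx i k) := `|v t| * (B * \1_(cset t.1) x).
have u0 x (t : idx i k) : 0 <= u x t by rewrite !mulr_ge0// ltW.
have bB x (t : idx i k) : `|basis t x| <= B * \1_(cset t.1) x.
 have [h|h] := pselect (cset t.1 x).
  by rewrite basis_in// indicE mem_set// mulr1 hB.
 by rewrite basis_out// normr0 mulr_ge0// ltW.
have su x : `|synth v x| <= N%:R * \big[Num.max/0]_t u x t.
 apply: (@le_trans _ _ (\sum_t u x t)).
  apply: le_trans (ler_norm_sum _ _ _) _; apply: ler_sum => t _.
  by rewrite normrM ler_wpM2l.
 apply: sum_le_max => //; apply: leq_trans (card_cset i k x).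
 apply: subset_leq_card; apply/fintype.subsetP => t; rewrite !inE => h; apply/asboolP.
 apply: contrapT => h2; move/negP : h; apply; apply/eqP.
 have h3 : ~ cset t.1 x by move=> h; apply: h2; apply/asboolP.
 by rewrite /u indicE memNset// !mulr0.
have ms := measurable_onW (synth_measurable v).
have L0 : 0 <= C * vol i k `^ recip q * lpn q v.
 by rewrite !mulr_ge0 ?powR_ge0 ?lpn_ge0// ltW.
case: q q1 L0 => [r| |]// q1 L0; last first.
 apply/Lp_norm_le_ae => //; apply: aeW => x Ox; apply: le_trans (su x) _.
 rewrite recipy powRr0 mulr1 /C; apply: (@le_trans _ _ (N%:R * (B * lpn +oo%E v))).
  rewrite ler_wpM2l//; apply/bigmax_leP; split; first by rewrite mulr_ge0 ?lpn_ge0// ltW.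
  move=> t _; rewrite /u mulrCA ler_wpM2l ?(ltW B0)//.
  apply: (@le_trans _ _ `|v t|); last exact: lpn_coord.
  by rewrite ler_piMr// indicE; case: (_ \in _).
 rewrite mulrA ler_wpM2r ?lpn_ge0// ler_peMr ?(ltW NB0)//.
 by rewrite exprn_ege1// ler1n.
have r1 : 1 <= r by exact: q1.
have r0 : 0 < r by apply: lt_le_trans r1.
have h24 : 1 <= 24 ^+ m.+1 :> R by rewrite exprn_ege1// ler1n.
rewrite Lp_norm_le_int//.
apply: (@le_trans _ _ (\int[leb]_(x in Omega) (\sum_(t : idx i k)
  ((N%:R * B * `|v t|) `^ r)%:E * (\1_(cset t.1) x)%:E)%E)%E).
 apply: ge0_le_integral => //.
 - apply/measurable_EFinP.
  apply: (@measurableT_comp _ _ _ _ _ _ (fun t : R => t `^ r)); first exact: measurable_powR.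
  by apply: measurableT_comp => //; exact: measurable_onP.
 - apply: emeasurable_sum => t; apply: measurable_funeM; apply/measurable_EFinP.
  by apply: measurable_indic; exact: cset_measurable.
 move=> x Ox; rewrite (eq_bigr (fun t : idx i k => ((N%:R * u x t) `^ r)%:E)); last first.
  move=> t _; rewrite -EFinM /u indicE; case: (_ \in _); first by rewrite !mulr1; congr ((_ `^ _)%:E); ring.
  by rewrite !mulr0 powR0// gt_eqF.
 rewrite sumEFin lee_fin.
 apply: (@le_trans _ _ ((N%:R * \big[Num.max/0]_t u x t) `^ r)).
  by apply: ge0_ler_powR; rewrite ?nnegrE ?(ltW r0) ?(le_trans _ (su x)).
 rewrite powRM ?(bigmax_ge_id) ?ler0n//.
 apply: (@le_trans _ _ (N%:R `^ r * \sum_t u x t `^ r)).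
  by rewrite ler_wpM2l ?powR_ge0// max_powR_le.
 by rewrite mulr_sumr; apply: ler_sum => t _; rewrite (powRM _ (ler0n _ _) (u0 x t)).
rewrite ge0_integral_sum//; last 2 first.
- move=> t; apply: measurable_funeM; apply/measurable_EFinP.
 by apply: measurable_indic; exact: cset_measurable.
- by move=> t x _; rewrite -EFinM lee_fin mulr_ge0 ?powR_ge0.
apply: (@le_trans _ _ (\sum_(t : idx i k) ((N%:R * B * `|v t|) `^ r * (24 ^+ m.+1 * vol i k))%:E)%E).
 apply: lee_sum => t _; have mc := cset_measurable t.1.
 rewrite ge0_integralZl//; last 2 first.
 - by apply/measurable_EFinP; exact: measurable_indic.
 - by rewrite lee_fin powR_ge0.
 rewrite integral_indic// EFinM; apply: lee_wpmul2l; first by rewrite lee_fin powR_ge0.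
 apply: le_trans (cset_measure t.1); apply: le_measure; rewrite ?inE//.
 exact: measurableI.
rewrite sumEFin lee_fin -mulr_suml.
have -> : \sum_(t : idx i k) (N%:R * B * `|v t|) `^ r = (N%:R * B) `^ r * \sum_(t : idx i k) `|v t| `^ r.
 by rewrite mulr_sumr; apply: eq_bigr => t _; rewrite powRM// ltW.
have S0 : 0 <= \sum_(t : idx i k) `|v t| `^ r by apply: sumr_ge0 => t _; exact: powR_ge0.
rewrite recip_fin ?gt_eqF// /C /lpn.
exact: (synth_num r1 (ltW NB0) h24 (vol_gt0 i k) S0).
Qed.

Lemma side_le_hp i k j : side i.+1 k j <= hp R i.
Proof.
apply: hp_le; rewrite /cexp; case: ifP => _; first by rewrite -addn3 leq_addr.
have : (k <= hexp sigma k)%N.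
 rewrite -(ler_nat R); have /andP[h _] := hexp_bound sigma_ge1 k.
 by apply: le_trans h; rewrite ler_peMl.
exact: cexp_num.
Qed.

Lemma hull_lo_hi i k z j : hull_lo i k z j <= hull_hi i k z j.
Proof.
rewrite /hull_lo /hull_hi; have s0 := side_gt0 sigma i.+1 k j.
apply: (@le_trans _ _ (corner sigma i.+1 k z j + side i.+1 k j / 4)).
 by rewrite lerD2r ge_min lexx orbT.
rewrite -lerBlDr opprK; apply: (@le_trans _ _ (corner sigma i.+1 k z j + side i.+1 k j)).
 by rewrite -addrA lerD2l box_num4.
by rewrite le_max lexx orbT.
Qed.

Definition hull i k (c : cell i.+1 k) := cbox (hull_lo i k (ckey c)) (hull_hi i k (ckey c)).

Lemma hull_ends i k (c : cell i.+1 k) j :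
 `|hull_lo i k (ckey c) j - ccorner c j| <= (pconst + pconst)%:R * side i.+1 k j /\
 `|hull_hi i k (ckey c) j - ccorner c j| <= (pconst + pconst)%:R * side i.+1 k j.
Proof.
split.
- have := @hull_near i k c (\row_j hull_lo i k (ckey c) j) j.
 rewrite mxE; apply => j'; rewrite mxE lexx; exact: hull_lo_hi.
- have := @hull_near i k c (\row_j hull_hi i k (ckey c) j) j.
 rewrite mxE; apply => j'; rewrite mxE lexx andbT; exact: hull_lo_hi.
Qed.

Lemma dco_point : exists2 C : R, 0 <= C & forall i k f (g : 'I_m.+1 -> 'rV[R]_m.+1 -> R) (u : idx i.+1 k),
 (forall j, weak_partial Omega (pure_index s.+1 j) f (g j)) ->
 `|dco f u| <= C * (vol i.+1 k)^-1 * hp R i ^+ s.+1 * \sum_j \int[leb]_(y in hull u.1) `|g j y|.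
Proof.
pose P : R := (pconst)%:R; pose K : R := s%:R + P + P + 1.
have P0 : 0 <= P by [].
have K1 : 1 <= K.
 by rewrite /K lerDr; apply: addr_ge0 => //; apply: addr_ge0 => //; exact: ler0n.
have [C C0 hC] := @taylor_diff R m.+1 s K (le_trans ler01 K1).
exists C => // i k f g u wf.
have s0 j := side_gt0 sigma i.+1 k j.
have sp j : side i.+1 k j <= pside i k j by have /andP[] := side_step sigma_ge1 j (cell_kap u.1).
have hs j : side i.+1 k j <= K * side i.+1 k j by rewrite ler_peMl// ltW.
have nn j : [/\ `|node u j - ccorner u.1 j| <= K * side i.+1 k j,
  `|node u j - pcorner i k (ckey u.1) j| <= K * pside i k j,
  `|node u j - hull_lo i k (ckey u.1) j| <= K * side i.+1 k j &
  `|node u j - hull_hi i k (ckey u.1) j| <= K * side i.+1 k j].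
 have [l1 l2] := hull_ends u.1 j; rewrite natrD -/P in l1 l2.
 have us : `|(u.2 j)%:R| <= s%:R :> R by rewrite normr_nat ler_nat -ltnS.
 exact: (dco_num (s0 j) (sp j) (ler0n R s) P0 us (cell_step u.1 j) l1 l2 (erefl K)).
have hb1 : own_box (ccorner u.1) (side i.+1 k) `<=` hull u.1 by exact: own_box_hull.
have hb2 : own_box (pcorner i k (ckey u.1)) (pside i k) `<=` hull u.1.
 by exact: pbox_hull.
have hb (a h lo hi : 'I_m.+1 -> R) : own_box a h `<=` cbox lo hi -> (forall j, 0 < h j) ->
  forall j, lo j <= a j + h j / 4 /\ a j + 3 * h j / 4 <= hi j.
 move=> sub h0 j.
 have pr : forall y, a j + h j / 4 <= y <= a j + 3 * h j / 4 -> lo j <= y <= hi j.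
  move=> y hy; have := sub (\row_j' (if j' == j then y else a j' + h j' / 4)).
  move=> /(_ _ j); rewrite mxE eqxx; apply => j'; rewrite mxE; case: eqP => [->//|_].
  by rewrite lexx/= lerD2l ler_pM2r// ler_peMl// ?(ltW (h0 _))// ler1n.
 have hj : a j + h j / 4 <= a j + 3 * h j / 4.
  by rewrite lerD2l ler_pM2r// ler_peMl// ?(ltW (h0 _))// ler1n.
 have /andP[h1 _] := pr (a j + h j / 4) ltac:(by rewrite lexx).
 by have /andP[_ h2] := pr (a j + 3 * h j / 4) ltac:(by rewrite lexx andbT).
have b1 := hb _ _ _ _ hb1 s0.
have b2 := hb _ _ _ _ hb2 (fun j => pside_gt0 i k j).
rewrite /dco /tco /pco.
apply: le_trans (hC Omega f g (ccorner u.1) (side i.+1 k) (pcorner i k (ckey u.1)) (pside i k)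
 (side i.+1 k) (hull_lo i k (ckey u.1)) (hull_hi i k (ckey u.1)) (node u) mO wf _ _ _ _ _) _.
- move=> j; split => //; first exact: pside_gt0.
 by apply: le_trans (sp j) _; rewrite ler_peMl// ltW// pside_gt0.
- by move=> j; have [h1 h2 _ _] := nn j.
- by move=> j; have [? ?] := b1 j; have [? ?] := b2 j.
- by move=> j; have [_ _ h1 h2] := nn j.
- exact: cell_hull_sub.
rewrite -!mulrA; apply: ler_wpM2l => //; apply: ler_wpM2l; first by rewrite invr_ge0 ltW// vol_gt0.
rewrite mulr_sumr; apply: ler_sum => j _; apply: ler_wpM2r; first by apply: Rintegral_ge0.
by rewrite lerXn2r ?nnegrE ?(ltW (s0 j)) ?hp_ge0 ?side_le_hp.
Qed.

(** The hulls overlap boundedly and have measure of order [vol], so [coef_lp] applies to the local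
    integrals of the derivatives; the factors vol^-1 and vol^(1 - 1/p) combine to vol^(-1/p). *)
Lemma dco_lp p : (1 <= p)%E -> exists2 C : R, 0 < C &
 forall i k f (g : 'I_m.+1 -> 'rV[R]_m.+1 -> R) (A : R), 0 <= A ->
 (forall j, weak_partial Omega (pure_index s.+1 j) f (g j)) ->
 (Lp_norm Omega p (fun x => \sum_j `|g j x|)%R <= A%:E)%E ->
 lpn p (fun u : idx i.+1 k => dco f u) <= C * vol i.+1 k `^ (- recip p) * hp R i ^+ s.+1 * A.
Proof.
move=> p1; have [C C0 hC] := dco_point.
pose N := #|{: nodes}|.
have N0 : (0 < N)%N by apply/card_gt0P; exists [ffun=> ord0].
pose Q : R := (pconst + pconst)%:R.
have Q0 : 0 < Q by rewrite ltr0n addn_gt0.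
pose K := (N * ((pconst + pconst + 3).*2.+1) ^ m.+1)%N.
have K0 : (0 < K)%N by rewrite muln_gt0 N0 expn_gt0.
pose c := (2 * Q) ^+ m.+1; have c0 : 0 < c by rewrite exprn_gt0// mulr_gt0.
pose D := (C + 1) * (2 * K%:R * c `^ (1 - recip p)).
have C10 : 0 < C + 1 by rewrite ltr_wpDl.
have D0 : 0 < D by rewrite !mulr_gt0 ?ltr0n ?powR_gt0.
exists D => // i k f g A A0 wf gA; have v0 : 0 < vol i.+1 k by exact: vol_gt0.
have lg j : L1loc Omega (g j) by have [] := wf j.
have HO (cc : cell i.+1 k) : hull cc `<=` Omega.
 exact: cell_hull_sub.
pose G x := \sum_j `|g j x|.
pose X (u : idx i.+1 k) := \sum_j \int[leb]_(y in hull u.1) `|g j y|.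
have mg j (cc : cell i.+1 k) : measurable_fun (hull cc) (fun x => `|g j x|%:E).
 have [mgj _] := lg j; apply/measurable_EFinP; apply: measurableT_comp => //.
 by apply: measurable_onS mgj _ _ => //; exact: cbox_measurable.
have X0 u : 0 <= X u by apply: sumr_ge0 => j _; exact: Rintegral_ge0.
have XE u : ((X u)%:E <= \int[leb]_(x in hull u.1) `|G x|%:E)%E.
 have -> : (\int[leb]_(x in hull u.1) `|G x|%:E = \int[leb]_(x in hull u.1) (\sum_j `|g j x|%:E)%E)%E.
  by apply: eq_integral => x _; rewrite sumEFin ger0_norm// sumr_ge0.
 rewrite ge0_integral_sum//; last exact: cbox_measurable.
 rewrite -sumEFin; apply: lee_sum => j _; rewrite /Rintegral fineK//.
 rewrite ge0_fin_numE ?integral_ge0//; have [_] := lg j; apply => //.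
 exact: cbox_compact.
have ov x : (#|[pred u : idx i.+1 k | `[< hull u.1 x >]]| <= K)%N.
 apply: leq_trans (_ : #|[pred cc : cell i.+1 k | `[< hull cc x >]]| * N <= _)%N.
  rewrite /N -cardX; apply: subset_leq_card; apply/fintype.subsetP => u hu.
  by rewrite !inE andbT.
 rewrite /K mulnC leq_mul2l; apply/orP; right.
 exact: hull_overlap.
have lebV (u : idx i.+1 k) : (leb (hull u.1) <= (c * vol i.+1 k)%:E)%E.
 rewrite -(near_box_measure i.+1 k (ccorner u.1))//.
 apply: le_measure; rewrite ?inE; try exact: cbox_measurable.
 move=> x hx j; have := hull_near j hx.
 by rewrite ler_distl.
have hcoef := coef_lp p1 K0 (mulr_gt0 c0 v0) A0 (fun u : idx i.+1 k => cbox_measurable _ _)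
 (fun u : idx i.+1 k => HO u.1) mO ov lebV gA X0 XE.
pose e := (C + 1) * (vol i.+1 k)^-1 * hp R i ^+ s.+1.
have e0 : 0 <= e by rewrite !mulr_ge0 ?exprn_ge0 ?hp_ge0 ?invr_ge0 ?(ltW v0) ?(ltW C10).
apply: (@le_trans _ _ (lpn p (fun u => e * X u))).
 apply: lpn_le_abs => // u; apply: le_trans (hC i k f g u wf) _.
 rewrite -/(X u) /e ler_wpM2r// ler_wpM2r ?exprn_ge0 ?hp_ge0// ler_wpM2r ?invr_ge0 ?(ltW v0)//.
 by rewrite lerDl.
rewrite lpnZ// ger0_norm//; apply: le_trans (ler_wpM2l e0 hcoef) _.
rewrite powRM ?(ltW c0) ?(ltW v0)// (powR_split (1 - recip p) v0).
rewrite (_ : 1 - recip p - 1 = - recip p); last by ring.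
rewrite le_eqVlt; apply/orP; left; apply/eqP; rewrite /e /D.
by field; rewrite gt_eqF.
Qed.

Definition own i k (c : cell i k) : set 'rV[R]_m.+1 := own_box (ccorner c) (side i k).

(** Reproduction of constants; together with the density of Lipschitz functions it is all that the
    convergence of the approximations requires. *)
Lemma kernel_integral i k (c : cell i k) (x : 'I_m.+1 -> R) :
 \int[leb]_(y in Omega) (taylor_tensor s (ccorner c) (side i k) x y) = 1.
Proof.
have e : \int[leb]_(y in Omega) (taylor_tensor s (ccorner c) (side i k) x y) =
  \int[leb]_y (taylor_tensor s (ccorner c) (side i k) x y).
 rewrite Rintegral_mkcond; apply: eq_Rintegral => y _; rewrite patchE; case: ifPn => // /negP yO.
 apply/esym; rewrite /taylor_tensor /tensor.
 have /existsNP[j hj] : ~ own c y by move=> /(own_box_sub) h; apply: yO; exact: mem_set.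
 rewrite (bigD1 j)//= taylor_ker_eq0 ?mul0r//; first exact: side_gt0.
 by move/negP : hj; rewrite negb_and -!ltNge.
have s0 j := side_gt0 sigma i k j.
rewrite e /Rintegral /taylor_tensor.
have h1 j := taylor_ker_integral s (ccorner c j) (x j) (s0 j).
have [|_ ->] := @tensor_integral R m.+1 (fun j => taylor_ker s (ccorner c j) (side i k j) (x j)) (fun=> 1) _ h1.
 move=> j; pose K : set (measurableTypeR R) := `[ccorner c j, ccorner c j + side i k j]%classic.
 have mK : measurable K by exact: measurable_itv.
 have iK : lebesgue_measure.-integrable K (EFin \o taylor_ker s (ccorner c j) (side i k j) (x j)).
  apply: continuous_compact_integrable; first exact: segment_compact.
  by apply: continuous_subspaceT; apply: smooth1_continuous; exact: taylor_ker_smooth.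
 have i2 := proj1 (integrable_mkcond _ mK) iK.
 apply: eq_integrable i2 => //= y _; rewrite patchE; case: ifPn => // /negP yK.
 apply/esym; congr EFin; apply: taylor_ker_eq0 => //.
 apply/orP; rewrite !ltNge; apply: contrapT => /not_orP[/negP h2 /negP h3].
 apply: yK; apply: mem_set; rewrite /K/= in_itv/=; move: h2 h3; rewrite !negbK => h2 h3.
 apply/andP; split; first by apply: le_trans h2; rewrite lerDl divr_ge0// ltW.
 by apply: le_trans h3 _; rewrite lerD2l ler_pdivrMr// mulrC ler_pM2l// ler_nat.
by rewrite prodr_const expr1n.
Qed.

Lemma L1loc_continuous f : continuous f -> L1loc Omega f.
Proof.
move=> cf; have mf := continuous_measurable_rV cf.
split; first by apply: measurable_on_funP => //; exact: measurable_funTS.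
move=> K cK KO; have mK := compact_measurable_rV cK.
have [M [Mr MP]] : bounded_set (f @` K).
 by apply/compact_bounded/continuous_compact => //; exact: continuous_subspaceT.
pose M' := `|M| + 1.
have hM x : K x -> `|f x| <= M'.
 by move=> Kx; apply: (MP M'); [rewrite /M' (le_lt_trans (ler_norm M))// ltrDl|exists x].
apply: (@le_lt_trans _ _ (\int[leb]_(x in K) (cst M'%:E) x)%E).
 apply: ge0_le_integral => //.
 by apply/measurable_EFinP; apply: measurableT_comp => //; exact: measurable_funTS.
rewrite integral_cst//; apply: lte_mul_pinfty => //; first by rewrite lee_fin addr_ge0.
have [N [Nr NP]] := compact_bounded cK; pose N' := `|N| + 1.
apply: (@le_lt_trans _ _ (leb (cbox (fun=> - N') (fun=> N')))).
 apply: le_measure; rewrite ?inE//; first exact: cbox_measurable.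
 move=> x Kx j; rewrite -ler_norml; apply: le_trans (rv_coord_le x j) _.
 by apply: (NP N') => //; rewrite /N' (le_lt_trans (ler_norm N))// ltrDl.
rewrite lebesgue_cbox ?ltry// => j; have N0 : 0 <= N' by rewrite addr_ge0.
by rewrite (le_trans _ N0)// oppr_le0.
Qed.

(** * Convergence of the approximations on cubes and almost everywhere *)

Section Cube.
Variables (x0 : 'rV[R]_m.+1) (de : R).
Hypothesis de0 : 0 < de.
Let F := cbox (fun j => x0 ord0 j - de) (fun j => x0 ord0 j + de).
Let E := cbox (fun j => x0 ord0 j - 2 * de) (fun j => x0 ord0 j + 2 * de).
Hypothesis EO : E `<=` Omega.

Let mF : measurable F. Proof. exact: cbox_measurable. Qed.
Let mE : measurable E. Proof. exact: cbox_measurable. Qed.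
Let FP x : F x <-> forall j, `|x ord0 j - x0 ord0 j| <= de.
Proof. by split => h j; have := h j; rewrite ler_distl. Qed.
Let EP x : E x <-> forall j, `|x ord0 j - x0 ord0 j| <= 2 * de.
Proof. by split => h j; have := h j; rewrite ler_distl. Qed.
Let FE : F `<=` E.
Proof. by move=> x /FP h; apply/EP => j; apply: le_trans (h j) _; rewrite ler_peMl ?ler1n ?(ltW de0). Qed.
Let FO : F `<=` Omega. Proof. exact: subset_trans EO. Qed.
Let finE : (leb E < +oo)%E.
Proof.
rewrite lebesgue_cbox ?ltry// => j; rewrite lerBlDr -addrA lerDl.
by rewrite addr_ge0// mulr_ge0// ltW.
Qed.

(** A compact cube keeps a positive distance from the top level and so meets finitely many strips;
    hence the sides of the cells meeting it tend to 0. *)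
Lemma cube_strip : exists k0, forall i x, F x -> (kap i (x ord0 ord_max) <= k0)%N.
Proof.
pose b := x0 ord0 ord_max + de.
pose z : 'rV[R]_m.+1 := \row_j (x0 ord0 j + de).
have Fz : F z by apply/FP => j; rewrite mxE addrC addKr gtr0_norm.
have /andP[_ b2] := Omega_y02 (FO Fz).
have hb := strip_lt b2; exists (strip (z ord0 ord_max)) => i x Fx.
rewrite /kap geq_min; apply/orP; right.
have xb : x ord0 ord_max <= z ord0 ord_max by rewrite mxE; have /andP[] := Fx ord_max.
rewrite strip_leE; first by apply: le_lt_trans hb.
exact: le_lt_trans b2.
Qed.

Lemma side_small i k k0 j : (k <= k0)%N -> side i k j <= hp R (i - k0).
Proof.
move=> kk; apply: hp_le; rewrite /cexp; case: ifP => _; first by rewrite (leq_trans (leq_subr _ _))// -addn2 leq_addr.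
exact: cexp_num2.
Qed.

Lemma own_near i k (c : cell i k) x w : cset c x -> own c w ->
 forall j, `|w ord0 j - x ord0 j| <= 13 * side i k j.
Proof.
move=> cx ow j; have h1 := cell_near j cx; have h2 := ow j.
exact: own_num h1 h2 (side_gt0 _ _ _ _).
Qed.

Lemma own_sub_E i k k0 (c : cell i k) x : (k <= k0)%N -> 13 * hp R (i - k0) <= de ->
 F x -> cset c x -> own c `<=` E.
Proof.
move=> kk sm /FP Fx cx w ow; apply/EP => j.
apply: conv_num1 (Fx j) (own_near cx ow j) _; apply: le_trans sm.
by rewrite ler_wpM2l// side_small.
Qed.

Lemma own_overlap i k w : (#|[pred c : cell i k | `[< (own c `&` E) w >]]| <=
  ((pconst + pconst + 3).*2.+1) ^ m.+1)%N.
Proof.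
apply: (@box_count R m.+1 _ _ (@ckey i k) (fun j => w ord0 j / side i k j)).
 exact: ckey_inj.
move=> c j hin; have [hw _] : (own c `&` E) w by apply/asboolP; exact: hin.
have s0 := side_gt0 sigma i k j; have := hw j; rewrite /ccorner /corner.
set u := (if _ then _ else _) => /andP[h1 h2].
have u3 : 0 <= u <= 3 * side i k j.
 by rewrite /u; case: ifP => _; rewrite ?lexx ?mulr_ge0 ?(ltW s0).
have -> : (ckey c j)%:R - w ord0 j / side i k j = ((ckey c j)%:R * side i k j - w ord0 j) / side i k j.
 by field; rewrite gt_eqF.
rewrite normrM normfV (gtr0_norm s0) ler_pdivrMr//.
apply: (@le_trans _ _ ((1 + 3) * side i k j)).
 apply: (@hull_num7 _ _ _ u) => //; rewrite mul1r ler_distl; apply/andP; split.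
  by apply: le_trans h1; apply: (@le_trans _ _ ((ckey c j)%:R * side i k j - u)); rewrite ?lerDl ?divr_ge0 ?(ltW s0)// gerBl ltW.
 apply: le_trans h2 _; rewrite lerD2l ler_pdivrMr// mulrC ler_pM2l// ler_nat//.
rewrite ler_wpM2r ?(ltW s0)// -(natrD _ 1 3) ler_nat /pconst -[X in (X <= _)%N]/(4%N).
by rewrite (leq_trans _ (leq_addr _ _))// (leq_trans _ (leq_addr _ _))// (leq_trans _ (leq_addr _ _)).
Qed.

Lemma approx_measurable i f D : measurable_fun D (@approx i f).
Proof.
apply: measurable_funTS; apply: measurable_sum => k.
exact: synth_measurable.
Qed.

Lemma own_measurable i k (c : cell i k) : measurable (own c).
Proof. exact: cbox_measurable. Qed.

Lemma approx_pointwise : exists2 C : R, 0 <= C & forall i k (c : cell i k) g x, L1loc Omega g ->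
 cset c x -> `|approx i g x| <= C * (vol i k)^-1 * \int[leb]_(y in own c) `|g y|.
Proof.
have [C C0 hC] := @taylor_bound R m.+1 s 12; exists C => // i k c g x lg cx.
rewrite (approxE lg cx); apply: hC => //.
- by move=> j; exact: side_gt0.
- by move=> j; exact: cell_near.
- exact: own_box_sub.
Qed.

(** Boundedness from L_1(E) to L_1(F), uniformly in i. The larger cube E is needed because the
    lowered boxes leave the cells, by 13 sides at most. *)
Lemma approx_L1_bound k0 : (forall i x, F x -> (kap i (x ord0 ord_max) <= k0)%N) ->
 exists2 C : R, 0 <= C & forall i g, 13 * hp R (i - k0) <= de -> L1loc Omega g ->
 (\int[leb]_(x in F) `|approx i g x|%:E <= C%:E * \int[leb]_(x in E) `|g x|%:E)%E.
Proof.
move=> hk0; have [C C0 hC] := approx_pointwise.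
pose K := (((pconst + pconst + 3).*2.+1) ^ m.+1)%N.
exists (k0.+1%:R * (C * 24 ^+ m.+1 * K%:R)).
 by rewrite !mulr_ge0 ?exprn_ge0.
move=> i g sm lg; have iE := L1loc_integrable_compact lg (@cbox_compact _ _ _ _) EO.
have mgE : measurable_fun E (fun x => `|g x|%:E).
 by apply/measurable_EFinP; apply: measurableT_comp => //; have /measurable_int/measurable_EFinP := iE.
have mcE k (c : cell i k) : measurable (own c `&` E) by apply: measurableI => //; exact: own_measurable.
pose J k (c : cell i k) : \bar R := (\int[leb]_(y in own c `&` E) `|g y|%:E)%E.
have J0 k (c : cell i k) : (0 <= J k c)%E by exact: integral_ge0.
have intE : (\int[leb]_(x in E) `|g x|%:E < +oo)%E by case/integrableP : iE.
have Jle k (c : cell i k) : (J k c <= \int[leb]_(x in E) `|g x|%:E)%E.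
 by apply: ge0_subset_integral.
have Jfin k (c : cell i k) : J k c \is a fin_num.
 by rewrite ge0_fin_numE//; apply: le_lt_trans intE.
pose a k (c : cell i k) : R := C * (vol i k)^-1 * fine (J k c).
have a0 k (c : cell i k) : 0 <= a k c.
 by rewrite !mulr_ge0 ?fine_ge0// invr_ge0 ltW// vol_gt0.
have mi k (c : cell i k) D : measurable_fun D (fun x => (\1_(cset c) x)%:E : \bar R).
 by apply/measurable_EFinP; apply: measurable_indic; exact: cset_measurable.
apply: (@le_trans _ _ (\int[leb]_(x in F) (\sum_(k < k0.+1) \sum_(c : cell i k)
  (a k c)%:E * (\1_(cset c) x)%:E)%E)%E).
 apply: ge0_le_integral => //.
 - by apply/measurable_EFinP; apply: measurableT_comp => //; exact: approx_measurable.
 - apply: emeasurable_sum => k; apply: emeasurable_sum => c; exact: measurable_funeM.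
 move=> x Fx; have Ox := FO Fx.
 have [c cx] := cell_of i Ox.
 have kk := hk0 i x Fx; set k := kap i (x ord0 ord_max) in c cx kk.
 have kk' : (k < k0.+1)%N by [].
 have t0 k' (c' : cell i k') : (0 <= (a k' c')%:E * (\1_(cset c') x)%:E)%E.
  by rewrite -EFinM lee_fin mulr_ge0.
 rewrite (bigD1 (Ordinal kk'))//= (bigD1 c)//=.
 apply: (@le_trans _ _ ((a k c)%:E * (\1_(cset c) x)%:E)%E).
  rewrite indicE mem_set// mule1 lee_fin; apply: le_trans (hC i k c g x lg cx) _.
  rewrite /a /J setIidl//; exact: own_sub_E kk sm Fx cx.
 rewrite -addeA leeDl// adde_ge0// sume_ge0// => k' _.
 by apply: sume_ge0 => c' _.
have step k : (\int[leb]_(x in F) (\sum_(c : cell i k) (a k c)%:E * (\1_(cset c) x)%:E)%E <=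
  (C * 24 ^+ m.+1 * K%:R)%:E * \int[leb]_(x in E) `|g x|%:E)%E.
 rewrite ge0_integral_sum//; last 2 first.
 - by move=> c; exact: measurable_funeM.
 - by move=> c x _; rewrite -EFinM lee_fin mulr_ge0.
 apply: (@le_trans _ _ (\sum_(c : cell i k) (C * 24 ^+ m.+1)%:E * J k c)%E).
  apply: lee_sum => c _; have mc := cset_measurable c.
  rewrite ge0_integralZl//; last by rewrite lee_fin.
  rewrite integral_indic//.
  apply: (@le_trans _ _ ((a k c)%:E * (24 ^+ m.+1 * vol i k)%:E)%E).
   apply: lee_wpmul2l; first by rewrite lee_fin.
   apply: le_trans (cset_measure c); apply: le_measure; rewrite ?inE//.
   exact: measurableI.
  rewrite -[J k c]fineK// -!EFinM lee_fin /a le_eqVlt; apply/orP; left; apply/eqP.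
  by field; rewrite gt_eqF// vol_gt0.
 rewrite -ge0_sume_distrr//.
 rewrite (EFinM (C * 24 ^+ m.+1)) -muleA; apply: lee_wpmul2l; first by rewrite lee_fin mulr_ge0// exprn_ge0.
 by apply: overlap_sum => // w; exact: own_overlap.
rewrite ge0_integral_sum//; last 2 first.
- by move=> k; apply: emeasurable_sum => c; exact: measurable_funeM.
- by move=> k x _; apply: sume_ge0 => c _; rewrite -EFinM lee_fin mulr_ge0.
apply: (@le_trans _ _ (\sum_(k < k0.+1) ((C * 24 ^+ m.+1 * K%:R)%:E * \int[leb]_(x in E) `|g x|%:E))%E).
 by apply: lee_sum => k _; exact: step.
rewrite -(fineK (_ : (\int[leb]_(x in E) `|g x|%:E)%E \is a fin_num)); last first.
 by rewrite ge0_fin_numE// integral_ge0.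
rewrite -!EFinM sumEFin lee_fin sumr_const card_ord -[_ *+ _]mulr_natl.
by rewrite mulrA.
Qed.

(** Since constants are reproduced, h may be replaced by h - h(x), which is at most L times the
    distance from x to the box. *)
Lemma approx_lipschitz k0 : (forall i x, F x -> (kap i (x ord0 ord_max) <= k0)%N) ->
 exists2 C : R, 0 <= C & forall i h (L : R) x, 0 <= L -> (forall x y, `|h x - h y| <= L * `|x - y|) ->
 F x -> `|approx i h x - h x| <= C * L * hp R (i - k0).
Proof.
move=> hk0; have [C C0 hC] := @taylor_bound R m.+1 s 12; exists (C * 13); first by rewrite mulr_ge0.
move=> i h L x L0 hL Fx; have Ox := FO Fx.
have [c cx] := cell_of i Ox.
have kk := hk0 i x Fx; set k := kap i (x ord0 ord_max) in c cx kk.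
have lh : L1loc Omega h by apply: L1loc_continuous; apply: lipschitz_continuous; exists L.
have l1 : L1loc Omega (cst 1) by apply: L1loc_continuous; exact: cst_continuous.
have s0 j := side_gt0 sigma i k j.
have bO := own_box_sub (c := c).
have v0 : 0 < vol i k by exact: vol_gt0.
pose g := h + (- h x) *: (cst 1 : 'rV[R]_m.+1 -> R).
have lg : L1loc Omega g by apply: L1locD => //; exact: L1locZ.
have gE y : g y = h y - h x by rewrite -[h x in RHS]mulr1 -mulNr.
rewrite (approxE lh cx).
have -> : taylor Omega s h (ccorner c) (side i k) (fun j => x ord0 j) - h x =
  taylor Omega s g (ccorner c) (side i k) (fun j => x ord0 j).
 rewrite taylorD ?taylorZ//; last exact: L1locZ.
 rewrite {3}/taylor; under eq_Rintegral do rewrite mul1r.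
 by rewrite kernel_integral mulr1.
apply: le_trans (hC Omega g (ccorner c) (side i k) _ mO lg s0 _ bO) _.
 by move=> j; exact: cell_near.
have hs : \int[leb]_(y in own c) `|g y| <= L * (13 * hp R (i - k0)) * vol i k.
 have mo := own_measurable c.
 have lo : (leb (own c) <= (vol i k)%:E)%E.
  rewrite lebesgue_cbox; last by move=> j; rewrite lerD2l ler_pM2r// ler_peMl ?(ltW (s0 _))// ler1n.
  rewrite lee_fin; apply: ler_prod => j _; apply/andP; split.
   by rewrite subr_ge0 lerD2l ler_pM2r// ler_peMl ?(ltW (s0 _))// ler1n.
  rewrite (_ : _ - _ = side i k j * 2^-1); last by field.
  by rewrite ler_piMr ?(ltW (s0 _))// invf_le1// ler1n.
 have lfin : (leb (own c) < +oo)%E by apply: le_lt_trans lo (ltry _).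
 rewrite -lee_fin /Rintegral fineK; last first.
  rewrite ge0_fin_numE ?integral_ge0//; have [_] := lg; apply => //; exact: cbox_compact.
 apply: (@le_trans _ _ (\int[leb]_(y in own c) (cst (L * (13 * hp R (i - k0)))%:E) y)%E).
  apply: ge0_le_integral => //.
  - have [mg _] := lg; apply/measurable_EFinP; apply: measurableT_comp => //.
   by apply: measurable_onS mg mo _; exact: bO.
  move=> y oy; rewrite lee_fin gE; apply: le_trans (hL y x) _; rewrite ler_wpM2l//.
  apply/rv_norm_leP; first by rewrite mulr_ge0// hp_ge0.
  move=> j; rewrite !mxE; apply: le_trans (own_near cx oy j) _.
  by rewrite ler_wpM2l// side_small.
 rewrite integral_cst// (EFinM (L * _)); apply: lee_wpmul2l => //.
 by rewrite lee_fin !mulr_ge0// hp_ge0.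
apply: (@le_trans _ _ (C * (vol i k)^-1 * (L * (13 * hp R (i - k0)) * vol i k))).
 by rewrite ler_wpM2l// mulr_ge0// invr_ge0 ltW.
rewrite le_eqVlt; apply/orP; left; apply/eqP.
by field; rewrite gt_eqF.
Qed.

(** Density: f is a Lipschitz function plus a remainder small in L_1(E), on which the approximations
    are uniformly bounded. *)
Lemma approx_L1_cvg f (e : R) : L1loc Omega f -> 0 < e -> exists N, forall i, (N <= i)%N ->
 (\int[leb]_(x in F) `|approx i f x - f x|%:E <= e%:E)%E.
Proof.
move=> lf e0; have [k0 hk0] := cube_strip.
have [C1 C10 hC1] := approx_L1_bound hk0; have [C2 C20 hC2] := approx_lipschitz hk0.
have iE := L1loc_integrable_compact lf (@cbox_compact _ _ _ _) EO.
have C11 : 0 < C1 + 1 by rewrite ltr_wpDl.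
have e1 : 0 < e / 2 / (C1 + 1) by rewrite !divr_gt0.
have [_ /(_ _ e1)[h [L hL] fh]] := lip_approx_integrable mE finE iE.
pose V := fine (leb F).
have leF : (leb F <= leb E)%E by apply: le_measure; rewrite ?inE.
have VE : V%:E = leb F by rewrite fineK// ge0_fin_numE//; exact: le_lt_trans leF finE.
have V0 : 0 <= V by rewrite fine_ge0.
pose D := C2 * `|L| * V + 1.
have D0 : 0 < D by rewrite ltr_wpDl// !mulr_ge0.
have c1 : 0 < de / 13 by rewrite divr_gt0.
have c2 : 0 < e / 2 / D by rewrite !divr_gt0.
have [n1 hn1] := hp_small c1; have [n2 hn2] := hp_small c2.
exists (k0 + maxn n1 n2)%N => i Ni.
have mi : (maxn n1 n2 <= i - k0)%N.
 by rewrite -(leq_add2l k0) subnKC// (leq_trans (leq_addr _ _) Ni).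
have i1 : (n1 <= i - k0)%N := leq_trans (leq_maxl _ _) mi.
have i2 : (n2 <= i - k0)%N := leq_trans (leq_maxr _ _) mi.
have sm : 13 * hp R (i - k0) <= de by have := hn1 _ i1; rewrite ler_pdivlMr// mulrC.
have hL' (x y : 'rV[R]_m.+1) : `|h x - h y| <= `|L| * `|x - y|.
 by apply: le_trans (hL x y) _; rewrite ler_wpM2r// ler_norm.
have lh : L1loc Omega h by apply: L1loc_continuous; apply: lipschitz_continuous; exists L.
pose g := f + (-1) *: h.
have lg : L1loc Omega g by apply: L1locD => //; exact: L1locZ.
have gE x : g x = f x - h x by rewrite -mulN1r.
have fE : f = g + h by rewrite /g scaleN1r subrK.
have mgF : measurable_fun F (fun x => `|g x|%:E).
 have [mg _] := lg; apply/measurable_EFinP; apply: measurableT_comp => //.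
 exact: measurable_onS mg mF FO.
have mfF : measurable_fun F f by have [mf _] := lf; exact: measurable_onS mf mF FO.
pose c := C2 * `|L| * hp R (i - k0).
have c0 : 0 <= c by rewrite !mulr_ge0// hp_ge0.
apply: (@le_trans _ _ (\int[leb]_(x in F) (`|approx i g x|%:E + (c%:E + `|g x|%:E)))%E).
 have ma : measurable_fun F (approx i g) by exact: approx_measurable.
 have ma' : measurable_fun F (fun x => `|approx i g x|%:E).
  by apply/measurable_EFinP; exact: measurableT_comp.
 apply: ge0_le_integral => //.
 - apply/measurable_EFinP; apply: measurableT_comp => //.
  by apply: measurable_funB => //; exact: approx_measurable.
 - by apply: emeasurable_funD => //; apply: emeasurable_funD.
 move=> x Fx; rewrite -!EFinD lee_fin.
 have Ox := FO Fx; have [cc cx] := cell_of i Ox.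
 have -> : approx i f x = approx i g x + approx i h x.
  rewrite !(approxE _ cx)// -taylorD//.
  - by rewrite -fE.
  - by move=> j; exact: side_gt0.
  - exact: own_box_sub.
 rewrite (_ : _ + _ - _ = approx i g x + ((approx i h x - h x) - g x)); last by rewrite gE; ring.
 apply: le_trans (ler_normD _ _) _; rewrite lerD2l; apply: le_trans (ler_normB _ _) _.
 by rewrite lerD2r /c; apply: hC2.
have mag : measurable_fun F (fun x => `|approx i g x|%:E).
 by apply/measurable_EFinP; apply: measurableT_comp => //; exact: approx_measurable.
rewrite ge0_integralD//; last 2 first.
- by move=> x _; rewrite -EFinD lee_fin addr_ge0.
- exact: emeasurable_funD.
rewrite ge0_integralD//.
rewrite (_ : (\int[leb]_(_ in F) c%:E = c%:E * leb F)%E); last by exact: integral_cst.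
have gf : (\int[leb]_(x in E) `|g x|%:E <= (e / 2 / (C1 + 1))%:E)%E.
 by apply: le_trans fh; rewrite le_eqVlt; apply/orP; left; apply/eqP; apply: eq_integral => x _; rewrite gE.
have gF : (\int[leb]_(x in F) `|g x|%:E <= \int[leb]_(x in E) `|g x|%:E)%E.
 apply: ge0_subset_integral => //.
 have [mg _] := lg; apply/measurable_EFinP; apply: measurableT_comp => //.
 exact: measurable_onS mg mE EO.
apply: (@le_trans _ _ ((C1 * (e / 2 / (C1 + 1)))%:E + ((c * V)%:E + (e / 2 / (C1 + 1))%:E))%E).
 apply: leeD; first by apply: le_trans (hC1 i g sm lg) _; rewrite EFinM; apply: lee_wpmul2l.
 by apply: leeD; [rewrite -VE -EFinM|exact: le_trans gF gf].
rewrite -!EFinD lee_fin.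
have cV : c * V <= e / 2.
 apply: (@le_trans _ _ (D * hp R (i - k0))).
  rewrite /c /D mulrDl mul1r -!mulrA (mulrC (hp _ _)) !mulrA lerDl hp_ge0//.
 by have := hn2 _ i2; rewrite ler_pdivlMr// mulrC.
have -> : C1 * (e / 2 / (C1 + 1)) + (c * V + e / 2 / (C1 + 1)) = c * V + e / 2.
 by field; rewrite gt_eqF.
by rewrite [leRHS](splitr e) lerD2r.
Qed.

End Cube.

Let mA i f D : measurable_fun D (approx i f).
Proof.
apply: measurable_funTS; apply: measurable_sum => k.
exact: synth_measurable.
Qed.

Definition bad_points f (e : R) (N : nat) (F : set 'rV[R]_m.+1) : set 'rV[R]_m.+1 :=
 F `&` \bigcap_i [set x | (N <= i)%N -> e <= `|approx i f x - f x|].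

(** Chebyshev's inequality at a single level beyond N at which the L_1 error is small. *)
Lemma bad_points_null f e N x0 de : 0 < e -> 0 < de ->
 let F := cbox (fun j => x0 ord0 j - de) (fun j => x0 ord0 j + de) in
 cbox (fun j => x0 ord0 j - 2 * de) (fun j => x0 ord0 j + 2 * de) `<=` Omega ->
 F `<=` Omega -> L1loc Omega f -> leb.-negligible (bad_points f e N F).
Proof.
move=> e0 de0 F EO FO lf.
have mF : measurable F by exact: cbox_measurable.
have mfF : measurable_fun F f by have [mf _] := lf; exact: measurable_onS mf mF FO.
have ma i : measurable_fun F (fun x => `|approx i f x - f x|).
 apply: measurableT_comp => //; apply: measurable_funB => //.
have mB : measurable (bad_points f e N F).
 rewrite /bad_points -bigcapIr; last by exists 0%N.
 apply: bigcap_measurable => // i _.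
 have [Ni|iN] := leqP N i.
  rewrite (_ : _ `&` _ = F `&` (fun x => `|approx i f x - f x|) @^-1` `[e, +oo[).
   exact: ma.
  by apply/seteqP; split => x [Fx h]; split => //=; move: h; rewrite /= in_itv/= andbT//; apply.
 rewrite (_ : _ `&` _ = F)//; apply/seteqP; split => [x []//|x Fx]; split => //=.
exists (bad_points f e N F); split => //.
apply/eqP; rewrite eq_le measure_ge0 andbT; apply/lee_addgt0Pr => eta eta0; rewrite add0e.
have e1 : 0 < e * eta by rewrite mulr_gt0.
have [M hM] := approx_L1_cvg de0 EO lf e1.
pose i := maxn M N; have := hM i (leq_maxl _ _).
have h1 : (e%:E * leb (bad_points f e N F) <= \int[leb]_(x in F) `|approx i f x - f x|%:E)%E.
 apply: (@le_trans _ _ (\int[leb]_(x in bad_points f e N F) `|approx i f x - f x|%:E)%E).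
  rewrite -(integral_cst leb mB); apply: ge0_le_integral => //.
  - by move=> x _; rewrite lee_fin ltW.
  - by apply/measurable_EFinP; apply: measurable_funS (ma i) => // x [].
  by move=> x [_ /(_ i I) h]; rewrite lee_fin; apply: h; exact: leq_maxr.
 apply: ge0_subset_integral => //; first by apply/measurable_EFinP; exact: ma.
 by move=> x [].
by move=> h2; have := le_trans h1 h2; rewrite EFinM lee_pmul2l// lte_fin.
Qed.

(** A weak form of convergence, along levels that may depend on the point. It is enough for
    [approx_tail], where it bounds the error by sums of increments. *)
Lemma approx_ae f : L1loc Omega f -> {ae leb, forall x, Omega x ->
 forall e, 0 < e -> forall N, exists2 i, (N <= i)%N & `|approx i f x - f x| < e}.
Proof.
move=> lf.
pose ctr (z : 'rV[rat]_m.+1 * nat) : 'rV[R]_m.+1 := \row_j ratr (z.1 ord0 j).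
pose rad (z : 'rV[rat]_m.+1 * nat) : R := z.2.+1%:R^-1.
pose cb z (a : R) := cbox (fun j => ctr z ord0 j - a * rad z) (fun j => ctr z ord0 j + a * rad z).
pose bad (j : nat) : set 'rV[R]_m.+1 :=
 if (unpickle j : option (('rV[rat]_m.+1 * nat) * (nat * nat))) is Some (z, (k, N)) then
  if `[< cb z 2 `<=` Omega >] then bad_points f k.+1%:R^-1 N (cb z 1) else set0 else set0.
have nb (j : nat) : leb.-negligible (bad j).
 rewrite /bad; case: (unpickle j) => [[z [k N]]|]; last exact: negligible_set0.
 case: asboolP => [sub|_]; last exact: negligible_set0.
 have r0 : 0 < rad z by rewrite invr_gt0.
 have sub1 : cb z 1 `<=` Omega.
  apply: subset_trans sub => x h j'; have /andP[h1 h2] := h j'; apply/andP; split.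
   by apply: le_trans h1; rewrite lerD2l lerN2 ler_pM2r// ler1n.
  by apply: le_trans h2 _; rewrite lerD2l ler_pM2r// ler1n.
 rewrite /cb (_ : (fun j => _ - 1 * rad z) = (fun j => ctr z ord0 j - rad z)) in sub1 *; last first.
  by apply/funext => j'; rewrite mul1r.
 rewrite (_ : (fun j => _ + 1 * rad z) = (fun j => ctr z ord0 j + rad z)) in sub1 *; last first.
  by apply/funext => j'; rewrite mul1r.
 by apply: bad_points_null => //; rewrite invr_gt0.
have nall := negligible_bigcup nb; apply: negligibleS nall => x /= /not_implyP[Ox].
move=> /existsNP[e /not_implyP[e0 /existsNP[N hN]]].
have hN' i : (N <= i)%N -> e <= `|approx i f x - f x|.
 by move=> Ni; rewrite leNgt; apply/negP => h; apply: hN; exists i.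
have oO := Omega_open.
have /nbhs_ballP[d /= d0 dO] : nbhs x Omega by exact: open_nbhs_nbhs.
have [k1 k1d] : exists k, 0 + k.+1%:R^-1 < d / 3 by apply/ltr_add_invr/divr_gt0.
have [k2 k2e] : exists k, 0 + k.+1%:R^-1 < e by exact/ltr_add_invr.
rewrite !add0r in k1d k2e.
have /choice[qq hq] : forall j : 'I_m.+1, exists q : rat, `|x ord0 j - ratr q| < k1.+1%:R^-1.
 move=> j; have [|q] := @rat_in_itvoo R (x ord0 j - k1.+1%:R^-1) (x ord0 j + k1.+1%:R^-1).
  by rewrite ltrD2l gtrN// invr_gt0.
 by rewrite in_itv/= => /andP[q1 q2]; exists q; rewrite ltr_distlC q1.
pose z : 'rV[rat]_m.+1 * nat := (\row_j qq j, k1).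
have zE j : ctr z ord0 j = ratr (qq j) by rewrite !mxE.
exists (pickle ((z, (k2, N)) : ('rV[rat]_m.+1 * nat) * (nat * nat))) => //.
rewrite /bad pickleK asboolT.
 split; last by move=> i _ /= /hN'; apply: le_trans; exact: ltW.
 by move=> j; rewrite zE mul1r -ler_distl ltW.
move=> w hw; apply: dO; rewrite -ball_normE/=.
apply: (@le_lt_trans _ _ (3 * rad z)); last by rewrite mulrC -ltr_pdivlMr.
apply/rv_norm_leP; first by rewrite mulr_ge0// invr_ge0.
move=> j; rewrite !mxE; have := hw j; rewrite zE -ler_distl => h1; have h2 := ltW (hq j).
rewrite (_ : x ord0 j - w ord0 j = (x ord0 j - ratr (qq j)) - (w ord0 j - ratr (qq j))); last by ring.
apply: le_trans (ler_normB _ _) _; rewrite (_ : 3 * rad z = rad z + 2 * rad z); last by ring.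
exact: lerD.
Qed.

(** Almost everywhere the error is at most the limit of the increasing sums of |approx(i+1) -
    approx(i)|; their norms are bounded by b, and monotone convergence passes this to the limit. *)
Lemma approx_tail q f I (B : nat -> R) (b : R) : (1 <= q)%E -> L1loc Omega f -> 0 <= b ->
 (forall i, (I <= i)%N ->
  (Lp_norm Omega q (fun x => approx i.+1 f x - approx i f x)%R <= (B i)%:E)%E) ->
 (forall N, \sum_(I <= i < N) B i <= b) ->
 (Lp_norm Omega q (fun x => f x - approx I f x)%R <= b%:E)%E.
Proof.
move=> q1 lf b0 hB sB.
pose D i x := `|approx i.+1 f x - approx i f x|.
pose M N x := \sum_(I <= i < N) D i x.
have mD i : measurable_fun setT (D i).
 apply: measurableT_comp => //; apply: measurable_funB; exact: mA.
have monW g : measurable_fun setT g -> measurable_on Omega g.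
 by move=> mg; apply: measurable_on_funP => //; exact: measurable_funTS.
have mM N : measurable_fun setT (M N) by apply: measurable_sum.
have D0 i x : 0 <= D i x by rewrite /D normr_ge0.
have M0 N x : 0 <= M N x by apply: sumr_ge0.
have nM N N' x : (N <= N')%N -> M N x <= M N' x.
 move=> NN; rewrite /M; have [IN|NI] := leqP I N.
  by rewrite (@big_cat_nat _ _ _ N I N')//= lerDl sumr_ge0.
 by rewrite [X in X <= _]big_geq ?sumr_ge0// ltnW.
have Mn N : (Lp_norm Omega q (M N) <= b%:E)%E.
 apply: (@le_trans _ _ (\sum_(I <= i < N) B i)%:E); last by rewrite lee_fin.
 have [NI|IN] := leqP N I.
  rewrite (_ : M N = 0); last by apply/funext => x; rewrite /M big_geq.
  by rewrite Lp_norm0// big_geq.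
 elim: N IN => // N IH; rewrite ltnS => IN.
 rewrite (_ : M N.+1 = M N + D N); last by apply/funext => x; rewrite /M big_nat_recr.
 rewrite big_nat_recr//= EFinD; apply: le_trans (Lp_normD _ _ _ q1) _; apply: leeD.
  move: IN; rewrite leq_eqVlt => /orP[/eqP <-|/IH//].
  rewrite (_ : M I = 0); last by apply/funext => x; rewrite /M big_geq.
  by rewrite Lp_norm0// big_geq.
 apply: le_trans (hB N IN); apply: Lp_norm_ae_le => //.
 - exact: monW.
 - by apply: monW; apply: measurable_funB; exact: mA.
 by apply: aeW => x _; rewrite /D normr_id.
have tele N x : (I <= N)%N -> `|approx N f x - approx I f x| <= M N x.
 move=> IN; rewrite -(telescope_sumr (fun i => approx i f x) IN).
 exact: ler_norm_sum.
pose G x := f x - approx I f x.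
have aeM : {ae leb, forall x, Omega x -> forall a, a < `|G x| -> exists N, a <= M N x}.
 apply: filterS (approx_ae lf) => x h Ox a aG.
 have e0 : 0 < `|G x| - a by rewrite subr_gt0.
 have [i Ii hi] := h Ox _ e0 I; exists i; apply: le_trans (tele i x Ii).
 have t1 : `|G x| <= `|approx i f x - f x| + `|approx i f x - approx I f x|.
  rewrite /G (_ : f x - _ = (approx i f x - approx I f x) - (approx i f x - f x)); last by ring.
  by rewrite [leRHS]addrC ler_normB.
 move: hi t1; set u := `|_ - f x|; set v := `|approx i f x - _|; set w := `|G x|.
 exact: tail_num.
have mG : measurable_on Omega G.
 apply: measurable_on_funP => //; apply: measurable_funB.
  by have [mf _] := lf; exact: measurable_onP.
 exact: mA.
case: q q1 hB Mn => [r| |]// q1 hB Mn; last first.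
 apply/Lp_norm_le_ae => //.
 have ae2 : {ae leb, forall x N, Omega x -> `|M N x| <= b}.
  by apply: ae_foralln => N; apply/Lp_norm_le_ae => //; exact: monW.
 apply: filterS2 aeM ae2 => x h1 h2 Ox; rewrite leNgt; apply/negP => bG.
 have [a1 a2] := midf_lt bG.
 have [N hN] := h1 Ox _ a2.
 have := h2 N Ox; rewrite (ger0_norm (M0 N x)) => h3.
 by have := le_trans hN h3; rewrite leNgt a1.
have r0 : 0 < r by apply: (@lt_le_trans _ _ 1).
rewrite Lp_norm_le_int//.
pose g N x := (M N x `^ r)%:E.
have mpow N h : measurable_fun N h -> measurable_fun N (fun x => ((h x) `^ r)%:E : \bar R).
 move=> mh; apply/measurable_EFinP.
 by apply: (@measurableT_comp _ _ _ _ _ _ (fun t : R => t `^ r)) => //; exact: measurable_powR.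
have mg N : measurable_fun Omega (g N) by apply: mpow; exact: measurable_funTS.
have g0 N x : Omega x -> (0 <= g N x)%E by move=> _; rewrite lee_fin powR_ge0.
have ng x : Omega x -> {homo g^~ x : n k / (n <= k)%N >-> (n <= k)%E}.
 by move=> _ N N' NN; rewrite lee_fin ge0_ler_powR ?nnegrE ?(ltW r0) ?nM.
have cg x : Omega x -> cvgn (g^~ x) by move=> Ox; apply: ereal_nondecreasing_is_cvgn; exact: ng.
apply: (@le_trans _ _ (\int[leb]_(x in Omega) limn (g^~ x))%E).
 apply: ae_ge0_le_integral => //.
 - by apply: mpow; apply: measurableT_comp => //; exact: measurable_onP.
 - by move=> x Ox; apply: lime_ge; [exact: cg|apply: nearW => N; exact: g0].
 - by apply: (emeasurable_fun_cvg g).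
 apply: filterS aeM => x h Ox; apply: powR_sup_le => //.
  by apply: lime_ge; [exact: cg|apply: nearW => N; exact: g0].
 move=> a a0 aG; have [N hN] := h Ox a aG.
 apply: (@le_trans _ _ (g N x)).
  by rewrite lee_fin ge0_ler_powR ?nnegrE ?(ltW r0).
 by apply: lime_ge; [exact: cg|exists N => // k /= Nk; exact: ng].
rewrite monotone_convergence//.
apply: lime_le.
 apply: ereal_nondecreasing_is_cvgn => N N' NN; apply: ge0_le_integral => //.
 - by move=> x Ox; exact: g0.
 by move=> x Ox; exact: ng.
apply: nearW => N; have := Mn N; rewrite Lp_norm_le_int//; last exact: monW.
apply: le_trans; rewrite le_eqVlt; apply/orP; left; apply/eqP; apply: eq_integral => x _.
by rewrite /g (ger0_norm (M0 N x)).
Qed.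

Lemma Omega_finite : (leb Omega < +oo)%E.
Proof.
apply: (@le_lt_trans _ _ (leb (cbox (fun=> 0) (fun=> 2)))).
 apply: le_measure; rewrite ?inE//; first exact: cbox_measurable.
 move=> x Ox j; have [->|jm] := eqVneq j ord_max.
  by have /andP[-> /ltW ->] := Omega_y02 Ox.
 have /andP[/ltW -> /ltW h] := Omega_x01 Ox jm.
 by rewrite (le_trans h)// ler1n.
by rewrite lebesgue_cbox ?ltry.
Qed.

Lemma volE k t : vol (k + t) k = hp R (k + t + 2 + m * (hexp sigma k + 2 + t)).
Proof.
rewrite /vol big_ord_recr/= /side /cexp eqxx hpD mulrC; congr (_ * _).
 by rewrite -addn2.
rewrite (eq_bigr (fun=> hp R (hexp sigma k + 2 + t))); last first.
 by move=> i _; rewrite (negbTE (widen_neq i)) addKn.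
by rewrite prodr_const card_ord /hp -exprM mulnC.
Qed.

(** * Discretization into weighted blocks *)

Variables (theta : R) (p q : \bar R).
Hypotheses (theta_ge0 : 0 <= theta) (hset : h_set (fun u : R => u `^ theta) Gamma).
Hypotheses (p1 : (1 <= p)%E) (pq : (p <= q)%E).
Let q1 : (1 <= q)%E := le_trans p1 pq.
Let del : R := recip p - recip q.
Let rho : R := s.+1%:R - (sigma * m%:R + 1) * del.
Let tau : R := s.+1%:R - m.+1%:R * del.
Hypothesis rho_gt0 : 0 < rho.

Let del0 : 0 <= del. Proof. by rewrite subr_ge0 recip_le. Qed.

Lemma tau_gt0 : 0 < tau.
Proof.
apply: lt_le_trans rho_gt0 _; rewrite /rho /tau lerD2l lerN2 ler_wpM2r//.
by rewrite -addn1 natrD lerD2r ler_peMl.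
Qed.

(** With t = i + 1 - k, [vol] to the power 1/q - 1/p is at most a constant times 2^(del (k + t + m
    (sigma k + t))); multiplied by 2^(-(s+1)(k + t)) this is 2^-(rho k + tau t). *)
Lemma block_weight : exists2 C : R, 0 < C & forall i k, (k <= i.+1)%N ->
 vol i.+1 k `^ recip q * vol i.+1 k `^ (- recip p) * hp R i ^+ s.+1 <=
 C * 2 `^ (- (rho * k%:R + tau * (i.+1 - k)%:R)).
Proof.
exists (2 `^ ((2 + 3 * m%:R) * del + s.+1%:R)); first by rewrite powR_gt0.
move=> i k ki; have v0 : 0 < vol i.+1 k by exact: vol_gt0.
have h2 (a b : R) : 2 `^ a * 2 `^ b = 2 `^ (a + b) by rewrite powRD// pnatr_eq0 implybT.
have hpE a : hp R a = 2 `^ (- a%:R) by rewrite powRN powR_mulrn// /hp exprVn.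
rewrite -powRD; last by rewrite (gt_eqF v0) implybT.
rewrite (_ : recip q - recip p = - del); last by rewrite opprB.
set T := (i.+1 - k)%N; have iT : (k + T = i.+1)%N by rewrite subnKC.
have e2 : i%:R = k%:R + T%:R - 1 :> R by rewrite -natrD iT -natr1 addrK.
rewrite -iT volE !hpE -powRrM -[X in _ * X]powR_mulrn ?powR_ge0// -powRrM !h2.
apply: ler_powR; first by rewrite ler1n.
have /andP[_ H2] := hexp_bound sigma_ge1 k.
have e1 : (k + T + 2 + m * (hexp sigma k + 2 + T))%:R =
  k%:R + T%:R + 2 + m%:R * ((hexp sigma k)%:R + 2 + T%:R) :> R.
 by rewrite !natrD natrM !natrD.
have e3 : m.+1%:R = m%:R + 1 :> R by rewrite natr1.
rewrite e1 e2 /rho /tau e3.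
exact: weight_num.
Qed.

Lemma tcoD i k f g (u : idx i k) : L1loc Omega f -> L1loc Omega g ->
 tco (f + g) u = tco f u + tco g u.
Proof.
move=> lf lg; apply: taylorD => //; first by move=> j; exact: side_gt0.
exact: own_box_sub.
Qed.

Lemma tcoZ i k f (c : R) (u : idx i k) : L1loc Omega f ->
 tco (c *: f) u = c * tco f u.
Proof.
move=> lf; apply: taylorZ => //; first by move=> j; exact: side_gt0.
exact: own_box_sub.
Qed.

Lemma pcoD i k f g (u : idx i.+1 k) : L1loc Omega f -> L1loc Omega g ->
 pco (f + g) u = pco f u + pco g u.
Proof.
move=> lf lg; apply: taylorD => //; first by move=> j; exact: pside_gt0.
exact: pbox_sub.
Qed.

Lemma pcoZ i k f (c : R) (u : idx i.+1 k) : L1loc Omega f ->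
 pco (c *: f) u = c * pco f u.
Proof.
move=> lf; apply: taylorZ => //; first by move=> j; exact: pside_gt0.
exact: pbox_sub.
Qed.

Lemma taylor_Lp_bound (a h x : 'I_m.+1 -> R) r0 : (1 <= r0)%E -> (forall j, 0 < h j) ->
 own_box a h `<=` Omega -> exists2 B : R, 0 <= B & forall f A, 0 <= A ->
 (Lp_norm Omega r0 f <= A%:E)%E -> `|taylor Omega s f a h x| <= B * A.
Proof.
move=> r1 h0 bO.
pose K := \sum_j `|x j - a j| / h j.
have K0 : 0 <= K by apply: sumr_ge0 => j _; rewrite divr_ge0// ltW.
have [C C0 hC] := @taylor_bound R m.+1 s K.
have mb : measurable (own_box a h) by exact: cbox_measurable.
pose V := fine (leb (own_box a h)) + 1.
have lb : (leb (own_box a h) < +oo)%E.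
 by apply: le_lt_trans Omega_finite; apply: le_measure; rewrite ?inE.
have V0 : 0 < V by rewrite ltr_wpDl// fine_ge0.
have hV : (leb (own_box a h) <= V%:E)%E.
 by rewrite -(fineK (_ : leb (own_box a h) \is a fin_num)) ?lee_fin ?lerDl// ge0_fin_numE.
have P0 : 0 < \prod_j h j by apply: prodr_gt0.
exists (C * (\prod_j h j)^-1 * (2 * 1%:R * V `^ (1 - recip r0))).
 by rewrite !mulr_ge0 ?powR_ge0// invr_ge0 ltW.
move=> f A A0 fA; have lf : L1loc Omega f.
 by apply: (Lp_norm_L1loc mO r1 Omega_finite); apply: le_lt_trans fA (ltry _).
have xK j : `|x j - a j| <= K * h j.
 by rewrite -ler_pdivrMr// /K (bigD1 j)//= lerDl sumr_ge0// => j' _; rewrite divr_ge0// ltW.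
apply: le_trans (hC Omega f a h x mO lf h0 xK bO) _.
rewrite -[leRHS]mulrA; apply: ler_wpM2l; first by rewrite mulr_ge0// invr_ge0 ltW.
(* A family with a single member turns [coef_lp] into a Holder inequality on one box. *)
pose X (i : 'I_1) := \int[leb]_(y in own_box a h) `|f y|.
have fin1 : (\int[leb]_(y in own_box a h) `|f y|%:E < +oo)%E.
 by have [_] := lf; apply => //; exact: cbox_compact.
have := @coef_lp R m.+1 r0 'I_1 (fun=> own_box a h) Omega 1 V A f X r1 isT V0 A0 (fun=> mb) (fun=> bO) mO _
 (fun=> hV) fA _ _.
rewrite -/(X ord0) => hX; apply: le_trans (hX _ _ _); last 3 first.
- by move=> y; rewrite (leq_trans (max_card _))// card_ord.
- by move=> i; exact: Rintegral_ge0.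
- by move=> i; rewrite /X /Rintegral fineK// ge0_fin_numE// integral_ge0.
by rewrite -[X in X <= _](ger0_norm (Rintegral_ge0 _ _)) ?(lpn_coord X ord0)//; exact: (lpn_coord X ord0 r1).
Qed.

Local Notation good_functional := (good_functional Omega q).

(** Normalization that puts the coefficients of functions of the class into the unit ball of l_p.
    Level 0, controlled by the L_p norm and not by derivatives, has its own constant. *)
Definition coef_scale (Cd c0 : R) (i k : nat) : R :=
 if i is i'.+1 then Cd * vol i k `^ (- recip p) * hp R i' ^+ s.+1 else c0.

Definition coef (Cd c0 : R) (i k : nat) (f : 'rV[R]_m.+1 -> R) : idx i k -> R :=
 match i return idx i k -> R with
 | 0%N => fun u => c0^-1 * tco f u
 | i'.+1 => fun u => (coef_scale Cd c0 i'.+1 k)^-1 * dco f u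
 end.

Lemma coef_good Cd c0 i k (u : idx i k) : good_functional (fun f => coef Cd c0 f u).
Proof.
have tl (i' : nat) k' (v : idx i' k') : good_functional (fun f => tco f v).
 split; [by move=> f g lf lg; exact: tcoD|by move=> c f lf; exact: tcoZ|].
 apply: taylor_Lp_bound => //; first by move=> j'; exact: side_gt0.
 exact: own_box_sub.
have pl (i' : nat) k' (v : idx i'.+1 k') : good_functional (fun f => pco f v).
 split; [by move=> f g lf lg; exact: pcoD|by move=> c f lf; exact: pcoZ|].
 apply: taylor_Lp_bound => //; first by move=> j'; exact: pside_gt0.
 exact: pbox_sub.
have scal (a : R) l : good_functional l -> good_functional (fun f => a * l f).
 move=> [lD lZ [B B0 lB]]; split => [f g lf lg|c f lf|].
 - by rewrite lD// mulrDr.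
 - by rewrite lZ// mulrCA.
 exists (`|a| * B); first by rewrite mulr_ge0.
 by move=> f A A0 fA; rewrite normrM -mulrA ler_wpM2l// lB.
have subl l l' : good_functional l -> good_functional l' -> good_functional (fun f => l f - l' f).
 move=> [lD lZ [B B0 lB]] [lD' lZ' [B' B0' lB']]; split => [f g lf lg|c f lf|].
 - by rewrite lD// lD'// opprD addrACA.
 - by rewrite lZ// lZ'// mulrBr.
 exists (B + B'); first exact: addr_ge0.
 by move=> f A A0 fA; apply: le_trans (ler_normB _ _) _; rewrite mulrDl lerD ?lB ?lB'.
case: i u => [|i] u; first by have := scal c0^-1 (fun f => tco f u) (tl 0%N k u).
by have := scal (coef_scale Cd c0 i.+1 k)^-1 _ (subl _ _ (tl i.+1 k u) (pl i k u)).
Qed.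

Lemma Lp_norm_eq_on r0 f g : (forall x, Omega x -> f x = g x) -> Lp_norm Omega r0 f = Lp_norm Omega r0 g.
Proof.
move=> fg; have e : f \_ Omega = g \_ Omega.
 by apply/funext => x; rewrite !patchE; case: ifPn => // /set_mem /fg.
by rewrite /Lp_norm /measurable_on e.
Qed.

(** The interface between analysis and the finite-dimensional estimates; with these properties at
    hand the domain is no longer needed. Level 0 is bounded only under the additional bound on the
    L_p norm. *)
Theorem discretization : exists (Cd c0 C1 C2 : R), [/\ 0 < C1, 0 < C2,
 forall i k, (k <= i)%N ->
  #|{: idx i k}|%:R <= C1 * 2 `^ (sigma * theta * k%:R + m.+1%:R * (i - k)%:R),
 (forall i k (v : idx i k -> R), (k <= i)%N -> (Lp_norm Omega q
   (fun x => coef_scale Cd c0 i k * synth v x)%R <=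
   (C2 * 2 `^ (- (rho * k%:R + tau * (i - k)%:R)) * lpn q v)%:E)%E) &
 [/\ (forall i k f, (0 < i)%N -> sobolev_class Omega s.+1 p f -> lpn p (@coef Cd c0 i k f) <= 1),
   (forall f, (Lp_norm Omega p f <= 1)%E -> lpn p (@coef Cd c0 0 0 f) <= 1) &
   forall e : R, 0 < e -> exists I0, forall f, sobolev_class Omega s.+1 p f ->
    (Lp_norm Omega q (fun x => f x - \sum_(i < I0.+1) \sum_(k < i.+1)
     coef_scale Cd c0 i k * synth (@coef Cd c0 i k f) x)%R <= e%:E)%E]].
Proof.
have [Cc Cc0 hcount] := cell_count theta_ge0 hset.
have [Cs Cs0 hsynth] := synth_Lp q1.
have [Cd' Cd0' hdco] := dco_lp p1.
have [Cw Cw0 hw] := block_weight.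
pose Cd := Cd' * (2 * m.+1%:R); have Cd0 : 0 < Cd by rewrite !mulr_gt0.
have /choice[B0 hB0] : forall u : idx 0 0, exists B : R, 0 <= B /\ forall f A, 0 <= A ->
  (Lp_norm Omega p f <= A%:E)%E -> `|tco f u| <= B * A.
 move=> u; have [||B B0 hB] := @taylor_Lp_bound (ccorner u.1) (side 0 0) (node u) p p1.
 - by move=> j; exact: side_gt0.
 - exact: own_box_sub.
 by exists B.
pose b0 := \sum_u B0 u + 1.
have b00 : 0 < b0 by rewrite ltr_wpDl// sumr_ge0// => u _; have [] := hB0 u.
pose c0 := #|{: idx 0 0}|.+1%:R * b0.
have c00 : 0 < c0 by rewrite mulr_gt0.
have scale_gt0 i k : 0 < coef_scale Cd c0 i k.
 case: i => [//|i]; rewrite /coef_scale !mulr_gt0 ?powR_gt0 ?exprn_gt0 ?hp_gt0//; exact: vol_gt0.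
pose N := #|{: nodes}|.
pose C1 := Cc * N.+1%:R; have C10 : 0 < C1 by rewrite mulr_gt0.
pose C2 := Cs * (Cd * Cw) + c0 * (Cs * vol 0 0 `^ recip q).
have C20 : 0 < C2.
 have h1 : 0 < Cs * (Cd * Cw) by rewrite !mulr_gt0.
 have h2 : 0 <= Cs * vol 0 0 `^ recip q by rewrite mulr_ge0 ?powR_ge0// ltW.
 by apply: ltr_wpDr h1; rewrite mulr_ge0// ltW.
have hS i k (v : idx i k -> R) : (k <= i)%N -> (Lp_norm Omega q
   (fun x => coef_scale Cd c0 i k * synth v x)%R <=
   (C2 * 2 `^ (- (rho * k%:R + tau * (i - k)%:R)) * lpn q v)%:E)%E.
 move=> ki; have L0 : 0 <= lpn q v by exact: lpn_ge0.
 rewrite (_ : (fun x => _) = coef_scale Cd c0 i k *: synth v)//.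
 rewrite Lp_normZ// gtr0_norm//; apply: le_trans (lee_wpmul2l _ (hsynth i k v)) _.
  by rewrite lee_fin ltW.
 rewrite -EFinM lee_fin; case: i ki v L0 => [|i] ki v L0.
  move: ki; rewrite leqn0 => /eqP k0; subst k.
  rewrite subnn !mulr0 addr0 oppr0 powRr0 mulr1 /coef_scale mulrA ler_wpM2r//.
  by rewrite /C2 lerDr !mulr_ge0// ltW.
 rewrite [leLHS]mulrA ler_wpM2r// /coef_scale.
 apply: (@le_trans _ _ (Cs * Cd * (vol i.+1 k `^ recip q * vol i.+1 k `^ (- recip p) * hp R i ^+ s.+1))).
  by rewrite le_eqVlt; apply/orP; left; apply/eqP; ring.
 apply: (@le_trans _ _ (Cs * Cd * (Cw * 2 `^ (- (rho * k%:R + tau * (i.+1 - k)%:R))))).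
  by apply: ler_wpM2l; [rewrite ltW// mulr_gt0|exact: hw].
 rewrite [leLHS]mulrA ler_wpM2r ?powR_ge0// /C2 -mulrA lerDl.
 by rewrite !mulr_ge0 ?powR_ge0// ltW.
have scaleK i k f x : coef_scale Cd c0 i.+1 k * synth (@coef Cd c0 i.+1 k f) x = synth (@dco i k f) x.
 rewrite /synth mulr_sumr; apply: eq_bigr => u _; rewrite /coef !mulrA mulfV ?mul1r//.
 by rewrite gt_eqF.
have scaleK0 k f x : coef_scale Cd c0 0 k * synth (@coef Cd c0 0 k f) x = synth (@tco 0 k f) x.
 rewrite /synth mulr_sumr; apply: eq_bigr => u _; rewrite /coef !mulrA mulfV ?mul1r//.
 by rewrite gt_eqF.
have hcl i k f : sobolev_class Omega s.+1 p f -> lpn p (@coef Cd c0 i.+1 k f) <= 1.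
 move=> [lf hg]; have [g wf gA] := sobolev_class_partials mO p1 hg.
 have A0 : 0 <= 2 * m.+1%:R :> R by rewrite mulr_ge0.
 have h := hdco i k f g _ A0 wf gA.
 rewrite /coef lpnZ// ger0_norm ?invr_ge0 ?(ltW (scale_gt0 _ _))//.
 rewrite mulrC ler_pdivrMr// mul1r; apply: le_trans h _.
 by rewrite /coef_scale /Cd le_eqVlt; apply/orP; left; apply/eqP; ring.
exists Cd, c0, C1, C2; split => //.
 move=> i k ki; have := hcount k (i - k)%N; rewrite subnKC// => h.
 set P := 2 `^ _ in h *; rewrite card_prod natrM.
 have hP : 0 <= Cc * P by rewrite mulr_ge0 ?powR_ge0// ltW.
 rewrite /C1 [leRHS]mulrAC; by apply: ler_pM => //; rewrite ler_nat.
split.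
- by move=> [//|i] k f _; exact: hcl.
- move=> f fA; rewrite /coef lpnZ// ger0_norm ?invr_ge0 ?(ltW c00)// mulrC ler_pdivrMr// mul1r.
 apply: lpn_le_card => // [|u]; first exact: ltW.
 have [B00 hb] := hB0 u; apply: le_trans (hb f 1 ler01 fA) _.
 by rewrite mulr1 /b0 (bigD1 u)//= -addrA lerDl addr_ge0// sumr_ge0// => u' _; have [] := hB0 u'.
move=> e e0.
(* The decay is split into two halves; one of them pays for the number of strips of a level through
   [poly_geom]. *)
pose a := 2 `^ (- (rho / 2)); pose b := 2 `^ (rho / 2).
have b1 : 1 < b by exact: two_powR_gt1 (divr_gt0 rho_gt0 (ltr0Sn R 1)).
have ab : a = b^-1 by rewrite /a powRN.
have a01 : 0 <= a < 1 by rewrite powR_ge0 ab invf_lt1// (lt_trans ltr01).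
have a1 : 0 < 1 - a by rewrite subr_gt0; case/andP: a01.
pose K := (b - 1)^-1 + 1; have K0 : 0 < K by rewrite ltr_wpDl// invr_ge0 subr_ge0 ltW.
pose D := C2 * K / (1 - a) + 1; have D0 : 0 < D by rewrite ltr_wpDl// divr_ge0 ?mulr_ge0 ?ltW.
have [I0 hI0] := geom_small a01 (divr_gt0 e0 D0).
exists I0 => f cf; have [lf _] := cf.
rewrite (@Lp_norm_eq_on q _ (fun x => f x - approx I0 f x)); last first.
 move=> x Ox; congr (_ - _); rewrite (approx_telescope _ lf Ox).
 rewrite big_ord_recl /=; congr (_ + _).
  by rewrite /approx; apply: eq_bigr => k _; rewrite scaleK0.
 by apply: eq_bigr => i _; apply: eq_bigr => k _; exact: scaleK.
pose B i := \sum_(k < i.+2) C2 * 2 `^ (- (rho * k%:R + tau * (i.+1 - k)%:R)).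
apply: (@approx_tail q f I0 B e q1 lf (ltW e0)).
 move=> i _; rewrite (@Lp_norm_eq_on q _ (fun x => \sum_(k < i.+2) coef_scale Cd c0 i.+1 k * synth (@coef Cd c0 i.+1 k f) x)).
  apply: Lp_norm_sum => // k; apply: le_trans (hS i.+1 k _ _) _; first by rewrite -ltnS.
  rewrite lee_fin ler_piMr ?mulr_ge0 ?powR_ge0 ?(ltW C20)//.
  by apply: lpn_le_lpn p1 pq _; exact: hcl.
 move=> x Ox; rewrite (approx_step _ lf Ox).
 by apply: eq_bigr => k _; rewrite scaleK.
have hB i : B i <= C2 * K * a ^+ i.+1.
 apply: (@le_trans _ _ (\sum_(k < i.+2) C2 * 2 `^ (- (rho * i.+1%:R)))).
  apply: ler_sum => k _; rewrite ler_wpM2l ?(ltW C20)//; apply: ler_powR; first by rewrite ler1n.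
  rewrite lerN2; have ki : (k <= i.+1)%N by rewrite -ltnS.
  rewrite -{1}(subnKC ki) natrD mulrDr lerD2l ler_wpM2r//.
  by rewrite /rho /tau lerD2l lerN2 ler_wpM2r// -natr1 lerD2r ler_peMl.
 rewrite sumr_const card_ord -[_ *+ _]mulr_natl.
 apply: (@le_trans _ _ (K * b ^+ i.+1 * (C2 * (a ^+ i.+1 * a ^+ i.+1)))).
  rewrite two_powR_nat -/a.
  rewrite ler_wpM2r ?mulr_ge0 ?powR_ge0 ?(ltW C20) ?exprn_ge0 ?poly_geom ?powR_ge0//.
 have be : b ^+ i.+1 * a ^+ i.+1 = 1.
  by rewrite -exprMn ab mulfV ?expr1n// gt_eqF// (lt_trans ltr01).
 by rewrite mulrACA [X in _ * X <= _]mulrA be mul1r [K * C2]mulrC.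
have CK0 : 0 <= C2 * K by rewrite mulr_ge0 ?(ltW C20) ?(ltW K0).
move=> M; apply: le_trans (geom_tail I0 M a01 CK0 hB) _.
apply: (@le_trans _ _ (D * a ^+ I0)).
 by apply: ler_wpM2r; [rewrite exprn_ge0 ?powR_ge0|rewrite /D lerDl].
by rewrite mulrC -ler_pdivlMr.
Qed.

Local Notation Nq := (Lp_norm Omega q).
Local Notation W := (sobolev_class Omega s.+1 p).

Lemma scale_synthE Cd c0 i k (v : idx i k -> R) x :
 coef_scale Cd c0 i k * synth v x = \sum_u v u * (coef_scale Cd c0 i k * basis u x).
Proof. by rewrite /synth mulr_sumr; apply: eq_bigr => u _; rewrite mulrCA. Qed.

Definition block (Cd c0 : R) (i k : nat) (f : 'rV[R]_m.+1 -> R) x : R :=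
 \sum_(u : idx i k) coef Cd c0 f u * (coef_scale Cd c0 i k * basis u x).

Lemma block_bound Cd c0 i k (B : R) : (forall v : idx i k -> R,
  (Nq (fun x => coef_scale Cd c0 i k * synth v x)%R <= (B * lpn q v)%:E)%E) -> forall v : idx i k -> R,
 (Nq (fun x => \sum_u v u * (coef_scale Cd c0 i k * basis u x))%R <= (B * lpn q v)%:E)%E.
Proof. by move=> h v; have := h v; congr (Nq _ <= _)%E; apply/funext => x; exact: scale_synthE. Qed.

Lemma block_basis_fin Cd c0 i k (B : R) : (forall v : idx i k -> R,
  (Nq (fun x => coef_scale Cd c0 i k * synth v x)%R <= (B * lpn q v)%:E)%E) ->
 forall u : idx i k, (Nq (fun x => coef_scale Cd c0 i k * basis u x)%R < +oo)%E.
Proof.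
move=> h u; have := h (fun u' => (u' == u)%:R); rewrite (_ : (fun x => _) = fun x => coef_scale Cd c0 i k * basis u x).
 by move=> h1; apply: le_lt_trans h1 (ltry _).
apply/funext => x; rewrite scale_synthE (bigD1 u)//= eqxx mul1r big1 ?addr0// => u' /negbTE ->.
by rewrite mul0r.
Qed.

Local Notation W1 := [set f | W f /\ (Lp_norm Omega p f <= 1)%E].

(** A comparison with finitely many blocks. It yields both that the class lies in L_q and that the
    embedding is bounded. *)
Lemma class_estimate : exists (Cd c0 : R) (I0 : nat) (a : nat -> nat -> R), [/\ forall i k, 0 <= a i k,
 forall f, W1 f -> forall i k, (k <= i)%N -> lpn q (coef Cd c0 f : idx i k -> R) <= 1 &
 forall f, W f -> (Nq f <=
  (1 + \sum_(i < I0.+1) \sum_(k < i.+1) a i k * lpn q (coef Cd c0 f : idx i k -> R))%R%:E)%E].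
Proof.
have [Cd [c0 [C1 [C2 [C10 C20 _ hS [hcl hcl0 htail]]]]]] :=
 discretization.
have [I0 hI0] := htail 1 ltr01.
exists Cd, c0, I0, (fun i k => C2 * 2 `^ (- (rho * k%:R + tau * (i - k)%:R))); split.
- by move=> i k; rewrite mulr_ge0 ?powR_ge0// ltW.
- move=> f [Wf pf] i k ki; apply: lpn_le_lpn p1 pq _.
 case: i ki => [|i] ki; last exact: hcl.
 by move: ki; rewrite leqn0 => /eqP k0; subst k; exact: hcl0.
move=> f Wf; have h1 := hI0 f Wf.
pose A x := \sum_(i < I0.+1) \sum_(k < i.+1) coef_scale Cd c0 i k * synth (coef Cd c0 f : idx i k -> R) x.
rewrite (_ : f = (fun x => f x - A x) + A); last by apply/funext => x; rewrite /= subrK.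
apply: le_trans (Lp_normD _ _ _ q1) _; rewrite EFinD; apply: leeD => //.
rewrite (_ : (fun x => f x - A x) + A = f); last by apply/funext => x; rewrite /= subrK.
apply: Lp_norm_sum => // i; apply: Lp_norm_sum => // k; apply: hS; by rewrite -ltnS.
Qed.

Lemma class_finite f : W f -> (Nq f < +oo)%E.
Proof. by move=> Wf; have [Cd [c0 [I0 [a [_ _ h]]]]] := class_estimate; exact: le_lt_trans (h f Wf) (ltry _). Qed.

Lemma class_bound : exists2 K : R, 0 <= K & forall f, W1 f -> (Nq f <= K%:E)%E.
Proof.
have [Cd [c0 [I0 [a [a0 h1 h]]]]] := class_estimate.
exists (1 + \sum_(i < I0.+1) \sum_(k < i.+1) a i k).
 by rewrite addr_ge0// sumr_ge0// => i _; rewrite sumr_ge0.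
move=> f Wf; apply: le_trans (h f Wf.1) _; rewrite lee_fin lerD2l.
apply: ler_sum => i _; apply: ler_sum => k _; rewrite ler_piMr//.
by apply: h1; rewrite // -ltnS.
Qed.

Lemma width_eventually kk (th : R) (q1' : (1 <= q)%E) :
 (forall C1, 0 < C1 -> balanced (@fd_width R kk p q) (sigma * theta) m.+1%:R rho tau C1 th) ->
 eventually_bounded (fun n => width kk n (sobolev_class_in Omega s.+1 p q1')) th.
Proof.
move=> hbal; have [Cd [c0 [C1 [C2 [C10 C20 hcard hS [hcl _ htail]]]]]] :=
 discretization.
have fO := Omega_finite.
apply: (@assemble_eventually R 'rV[R]_m.+1 (op_width Omega q W kk) _ _ (@fd_width R kk p q) #|{: idx 0 0}|
 (sigma * theta) m.+1%:R rho tau C1 C2 th (fun i k => idx i k) (block Cd c0)) (hbal C1 C10) => //.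
- by apply: op_width_zero => // f _; rewrite Lp_norm0.
- by move=> N1 N2 E1 E2 U1 U2; exact: op_width_add.
- move=> i k n E ki E0 hE.
 have hS' v := block_bound (fun v => hS i k v ki) v.
 have w0 : 0 <= C2 * 2 `^ (- (rho * k%:R + tau * (i - k)%:R)) by rewrite mulr_ge0 ?powR_ge0// ltW.
 have cg (u : idx i k) := coef_good Cd c0 (i := i) (k := k) u.
 have pf := block_basis_fin (hS i k ^~ ki).
 case: i ki hS' w0 cg pf hE => [|i] ki hS' w0 cg pf hE.
  move: ki; rewrite leqn0 => /eqP k0; subst k.
  (* At level 0 the class does not bound the coefficients; the block is reproduced exactly by the
     extra rank, and the allotted n is mere padding. *)
  rewrite muln1; apply: (op_width_pad q1 (leq_addl n _)).
  by apply: (op_width_le (mulr_ge0 w0 E0)); exact: (op_width_exact q1 W pf cg).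
 rewrite muln0 addn0.
 by apply: (op_width_block q1 pf cg w0 hS' _ hE) => f Wf; exact: hcl.
- move=> e e0; have [I0 hI0] := htail e e0; exists I0; apply: op_width_zero => // f Wf.
 have := hI0 f Wf; congr (Nq _ <= _)%E; apply/funext => x; congr (_ - _).
 by apply: eq_bigr => i _; apply: eq_bigr => k _; exact: scale_synthE.
move=> N n E Nn E0 hP; apply: (op_width_width mO fO) => //.
exact: (op_width_pad q1 (leq_trans Nn (leq_pred n)) hP).
Qed.

Lemma cover_eventually (th : R) (w : nat -> \bar R) :
 (forall N n E, (N <= n.-1)%N -> 0 <= E -> op_cover Omega q W1 N E (fun f => f) -> (w n <= E%:E)%E) ->
 (forall C1, 0 < C1 -> balanced (@fd_cover R p q) (sigma * theta) m.+1%:R rho tau C1 th) ->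
 eventually_bounded w th.
Proof.
move=> hw hbal; have [Cd [c0 [C1 [C2 [C10 C20 hcard hS [hcl hcl0 htail]]]]]] :=
 discretization.
apply: (@assemble_eventually R 'rV[R]_m.+1 (op_cover Omega q W1) _ _ (@fd_cover R p q) 0
 (sigma * theta) m.+1%:R rho tau C1 C2 th (fun i k => idx i k) (block Cd c0) _ _ _ _ w hw (hbal C1 C10)) => //.
- by apply: op_cover_zero => // f _; rewrite Lp_norm0.
- by move=> N1 N2 E1 E2 U1 U2; exact: op_cover_add.
- move=> i k n E ki E0 hE.
 have hS' v := block_bound (fun v => hS i k v ki) v.
 have w0 : 0 <= C2 * 2 `^ (- (rho * k%:R + tau * (i - k)%:R)) by rewrite mulr_ge0 ?powR_ge0// ltW.
 have pf := block_basis_fin (hS i k ^~ ki).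
 rewrite mul0n addn0; apply: (op_cover_block q1 w0 pf hS' _ hE) => f [Wf pf1].
 case: i ki {hS' w0 pf hE} => [|i] ki; last exact: hcl.
 by move: ki; rewrite leqn0 => /eqP k0; subst k; exact: hcl0.
move=> e e0; have [I0 hI0] := htail e e0; exists I0; apply: op_cover_zero => // f [Wf _].
have := hI0 f Wf; congr (Nq _ <= _)%E; apply/funext => x; congr (_ - _).
by apply: eq_bigr => i _; apply: eq_bigr => k _; exact: scale_synthE.
Qed.

End Operators.

(** An allocation rule turns a slope s, the ratio of weight exponent to size exponent along one
    direction, into a final exponent [th s], provided the other direction has a surplus g > 0. [P]
    delimits the slopes for which the rule is valid. *)
Definition allocates (R : realType) (fdw : finType -> nat -> R -> Prop) (P : R -> Prop) (th : R -> R) :=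
 forall A B rho s g C1 : R, 0 <= A -> 0 < B -> 0 < s -> 0 < g -> rho = g + A * s -> 0 < C1 -> P s ->
 allocation fdw A B rho (s * B) C1 (th s).

(** * The two directions of the quadrant *)

Section Directions.
Variables (R : realType) (m r : nat) (theta sigma : R) (p q : \bar R).
Let del : R := recip p - recip q.
Let rho : R := r%:R - (sigma * m%:R + 1) * del.
Let tau : R := r%:R - m.+1%:R * del.
Hypotheses (theta_ge0 : 0 <= theta) (sigma_ge1 : 1 <= sigma) (rho_gt0 : 0 < rho) (tau_gt0 : 0 < tau).
Local Notation kap := (kappa m.+1 r theta sigma p q).
Let sd : R := r%:R / m.+1%:R + recip q - recip p.
Variables (fdw : finType -> nat -> R -> Prop) (Pc : R -> Prop) (th : R -> R).
Hypothesis halloc : allocates fdw Pc th.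

Lemma slope_tau : sd * m.+1%:R = tau.
Proof.
rewrite /sd /tau /del mulrBl mulrDl divfK ?pnatr_eq0//.
by set D := m.+1%:R; ring.
Qed.

Lemma kappa_fin : theta != 0 -> kap = (rho / (sigma * theta))%:E.
Proof.
move=> t0; rewrite /kappa (negbTE t0) /rho /del; congr (_ / _)%:E.
by rewrite -[m.+1%:R]natr1; ring.
Qed.

(** The slope in the direction t is sd = tau/d. If it is below kappa, weights decay faster relative
    to sizes in the direction k, with surplus rho - sigma theta sd. *)
Lemma balanced_vertical (C1 : R) : (sd%:E < kap)%E -> Pc sd -> 0 < C1 ->
 balanced fdw (sigma * theta) m.+1%:R rho tau C1 (th sd).
Proof.
move=> hk hP C10; have sg0 : 0 < sigma by apply: lt_le_trans sigma_ge1.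
have sd0 : 0 < sd by rewrite -(pmulr_lgt0 _ (_ : 0 < m.+1%:R)) ?slope_tau.
have g0 : 0 < rho - sigma * theta * sd.
 have [t0|t0] := eqVneq theta 0; first by rewrite t0 mulr0 mul0r subr0.
 have st0 : 0 < sigma * theta by rewrite mulr_gt0// lt_neqAle eq_sym t0.
 by move: hk; rewrite kappa_fin// lte_fin ltr_pdivlMr// mulrC subr_gt0.
have A0 : 0 <= sigma * theta by rewrite mulr_ge0// ltW.
apply: allocation_balanced => //; rewrite -slope_tau.
by apply: (halloc A0 _ sd0 g0) => //; rewrite subrK.
Qed.

(** The opposite case, treated by exchanging the directions: the slope is kappa, finite and hence
    with theta > 0, and the surplus tau - d kappa lies in the direction t. *)
Lemma balanced_horizontal (C1 : R) : (kap < sd%:E)%E -> Pc (fine kap) -> 0 < C1 ->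
 balanced fdw (sigma * theta) m.+1%:R rho tau C1 (th (fine kap)).
Proof.
move=> hk; have [t0|t0] := eqVneq theta 0; first by move: hk; rewrite /kappa t0 eqxx ltNge leey.
have sg0 : 0 < sigma by apply: lt_le_trans sigma_ge1.
have st0 : 0 < sigma * theta by rewrite mulr_gt0// lt_neqAle eq_sym t0.
rewrite kappa_fin//= in hk *; rewrite lte_fin in hk; set k0 := rho / _ in hk * => hP C10.
have k00 : 0 < k0 by rewrite divr_gt0.
have g0 : 0 < tau - m.+1%:R * k0 by rewrite -slope_tau mulrC -mulrBr mulr_gt0// subr_gt0.
apply: balanced_swap; apply: allocation_balanced => //.
have -> : rho = k0 * (sigma * theta) by rewrite /k0 divfK// gt_eqF.
by apply: (halloc _ _ k00 g0) => //; rewrite subrK.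
Qed.

End Directions.

Lemma allocation_width_none (R : realType) kk (p q : \bar R) : (1 <= p)%E -> (p <= q)%E ->
 allocates (@fd_width R kk p q) (fun=> True) id.
Proof.
move=> p1 pq A B rho' s g C1 A0 B0 s0 g0 rE C10 _.
apply: (allocation_none _ _ B s0 g0 rE C10) => I; last exact: fd_width1.
exact: fd_width_full (le_trans p1 pq) (leqnn _).
Qed.

Lemma allocation_cover (R : realType) (p q : \bar R) : (1 <= p)%E -> (p <= q)%E ->
 allocates (@fd_cover R p q) (fun=> True) (fun s => s + (recip p - recip q)).
Proof.
move=> p1 pq A B rho' s g C1 A0 B0 s0 g0 rE C10 _.
apply: (allocation_entropy A0 B0 s0 g0 rE); first by rewrite subr_ge0 recip_le.
by move=> K1 K2 K10 K20; exact: entropy_mid.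
Qed.

Section RandomAllocation.
Variables (R : realType) (kk : width_kind) (P Q : R).
Hypotheses (P1 : 1 < P) (PQ : P < Q).
Let h := qhat kk P%:E Q%:E.
Hypothesis h2 : 2 < h.
Let delta := Num.min (P^-1 - Q^-1) (2^-1 - h^-1).
Let M2 := delta / (2^-1 - h^-1) / h.

Let h0 : 0 < h. Proof. by apply: lt_trans h2. Qed.
Let gap0 : 0 < 2^-1 - h^-1. Proof. by rewrite subr_gt0 ltf_pV2 ?posrE. Qed.
Let delta0 : 0 < delta.
Proof.
by rewrite lt_min gap0 subr_gt0 ltf_pV2 ?PQ// posrE (lt_trans ltr01)// (lt_trans P1).
Qed.
Let M20 : 0 < M2. Proof. by rewrite !divr_gt0. Qed.

(** It identifies the slope M2, where the random bound neither gains nor loses with the block size,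
    as the point where s + delta and (h/2) s coincide; comparing two of the exponents of the theorem
    thus decides the regime. *)
Lemma delta_threshold : delta = M2 * (h / 2 - 1).
Proof.
have hn : h != 0 by rewrite gt_eqF.
have gn : 2^-1 - h^-1 != 0 by rewrite gt_eqF.
have -> : h / 2 - 1 = h * (2^-1 - h^-1) by rewrite mulrBr mulfV.
by rewrite /M2 mulrA divfK// divfK.
Qed.

Let mid (C1 : R) := @fd_width_mid R kk P Q (delta / (2^-1 - h^-1)) C1 P1 PQ h2 (divr_gt0 delta0 gap0).

Lemma allocation_width_right : allocates (@fd_width R kk P%:E Q%:E) (fun s => M2 < s) (fun s => s + delta).
Proof.
move=> A B rho' s g C1 A0 B0 s0 g0 rE C10 Ms.
have muE : delta / (2^-1 - h^-1) * (2^-1 - h^-1) = delta by rewrite divfK// gt_eqF.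
have [Cr Cr0 hmid] := mid C10 muE.
have -> : s + delta = s - M2 + delta / (2^-1 - h^-1) / 2.
 by rewrite {1}delta_threshold /M2 mulrBr mulr1 mulrA divfK ?gt_eqF//; ring.
have P1e : (1 <= P%:E)%E by rewrite lee_fin ltW.
have PQe : (P%:E <= Q%:E)%E by rewrite lee_fin ltW.
apply: (allocation_right _ A0 B0 g0 rE C10 _ Cr0 hmid); last by rewrite subr_gt0.
 by move=> I; exact: fd_width_full (le_trans P1e PQe) (leqnn _).
by rewrite !divr_gt0.
Qed.

Lemma allocation_width_left : allocates (@fd_width R kk P%:E Q%:E) (fun s => s < M2) (fun s => h / 2 * s).
Proof.
move=> A B rho' s g C1 A0 B0 s0 g0 rE C10 sM.
have muE : delta / (2^-1 - h^-1) * (2^-1 - h^-1) = delta by rewrite divfK// gt_eqF.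
have [Cr Cr0 hmid] := mid C10 muE.
have P1e : (1 <= P%:E)%E by rewrite lee_fin ltW.
have PQe : (P%:E <= Q%:E)%E by rewrite lee_fin ltW.
rewrite [h / 2 * s]mulrC; apply: (allocation_left _ A0 B0 s0 g0 rE _ Cr0 hmid).
- by move=> I; exact: fd_width1.
- by rewrite !divr_gt0.
- by rewrite divr_gt0.
- by rewrite /M2 mulrA divfK ?gt_eqF.
by rewrite subr_gt0.
Qed.

Lemma above_threshold s : s + delta < h / 2 * s -> M2 < s.
Proof.
have h21 : 0 < h / 2 - 1 by rewrite subr_gt0 ltr_pdivlMr// mul1r.
by rewrite -ltrBDl -{2}[s]mul1r -mulrBl delta_threshold mulrC ltr_pM2l.
Qed.

Lemma below_threshold s : h / 2 * s < s + delta -> s < M2.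
Proof.
have h21 : 0 < h / 2 - 1 by rewrite subr_gt0 ltr_pdivlMr// mul1r.
by rewrite -ltrBlDl -{2}[s]mul1r -mulrBl delta_threshold [M2 * _]mulrC ltr_pM2l.
Qed.

End RandomAllocation.

(** * Choice of direction and regime *)

Theorem theorem3 (R : realType) (m r : nat) (theta sigma : R) (p q : \bar R)
    (Omega : set 'rV[R]_m.+1)
    (d_ge2 : (2 <= m.+1)%N) (r_gt0 : (0 < r)%N)
    (theta_ge0 : 0 <= theta) (theta_lt_d : theta < m.+1%:R)
    (sigma_ge1 : 1 <= sigma)
    (p_ge1 : (1 <= p)%E) (p_le_q : (p <= q)%E)
    (OmegaG : class_G theta sigma Omega)
    (r_pos : 0 < r%:R + (sigma * (m.+1%:R - 1) + 1) * (recip q - recip p)) :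
  let q_ge1 := le_trans p_ge1 p_le_q in
  (alpha1 m.+1 r != alpha2 m.+1 r theta sigma p q ->
    exists Id : {linear sobolev_space Omega r p_ge1 -> Lp_space Omega q_ge1},
      [/\ continuous Id, is_embedding Id &
        eventually_bounded (entropy_number Id)
          (alpha_min m.+1 r theta sigma p q)])
  /\
  ((1 < p)%E -> (q < +oo)%E ->
    (forall f, sobolev_class Omega r p f -> (Lp_norm Omega q f < +oo)%E) /\
    forall k : width_kind,
      let qh := qhat k p q in
      let w := fun n => width k n (sobolev_class_in Omega r p q_ge1) in
      (qh <= 2 \/ p = q -> alpha1 m.+1 r != alpha2 m.+1 r theta sigma p q ->
        eventually_bounded w
          (alpha_min m.+1 r theta sigma p q - recip p + recip q))
      /\
      ((p < q)%E -> 2 < qh ->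
        let th := theta_exps m.+1 r theta sigma p q qh in
        forall j : 'I_4,
          (tnth th j < \big[mine/+oo]_(i < 4 | i != j) tnth th i)%E ->
          eventually_bounded w (fine (tnth th j)))).
Proof.
move=> q_ge1; case: r r_gt0 r_pos => // s _ r_pos.
have [Gamma [GammaQ hset OmegaE]] := OmegaG.
have [_ _ Gamma0 _ _] := hset.
set rho := s.+1%:R - (sigma * m%:R + 1) * (recip p - recip q).
set tau := s.+1%:R - m.+1%:R * (recip p - recip q).
have rho_gt0 : 0 < rho.
 move: r_pos; rewrite -[m.+1%:R]natr1 addrK; congr (0 < _); rewrite /rho -mulrN; congr (_ + _ * _).
 by rewrite opprB.
have tau0 : 0 < tau := tau_gt0 sigma_ge1 p_ge1 p_le_q rho_gt0.
have mO := Omega_measurable sigma_ge1 Gamma0 OmegaE.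
pose sd : R := s.+1%:R / m.+1%:R + recip q - recip p.
set kap := kappa m.+1 s.+1 theta sigma p q.
have kap_top : kap = +oo%E \/ kap = (fine kap)%:E.
 by rewrite /kap /kappa; case: ifP => _; [left|right].
have a1E : alpha1 m.+1 s.+1 = (sd + (recip p - recip q))%:E.
 by rewrite /alpha1 /sd; congr EFin; rewrite addrA subrK addrK.
have a2E : alpha2 m.+1 s.+1 theta sigma p q = (kap + (recip p - recip q)%:E)%E by [].
(* The exponents alpha1 and alpha2 are [sd] and [kap] shifted by the same 1/p - 1/q, so the smaller
   one names the direction whose slope decides. *)
have amin : alpha1 m.+1 s.+1 != alpha2 m.+1 s.+1 theta sigma p q ->
  (sd%:E < kap)%E /\ alpha_min m.+1 s.+1 theta sigma p q = sd + (recip p - recip q) \/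
  (kap < sd%:E)%E /\ alpha_min m.+1 s.+1 theta sigma p q = fine kap + (recip p - recip q).
 rewrite /alpha_min a2E a1E; case: kap_top => [->|->].
  by move=> _; left; rewrite ltry addye// minEle leey.
 rewrite -EFinD !lte_fin => ne; have [h|h|h] := ltgtP sd (fine kap).
 - by left; rewrite minEle lee_fin lerD2r (ltW h).
 - by right; rewrite minC minEle lee_fin lerD2r (ltW h).
 by move: ne; rewrite h eqxx.
split.
 move=> /amin ha.
 have [K K0 hK] := class_bound sigma_ge1 GammaQ Gamma0 OmegaE theta_ge0 hset p_ge1 p_le_q rho_gt0.
 pose emb := @embedding R m s.+1 Omega p q p_ge1 q_ge1 K K0 hK.
 pose Id : {linear sobolev_space Omega s.+1 p_ge1 -> Lp_space Omega q_ge1} :=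
  HB.pack emb (GRing.isLinear.Build R _ _ *:%R emb (@embedding_linear R m s.+1 Omega p q p_ge1 q_ge1 K K0 hK)).
 exists Id; split.
 - apply: (@bounded_linear_cont _ _ _ Id K) => u; rewrite -lee_fin /= embedding_norm.
  exact: rep_Lp_bound.
 - by move=> u; exact: embedding_ae.
 apply: (cover_eventually sigma_ge1 GammaQ Gamma0 OmegaE theta_ge0 hset p_ge1 p_le_q rho_gt0).
  move=> N n E Nn E0; apply: entropy_le => // u.
  by exists (@rep_Lp_fin R m s.+1 Omega p q p_ge1 q_ge1 K K0 hK u).
 move=> C1 C10; case: ha => [[hk ->]|[hk ->]].
  exact: (balanced_vertical theta_ge0 sigma_ge1 rho_gt0 tau0 (allocation_cover p_ge1 p_le_q) hk I C10).
 exact: (balanced_horizontal theta_ge0 sigma_ge1 rho_gt0 (allocation_cover p_ge1 p_le_q) hk I C10).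
move=> p_gt1 q_fin; split.
 by move=> f; exact: (class_finite sigma_ge1 GammaQ Gamma0 OmegaE theta_ge0 hset p_ge1 p_le_q rho_gt0).
have wev kk th := width_eventually sigma_ge1 GammaQ Gamma0 OmegaE (s := s) theta_ge0 hset p_ge1 p_le_q rho_gt0
 (kk := kk) (th := th) q_ge1.
move=> k qh w; split.
 have canc (x a b : R) : x + (a - b) - a + b = x by ring.
 move=> _ /amin ha; apply: wev => C1 C10; case: ha => [[hk ->]|[hk ->]]; rewrite canc.
  exact: (balanced_vertical theta_ge0 sigma_ge1 rho_gt0 tau0 (allocation_width_none k p_ge1 p_le_q) hk I C10).
 exact: (balanced_horizontal theta_ge0 sigma_ge1 rho_gt0 (allocation_width_none k p_ge1 p_le_q) hk I C10).
move=> pq qh2 th j hj.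
have hlt (i : 'I_4) : i != j -> (tnth th j < tnth th i)%E.
 by move=> ij; apply: lt_le_trans hj _; exact: bigmin_le_cond.
have {hlt}hlt i : (i < 4)%N -> i != j :> nat -> (nth 0%E th j < nth 0%E th i)%E.
 by move=> i4 ij; have := hlt (Ordinal i4) ij; rewrite !(tnth_nth 0%E).
rewrite (tnth_nth 0%E).
have [P pE] : exists P : R, p = P%:E.
 by case: (p) p_gt1 pq => [P| |]//= _; [exists P|rewrite ltNge leey].
have [Q qE] : exists Q : R, q = Q%:E.
 by move: q_fin pq; case: (q) => [Q| |]//= _; [exists Q|rewrite ltNge leNye].
have P1 : 1 < P by rewrite -lte_fin -pE.
have PQ : P < Q by rewrite -lte_fin -pE -qE.
have rpE : P^-1 = recip p by rewrite pE recip_fin// gt_eqF// (lt_trans ltr01).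
have rqE : Q^-1 = recip q by rewrite qE recip_fin// gt_eqF// (lt_trans ltr01)// (lt_trans P1).
have h2 : 2 < qhat k P%:E Q%:E by rewrite -pE -qE.
have alr := allocation_width_right P1 PQ h2; have all := allocation_width_left P1 PQ h2.
have abv := above_threshold h2; have blw := below_threshold h2.
rewrite -pE -qE rpE rqE -/qh in alr all abv blw.
have qh20 : 0 < qh / 2 by rewrite divr_gt0// (lt_trans _ qh2).
have qh20e : (0%:E < (qh / 2)%:E)%E by rewrite lte_fin.
move: hlt; rewrite /th /theta_exps -/kap -/sd; set delta := Num.min _ _ in alr all abv blw *.
(* Minimality is used through two comparisons: with the exponent of the same form for the other
   slope, which fixes the direction, and with the other exponent for the same slope, which fixes the
   regime. *)
case: j {hj} => [[|[|[|[|//]]]] jlt] /= hlt.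
- have h1 := hlt 1%N isT isT; have h2' := hlt 2%N isT isT; rewrite /= in h1 h2'.
 rewrite lte_fin in h1; rewrite EFinD lteD2rE// in h2'.
 apply: wev => C1 C10.
 exact: (balanced_vertical theta_ge0 sigma_ge1 rho_gt0 tau0 alr h2' (abv _ h1) C10).
- have h1 := hlt 0%N isT isT; have h2' := hlt 3%N isT isT; rewrite /= in h1 h2'.
 rewrite lte_fin in h1; rewrite EFinM lte_pmul2l// in h2'.
 apply: wev => C1 C10.
 exact: (balanced_vertical theta_ge0 sigma_ge1 rho_gt0 tau0 all h2' (blw _ h1) C10).
- have h1 := hlt 0%N isT isT; have h2' := hlt 3%N isT isT; rewrite /= in h1 h2'.
 rewrite EFinD lteD2rE// in h1.
 case: kap_top => kE; first by move: h1; rewrite kE ltNge leey.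
 rewrite kE -EFinM -EFinD lte_fin in h2'; rewrite kE -EFinD /=.
 apply: wev => C1 C10.
 exact: (balanced_horizontal theta_ge0 sigma_ge1 rho_gt0 alr h1 (abv _ h2') C10).
have h1 := hlt 1%N isT isT; have h2' := hlt 2%N isT isT; rewrite /= in h1 h2'.
rewrite (EFinM (qh / 2) sd) lte_pmul2l// in h1.
case: kap_top => kE; first by move: h1; rewrite kE ltNge leey.
rewrite kE -EFinM -EFinD lte_fin in h2'; rewrite kE -EFinM /=.
apply: wev => C1 C10.
exact: (balanced_horizontal theta_ge0 sigma_ge1 rho_gt0 all h1 (blw _ h2') C10).
Qed.
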